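(* Let $r\in(0,\infty)$ and let $f\in C^2[0,r)$ satisfy (i) $f(u)>0$ for $0\le u<r$; (ii) $f'(u)>0$ for $0<u<r$; (iii) $f''(u)>0$ for $0<u<r$; (iv) $0<\liminf_{u\to r^-}(r-u)f(u)\le\infty$. Consider the boundary value problem $$u''''(x)=\lambda f(u(x)),\quad x\in(0,1),\qquad u(0)=u(1)=u'(0)=u'(1)=0, \qquad (P_\lambda)$$ with parameter $\lambda>0$. Then all positive solutions of $(P_\lambda)$ (as $\lambda$ ranges over $(0,\infty)$) lie on a unique smooth curve of solutions $(\lambda,u)$. This curve starts at $(\lambda,u)=(0,0)$; it continues for $\lambda>0$ until a critical value $\lambda_0>0$, where it bends back, and then continues for decreasing $\lambda$ without any more turns, with $u$ tending to a bounded function $w$ when $\lambda\downarrow 0$. In other words, $(P_\lambda)$ has exactly two, one, or no positive solutions, depending on whether $0<\lambda<\lambda_0$, $\lambda=\lambda_0$, or $\lambda>\lambda_0$. Moreover, all positive solutions are symmetric with respect to the midpoint $x=\frac12$, and the maximum value of the solution, $u(\frac12)$, is strictly monotone on the curve. Furthermore, the function $w$ belongs to $\left(C^{2+\alpha}[0,1]\setminus C^3[0,1]\right)\cap C^4\left([0,1]\setminus\{\frac12\}\right)$ for any $\alpha\in(0,1)$, is symmetric with respect to $x=\frac12$, has maximum value $w(\frac12)=r$, and is given explicitly by $$w(x)=\begin{cases}-16rx^3+12rx^2, & x\in[0,\frac12],\\ -16r(1-x)^3+12r(1-x)^2, & x\in[\frac12,1].\end{cases}$$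
   Context: A positive solution of $(P_\lambda)$ is a function $u\in C^4[0,1]$ satisfying $(P_\lambda)$ with $u\ge 0$ and $u\not\equiv 0$ on $(0,1)$; since $f$ is defined on $[0,r)$, its values lie in $[0,r)$. The solution curve is a curve in the space of pairs $(\lambda,u)\in\mathbb{R}\times X$, where $X=\{u\in C^4[0,1]: u(0)=u(1)=u'(0)=u'(1)=0\}$. ''Smooth'' means of the differentiability class provided by the implicit function theorem and the Crandall-Rabinowitz theorem applied to the $C^2$ map $(\lambda,u)\mapsto u''''-\lambda f(u)$ with values in $C[0,1]$, i.e. a $C^2$ curve. The convergence $u\to w$ along the upper branch as $\lambda\downarrow0$ is in $C^{2+\alpha}[0,1]$ for every $\alpha\in(0,1)$, where $C^{2+\alpha}[0,1]$ denotes the usual Hölder space. *)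

(* Defs.v *)
From HB Require Import structures.
From mathcomp Require Import all_boot all_order all_algebra.
From mathcomp Require Import all_classical all_reals all_analysis.
From mathcomp Require Import lra.

Set Implicit Arguments.
Unset Strict Implicit.
Unset Printing Implicit Defensive.

Import Order.TTheory GRing.Theory Num.Theory.
Import numFieldNormedType.Exports.

Local Open Scope classical_set_scope.
Local Open Scope ring_scope.

(* The library's [derive1] is two-sided.  Here the derivative of [g] at [x] is
   taken relative to a set [A]: the increment is restricted to points of [A]
   other than [x], so that it is one-sided at the endpoints of an interval.
   It is meaningful at points of [A] that are limit points of [A]. *)
Section derivative_relative_to_a_set.
Context {R : realType} {V : normedModType R}.
Implicit Types (A : set R) (g h : R -> V).

Definition slope_in g (x : R) : R -> V :=
  fun y => (y - x)^-1 *: (g y - g x).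

Definition derivable_in A g (x : R) : Prop :=
  cvg (slope_in g x @ within A x^').

Definition derive_in A g (x : R) : V :=
  lim (slope_in g x @ within A x^').

Definition derive_in_n A (k : nat) g : R -> V := iter k (derive_in A) g.

Definition Cn A (k : nat) g : Prop :=
  (forall j, (j < k)%N -> forall x, A x -> derivable_in A (derive_in_n A j g) x)
  /\ (forall j, (j <= k)%N -> {within A, continuous (derive_in_n A j g)}).

Lemma derive_in_interior A g x : A° x -> derive_in A g x = derive1 g x.
Proof.
move=> /nbhs_ballP[d /= d0 dA]; rewrite /derive_in /derive1.
suff -> : slope_in g x @ within A x^' =
    (fun z => z^-1 *: (g (z + x) - g x)) @ 0^' by [].
apply/seteqP; split => P /=; rewrite /fmap /= /within /dnbhs /= /within /=
  => /nbhs_ballP[e /= e0 eP]; apply/nbhs_ballP.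
  exists (Num.min d e); rewrite /= ?lt_min ?d0//= => z.
  rewrite /ball/= sub0r normrN lt_min => /andP[zd ze] z0.
  have := eP (z + x); rewrite /ball /= opprD addrA [x - z]addrC addrK normrN.
  rewrite /slope_in addrK; apply => //; last first.
    by apply: dA; rewrite /ball /= opprD addrA [x - z]addrC addrK normrN.
  by apply: contra_neq z0 => zx; rewrite -[z](addrK x) zx subrr.
exists e => //= y xy yx Ay.
have := eP (y - x); rewrite /ball /= sub0r opprB subrK; apply => //.
by rewrite subr_eq0.
Qed.

Lemma eq_slope_in A g h x : {in A, g =1 h} -> A x ->
  slope_in g x @ within A x^' = slope_in h x @ within A x^'.
Proof.
move=> gh Ax; have E y : A y -> slope_in g x y = slope_in h x y.
  by move=> Ay; rewrite /slope_in !gh ?inE.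
rewrite /fmap /within; apply/seteqP.
by split=> P; apply: (@filterS _ x^' _) => y + Ay => /(_ Ay) /=; rewrite E.
Qed.

Lemma eq_derive_in A g h : {in A, g =1 h} ->
  {in A, derive_in A g =1 derive_in A h}.
Proof.
by move=> gh x /set_mem Ax; rewrite /derive_in (eq_slope_in gh Ax).
Qed.

Lemma eq_derivable_in A g h x : {in A, g =1 h} -> A x ->
  derivable_in A g x -> derivable_in A h x.
Proof. by move=> gh Ax; rewrite /derivable_in (eq_slope_in gh Ax). Qed.

Lemma slope_in_linear a g h x :
  slope_in (a *: g + h) x = a *: slope_in g x + slope_in h x.
Proof.
apply/funext => y; rewrite /slope_in !fctE/=.
by rewrite opprD addrACA -scalerBr scalerDr scalerA mulrC -scalerA.
Qed.

Lemma derive_in_cvg_linear A a g h x :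
  derivable_in A g x -> derivable_in A h x ->
  slope_in (a *: g + h) x y @[y --> within A x^'] -->
    a *: derive_in A g x + derive_in A h x.
Proof.
by move=> dg dh; rewrite slope_in_linear; apply: cvgD => //; apply: cvgZr.
Qed.

Lemma derivable_in_linear A a g h x :
  derivable_in A g x -> derivable_in A h x ->
  derivable_in A (a *: g + h) x.
Proof. by move=> dg dh; apply/cvg_ex; eexists; apply: derive_in_cvg_linear. Qed.

Lemma limit_point_within_proper A x :
  limit_point A x -> ProperFilter (within A x^').
Proof.
move=> Ax; apply: Build_ProperFilter_ex => P.
rewrite /within /dnbhs /within/= => /Ax[y [yx Ay Py]].
by exists y; apply: Py.
Qed.

Lemma derive_in_linear A a g h x : limit_point A x ->
  derivable_in A g x -> derivable_in A h x ->
  derive_in A (a *: g + h) x = a *: derive_in A g x + derive_in A h x.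
Proof.
move=> /limit_point_within_proper Ax dg dh.
by apply: cvg_lim => //; apply: derive_in_cvg_linear.
Qed.

Lemma derive_in_n_linear A k a g h : A `<=` limit_point A ->
  Cn A k g -> Cn A k h -> forall j, (j <= k)%N ->
  {in A, derive_in_n A j (a *: g + h) =1
         a *: derive_in_n A j g + derive_in_n A j h}.
Proof.
move=> Alim [dg _] [dh _]; elim=> [//|j IHj jk x xA].
have /= -> := eq_derive_in (IHj (ltnW jk)) xA.
have Ax := set_mem xA.
by rewrite derive_in_linear//; [exact: Alim|exact: dg|exact: dh].
Qed.

Lemma Cn_linear A k a g h : A `<=` limit_point A ->
  Cn A k g -> Cn A k h -> Cn A k (a *: g + h).
Proof.
move=> Alim Cg Ch; have E := derive_in_n_linear a Alim Cg Ch.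
have [[dg cg] [dh ch]] := (Cg, Ch); split=> [j jk x Ax|j jk].
  apply: (@eq_derivable_in A (a *: derive_in_n A j g + derive_in_n A j h)) => //.
    by move=> y yA; rewrite (E j (ltnW jk) y yA).
  by apply: derivable_in_linear; [exact: dg|exact: dh].
apply: (@subspace_eq_continuous _ _ _
  (a *: derive_in_n A j g + derive_in_n A j h : subspace A -> V)).
  by move=> y yA; apply/esym; exact: (E j jk y yA).
apply: within_continuousD; last exact: ch.
by move=> x; apply: cvgZr; exact: cg.
Qed.

Lemma derive_in0 A x : limit_point A x -> derive_in A (0 : R -> V) x = 0.
Proof.
move=> /limit_point_within_proper Ax; apply: cvg_lim => //.
rewrite (_ : slope_in _ _ = cst 0); first exact: cvg_cst.
by apply/funext => y; rewrite /slope_in subrr scaler0.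
Qed.

Lemma derive_in_n0 A j : A `<=` limit_point A ->
  {in A, derive_in_n A j (0 : R -> V) =1 0}.
Proof.
move=> Alim; elim: j => // j IHj x xA.
by have /= -> := eq_derive_in IHj xA; rewrite derive_in0//; exact/Alim/set_mem.
Qed.

Lemma Cn0 A k : A `<=` limit_point A -> Cn A k (0 : R -> V).
Proof.
move=> Alim; split=> [j _ x Ax|j _].
  apply: (@eq_derivable_in A 0) => // [y yA|]; first by rewrite derive_in_n0.
  rewrite /derivable_in (_ : slope_in _ _ = cst 0); first exact: is_cvg_cst.
  by apply/funext => y; rewrite /slope_in subrr scaler0.
apply: (@subspace_eq_continuous _ _ _ (0 : subspace A -> V)).
  by move=> y yA; apply/esym; exact: derive_in_n0.
by move=> x; exact: cvg_cst.
Qed.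

End derivative_relative_to_a_set.

Section clamped_space.
Context {R : realType}.
Local Notation I01 := (`[0%R, 1%R]%classic : set R).

Lemma segment01_limit_point : I01 `<=` limit_point I01.
Proof.
move=> x /=; rewrite in_itv/= => /andP[x0 x1] U /nbhs_ballP[e /= e0 eU].
pose d := Num.min (e / 2) (1 / 2).
have d0 : 0 < d by rewrite lt_min; apply/andP; split; lra.
have de : d < e by rewrite gt_min; apply/orP; left; lra.
have d1 : d <= 1 / 2 by rewrite ge_min lexx orbT.
have [x2|x2] := leP x (1 / 2).
  exists (x + d); split.
  - by rewrite gt_eqF// ltrDl.
  - by rewrite /= in_itv/=; apply/andP; split; lra.
  - by apply: eU; rewrite /ball /= opprD addrA subrr sub0r normrN gtr0_norm.
exists (x - d); split.
- by rewrite lt_eqF// gtrDl oppr_lt0.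
- by rewrite /= in_itv/=; apply/andP; split; lra.
- by apply: eU; rewrite /ball /= opprB addrC subrK gtr0_norm.
Qed.

(* $X = \{u \in C^4[0,1] : u(0) = u(1) = u'(0) = u'(1) = 0\}$.  Elements are
   represented by their extension by 0, so that Leibniz equality on [clamped]
   is equality of functions on [0,1]. *)
Definition clamped_pred : {pred R -> R} := fun u =>
  `[< [/\ Cn I01 4 u, u 0 = 0 /\ u 1 = 0,
          derive_in I01 u 0 = 0 /\ derive_in I01 u 1 = 0
        & forall x, ~ I01 x -> u x = 0] >].

Lemma clamped_submod_closed : submod_closed clamped_pred.
Proof.
have I0 : I01 0 by rewrite /= in_itv/= lexx ler01.
have I1 : I01 1 by rewrite /= in_itv/= lexx ler01.
split=> [|a u v]; rewrite /in_mem/=.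
  by apply/asboolP; split=> //; [exact/Cn0/segment01_limit_point|
    split; apply: derive_in0; exact: segment01_limit_point].
move=> /asboolP[Cu [u0 u1] [du0 du1] uN] /asboolP[Cv [v0 v1] [dv0 dv1] vN].
have D x : I01 x ->
    derive_in I01 (a *: u + v) x = a *: derive_in I01 u x + derive_in I01 v x.
  move=> Ix; apply: derive_in_linear; first exact: segment01_limit_point.
  - exact: (Cu.1 0%N).
  - exact: (Cv.1 0%N).
apply/asboolP; split.
- exact: (Cn_linear _ segment01_limit_point).
- by rewrite !fctE/= u0 v0 u1 v1 scaler0 addr0.
- by rewrite !D// du0 dv0 du1 dv1 scaler0 addr0.
- by move=> x Ix; rewrite !fctE/= uN// vN// scaler0 addr0.
Qed.

HB.instance Definition _ :=
  GRing.isSubmodClosed.Build R (R -> R) clamped_pred clamped_submod_closed.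

End clamped_space.

Record clamped (R : realType) := Clamped {
  clamped_val :> R -> R;
  clamped_valP : clamped_val \in @clamped_pred R }.

HB.instance Definition _ (R : realType) := [isSub for @clamped_val R].
HB.instance Definition _ (R : realType) := [Choice of clamped R by <:].
HB.instance Definition _ (R : realType) :=
  [SubChoice_isSubLmodule of clamped R by <:].

Section clamped_norm.
Context {R : realType}.
Local Notation I01 := (`[0%R, 1%R]%classic : set R).
Implicit Types u v : clamped R.

Definition sup_norm01 (g : R -> R) : R := sup [set `|g x| | x in I01].

Definition clamped_norm u : R :=
  \sum_(j < 5) sup_norm01 (derive_in_n I01 j u).

Let I0 : I01 0. Proof. by rewrite /= in_itv/= lexx ler01. Qed.

Lemma clamped_Cn u : Cn I01 4 u.
Proof. by case: u => u /= /asboolP[]. Qed.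

Lemma sup_norm01_has_ub (g : R -> R) : {within I01, continuous g} ->
  has_ubound [set `|g x| | x in I01].
Proof.
move=> cg; have cng : {within I01, continuous (fun x => `|g x|)}.
  by move=> x; apply: cvg_norm; exact: cg.
have [c _ cP] := EVT_max ler01 cng.
by exists `|g c| => _ [x Ix <-]; exact: cP.
Qed.

Lemma le_sup_norm01 (g : R -> R) x : {within I01, continuous g} ->
  I01 x -> `|g x| <= sup_norm01 g.
Proof.
by move=> cg Ix; apply: ub_le_sup; [exact: sup_norm01_has_ub|exists x].
Qed.

Lemma sup_norm01_le (g : R -> R) M :
  (forall x, I01 x -> `|g x| <= M) -> sup_norm01 g <= M.
Proof.
move=> gM; apply: ge_sup; first by exists `|g 0|, 0.
by move=> _ [x Ix <-]; exact: gM.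
Qed.

Lemma clamped_derive_continuous u (j : 'I_5) :
  {within I01, continuous (derive_in_n I01 j u)}.
Proof. by apply: (clamped_Cn u).2; rewrite -ltnS. Qed.

Lemma clamped_derive_linear a u v (j : 'I_5) : {in I01,
  derive_in_n I01 j (a *: u + v : clamped R) =1
  a *: derive_in_n I01 j u + derive_in_n I01 j v}.
Proof.
apply: derive_in_n_linear.
- exact: segment01_limit_point.
- exact: clamped_Cn.
- exact: clamped_Cn.
- by rewrite -ltnS.
Qed.

Lemma sup_norm01_ge0 u (j : 'I_5) : 0 <= sup_norm01 (derive_in_n I01 j u).
Proof.
have /(le_trans _) := le_sup_norm01 (@clamped_derive_continuous u j) I0.
by apply; exact: normr_ge0.
Qed.

Lemma clamped_normD u v :
  clamped_norm (u + v) <= clamped_norm u + clamped_norm v.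
Proof.
rewrite /clamped_norm -big_split/=; apply: ler_sum => j _.
apply: sup_norm01_le => x Ix; have := clamped_derive_linear 1 u v j (mem_set Ix).
rewrite !scale1r => ->; apply: le_trans (ler_normD _ _) _.
by apply: lerD; apply: le_sup_norm01 => //; exact: clamped_derive_continuous.
Qed.

Lemma clamped_normZ_le a u : clamped_norm (a *: u) <= `|a| * clamped_norm u.
Proof.
rewrite /clamped_norm mulr_sumr; apply: ler_sum => j _.
apply: sup_norm01_le => x Ix; have := clamped_derive_linear a u 0 j (mem_set Ix).
rewrite addr0 => ->; rewrite !fctE/= (derive_in_n0 _ segment01_limit_point) ?inE//.
rewrite addr0 normrM ler_wpM2l//.
by apply: le_sup_norm01 => //; exact: clamped_derive_continuous.
Qed.

Lemma clamped_normZ a u : clamped_norm (a *: u) = `|a| * clamped_norm u.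
Proof.
apply/eqP; rewrite eq_le clamped_normZ_le/=.
have [->|a0] := eqVneq a 0.
  by rewrite normr0 mul0r; apply: sumr_ge0 => j _; exact: sup_norm01_ge0.
have := clamped_normZ_le a^-1 (a *: u); rewrite scalerA mulVf// scale1r normfV.
by rewrite ler_pdivlMl ?normr_gt0.
Qed.

Lemma clamped_norm_eq0 u : clamped_norm u = 0 -> u = 0.
Proof.
move/eqP; rewrite psumr_eq0 => [|j _]; last exact: sup_norm01_ge0.
move=> /allP/(_ ord0); rewrite mem_index_enum => /(_ isT)/= /eqP u0.
apply/val_inj/funext => x /=; have [Ix|Ix] := pselect (I01 x).
  apply/eqP; rewrite -normr_le0 -u0.
  exact: (le_sup_norm01 (@clamped_derive_continuous u ord0) Ix).
by case: u {u0} => u /= /asboolP[_ _ _]; apply.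
Qed.

End clamped_norm.

HB.instance Definition _ (R : realType) :=
  Lmodule_isNormed.Build R (clamped R)
    clamped_normD clamped_normZ clamped_norm_eq0.

Section holder_space.
Context {R : realType}.
Local Notation I01 := (`[0%R, 1%R]%classic : set R).
Local Open Scope ereal_scope.

Definition holder_seminorm (alpha : R) (g : R -> R) : \bar R :=
  ereal_sup [set (`|g p.1 - g p.2| / `|p.1 - p.2| `^ alpha)%R%:E
            | p in [set p : R * R | [/\ I01 p.1, I01 p.2 & p.1 != p.2]]].

Definition holder_norm (k : nat) (alpha : R) (g : R -> R) : \bar R :=
  \sum_(j < k.+1) ereal_sup [set `|derive_in_n I01 j g x|%:E | x in I01]
  + holder_seminorm alpha (derive_in_n I01 k g).

Definition holder (k : nat) (alpha : R) (g : R -> R) : Prop :=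
  Cn I01 k g /\ holder_norm k alpha g < +oo.

End holder_space.

Section boundary_value_problem.
Context {R : realType}.
Local Notation I01 := (`[0%R, 1%R]%classic : set R).
Variables (r : R) (f : R -> R).

(* The boundary conditions are part of [clamped R]. *)
Definition solution (lambda : R) (u : clamped R) : Prop :=
  (forall x, 0 <= x <= 1 -> 0 <= u x < r) /\
  (forall x, 0 < x < 1 -> derive_in_n I01 4 u x = lambda * f (u x)).

Definition positive_solution (lambda : R) (u : clamped R) : Prop :=
  [/\ 0 < lambda, solution lambda u & exists2 x, 0 < x < 1 & u x != 0].

End boundary_value_problem.

Section arcs.
Context {R : realType} {V : normedModType R}.

(* A regular simple arc of class C^2 with an initial point and an open end. *)
Definition smooth_arc (g : R -> V) : Prop :=
  [/\ Cn `[0, 1[ 2 g,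
      forall s, 0 <= s < 1 -> derive_in `[0, 1[ g s != 0
    & {in `[0, 1[ &, injective g}].

(* [h] parametrizes the same oriented arc as [g]. *)
Definition reparametrization (g h : R -> V) : Prop :=
  exists phi : R -> R,
    [/\ Cn `[0, 1[ 2 phi,
        forall s, 0 <= s < 1 -> 0 < derive_in `[0, 1[ phi s,
        phi @` `[0, 1[ = `[0, 1[%classic
      & forall s, 0 <= s < 1 -> h s = g (phi s)].

End arcs.

(* Main.v *)
(** The curve is parametrized by the maximum [m] of the solution.  Centred at
    [1/2], a positive solution is even, and for each [m] in (0, r) there is
    exactly one pair [(lam, v)]: existence by shooting and rescaling, uniqueness
    because slowing one solution down and comparing it with the other
    contradicts the growth of fourth order inequalities [y'''' >= - L y^-].
    Symmetry on [0, 1] comes from a conserved energy and the same growth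
    argument.  The family [(lam m, v m)] is C^2 in [m]: by differentiating the
    integral equation, the derivatives of [lam] and [k = - v''(0)] solve a 2x2
    system whose determinant does not vanish because the rescalings of [v] give
    an explicit solution of the linearized equation.  At a critical point of
    [lam], [dv/dm >= 0] by a touching argument against [- v'], and the
    concomitant of [dv/dm] with [d2v/dm2] shows [lam'' < 0]; hence there is a
    single turn.  When [m] tends to [r] the singularity of [f] makes [lam]
    tend to [0] and concentrates [v''''] near the middle, so [v] tends to a
    piecewise cubic. *)
Require Import Defs.
From HB Require Import structures.
From mathcomp Require Import all_boot all_order all_algebra.
From mathcomp Require Import all_classical all_reals all_analysis.
From mathcomp Require Import ring lra.

Set Implicit Arguments.
Unset Strict Implicit.
Unset Printing Implicit Defensive.

Import Order.TTheory GRing.Theory Num.Theory.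
Import numFieldNormedType.Exports.

Local Open Scope classical_set_scope.
Local Open Scope card_scope.
Local Open Scope ring_scope.

(** * Real calculus *)

(** The singularity of [f] at [r] is kept away by fixing the maximum: a solution of height [m < r]
    sees [f] only on [[0, m]], where it is Lipschitz. Composing [f] with the truncation [clip m]
    turns each initial value problem into a Volterra equation solvable on the whole line. Most
    comparison and stability estimates rest on one device: in the sup norm weighted by
    [expR (- s * |t|)], four integrations gain [1 / s ^+ 4], which beats any Lipschitz constant.

    The obstacle is regularity in [m], since uniqueness of [(lam, k)] for each [m] gives neither
    continuity nor derivatives. Continuity comes from compactness: any limit of [(lam, k)] is again
    the data of a profile, hence the right one. For the first derivative, the end conditions are
    expanded jointly in [m], [k] and [lam]. For the second, [f] of class C^2 suffices: the first
    derivatives are rational in solutions of linear equations whose coefficients are already C^1.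
    The trivial solution [m = 0] belongs to the family; since [lam] vanishes there, the scaling
    argument is replaced at that point by a direct computation. *)

Definition der {R : realType} (f : R -> R) (x d : R) : Prop := is_derive x 1 f d.

Section basic_calculus.
Context {R : realType}.
Implicit Types (f g : R -> R) (a b c d x y e : R).

Lemma der_eq f x a b : der f x a -> a = b -> der f x b.
Proof. by move=> h <-. Qed.

Lemma der_cst (k x : R) : der (fun _ : R => k) x 0.
Proof. exact: is_derive_cst. Qed.

Lemma der_id x : der (fun t : R => t) x 1.
Proof. exact: is_derive_id. Qed.

Lemma derD f g x a b : der f x a -> der g x b ->
  der (fun t => f t + g t) x (a + b).
Proof. move=> hf hg; exact: is_deriveD. Qed.

Lemma derN f x a : der f x a -> der (fun t => - f t) x (- a).
Proof. move=> hf; exact: is_deriveN. Qed.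

Lemma derM f g x a b : der f x a -> der g x b ->
  der (fun t => f t * g t) x (f x * b + g x * a).
Proof. move=> hf hg; exact: is_deriveM. Qed.

Lemma der_comp f g x a b : der f (g x) a -> der g x b ->
  der (fun t => f (g t)) x (a * b).
Proof. move=> hf hg; exact: is_derive1_comp. Qed.

Lemma derX f n x a : der f x a ->
  der (fun t => f t ^+ n) x (n%:R * f x ^+ n.-1 * a).
Proof.
move=> hf; have -> : (fun t => f t ^+ n) = f ^+ n.
  by apply/funext => t; rewrite exprfctE.
exact: is_deriveX.
Qed.

Lemma within_dnbhs_cvgP {V : normedModType R} (A : set R) (F : R -> V) x (l : V) :
  F y @[y --> within A x^'] --> l <->
  forall e, 0 < e -> exists2 del, 0 < del &
    forall y, A y -> y != x -> `|y - x| < del -> `|F y - l| < e.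
Proof.
split=> [/cvgrPdist_lt h e e0|h].
  have := h _ e0; rewrite /within /= /dnbhs /within /= => /nbhs_ballP[del /= d0 H].
  exists del => // y Ay yx ydel; rewrite distrC; apply: H => //.
  by rewrite /ball /= distrC.
apply/cvgrPdist_lt => e e0; have [del d0 H] := h _ e0.
rewrite /within /= /dnbhs /within /=; apply/nbhs_ballP; exists del => //= y.
by rewrite /ball/= distrC => ydel yx Ay; rewrite distrC; apply: H.
Qed.

Lemma withinC_P {V : normedModType R} (A : set R) (F : R -> V) :
  {within A, continuous F} <->
  forall x, A x -> forall e, 0 < e -> exists2 del, 0 < del &
    forall y, A y -> `|y - x| < del -> `|F y - F x| < e.
Proof.
split=> [/subspace_continuousP h x Ax e e0|h].
  have /cvgrPdist_lt/(_ _ e0) := h x Ax.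
  rewrite /within /= => /nbhs_ballP[del /= d0 H].
  exists del => // y Ay ydel; rewrite distrC; apply: H => //.
  by rewrite /ball /= distrC.
apply/subspace_continuousP => x Ax; apply/cvgrPdist_lt => e e0.
have [del d0 H] := h x Ax _ e0.
rewrite /within /=; apply/nbhs_ballP; exists del => //= y.
by rewrite /ball/= distrC => ydel Ay; rewrite distrC; apply: H.
Qed.

Lemma contP f x : {for x, continuous f} <->
  forall e, 0 < e -> exists2 del, 0 < del &
    forall y, `|y - x| < del -> `|f y - f x| < e.
Proof.
split=> [/cvgrPdist_lt h e e0|h].
  have /nbhs_ballP[del /= d0 H] := h _ e0.
  exists del => // y ydel; rewrite distrC; apply: H => //.
  by rewrite /ball /= distrC.
apply/cvgrPdist_lt => e e0; have [del d0 H] := h _ e0.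
apply/nbhs_ballP; exists del => //= y.
by rewrite /ball/= distrC => ydel; rewrite distrC; apply: H.
Qed.

(** The quotient-free form allows [y = x], and its errors can be added and composed without
    division. The derivatives in the parameter [m] are later stated in the same shape. *)
Lemma derP f x d : der f x d <-> forall e, 0 < e -> exists2 del, 0 < del &
  forall y, `|y - x| < del -> `|f y - f x - d * (y - x)| <= e * `|y - x|.
Proof.
have E : der f x d <-> h^-1 *: (f (h *: 1 + x) - f x) @[h --> 0^'] --> d.
  split=> [[df <-]|h]; first exact: df.
  by apply: DeriveDef; [apply/cvg_ex; exists d|apply/cvg_lim].
rewrite E; split=> [/cvgrPdist_lt h e e0|h].
  have := h _ e0; rewrite /dnbhs /within /= => /nbhs_ballP[del /= d0 H].
  exists del => // y ydel.
  have [->|yx] := eqVneq y x; first by rewrite !subrr mulr0 subrr !normr0 mulr0.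
  have yx0 : y - x != 0 by rewrite subr_eq0.
  have := H (y - x); rewrite /ball /= sub0r normrN => /(_ ydel yx0).
  rewrite [_ *: 1]mulr1 subrK => /ltW H1.
  rewrite -ler_pdivrMr ?normr_gt0// -normf_div.
  by apply: le_trans H1; rewrite mulrBl mulfK// distrC [_ *: _]mulrC.
apply/cvgrPdist_lt => e e0; have [del d0 H] := h _ (divr_gt0 e0 (@ltr0n R 2)).
rewrite /dnbhs /within /=; apply/nbhs_ballP; exists del => //= y.
rewrite /ball/= sub0r normrN => ydel y0.
have := H (y + x); rewrite addrK => /(_ ydel) H1.
rewrite [_ *: 1]mulr1; apply: (@le_lt_trans _ _ (e / 2)); last by lra.
rewrite distrC -(ler_pM2r (x := `|y|)) ?normr_gt0// -normrM mulrBl.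
by rewrite [_ *: _]mulrC -mulrA mulVf// mulr1.
Qed.

Lemma der_cont f x d : der f x d -> {for x, continuous f}.
Proof.
by case=> df _; apply: differentiable_continuous; rewrite -derivable1_diffP.
Qed.

Lemma der_uniq f x c d : der f x c -> der f x d -> c = d.
Proof. by case=> [_ <-] [_ <-]. Qed.

Lemma der_near f g x d a b : a < x < b ->
  (forall y, a < y < b -> f y = g y) -> der f x d -> der g x d.
Proof.
move=> xab fg /derP h; apply/derP => e /h[del d0 H].
exists (Num.min del (Num.min (x - a) (b - x))).
  rewrite !lt_min d0 /=; lra.
move=> y; rewrite !lt_min => /and3P[yd ya yb].
rewrite -!fg ?H//; first by move: ya yb; rewrite !ltr_norml; lra.
Qed.

Lemma MVT_in a b f df : a < b -> (forall x, a < x < b -> der f x (df x)) ->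
  {within `[a, b], continuous f} ->
  exists2 c, a < c < b & f b - f a = df c * (b - a).
Proof.
move=> ab h cf.
have h' x : x \in `]a, b[ -> der f x (df x) by rewrite in_itv/=; apply: h.
by have [c] := MVT ab h' cf; rewrite in_itv/=; exists c.
Qed.

Lemma sub_within (A B : set R) f : A `<=` B ->
  {within B, continuous f} -> {within A, continuous f}.
Proof. move=> AB; exact: continuous_subspaceW. Qed.

Lemma sub_cc a b c d f : a <= c -> d <= b ->
  {within `[a, b], continuous f} -> {within `[c, d], continuous f}.
Proof.
move=> ac db; apply: continuous_subspaceW => x /=; rewrite !in_itv/=; lra.
Qed.

Lemma cont_within (A : set R) f : continuous f -> {within A, continuous f}.
Proof. by move=> cf; apply: continuous_subspaceT. Qed.

Lemma nondecr_le a b f df : (forall x, a < x < b -> der f x (df x)) ->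
  {within `[a, b], continuous f} -> (forall x, a < x < b -> 0 <= df x) ->
  forall x y, a <= x -> x <= y -> y <= b -> f x <= f y.
Proof.
move=> h cf dpos x y ax; rewrite le_eqVlt => /predU1P[->//|xy] yb.
have h' z : x < z < y -> der f z (df z) by move=> ?; apply: h; lra.
have [z zz E] := MVT_in xy h' (sub_cc ax yb cf).
by rewrite -subr_ge0 E mulr_ge0 ?dpos//; lra.
Qed.

Lemma incr_lt a b f df : (forall x, a < x < b -> der f x (df x)) ->
  {within `[a, b], continuous f} -> (forall x, a < x < b -> 0 < df x) ->
  forall x y, a <= x -> x < y -> y <= b -> f x < f y.
Proof.
move=> h cf dpos x y ax xy yb.
have h' z : x < z < y -> der f z (df z) by move=> ?; apply: h; lra.
have [z zz E] := MVT_in xy h' (sub_cc ax yb cf).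
by rewrite -subr_gt0 E mulr_gt0 ?dpos//; lra.
Qed.

Lemma within_cont_at a b f x : a < x < b ->
  {within `[a, b], continuous f} -> {for x, continuous f}.
Proof.
move=> xab /withinC_P h; apply/contP => e e0.
have [|del d0 H] := h x _ _ e0; first by rewrite /= in_itv/=; lra.
exists (Num.min del (Num.min (x - a) (b - x))).
  rewrite !lt_min d0 /=; lra.
move=> y; rewrite !lt_min => /and3P[yd ya yb]; apply: H => //.
by rewrite /= in_itv/=; move: ya yb; rewrite !ltr_norml; lra.
Qed.

Lemma EVT_bound a b f : a <= b -> {within `[a, b], continuous f} ->
  exists2 M, 0 < M & forall x, a <= x <= b -> `|f x| <= M.
Proof.
move=> ab cf; have cn : {within `[a, b], continuous (fun x => `|f x|)}.
  by move=> x; apply: cvg_norm; exact: cf.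
have [c _ H] := EVT_max ab cn.
exists (1 + `|f c|) => [|x xab]; first by rewrite ltr_pwDl.
by apply: le_trans (H x _) _; rewrite ?in_itv//= lerDr.
Qed.

End basic_calculus.

Ltac der_auto := repeat first
  [ eassumption | apply: der_cst | apply: der_id | apply: derD | apply: derN
  | apply: derM | apply: derX ].

Ltac clear_order := repeat match goal with
  | H : is_true _ |- _ => clear H
  | H : _ = _ |- _ => clear H
  end.
Tactic Notation "lra_from" := clear_order; lra.
Tactic Notation "lra_from" hyp(h) := generalize h; clear_order; lra.
Tactic Notation "lra_from" hyp(h) hyp(h') := generalize h, h'; clear_order; lra.
Tactic Notation "lra_from" hyp(h) hyp(h') hyp(h'') := generalize h, h', h''; clear_order; lra.

(** * Primitives on the whole line *)

Section antiderivative.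
Context {R : realType}.
Implicit Types (f g : R -> R) (a b c d x y t e s : R).
Local Notation mu := (@lebesgue_measure R).

Lemma antiderivative_exists g : continuous g ->
  exists2 G : R -> R, G 0 = 0 & forall t, der G t (g t).
Proof.
move=> cg.
have int a b : mu.-integrable `[a, b] (EFin \o g).
  apply: continuous_compact_integrable; first exact: segment_compact.
  exact: cont_within.
pose F a (t : R) := (\int[mu]_(x in `[a, t]) g x)%R.
have dF a t : a < t -> der (F a) t (g t).
  move=> at_; have tt1 : t < t + 1 by rewrite ltrDl.
  have [d1 d2] := continuous_FTC1_closed tt1 (int a _) at_ (cg t).
  by apply: DeriveDef; [exact: d1|rewrite -derive1E].
have Fab a b t : a <= b -> b <= t -> F a t - F a b = F b t.
  move=> ab bt; rewrite /F Rintegral_itvB ?bnd_simp//.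
  rewrite Rintegral_itv_obnd_cbnd//.
  apply: integrableS (int b t) => //.
  by apply: subset_itvr; rewrite bnd_simp.
(* The fundamental theorem needs an integral started strictly to the left of the point. The starting
   point here lies below both [t] and [0], and [GE] shows that the value does not depend on it. *)
pose G (t : R) := F (Num.min t 0 - 1) t - F (Num.min t 0 - 1) 0.
have GE a t : a < t -> a < 0 -> G t = F a t - F a 0.
  move=> at_ a0; rewrite /G; set b := Num.min t 0 - 1.
  have [mt m0] : Num.min t 0 <= t /\ Num.min t 0 <= 0.
    by rewrite !ge_min !lexx orbT.
  have [bt b0] : b < t /\ b < 0 by rewrite /b; split; lra.
  have [ab|ba] := leP a b.
    by rewrite -(Fab a b t)// -?(Fab a b 0)//; lra.
  by rewrite -(Fab b a t)// -?(Fab b a 0)//; lra.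
exists G; first by rewrite /G subrr.
move=> t; set a := Num.min t 0 - 1.
have [mt m0] : Num.min t 0 <= t /\ Num.min t 0 <= 0.
  by rewrite !ge_min !lexx orbT.
have [at_ a0] : a < t /\ a < 0 by rewrite /a; split; lra.
apply: (@der_near _ (fun t => F a t - F a 0) _ _ _ a (t + 1)); first lra.
  by move=> y ay; rewrite (GE a)//; lra.
apply: der_eq; first by apply: derD; [exact: dF|exact: der_cst].
by rewrite addr0.
Qed.

(** A total function of [g], with the zero function as default when there is no primitive, so that
    iterates can be formed before continuity is established. *)
Definition prim g : R -> R :=
  xget (fun=> 0) [set G : R -> R | G 0 = 0 /\ forall t, der G t (g t)].

Lemma primP g : continuous g -> prim g 0 = 0 /\ forall t, der (prim g) t (g t).
Proof.
move=> /antiderivative_exists[G G0 dG]; rewrite /prim.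
by case: xgetP => [H -> //|/(_ G)[]].
Qed.

Lemma prim0 g : continuous g -> prim g 0 = 0.
Proof. by case/primP. Qed.

Lemma der_prim g : continuous g -> forall t, der (prim g) t (g t).
Proof. by case/primP. Qed.

Lemma continuous_prim g : continuous g -> continuous (prim g).
Proof. by move=> cg t; apply: der_cont (der_prim cg t). Qed.

Lemma der0_const f : (forall t, der f t 0) -> forall t, f t = f 0.
Proof. by move=> h t; apply: is_derive_0_is_cst. Qed.

Lemma prim_uniq f g : continuous g -> f 0 = 0 -> (forall t, der f t (g t)) ->
  f = prim g.
Proof.
move=> cg f0 df; apply/funext => t; apply/eqP; rewrite -subr_eq0.
rewrite (@der0_const (fun t => f t - prim g t)) ?f0 ?prim0 ?subrr// => s.
by apply: der_eq; [apply: derD; [exact: df|apply/derN/der_prim]|rewrite subrr].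
Qed.

End antiderivative.

Section prim_theory.
Context {R : realType}.
Implicit Types (f g : R -> R) (a b c d x y t e s M T : R).

Lemma ctD f g : continuous f -> continuous g -> continuous (fun t => f t + g t).
Proof. by move=> cf cg t; apply: continuousD; [exact: cf|exact: cg]. Qed.

Lemma ctN f : continuous f -> continuous (fun t => - f t).
Proof. by move=> cf t; apply: continuousN; exact: cf. Qed.

Lemma ctM f g : continuous f -> continuous g -> continuous (fun t => f t * g t).
Proof. by move=> cf cg t; apply: continuousM; [exact: cf|exact: cg]. Qed.

Lemma ct_cst (k : R) : continuous (fun _ : R => k).
Proof. by move=> t; exact: cvg_cst. Qed.

Lemma ct_id : continuous (fun t : R => t).
Proof. by move=> t; exact: cvg_id. Qed.

Lemma ctX f n : continuous f -> continuous (fun t => f t ^+ n).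
Proof.
move=> cf; elim: n => [|n ih]; first exact: ct_cst.
have -> : (fun t => f t ^+ n.+1) = (fun t => f t * f t ^+ n).
  by apply/funext => t; rewrite exprS.
exact: ctM.
Qed.

Lemma ct_comp f g : continuous f -> continuous g -> continuous (fun t => f (g t)).
Proof. by move=> cf cg t; apply: continuous_comp; [exact: cg|exact: cf]. Qed.

Lemma wctD (A : set R) f g : {within A, continuous f} ->
  {within A, continuous g} -> {within A, continuous (fun t => f t + g t)}.
Proof. by move=> cf cg x; apply: cvgD; [exact: cf|exact: cg]. Qed.

Lemma wctN (A : set R) f : {within A, continuous f} ->
  {within A, continuous (fun t => - f t)}.
Proof. by move=> cf x; apply: cvgN; exact: cf. Qed.

Lemma wctM (A : set R) f g : {within A, continuous f} ->
  {within A, continuous g} -> {within A, continuous (fun t => f t * g t)}.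
Proof. by move=> cf cg x; apply: cvgM; [exact: cf|exact: cg]. Qed.

Lemma wct_cst (A : set R) (k : R) : {within A, continuous (fun _ : R => k)}.
Proof. by move=> x; exact: cvg_cst. Qed.

Lemma wct_norm (A : set R) f : {within A, continuous f} ->
  {within A, continuous (fun t => `|f t|)}.
Proof. by move=> cf x; apply: cvg_norm; exact: cf. Qed.

Lemma wct_max (A : set R) f g : {within A, continuous f} ->
  {within A, continuous g} -> {within A, continuous (fun t => Num.max (f t) (g t))}.
Proof.
move=> cf cg.
have -> : (fun t => Num.max (f t) (g t)) =
    (fun t => (f t + g t + `|f t + - g t|) * 2^-1).
  by apply/funext => t; rewrite maxr_absE.
apply: wctM; last exact: wct_cst.
by apply: wctD; [exact: wctD|apply/wct_norm/wctD => //; exact: wctN].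
Qed.

Lemma der_within (A : set R) f df : (forall t, der f t (df t)) ->
  {within A, continuous f}.
Proof. by move=> h; apply: cont_within => t; exact: der_cont (h t). Qed.

(** For continuous [h], [primn 4 h] solves [y'''' = h] with zero initial data at [0]; through it a
    fourth order initial value problem becomes an integral equation. *)
Definition primn n g : R -> R := iter n prim g.
Arguments primn : simpl never.

Lemma primnS n g : primn n.+1 g = prim (primn n g). Proof. by []. Qed.

Lemma ct_primn n g : continuous g -> continuous (primn n g).
Proof. by move=> cg; elim: n => //= n ih; exact: continuous_prim. Qed.

Lemma primn0 n g : continuous g -> primn n.+1 g 0 = 0.
Proof. by move=> cg; rewrite primnS prim0//; exact: ct_primn. Qed.

Lemma der_primn n g t : continuous g -> der (primn n.+1 g) t (primn n g t).
Proof. by move=> cg; apply: der_prim; exact: ct_primn. Qed.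

Lemma primD f g : continuous f -> continuous g ->
  prim (fun t => f t + g t) = fun t => prim f t + prim g t.
Proof.
move=> cf cg; apply/esym/prim_uniq; first exact: ctD.
  by rewrite !prim0// addr0.
by move=> t; apply: derD; exact: der_prim.
Qed.

Lemma derZ f k x a : der f x a -> der (fun t => k * f t) x (k * a).
Proof.
by move=> h; apply: der_eq; [apply: derM; [exact: der_cst|exact: h]|rewrite /=; ring].
Qed.

Lemma primZ k g : continuous g -> prim (fun t => k * g t) = fun t => k * prim g t.
Proof.
move=> cg; apply/esym/prim_uniq; first by apply: ctM => //; exact: ct_cst.
  by rewrite prim0// mulr0.
by move=> t; apply: derZ; exact: der_prim.
Qed.

Lemma primnD n f g : continuous f -> continuous g ->
  primn n (fun t => f t + g t) = fun t => primn n f t + primn n g t.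
Proof.
by move=> cf cg; elim: n => // n ih; rewrite !primnS ih primD//; exact: ct_primn.
Qed.

Lemma primnZ n k g : continuous g ->
  primn n (fun t => k * g t) = fun t => k * primn n g t.
Proof.
by move=> cg; elim: n => // n ih; rewrite !primnS ih primZ//; exact: ct_primn.
Qed.

Lemma primnB n f g : continuous f -> continuous g ->
  primn n (fun t => f t - g t) = fun t => primn n f t - primn n g t.
Proof.
move=> cf cg.
have -> : (fun t => f t - g t) = (fun t => f t + -1 * g t).
  by apply/funext => t; rewrite mulN1r.
rewrite primnD ?primnZ//; first by apply/funext => t; rewrite mulN1r.
by apply: ctM => //; exact: ct_cst.
Qed.

Lemma prim_scale c g : continuous g ->
  prim (fun t => c * g (c * t)) = fun t => prim g (c * t).
Proof.
move=> cg; apply/esym/prim_uniq.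
- apply: ctM; first exact: ct_cst.
  by apply: ct_comp => //; apply: ctM; [exact: ct_cst|exact: ct_id].
- by rewrite mulr0 prim0.
- move=> t; apply: der_eq.
    by apply: der_comp; [exact: der_prim|apply: derZ; exact: der_id].
  by rewrite /=; ring.
Qed.

Lemma ct_scale c g : continuous g -> continuous (fun t => g (c * t)).
Proof.
by move=> cg; apply: ct_comp => //; apply: ctM; [exact: ct_cst|exact: ct_id].
Qed.

(** Serves twice: with a positive [c] to rescale a profile, and with [c = -1] for parity. *)
Lemma primn_scale n c g : continuous g ->
  primn n (fun t => c ^+ n * g (c * t)) = fun t => primn n g (c * t).
Proof.
move=> cg; elim: n => [|n ih]; first by apply/funext => t; rewrite /primn/= expr0 mul1r.
have -> : (fun t => c ^+ n.+1 * g (c * t)) =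
          (fun t => c * (c ^+ n * g (c * t))).
  by apply/funext => t; rewrite exprS mulrA.
rewrite primnS primnZ ?ih; last by apply: ctM; [exact: ct_cst|exact: ct_scale].
by rewrite prim_scale//; exact: ct_primn.
Qed.

Lemma prim_le f g t : continuous f -> continuous g -> 0 <= t ->
  (forall x, 0 < x < t -> f x <= g x) -> prim f t <= prim g t.
Proof.
move=> cf cg t0 fg; rewrite -subr_ge0.
have := @nondecr_le _ 0 t (fun t => prim g t - prim f t) (fun t => g t - f t).
move=> /(_ _ _ _ 0 t (lexx _) t0 (lexx _)).
rewrite !prim0// subrr; apply.
- by move=> x _; apply: derD; [|apply: derN]; exact: der_prim.
- by apply: cont_within; apply: ctD; [|apply: ctN]; exact: continuous_prim.
- by move=> x /fg; rewrite subr_ge0.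
Qed.

Lemma prim_cst k : prim (fun=> k) = fun t : R => k * t.
Proof.
apply/esym/prim_uniq; [exact: ct_cst|by rewrite mulr0|move=> t].
by apply: der_eq; [apply: derZ; exact: der_id|rewrite mulr1].
Qed.

Lemma prim_opp g : continuous g -> prim (fun t => g (- t)) = fun t => - prim g (- t).
Proof.
move=> cg; have := prim_scale (-1) cg.
rewrite primZ; last exact: ct_scale.
move=> /funeqP h; apply/funext => t; have := h t.
have -> : (fun t => g (-1 * t)) = (fun t => g (- t)).
  by apply/funext => s; rewrite mulN1r.
by rewrite !mulN1r => <-; rewrite opprK.
Qed.

Lemma der_expRs s t : der (fun t => expR (s * t)) t (s * expR (s * t)).
Proof.
apply: der_eq.
  by apply: (@der_comp _ expR); [exact: is_derive_expR|apply: derZ; exact: der_id].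
by ring.
Qed.

Lemma ct_expRs s : continuous (fun t => expR (s * t)).
Proof. by move=> t; exact: der_cont (der_expRs s t). Qed.

Lemma prim_expRs s : s != 0 ->
  prim (fun t => expR (s * t)) = fun t => s^-1 * (expR (s * t) - 1).
Proof.
move=> s0; apply/esym/prim_uniq; first exact: ct_expRs.
  by rewrite mulr0 expR0 subrr mulr0.
move=> t; apply: der_eq.
  by apply/derZ/derD; [exact: der_expRs|apply/derN/der_cst].
by rewrite subr0 mulKf.
Qed.

Lemma prim_abs g f t : continuous g -> continuous f -> 0 <= t ->
  (forall x, 0 < x < t -> `|g x| <= f x) -> `|prim g t| <= prim f t.
Proof.
move=> cg cf t0 h; rewrite ler_norml; apply/andP; split.
  have := @prim_le (fun t => -1 * f t) g t.
  rewrite primZ// mulN1r; apply => //; first by apply: ctM => //; exact: ct_cst.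
  by move=> x /h; rewrite ler_norml mulN1r => /andP[].
by apply: prim_le => // x /h; rewrite ler_norml => /andP[].
Qed.

(** In the norm weighted by [expR (- s * |x|)] each primitive gains a factor [1 / s], whatever the
    length [T] of the interval. A large [s] therefore turns Volterra operators into contractions
    without any smallness of [T]. *)
Lemma prim_wbound g s M T t : continuous g -> 0 < s -> 0 <= M ->
  (forall x, `|x| <= T -> `|g x| <= M * expR (s * `|x|)) -> `|t| <= T ->
  `|prim g t| <= M / s * expR (s * `|t|).
Proof.
move=> + s0 M0; wlog t0 : g t / 0 <= t => [hw cg h tT|cg h tT].
  have [t0|/ltW t0] := leP 0 t; first exact: hw.
  have := hw (fun t => g (- t)) (- t); rewrite oppr_ge0 prim_opp// opprK !normrN.
  apply => //; first by apply: ct_comp => //; apply: ctN; exact: ct_id.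
  by move=> x xT; rewrite -(normrN x); apply: h; rewrite normrN.
rewrite (ger0_norm t0); move: tT; rewrite (ger0_norm t0) => tT.
apply: (@le_trans _ _ (prim (fun t => M * expR (s * t)) t)).
  apply: prim_abs => //; first by apply: ctM; [exact: ct_cst|exact: ct_expRs].
  move=> x /andP[x0 xt]; rewrite -{2}(gtr0_norm x0); apply: h.
  by rewrite gtr0_norm//; lra.
rewrite primZ; last exact: ct_expRs.
rewrite prim_expRs ?gt_eqF// -mulrA; apply: ler_wpM2l => //.
by apply: ler_wpM2l; rewrite ?invr_ge0 ?(ltW s0)// lerBlDr lerDl ler01.
Qed.

Lemma primn_wbound n g s M T t : continuous g -> 0 < s -> 0 <= M ->
  (forall x, `|x| <= T -> `|g x| <= M * expR (s * `|x|)) -> `|t| <= T ->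
  `|primn n g t| <= M / s ^+ n * expR (s * `|t|).
Proof.
move=> cg s0 M0 h; elim: n t => [|n ih] t tT; first by rewrite expr0 divr1; exact: h.
rewrite exprS invfM mulrCA [_ * (M / _)]mulrC primnS.
apply: (prim_wbound (T := T)) => //; first exact: ct_primn.
by rewrite divr_ge0// exprn_ge0// ltW.
Qed.

Lemma prim_bound g M T t : continuous g ->
  (forall x, `|x| <= T -> `|g x| <= M) -> `|t| <= T -> `|prim g t| <= M * `|t|.
Proof.
wlog t0 : g t / 0 <= t => [hw cg h tT|cg h].
  have [t0|/ltW t0] := leP 0 t; first exact: hw.
  have := hw (fun t => g (- t)) (- t); rewrite oppr_ge0 prim_opp// opprK !normrN.
  apply => //; first by apply: ct_comp => //; apply: ctN; exact: ct_id.
  by move=> x xT; apply: h; rewrite normrN.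
rewrite (ger0_norm t0) => tT; have := @prim_abs g (fun=> M) t cg (@ct_cst M) t0.
by rewrite prim_cst; apply => x /andP[x0 xt]; apply: h; rewrite gtr0_norm//; lra.
Qed.

Lemma primn_bound n g M T t : continuous g -> T <= 1 -> 0 <= M ->
  (forall x, `|x| <= T -> `|g x| <= M) -> `|t| <= T -> `|primn n g t| <= M.
Proof.
move=> cg T1 M0 h; elim: n t => [|n ih] t tT; first exact: h.
have := prim_bound (@ct_primn n g cg) ih tT.
move=> /le_trans; apply; rewrite -[leRHS]mulr1; apply: ler_wpM2l => //.
exact: le_trans tT T1.
Qed.

End prim_theory.

Arguments primn : simpl never.

(** * Fourth order jets and Volterra equations *)

Section jets.
Context {R : realType}.
Implicit Types (f g : R -> R) (a b c d x t e s M T L K : R) (y z : nat -> R -> R).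

(** A function carried together with its derivatives up to order 4. Differentiability is asked only
    inside []0, T[], and continuity up to the ends only below order 4, so a fourth derivative known
    only inside, through the equation, is enough. *)
Definition jet T y :=
  (forall j, (j < 4)%N -> forall t, 0 < t < T -> der (y j) t (y j.+1 t)) /\
  (forall j, (j < 4)%N -> {within `[0, T], continuous (y j)}).

Lemma exp_lower_bound T K s f df : 0 < s -> 0 <= K ->
  (forall t, 0 < t < T -> der f t (df t)) -> {within `[0, T], continuous f} ->
  (forall t, 0 < t < T -> - K * expR (s * t) <= df t) -> 0 <= f 0 ->
  forall t, 0 <= t <= T -> - (K / s) * expR (s * t) <= f t.
Proof.
move=> s0 K0 hf cf hdf f0 t /andP[t0 tT].
have := @nondecr_le _ 0 T (fun t => f t + K / s * expR (s * t))
  (fun t => df t + K * expR (s * t)) _ _ _ 0 t (lexx _) t0 tT.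
rewrite mulr0 expR0 mulr1 => h.
have {h} : f 0 + K / s <= f t + K / s * expR (s * t).
  apply: h.
  - move=> x xT; apply: derD; first exact: hf.
    apply: der_eq; first by apply: derZ; exact: der_expRs.
    by rewrite mulrA divfK// gt_eqF.
  - by apply: wctD cf _; apply: cont_within; apply: ctM; [exact: ct_cst|exact: ct_expRs].
  - by move=> x /hdf; rewrite mulNr -lerBlDr sub0r.
have : 0 <= K / s by rewrite divr_ge0// ltW.
by lra.
Qed.

Lemma within_pow_bound L : 0 <= L -> L / (L + 1) ^+ 4 < 1.
Proof.
move=> L0; rewrite ltr_pdivrMr ?mul1r; last by apply: exprn_gt0; lra.
by apply: (@lt_le_trans _ _ (L + 1)); [lra|apply: ler_eXnr => //; lra].
Qed.

(** Let [N] be the maximum of the negative part of [y] in the weight with rate [s = L + 1]. Then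
    [y''''] is at least [- L * N * expR (s * t)], and four integrations from nonnegative data bound
    the negative part by [L / s ^+ 4 * N] in the same weight. Since [L / s ^+ 4 < 1], [N] is
    zero. *)
Lemma jet_ge0 T L y : jet T y -> 0 <= L ->
  (forall t, 0 < t < T -> - (L * Num.max 0 (- y 0%N t)) <= y 4%N t) ->
  (forall j, (j < 4)%N -> 0 <= y j 0) -> forall t, 0 <= t <= T -> 0 <= y 0%N t.
Proof.
move=> [dy cy] L0 hy y0 t tT.
have T0 : 0 <= T by lra.
pose s := L + 1; have s0 : 0 < s by rewrite /s; lra.
pose n x := Num.max 0 (- y 0%N x) * expR (- s * x).
have cn : {within `[0, T], continuous n}.
  apply: wctM; last by apply: cont_within; exact: ct_expRs.
  by apply: wct_max; [exact: wct_cst|apply: wctN; exact: (cy 0%N)].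
have [c /[!in_itv]/= cT nc] := EVT_max T0 cn.
have yN x : 0 <= x <= T -> Num.max 0 (- y 0%N x) <= n c * expR (s * x).
  move=> xT; have := nc x; rewrite in_itv/= => /(_ xT).
  by rewrite {1}/n mulNr expRN ler_pdivrMr ?expR_gt0.
have N0 : 0 <= n c by rewrite mulr_ge0 ?expR_ge0// le_max lexx.
have K0 : 0 <= L * n c by rewrite mulr_ge0.
have step j K : (j < 4)%N -> 0 <= K ->
    (forall t, 0 < t < T -> - K * expR (s * t) <= y j.+1 t) ->
    forall t, 0 <= t <= T -> - (K / s) * expR (s * t) <= y j t.
  move=> j4 K0' h.
  by apply: (exp_lower_bound s0 K0' (dy _ j4) (cy _ j4) h); exact: y0.
have sub (P : R -> Prop) : (forall t, 0 <= t <= T -> P t) ->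
  (forall t, 0 < t < T -> P t) by move=> h u uT; apply: h; lra.
have s0' := ltW s0.
have h4 : (forall t, 0 < t < T -> - (L * n c) * expR (s * t) <= y 4%N t).
  move=> x xT; apply: le_trans (hy x xT); rewrite mulNr lerN2 -mulrA.
  by apply: ler_wpM2l => //; apply: yN; lra.
move: h4 => /(step 3%N _ isT K0)/sub/(step 2%N _ isT (divr_ge0 K0 s0')).
move=> /sub/(step 1%N _ isT (divr_ge0 (divr_ge0 K0 s0') s0')).
move=> /sub/(step 0%N _ isT (divr_ge0 (divr_ge0 (divr_ge0 K0 s0') s0') s0')).
have -> : L * n c / s / s / s / s = L / s ^+ 4 * n c by field; rewrite gt_eqF.
have q1 := within_pow_bound L0.
move=> hh; have nc0 : n c <= 0.
  have : n c <= L / s ^+ 4 * n c.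
    rewrite {1}/n mulNr expRN ler_pdivrMr ?expR_gt0// ge_max; apply/andP; split.
      by rewrite mulr_ge0 ?expR_ge0// mulr_ge0// divr_ge0// exprn_ge0.
    by have := hh c cT; rewrite mulNr => h; rewrite lerNl.
  have [//|n0] := leP (n c) 0.
  by rewrite -[leLHS]mul1r ler_pM2r// leNgt q1.
have := yN t tT; have : n c * expR (s * t) <= 0 by rewrite mulr_le0_ge0// expR_ge0.
move=> h1 /le_trans/(_ h1); rewrite ge_max => /andP[_]; lra.
Qed.

Lemma jet_taylor T y : jet T y -> (forall t, 0 < t < T -> 0 <= y 4%N t) ->
  forall t, 0 <= t <= T ->
  [/\ y 3%N 0 <= y 3%N t, y 2%N 0 + y 3%N 0 * t <= y 2%N t,
   y 1%N 0 + y 2%N 0 * t + y 3%N 0 * (t ^+ 2 / 2) <= y 1%N t &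
   y 0%N 0 + y 1%N 0 * t + y 2%N 0 * (t ^+ 2 / 2) + y 3%N 0 * (t ^+ 3 / 6)
     <= y 0%N t].
Proof.
move=> [dy cy] h4.
have step j (P p : R -> R) : (j < 4)%N -> (forall t, der P t (p t)) ->
   (forall t, 0 < t < T -> p t <= y j.+1 t) -> P 0 = y j 0 ->
   forall t, 0 <= t <= T -> P t <= y j t.
  move=> j4 dP hp P0 t /andP[t0 tT]; rewrite -subr_ge0.
  have -> : 0 = y j 0 - P 0 by rewrite P0 subrr.
  apply: (@nondecr_le _ 0 T (fun t => y j t - P t) (fun t => y j.+1 t - p t)) => //.
  - by move=> x xT; apply: derD; [exact: dy|exact: derN].
  - by apply: wctD; [exact: cy|apply/wctN/der_within/dP].
  - by move=> x /hp; rewrite subr_ge0.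
have h3 : forall t, 0 <= t <= T -> y 3%N 0 <= y 3%N t.
  by apply: (step 3%N (fun=> y 3%N 0) (fun=> 0)) => // t; exact: der_cst.
have h2 : forall t, 0 <= t <= T -> y 2%N 0 + y 3%N 0 * t <= y 2%N t.
  apply: (step 2%N _ (fun=> y 3%N 0)) => //; last by rewrite mulr0 addr0.
    move=> t; apply: der_eq; first by apply: derD; [exact: der_cst|exact/derZ/der_id].
    by ring.
  by move=> t tT; apply: h3; lra.
have h1 : forall t, 0 <= t <= T ->
    y 1%N 0 + y 2%N 0 * t + y 3%N 0 * (t ^+ 2 / 2) <= y 1%N t.
  apply: (step 1%N _ (fun t => y 2%N 0 + y 3%N 0 * t)) => //.
  - move=> t; apply: der_eq; first by der_auto.
    by rewrite /=; field.
  - by move=> t tT; apply: h2; lra.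
  - by rewrite expr0n/= mul0r !mulr0 !addr0.
have h0 : forall t, 0 <= t <= T -> y 0%N 0 + y 1%N 0 * t + y 2%N 0 * (t ^+ 2 / 2) + y 3%N 0 * (t ^+ 3 / 6) <= y 0%N t.
  apply: (step 0%N _ (fun t => y 1%N 0 + y 2%N 0 * t + y 3%N 0 * (t ^+ 2 / 2))) => //.
  - move=> t; apply: der_eq; first by der_auto.
    by rewrite /=; field.
  - by move=> t tT; apply: h1; lra.
  - by rewrite !expr0n/= !mul0r !mulr0 !addr0.
by move=> t tT; split; [exact: h3|exact: h2|exact: h1|exact: h0].
Qed.

Lemma jet_lin T a b y z : jet T y -> jet T z ->
  jet T (fun j t => a * y j t + b * z j t).
Proof.
move=> [dy cy] [dz cz]; split=> j j4.
  by move=> t tT; apply: derD; apply: derZ; [exact: dy|exact: dz].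
by apply: wctD; apply: wctM; [exact: wct_cst|exact: cy|exact: wct_cst|exact: cz].
Qed.

Lemma jet_eq0 T L y : jet T y -> 0 <= L ->
  (forall t, 0 < t < T -> - (L * Num.max 0 (- y 0%N t)) <= y 4%N t) ->
  (forall t, 0 < t < T -> y 4%N t <= L * Num.max 0 (y 0%N t)) ->
  (forall j, (j < 4)%N -> y j 0 = 0) -> forall t, 0 <= t <= T -> y 0%N t = 0.
Proof.
move=> jy L0 h1 h2 y0 t tT.
have ge : 0 <= y 0%N t.
  by apply: (jet_ge0 jy L0 h1) => // j j4; rewrite y0.
have : 0 <= -1 * y 0%N t + 0 * y 0%N t.
  apply: (jet_ge0 (jet_lin (-1) 0 jy jy) L0) => // [x xT|j j4]; last first.
    by rewrite y0// !mulr0 addr0.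
  by rewrite !mul0r !addr0 !mulN1r opprK lerN2; exact: h2.
by lra.
Qed.

Lemma jet_sub T T' y : T' <= T -> jet T y -> jet T' y.
Proof.
move=> TT [dy cy]; split=> j j4; last exact: sub_cc (cy j j4).
by move=> t tT; apply: dy => //; lra.
Qed.

End jets.

Section volterra.
Context {R : realType}.
Implicit Types (f g h y z : R -> R) (a b c d x t e s M T L K : R).

Lemma le_add_geometric a b C : 0 <= C ->
  (forall p, a <= b + C / 2 ^+ p) -> a <= b.
Proof.
move=> C0 h; apply/ler_addgt0Pr => e e0.
pose p := Num.bound (C / e).
apply: le_trans (h p) _; rewrite lerD2l.
rewrite ler_pdivrMr ?exprn_gt0// -ler_pdivrMl// mulrC.
have : C / e < p%:R by apply: archi_boundP; rewrite divr_ge0// ltW.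
move=> /ltW/le_trans; apply; rewrite -natrX ler_nat.
exact/ltnW/ltn_expl.
Qed.

(** The intervals of radius [2 * C / 2 ^+ n] around [u n] are nested, so the supremum of their lower
    ends is a limit with an explicit rate. *)
Lemma geometric_cauchy_limit (u : nat -> R) C : 0 <= C ->
  (forall n, `|u n.+1 - u n| <= C / 2 ^+ n) ->
  exists l, forall n, `|u n - l| <= 2 * C / 2 ^+ n.
Proof.
move=> C0 hu.
have le_add n : C / 2 ^+ n = 2 * C / 2 ^+ n - 2 * C / 2 ^+ n.+1.
  by rewrite exprS; field; rewrite expf_neq0.
pose lo n := u n - 2 * C / 2 ^+ n; pose hi n := u n + 2 * C / 2 ^+ n.
have lo1 n : lo n <= lo n.+1.
  by have := hu n; rewrite ler_norml le_add /lo => /andP[]; lra.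
have hi1 n : hi n.+1 <= hi n.
  by have := hu n; rewrite ler_norml le_add /hi => /andP[]; lra.
have loM n m : (n <= m)%N -> lo n <= lo m.
  by move=> /subnK <-; elim: (m - n)%N => // k ih; exact: le_trans ih (lo1 _).
have hiM n m : (n <= m)%N -> hi m <= hi n.
  by move=> /subnK <-; elim: (m - n)%N => // k ih; exact: le_trans (hi1 _) ih.
have lohi n m : lo n <= hi m.
  apply: le_trans (loM _ _ (leq_maxl n m)) _.
  apply: le_trans (hiM _ _ (leq_maxr n m)).
  have : 0 <= 2 * C / 2 ^+ maxn n m by rewrite divr_ge0 ?mulr_ge0// exprn_ge0.
  by rewrite /lo /hi; lra.
exists (sup (range lo)) => n; rewrite ler_norml.
have h1 : lo n <= sup (range lo).
  by apply: ub_le_sup; [exists (hi n) => _ [m _ <-]; exact: lohi|exists n].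
have h2 : sup (range lo) <= hi n.
  by apply: ge_sup; [exists (lo 0), 0|move=> _ [m _ <-]; exact: lohi].
by move: h1 h2; rewrite /lo /hi; lra.
Qed.

(** A rate [s] with [L / s ^+ 4 <= 1 / 2]: in this weight the fourfold primitive of an [L]-Lipschitz
    source contracts by one half. *)
Definition wrate L : R := 2 * L + 1.

Lemma wrate_gt0 L : 0 <= L -> 0 < wrate L.
Proof. by rewrite /wrate; lra. Qed.

Lemma wrate4 L : 0 <= L -> 1 <= wrate L ^+ 4 /\ L / wrate L ^+ 4 <= 1 / 2.
Proof.
move=> L0; have s1 : 1 <= wrate L by rewrite /wrate; lra.
have s4 : wrate L <= wrate L ^+ 4 by apply: ler_eXnr.
split; first exact: le_trans s1 s4.
rewrite ler_pdivrMr; last by apply: exprn_gt0; lra.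
by move: s4; rewrite {1}/wrate; lra.
Qed.

(** The weighted maximum [M] of [y] satisfies [M <= a + c + M / 2], and the last term is absorbed.
    This is the source of every estimate of dependence on data and parameters. *)
Lemma volterra_gronwall y g h T L a c : 0 <= T -> 0 <= L -> 0 <= a -> 0 <= c ->
  continuous y -> continuous h ->
  (forall t, `|t| <= T -> y t = g t + primn 4 h t) ->
  (forall t, `|t| <= T -> `|g t| <= a) ->
  (forall t, `|t| <= T -> `|h t| <= L * `|y t| + c) ->
  forall t, `|t| <= T -> `|y t| <= 2 * (a + c) * expR (wrate L * `|t|).
Proof.
move=> T0 L0 a0 c0 cy ch yE hg hh.
set s := wrate L; have s0 := wrate_gt0 L0; have [s1 sL] := wrate4 L0.
have cn : {within `[- T, T], continuous (fun t => `|y t| * expR (- s * `|t|))}.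
  apply: wctM; first by apply: wct_norm; exact: cont_within.
  apply: cont_within => t; apply: (@continuous_comp _ _ _ (fun t => `|t|) (fun t => expR (- s * t))).
    exact: norm_continuous.
  exact: ct_expRs.
have TT : - T <= T by lra.
have [x] := EVT_max TT cn; rewrite in_itv/= -ler_norml => xT hx.
set M := `|y x| * _ in hx.
have M0 : 0 <= M by rewrite mulr_ge0// expR_ge0.
have yM t : `|t| <= T -> `|y t| <= M * expR (s * `|t|).
  move=> tT; have := hx t; rewrite in_itv/= -ler_norml => /(_ tT).
  by rewrite mulNr expRN ler_pdivrMr ?expR_gt0.
have e1 t : 1 <= expR (s * `|t|).
  by rewrite -expR0 ler_expR mulr_ge0// ltW.
have hM t : `|t| <= T -> `|h t| <= (L * M + c) * expR (s * `|t|).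
  move=> tT; apply: le_trans (hh t tT) _; rewrite mulrDl; apply: lerD.
    by rewrite -mulrA; apply: ler_wpM2l => //; exact: yM.
  by rewrite -[leLHS]mulr1; apply: ler_wpM2l.
have K0 : 0 <= L * M + c by rewrite addr_ge0// mulr_ge0.
have pM := primn_wbound 4 ch s0 K0 hM xT.
have : M <= a + (L * M + c) / s ^+ 4.
  rewrite {1}/M mulNr expRN ler_pdivrMr ?expR_gt0// yE//.
  apply: le_trans (ler_normD _ _) _; rewrite mulrDl; apply: lerD => //.
  apply: le_trans (hg _ xT) _.
  by rewrite -[leLHS]mulr1; apply: ler_wpM2l.
have E : (L * M + c) / s ^+ 4 = (L / s ^+ 4) * M + c / s ^+ 4.
  by field; rewrite gt_eqF.
rewrite E => h1.
have h2 : (L / s ^+ 4) * M <= 1 / 2 * M by apply: ler_wpM2r.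
have h3 : c / s ^+ 4 <= c.
  rewrite ler_pdivrMr; last by apply: lt_le_trans s1.
  by rewrite -[leLHS]mulr1; apply: ler_wpM2l.
move=> t tT; apply: le_trans (yM t tT) _; apply: ler_wpM2r; first exact: expR_ge0.
by clear - h1 h2 h3; lra.
Qed.

Section existence.
Variables (N : R -> R -> R) (g : R -> R) (L : R).
Hypotheses (L0 : 0 <= L) (NL : forall t a b, `|N t a - N t b| <= L * `|a - b|).
Hypothesis Nc : forall y : R -> R, continuous y -> continuous (fun t => N t (y t)).
Hypothesis gc : continuous g.

Let Phi y t := g t + primn 4 (fun t => N t (y t)) t.
Let Y n := iter n Phi g.

Let cY n : continuous (Y n).
Proof.
elim: n => // n ih /=; rewrite -/(Y n); apply: ctD => //.
by apply: ct_primn; exact: Nc.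
Qed.

Let Phi_dist y z T K : continuous y -> continuous z -> 0 <= K ->
  (forall t, `|t| <= T -> `|y t - z t| <= K * expR (wrate L * `|t|)) ->
  forall t, `|t| <= T -> `|Phi y t - Phi z t| <= K / 2 * expR (wrate L * `|t|).
Proof.
move=> cy cz K0 h t tT; rewrite /Phi opprD addrACA subrr add0r.
have := @primnB _ 4 _ _ (Nc cy) (Nc cz); move=> /funeqP/(_ t) <-.
have LK0 : 0 <= L * K by rewrite mulr_ge0.
have [s1 sL] := wrate4 L0.
have := @primn_wbound _ 4 (fun t => N t (y t) - N t (z t)) (wrate L) (L * K) T t.
move=> /(_ _ (wrate_gt0 L0) LK0 _ tT) H; apply: le_trans (H _ _) _.
- by apply: ctD; [exact: Nc|apply: ctN; exact: Nc].
- move=> x xT; apply: le_trans (NL _ _ _) _; rewrite -mulrA.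
  by apply: ler_wpM2l => //; exact: h.
- apply: ler_wpM2r; first exact: expR_ge0.
  by rewrite mulrAC mulrC; apply: ler_wpM2l => //; lra_from sL.
Qed.

Let Y_step T : 0 <= T -> exists2 K, 0 <= K & forall n t, `|t| <= T ->
  `|Y n.+1 t - Y n t| <= K / 2 ^+ n * expR (wrate L * `|t|).
Proof.
move=> T0.
have cd : continuous (fun t => Y 1 t - Y 0 t) by apply: ctD; [|apply: ctN]; exact: cY.
have TT : - T <= T by lra.
have [K K0 hK] := EVT_bound TT (@cont_within _ _ _ cd).
exists K; [exact: ltW|elim=> [|n ih] t tT].
  rewrite expr0 divr1; apply: le_trans (hK t _) _; first by rewrite -ler_norml.
  rewrite -[leLHS]mulr1; apply: ler_wpM2l; first exact: ltW.
  by rewrite -expR0 ler_expR mulr_ge0// ltW// wrate_gt0.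
have Kn0 : 0 <= K / 2 ^+ n by rewrite divr_ge0 ?exprn_ge0// ltW.
have := Phi_dist (@cY _) (@cY _) Kn0 ih tT.
by move=> h; rewrite exprS (mulrC 2) invfM mulrA; exact: h.
Qed.

(** Picard iteration from [g]. The weighted contraction [Phi_dist] holds on every [[- T, T]] with
    the same factor, so the pointwise limits are locally uniform and the solution is global. *)
Lemma volterra_exists :
  exists2 y, continuous y & forall t, y t = g t + primn 4 (fun t => N t (y t)) t.
Proof.
have lim t : exists l, exists2 C, 0 <= C & forall n, `|Y n t - l| <= 2 * C / 2 ^+ n.
  have [K K0 hK] := Y_step (normr_ge0 t).
  have C0 : 0 <= K * expR (wrate L * `|t|) by rewrite mulr_ge0// expR_ge0.
  have [n|l hl] := @geometric_cauchy_limit (Y^~ t) _ C0.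
    by rewrite mulrAC; exact: hK.
  by exists l; exists (K * expR (wrate L * `|t|)).
have [y hy] := choice lim.
have {hy} yT T : 0 <= T -> exists2 K, 0 <= K & forall n t, `|t| <= T ->
    `|Y n t - y t| <= K / 2 ^+ n * expR (wrate L * `|t|).
  move=> T0; have [K K0 hK] := Y_step T0.
  exists (2 * K); first by rewrite mulr_ge0.
  move=> n t tT; have [C C0 hC] := hy t.
  set E := expR _; have E0 : 0 <= E by exact: expR_ge0.
  (* The subtracted tail is what makes this telescoping induction close. *)
  have Yp p : `|Y n t - Y (p + n)%N t| <= 2 * K * E / 2 ^+ n - 2 * K * E / 2 ^+ (p + n).
    elim: p => [|p ih]; first by rewrite add0n !subrr normr0.
    rewrite addSn; have := hK (p + n)%N t tT; rewrite -/E => h.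
    have := ler_normD (Y n t - Y (p + n)%N t) (Y (p + n)%N t - Y (p + n).+1 t).
    rewrite addrA subrK (distrC (Y (p + n)%N t)) => h2.
    apply: le_trans h2 _; apply: le_trans (lerD ih h) _.
    have -> : 2 * K * E / 2 ^+ (p + n).+1 = K / 2 ^+ (p + n) * E.
      by rewrite exprS; field; rewrite expf_neq0.
    lra_from.
  apply: (@le_add_geometric _ _ (2 * C)); first by rewrite mulr_ge0.
  move=> p; have := ler_normD (Y n t - Y (p + n)%N t) (Y (p + n)%N t - y t).
  rewrite addrA subrK => h; apply: le_trans h _; apply: lerD.
    apply: le_trans (Yp p) _; rewrite mulrAC.
    have : 0 <= 2 * K * E / 2 ^+ (p + n) by rewrite divr_ge0 ?exprn_ge0// !mulr_ge0.
    lra.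
  apply: le_trans (hC _) _; apply: ler_wpM2l; first by rewrite mulr_ge0.
  by rewrite lef_pV2 ?posrE ?exprn_gt0// ler_eXn2l ?leq_addr//; lra.
have Ebound T t : `|t| <= T -> expR (wrate L * `|t|) <= expR (wrate L * T).
  by move=> tT; rewrite ler_expR ler_wpM2l// ltW// wrate_gt0.
have cy : continuous y.
  move=> x; apply/contP => e e0.
  have T0 : 0 <= `|x| + 1 by rewrite addr_ge0.
  have [K K0 hK] := yT _ T0.
  have [n hn] : exists n, K / 2 ^+ n * expR (wrate L * (`|x| + 1)) < e / 3.
    apply: contrapT => /forallNP H.
    have : e / 3 <= 0.
      apply: (@le_add_geometric _ _ (K * expR (wrate L * (`|x| + 1)))).
        by rewrite mulr_ge0// expR_ge0.
      by move=> p; rewrite add0r mulrAC leNgt; apply/negP; exact: H.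
    lra.
  have hn' t : `|t| <= `|x| + 1 -> `|Y n t - y t| < e / 3.
    move=> tT; apply: le_lt_trans hn; apply: le_trans (hK n t tT) _.
    by apply: ler_wpM2l; [rewrite divr_ge0// exprn_ge0|exact: Ebound].
  have [d d0 hd] := (contP _ _).1 (@cY n x) _ (divr_gt0 e0 (@ltr0n R 3)).
  exists (Num.min d 1); first by rewrite lt_min d0 ltr01.
  move=> t; rewrite lt_min => /andP[td t1].
  have tT : `|t| <= `|x| + 1.
    by have := ler_normD (t - x) x; rewrite subrK; lra_from t1.
  have xT : `|x| <= `|x| + 1 by lra_from.
  have := hd t td; have := hn' t tT; have := hn' x xT.
  by rewrite !ltr_norml; lra_from.
exists y => // t; apply/eqP; rewrite -subr_eq0 -normr_le0.
have [K K0 hK] := yT _ (normr_ge0 t).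
apply: (@le_add_geometric _ _ (2 * (K * expR (wrate L * `|t|)))).
  by rewrite !mulr_ge0// expR_ge0.
move=> n; rewrite add0r -/(Phi y t).
have h1 := hK n.+1 t (lexx _).
have Kn0 : 0 <= K / 2 ^+ n by rewrite divr_ge0 ?exprn_ge0.
have h2 := Phi_dist (@cY n) cy Kn0 (hK n) (lexx _).
have -> : y t - Phi y t = (y t - Y n.+1 t) + (Y n.+1 t - Phi y t).
  by rewrite addrA subrK.
apply: le_trans (ler_normD _ _) _; rewrite distrC.
apply: le_trans (lerD h1 h2) _; rewrite exprS.
have -> : K / (2 * 2 ^+ n) * expR (wrate L * `|t|) +
   K / 2 ^+ n / 2 * expR (wrate L * `|t|) = K * expR (wrate L * `|t|) / 2 ^+ n.
  by field; rewrite expf_neq0.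
apply: ler_wpM2r; first by rewrite invr_ge0 exprn_ge0.
have : 0 <= K * expR (wrate L * `|t|) by rewrite mulr_ge0// expR_ge0.
lra.
Qed.

Lemma volterra_unique T y z : 0 <= T -> continuous y -> continuous z ->
  (forall t, `|t| <= T -> y t = g t + primn 4 (fun t => N t (y t)) t) ->
  (forall t, `|t| <= T -> z t = g t + primn 4 (fun t => N t (z t)) t) ->
  forall t, `|t| <= T -> y t = z t.
Proof.
move=> T0 cy cz hy hz t tT; apply/eqP; rewrite -subr_eq0 -normr_le0.
have := @volterra_gronwall (fun t => y t - z t) (fun=> 0)
  (fun t => N t (y t) - N t (z t)) T L 0 0 T0 L0 (lexx _) (lexx _).
rewrite addr0 mulr0 => H; rewrite -(mul0r (expR (wrate L * `|t|))).
apply: H => //.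
- by apply: ctD => //; exact: ctN.
- by apply: ctD; [|apply: ctN]; exact: Nc.
- move=> x xT; rewrite hy// hz// opprD addrACA subrr add0r.
  by have /funeqP/(_ x) -> := primnB 4 (Nc cy) (Nc cz); rewrite add0r.
- by move=> x _; rewrite normr0.
- by move=> x _; rewrite addr0; exact: NL.
Qed.

End existence.
End volterra.

(** * Profiles *)

(** The hypotheses on [f] with its derivatives given as functions that stay continuous at the end
    [0]. [nl_sing] is the lower limit condition in working form: near [r], [f u] is at least
    [c / (r - u)]. *)
Record nonlinearity (R : realType) := Nonlinearity {
  nl_r : R; nl_f : R -> R; nl_f1 : R -> R; nl_f2 : R -> R;
  nl_r_gt0 : 0 < nl_r;
  nl_cf : {within `[0, nl_r[, continuous nl_f};
  nl_cf1 : {within `[0, nl_r[, continuous nl_f1};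
  nl_cf2 : {within `[0, nl_r[, continuous nl_f2};
  nl_df : forall u, 0 < u < nl_r -> der nl_f u (nl_f1 u);
  nl_df1 : forall u, 0 < u < nl_r -> der nl_f1 u (nl_f2 u);
  nl_f_gt0 : forall u, 0 <= u < nl_r -> 0 < nl_f u;
  nl_f1_gt0 : forall u, 0 < u < nl_r -> 0 < nl_f1 u;
  nl_f2_gt0 : forall u, 0 < u < nl_r -> 0 < nl_f2 u;
  nl_sing : exists2 c, 0 < c & exists2 r1, r1 < nl_r &
    forall u, r1 < u < nl_r -> c <= (nl_r - u) * nl_f u }.

Section clip.
Context {R : realType}.
Implicit Types (m x y : R).

(** Truncation to [[0, m]]. For [0 <= m < r] it keeps the argument of [f] in its domain and makes
    the composition globally Lipschitz, while a solution with values in [[0, m]] does not notice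
    it. *)
Definition clip m x : R := Num.max 0 (Num.min m x).

Lemma clip_itv m x : 0 <= m -> 0 <= clip m x <= m.
Proof. by move=> m0; rewrite /clip le_max lexx /= ge_max m0 ge_min lexx. Qed.

Lemma clip_id m x : 0 <= x <= m -> clip m x = x.
Proof. by move=> /andP[x0 xm]; rewrite /clip min_r// max_r. Qed.

Lemma clip_lip m m' x y : `|clip m x - clip m' y| <= `|x - y| + `|m - m'|.
Proof.
rewrite /clip; case: (lerP m x) => h1; case: (lerP m' y) => h2;
 [case: (lerP 0 m) => h3; case: (lerP 0 m') => h4
 |case: (lerP 0 m) => h3; case: (lerP 0 y) => h4
 |case: (lerP 0 x) => h3; case: (lerP 0 m') => h4
 |case: (lerP 0 x) => h3; case: (lerP 0 y) => h4];
 case: (ger0P (x - y)) => h5; case: (ger0P (m - m')) => h6;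
 rewrite ?ler_norml; lra.
Qed.

Lemma ct_clip m : continuous (clip m).
Proof.
move=> x; apply/contP => e e0; exists e => // y yx.
by apply: le_lt_trans (clip_lip m m y x) _; rewrite subrr normr0 addr0.
Qed.

End clip.

Section nonlinearity_theory.
Context {R : realType} (F : nonlinearity R).
Implicit Types (m t u v x y k c lam : R).
Local Notation r := (nl_r F).
Local Notation f := (nl_f F).
Local Notation f1 := (nl_f1 F).
Local Notation f2 := (nl_f2 F).

Lemma continuous_comp_range (g v : R -> R) : {within `[0, r[, continuous g} ->
  continuous v -> (forall t, 0 <= v t < r) -> continuous (fun t => g (v t)).
Proof.
move=> /withinC_P cg cv hv x; apply/contP => e e0.
have [|d d0 hd] := cg (v x) _ e e0; first by rewrite /= in_itv/=; exact: hv.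
have [d' d'0 hd'] := (contP _ _).1 (cv x) d d0.
by exists d' => // y /hd'; apply: hd; rewrite /= in_itv/=; exact: hv.
Qed.

Lemma clip_lt m x : 0 <= m < r -> 0 <= clip m x < r.
Proof. by case/andP=> m0 mr; have := clip_itv x m0; lra. Qed.

Lemma ct_fclip (g v : R -> R) m : 0 <= m < r -> {within `[0, r[, continuous g} ->
  continuous v -> continuous (fun t => g (clip m (v t))).
Proof.
move=> mr cg cv; apply: (continuous_comp_range cg).
  exact: (ct_comp (@ct_clip _ m) cv).
by move=> t; exact: clip_lt.
Qed.

Lemma sub_r (g : R -> R) a b : 0 <= a -> b < r -> {within `[0, r[, continuous g} ->
  {within `[a, b], continuous g}.
Proof.
by move=> a0 br; apply: sub_within => x /=; rewrite !in_itv/=; lra.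
Qed.

Lemma f_incr x y : 0 <= x -> x < y -> y < r -> f x < f y.
Proof.
move=> x0 xy yr; apply: (@incr_lt _ x y f f1) => //.
- by move=> z xz; apply: nl_df; lra.
- by apply: sub_r => //; exact: nl_cf.
- by move=> z xz; apply: nl_f1_gt0; lra.
Qed.

Lemma f_nd x y : 0 <= x -> x <= y -> y < r -> f x <= f y.
Proof.
by move=> x0; rewrite le_eqVlt => /predU1P[->//|xy] yr; apply/ltW/f_incr.
Qed.

Lemma f1_ge0 x : 0 <= x < r -> 0 <= f1 x.
Proof.
move=> xr; have [x0|x0] := ltP 0 x; first by apply/ltW/nl_f1_gt0; lra.
have -> : x = 0 by lra.
rewrite leNgt; apply/negP => fneg; have {fneg} e0 : 0 < - f1 0 by lra.
have /withinC_P h := @nl_cf1 _ F.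
have I0 : `[0, r[%classic (0 : R) by rewrite /= in_itv/= lexx nl_r_gt0.
have [d d0 hd] := h 0 I0 _ e0.
pose y := Num.min d r / 2.
have mp : 0 < Num.min d r by rewrite lt_min d0 nl_r_gt0.
have [m1 m2] : Num.min d r <= d /\ Num.min d r <= r by rewrite !ge_min !lexx orbT.
have yr : 0 < y < r by rewrite /y; have := nl_r_gt0 F; lra.
have := hd y; rewrite /= in_itv/= subr0 gtr0_norm; last lra.
have y1 : 0 <= y < r by lra.
have y2 : y < d by rewrite /y; lra.
move=> /(_ y1 y2); have := nl_f1_gt0 yr; rewrite ltr_norml; lra.
Qed.

Lemma lipschitz_sub (g g1 : R -> R) m : 0 <= m < r ->
  {within `[0, r[, continuous g} -> {within `[0, r[, continuous g1} ->
  (forall u, 0 < u < r -> der g u (g1 u)) ->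
  exists2 L, 0 <= L & forall x y, 0 <= x <= m -> 0 <= y <= m ->
    `|g x - g y| <= L * `|x - y|.
Proof.
move=> mr cg cg1 dg; have m0 : 0 <= m by lra.
have mr' : m < r by lra.
have [L L0 hL] := EVT_bound m0 (sub_r (lexx _) mr' cg1).
exists L; first exact: ltW.
have key x y : 0 <= x -> x < y -> y <= m -> `|g x - g y| <= L * `|x - y|.
  move=> x0 xy ym.
  have dg' z : x < z < y -> der g z (g1 z) by move=> zz; apply: dg; lra.
  have yr : y < r by lra.
  have [z zz E] := MVT_in xy dg' (sub_r x0 yr cg).
  rewrite distrC E normrM (distrC x); apply: ler_wpM2r => //; apply: hL; lra.
move=> x y xm ym; have [xy|yx|->] := ltgtP x y; last by rewrite !subrr normr0 mulr0.
  by apply: key; lra.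
by rewrite distrC (distrC x); apply: key; lra.
Qed.

Lemma f_lipschitz m : 0 <= m < r ->
  exists2 L, 0 <= L & forall x y, 0 <= x <= m -> 0 <= y <= m ->
    `|f x - f y| <= L * `|x - y|.
Proof. by move=> mr; apply: lipschitz_sub (@nl_cf1 _ F) _ => //; [exact: nl_cf|exact: nl_df]. Qed.

(** Monotonicity settles one sign of [x - y] and the Lipschitz bound the other. The result is the
    one-sided control by a negative part that [jet_ge0] asks for. *)
Lemma f_diff_lip m : 0 <= m < r -> exists2 L, 0 <= L & forall x y,
  0 <= x <= m -> 0 <= y <= m ->
  - (L * Num.max 0 (y - x)) <= f x - f y <= L * Num.max 0 (x - y).
Proof.
move=> mr; have [L L0 hL] := f_lipschitz mr; exists L => // x y xm ym.
have := hL x y xm ym; have [xy|yx|->] := ltgtP x y; last first.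
- by rewrite !subrr normr0 maxxx mulr0 oppr0 lexx.
- have fxy : f y < f x by apply: f_incr; lra.
  rewrite max_l; last lra.
  rewrite max_r; last lra.
  rewrite gtr0_norm; last lra.
  rewrite gtr0_norm; lra.
- have fxy : f x < f y by apply: f_incr; lra.
  rewrite max_r; last lra.
  rewrite max_l; last lra.
  rewrite ltr0_norm; last lra.
  rewrite ltr0_norm; lra.
Qed.

End nonlinearity_theory.

Section volterra_jets.
Context {R : realType}.
Implicit Types (a k t T : R) (h : R -> R).

(* The derivatives [j <= 4] of the [v] with [v'''' = h], [v 0 = a],
   [v'' 0 = - k] and [v' 0 = v''' 0 = 0]. *)
Definition vjet a k h (j : nat) t : R :=
  match j with
  | 0 => a - k * (t ^+ 2 / 2) + primn 4 h t
  | 1 => - (k * t) + primn 3 h t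
  | 2 => - k + primn 2 h t
  | 3 => primn 1 h t
  | _ => h t
  end.

Lemma der_vjet a k h j t : continuous h -> (j < 4)%N ->
  der (vjet a k h j) t (vjet a k h j.+1 t).
Proof.
move=> ch; case: j => [|[|[|[|//]]]] _ /=.
- apply: der_eq; first by apply: derD; [der_auto|exact: (der_primn 3)].
  by rewrite /=; field.
- apply: der_eq; first by apply: derD; [der_auto|exact: (der_primn 2)].
  by rewrite /=; ring.
- apply: der_eq; first by apply: derD; [der_auto|exact: (der_primn 1)].
  by rewrite /=; ring.
- exact: (der_primn 0).
Qed.

Lemma ct_vjet a k h j : continuous h -> continuous (vjet a k h j).
Proof.
move=> ch; case: (ltnP j 4) => j4 t; first exact: der_cont (der_vjet _ _ _ ch j4).
by move: j j4 => [|[|[|[|j]]]]//= _; exact: ch.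
Qed.

Lemma jet_vjet T a k h : continuous h -> jet T (vjet a k h).
Proof.
move=> ch; split=> j j4; first by move=> t _; exact: der_vjet.
by apply: cont_within; exact: ct_vjet.
Qed.

Lemma vjet_at0 a k h : continuous h ->
  [/\ vjet a k h 0%N 0 = a, vjet a k h 1%N 0 = 0, vjet a k h 2%N 0 = - k
    & vjet a k h 3%N 0 = 0].
Proof.
move=> ch; rewrite /vjet !primn0// expr0n/=; split=> //; ring.
Qed.

Lemma primn4_opp h t : continuous h ->
  primn 4 (fun s => h (- s)) t = primn 4 h (- t).
Proof.
move=> ch; have /funeqP/(_ t) := primn_scale 4 (-1) ch.
rewrite mulN1r => <-; congr (primn 4 _ t).
by apply/funext => s; rewrite mulN1r -signr_odd expr0 mul1r.
Qed.

Lemma der_min (g : R -> R) a b c d : a < c < b -> der g c d ->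
  (forall t, a < t < b -> g c <= g t) -> d = 0.
Proof.
move=> cab /derP dg gmin; apply/eqP; apply: contrapT => /negP d0.
have d2 : 0 < `|d| / 2 by rewrite divr_gt0// normr_gt0.
have [del del0 hd] := dg _ d2.
pose e := Num.min (del / 2) (Num.min ((c - a) / 2) ((b - c) / 2)).
have e0 : 0 < e by rewrite !lt_min; lra.
have [e1 [e2 e3]] : e <= del / 2 /\ (e <= (c - a) / 2 /\ e <= (b - c) / 2).
  by rewrite !ge_min !lexx !orbT.
pose y := c - Num.sg d * e.
have dd : d * Num.sg d = `|d| by rewrite mulrC -normrEsg.
have sg1 : `|Num.sg d| = 1 by rewrite normr_sg d0.
have ya : `|y - c| = e.
  by rewrite /y [c - _]addrC addrK normrN normrM sg1 mul1r gtr0_norm.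
have yi : a < y < b.
  have : `|y - c| <= e by rewrite ya.
  by rewrite ler_norml; lra.
have edel : e < del by lra.
have := hd y; rewrite ya => /(_ edel).
have -> : d * (y - c) = - (`|d| * e) by rewrite /y -dd; ring.
rewrite ler_norml => /andP[_]; have := gmin y yi.
have : 0 < `|d| * e by rewrite mulr_gt0// normr_gt0.
lra.
Qed.

Lemma convex_le0 a b (p q : R -> R) : (forall t, a < t < b -> der p t (q t)) ->
  {within `[a, b], continuous p} ->
  (forall x y, a < x -> x < y -> y < b -> q x <= q y) -> p a <= 0 -> p b <= 0 ->
  forall t, a <= t <= b -> p t <= 0.
Proof.
move=> dp cp qm pa pb t tab; rewrite leNgt; apply/negP => pt.
have at_ : a < t by rewrite lt_neqAle; apply/andP; split; [apply/eqP => E; move: pt pa; rewrite E; lra|lra].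
have tb : t < b by rewrite lt_neqAle; apply/andP; split; [apply/eqP => E; move: pt pb; rewrite E; lra|lra].
have d1 x : a < x < t -> der p x (q x) by move=> ?; apply: dp; lra.
have d2 x : t < x < b -> der p x (q x) by move=> ?; apply: dp; lra.
have [x xx Ex] := MVT_in at_ d1 (sub_cc (lexx _) (ltW tb) cp).
have [y yy Ey] := MVT_in tb d2 (sub_cc (ltW at_) (lexx _) cp).
have qxy : q x <= q y by apply: qm; lra.
have : 0 < q x by rewrite -(pmulr_lgt0 (x := t - a)) -?Ex; lra.
have : q y < 0 by rewrite -(pmulr_llt0 (x := b - t)) -?Ey; lra.
lra.
Qed.

Lemma convex_lt0 a b (p q : R -> R) : (forall t, a < t < b -> der p t (q t)) ->
  {within `[a, b], continuous p} ->
  (forall x y, a < x -> x < y -> y < b -> q x < q y) -> p a <= 0 -> p b <= 0 ->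
  forall t, a < t < b -> p t < 0.
Proof.
move=> dp cp qm pa pb t tab; rewrite ltNge; apply/negP => pt.
have at_ : a < t by lra.
have tb : t < b by lra.
have d1 x : a < x < t -> der p x (q x) by move=> ?; apply: dp; lra.
have d2 x : t < x < b -> der p x (q x) by move=> ?; apply: dp; lra.
have [x xx Ex] := MVT_in at_ d1 (sub_cc (lexx _) (ltW tb) cp).
have [y yy Ey] := MVT_in tb d2 (sub_cc (ltW at_) (lexx _) cp).
have qxy : q x < q y by apply: qm; lra.
have : 0 <= q x by rewrite -(pmulr_lge0 (x := t - a)) -?Ex; lra.
have : q y <= 0 by rewrite -(pmulr_lle0 (x := b - t)) -?Ey; lra.
lra.
Qed.

Lemma prim_pow c n : prim (fun t => c * t ^+ n) =
  fun t : R => c / n.+1%:R * t ^+ n.+1.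
Proof.
apply/esym/prim_uniq; first by apply: ctM; [exact: ct_cst|apply: ctX; exact: ct_id].
  by rewrite expr0n/= mulr0.
move=> t; apply: der_eq; first by apply: derZ; apply: derX; exact: der_id.
by rewrite /= mulr1 mulrA divfK// pnatr_eq0.
Qed.

End volterra_jets.

Section profiles.
Context {R : realType} (F : nonlinearity R).
Implicit Types (m t u x y k c lam : R) (v w : R -> R).
Local Notation r := (nl_r F).
Local Notation f := (nl_f F).
Local Notation f1 := (nl_f1 F).
Local Notation f2 := (nl_f2 F).

Definition source m lam v : R -> R := fun t => lam * f (clip m (v t)).

Lemma ct_source m lam v : 0 <= m < r -> continuous v -> continuous (source m lam v).
Proof.
move=> mr cv; apply: ctM; first exact: ct_cst.
exact: (ct_fclip mr (@nl_cf _ F) cv).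
Qed.

Lemma source_exists m lam k : 0 <= m < r -> exists2 v, continuous v &
  forall t, v t = vjet m k (source m lam v) 0%N t.
Proof.
move=> mr; have [L L0 hL] := f_lipschitz mr; have m0 : 0 <= m by lra.
apply: (@volterra_exists _ (fun _ y => lam * f (clip m y)) _ (`|lam| * L)).
- by rewrite mulr_ge0.
- move=> _ a b; rewrite -mulrBr normrM -mulrA; apply: ler_wpM2l => //.
  apply: le_trans (hL _ _ (clip_itv a m0) (clip_itv b m0)) _.
  apply: ler_wpM2l => //; have := clip_lip m m a b.
  by rewrite subrr normr0 addr0.
- by move=> y cy; apply: (@ct_source m lam y).
- apply: ctD; first exact: ct_cst.
  apply: ctN; apply: ctM; first exact: ct_cst.
  by apply: ctM; [apply: ctX; exact: ct_id|exact: ct_cst].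
Qed.

(** Continuous dependence on the three data at once. The term [|m - m'|] in the Lipschitz hypothesis
    pays for the two different truncation levels. *)
Lemma source_stable m m' lam lam' k k' v v' L fM : 0 <= m < r -> 0 <= m' < r ->
  0 <= L -> 0 <= lam ->
  (forall t, `|f (clip m (v t)) - f (clip m' (v' t))| <= L * (`|v t - v' t| + `|m - m'|)) ->
  (forall t, `|f (clip m' (v' t))| <= fM) ->
  continuous v -> continuous v' ->
  (forall t, v t = vjet m k (source m lam v) 0%N t) ->
  (forall t, v' t = vjet m' k' (source m' lam' v') 0%N t) ->
  forall T t, 0 <= T -> `|t| <= T -> `|v t - v' t| <=
    2 * (`|m - m'| + `|k - k'| * T ^+ 2 + (lam * L * `|m - m'| + `|lam - lam'| * fM)) *
    expR (wrate (lam * L) * `|t|).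
Proof.
move=> mr mr' L0 lam0 hL hfM cv cv' hv hv' T t T0 tT.
have fM0 : 0 <= fM := le_trans (normr_ge0 _) (hfM 0).
have cs := @ct_source m lam v mr cv; have cs' := @ct_source m' lam' v' mr' cv'.
apply: (@volterra_gronwall _ (fun t => v t - v' t)
   (fun t => (m - m') - (k - k') * (t ^+ 2 / 2))
   (fun t => source m lam v t - source m' lam' v' t) T) => //.
- by rewrite mulr_ge0.
- by rewrite addr_ge0 ?mulr_ge0// exprn_ge0.
- by rewrite addr_ge0 ?mulr_ge0.
- by apply: ctD => //; exact: ctN.
- by apply: ctD => //; exact: ctN.
- move=> x _; have /funeqP/(_ x) -> := primnB 4 cs cs'.
  rewrite hv hv' /vjet; move: (primn 4 _ x) (primn 4 _ x) => p p'.
  by ring.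
- move=> x xT; apply: le_trans (ler_normB _ _) _; rewrite lerD2l normrM.
  apply: ler_wpM2l => //; rewrite ger0_norm; last by rewrite divr_ge0// sqr_ge0.
  have : x ^+ 2 <= T ^+ 2 by rewrite -(real_normK (num_real x)) lerXn2r ?nnegrE.
  have := sqr_ge0 T; lra.
- move=> x _; rewrite /source.
  have -> : lam * f (clip m (v x)) - lam' * f (clip m' (v' x)) =
    lam * (f (clip m (v x)) - f (clip m' (v' x))) + (lam - lam') * f (clip m' (v' x)).
    by ring.
  apply: le_trans (ler_normD _ _) _; rewrite !normrM (ger0_norm lam0).
  rewrite addrA; apply: lerD; last exact: ler_wpM2l.
  have := hL x; move=> /(ler_wpM2l lam0) /le_trans; apply.
  by rewrite mulrA mulrDr.
Qed.

Lemma f_clip_bounds m x : 0 <= m < r -> f 0 <= f (clip m x) <= f m.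
Proof.
move=> mr; have m0 : 0 <= m by lra.
by have := clip_itv x m0 => h; rewrite !f_nd//; lra.
Qed.

Lemma f0_gt0 : 0 < f 0.
Proof. by apply: nl_f_gt0; rewrite lexx nl_r_gt0. Qed.

(** A solution centred at its maximum, with [k = - v'' (0)]. Conditions are imposed at [1 / 2] only,
    evenness supplying those at [- 1 / 2]; [prof_itv] makes the truncation inactive on the interval
    that matters. *)
Record profile m lam k v : Prop := Profile {
  prof_ct : continuous v;
  prof_eq : forall t, v t = vjet m k (source m lam v) 0%N t;
  prof_lam : 0 < lam;
  prof_itv : forall t, `|t| <= 1 / 2 -> 0 <= v t <= m;
  prof_v0 : v (1 / 2) = 0;
  prof_v1 : vjet m k (source m lam v) 1%N (1 / 2) = 0 }.

(* Shooting with [lam = 1]: the largest [k] for which [v] stays nonnegative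
   makes [v] touch zero at some [L]; then rescale [0, L] to [0, 1/2]. *)
Lemma touching_exists m : 0 < m < r -> exists k, exists L, exists v,
  [/\ continuous v, forall t, v t = vjet m k (source m 1 v) 0%N t, 0 < L,
      forall t, 0 <= t -> 0 <= v t & v L = 0 /\ vjet m k (source m 1 v) 1%N L = 0].
Proof.
move=> mr; have mr' : 0 <= m < r by lra.
have m0 : 0 <= m by lra.
have ex k : exists v, continuous v /\ forall t, v t = vjet m k (source m 1 v) 0%N t.
  by have [v cv ev] := @source_exists m 1 k mr'; exists v.
have [V hV] := choice ex.
have cV k : continuous (V k) by have [] := hV k.
have eV k t : V k t = vjet m k (source m 1 (V k)) 0%N t by have [] := hV k.
pose h k := source m 1 (V k).
have ch k : continuous (h k) by apply: ct_source.
have hb k t : f 0 <= h k t <= f m by rewrite /h /source mul1r f_clip_bounds.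
have f00 := f0_gt0.
have [L L0 hL] := f_lipschitz mr'.
have Vlip T : 0 <= T -> exists2 C, 0 <= C & forall k k' t, `|t| <= T ->
    `|V k t - V k' t| <= C * `|k - k'|.
  move=> T0; exists (2 * (T ^+ 2 * expR (wrate L * T))).
    by rewrite !mulr_ge0// ?expR_ge0// sqr_ge0.
  move=> k k' t tT.
  have := @source_stable m m 1 1 k k' (V k) (V k') L (f m) mr' mr' L0 ler01.
  move=> /(_ _ _ (@cV _) (@cV _) (eV _) (eV _) T t T0 tT) H.
  apply: le_trans (H _ _) _.
  - move=> x; rewrite subrr normr0 addr0.
    apply: le_trans (hL _ _ (clip_itv _ m0) (clip_itv _ m0)) _.
    apply: ler_wpM2l => //; have := clip_lip m m (V k x) (V k' x).
    by rewrite subrr normr0 addr0.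
  - move=> x; have := f_clip_bounds (V k' x) mr'; rewrite ler_norml; clear - f00; lra.
  - rewrite !subrr normr0 mulr0 mul0r !addr0 add0r mul1r.
    have -> : 2 * (T ^+ 2 * expR (wrate L * T)) * `|k - k'| =
      2 * (`|k - k'| * T ^+ 2) * expR (wrate L * T) by ring.
    apply: ler_wpM2l; first by rewrite !mulr_ge0// sqr_ge0.
    by rewrite ler_expR; apply: ler_wpM2l => //; rewrite ltW ?wrate_gt0.
have jV k T : jet T (vjet m k (h k)) by exact: jet_vjet.
have Vlow k t : 0 <= t -> m - k * (t ^+ 2 / 2) <= V k t.
  move=> t0; have h0 x : 0 < x < t -> 0 <= vjet m k (h k) 4%N x.
    by move=> _ /=; have := hb k x; lra.
  have tt : 0 <= t <= t by rewrite t0 lexx.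
  have [_ _ _] := jet_taylor (jV k t) h0 tt.
  have [-> -> -> ->] := vjet_at0 m k (ch k).
  by rewrite -eV; lra_from.
(* [0] belongs to [S] because [V 0] stays above [m], and evaluation at [t = 1] bounds [S]: there
   [V k] is at most [m - k / 2 + f m]. *)
pose S := [set k | 0 <= k /\ forall t, 0 <= t -> 0 <= V k t].
have S0 : S 0.
  by split=> // t t0; apply: le_trans (Vlow 0 t t0); rewrite mul0r subr0.
have Sub k : S k -> k <= 2 * (m + f m).
  move=> [k0 /(_ 1 ler01)]; rewrite eV /= => H.
  have fm : 0 <= f m by have := hb 0 0; lra.
  have hk x : `|x| <= 1 -> `|h k x| <= f m.
    by move=> _; rewrite ler_norml; have := hb k x; lra.
  have n1 : `|1 : R| <= 1 by rewrite normr1.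
  have := primn_bound 4 (@ch k) (lexx 1) fm hk n1.
  by move: H; rewrite ler_norml expr1n /h /=; lra_from.
have Sbd : has_ubound S by exists (2 * (m + f m)) => k /Sub.
pose k0 := sup S.
have k00 : 0 <= k0 by exact: ub_le_sup.
have V0 t : 0 <= t -> 0 <= V k0 t.
  move=> t0; rewrite leNgt; apply/negP => Vt.
  have [C C0 hC] := Vlip t t0.
  have e0 : 0 < - V k0 t / (C + 1) by rewrite divr_gt0//; clear - Vt C0; lra.
  have [k [Sk1 Sk2] kk] := sup_adherent e0 (conj (ex_intro _ 0 S0) Sbd).
  have kle : k <= k0 by apply: ub_le_sup => //; split.
  have := hC k k0 t; rewrite ger0_norm// => /(_ (lexx _)).
  have : C * `|k - k0| < - V k0 t.
    rewrite ler0_norm; last (clear - kle; lra).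
    apply: (@le_lt_trans _ _ ((C + 1) * - (k - k0))).
      by apply: ler_wpM2r; clear - kle; lra.
    rewrite mulrC -ltr_pdivlMr; last (clear - C0; lra).
    rewrite /k0; clear - kk; lra.
  have := Sk2 t t0; rewrite ler_norml; lra_from.
suff [L1 L10 VL] : exists2 L1, 0 <= L1 & V k0 L1 = 0.
  have L1p : 0 < L1.
    rewrite lt_neqAle L10 andbT; apply/eqP => E.
    by move: VL; rewrite -E eV; have [-> _ _ _] := vjet_at0 m k0 (ch k0); lra_from mr.
  exists k0, L1, (V k0); split=> //; split=> //.
  (* The zero is an interior minimum of a nonnegative function, so the slope vanishes with the
     value. *)
  apply: (@der_min _ (vjet m k0 (h k0) 0%N) 0 (L1 + 1) L1); first lra_from L1p.
    exact: der_vjet.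
  by move=> t t0; rewrite -!eV VL; apply: V0; lra_from t0.
(* If [V k0] had no zero, a slightly larger [k] would still belong to [S]. *)
apply: contrapT => H.
have Vpos t : 0 <= t -> 0 < V k0 t.
  move=> t0; rewrite lt_neqAle V0// andbT; apply/eqP => E.
  by apply: H; exists t.
(* Beyond [T] the lower bound [f 0 / 6 * x ^+ 3] of the third primitive exceeds [k * x] for all
   [k <= k0 + 1], so [V k] is nondecreasing there. Only the compact [[0, T]] remains to be
   controlled under a small change of [k]. *)
pose T := 1 + 6 * (k0 + 1) / f 0.
have T1 : 1 <= T.
  by rewrite lerDl divr_ge0 ?mulr_ge0//; clear - k00 f00; lra.
have T0 : 0 <= T by lra.
have Vmono k t : 0 <= k <= k0 + 1 -> T <= t -> V k T <= V k t.
  move=> kk Tt; rewrite !eV.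
  apply: (@nondecr_le _ T t (vjet m k (h k) 0%N) (vjet m k (h k) 1%N) _ _ _ T t (lexx T) Tt (lexx t)).
  - by move=> x _; exact: der_vjet.
  - by apply: cont_within; exact: ct_vjet.
  - move=> x Tx /=; rewrite /h.
    have x0 : 0 <= x by lra_from T0 Tx.
    have h1 y : 0 <= y -> f 0 * y <= primn 1 (h k) y.
      move=> y0; have /funeqP/(_ y) := prim_cst (f 0); rewrite /= => <-.
      by apply: prim_le => // [|z _]; [exact: ct_cst|have := hb k z; lra_from].
    have cl (c : R) n : continuous (fun t => c * t ^+ n).
      by apply: ctM; [exact: ct_cst|apply: ctX; exact: ct_id].
    have h2 y : 0 <= y -> f 0 / 2 * y ^+ 2 <= primn 2 (h k) y.
      move=> y0; have /funeqP/(_ y) := prim_pow (f 0) 1; rewrite /= => <-.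
      by apply: prim_le => // [|z zy]; [exact: (@ct_primn _ 1 _ (@ch k))|rewrite expr1; apply: h1; clear - zy; lra].
    have h3 : f 0 / 2 / 3 * x ^+ 3 <= primn 3 (h k) x.
      have /funeqP/(_ x) := prim_pow (f 0 / 2) 2; rewrite /= => <-.
      by apply: prim_le => // [|z zy]; [exact: (@ct_primn _ 2 _ (@ch k))|apply: h2; clear - zy; lra].
    suff : k * x <= f 0 / 2 / 3 * x ^+ 3 by rewrite /h in h3; clear - h3; lra.
    have -> : f 0 / 2 / 3 * x ^+ 3 = (f 0 / 6 * x ^+ 2) * x by field.
    apply: ler_wpM2r => //.
    have xx : x <= x ^+ 2 by apply: ler_eXnr => //; clear - Tx T1; lra.
    have : f 0 / 6 * T <= f 0 / 6 * x ^+ 2 by apply: ler_wpM2l; clear - f00 xx Tx; lra.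
    have -> : f 0 / 6 * T = f 0 / 6 + (k0 + 1) by rewrite /T; field; rewrite gt_eqF.
    (clear - kk f00; lra).
have [c] := EVT_min T0 (@cont_within _ _ _ (@cV k0)).
rewrite in_itv/= => cT hc; have Vc : 0 < V k0 c by apply: Vpos; clear - cT; lra.
have [C C0 hC] := Vlip T T0.
pose e := Num.min 1 (V k0 c / (C + 1)).
have C1 : 0 < C + 1 by clear - C0; lra.
have e0 : 0 < e by rewrite lt_min ltr01 divr_gt0.
have [e1 e2] : e <= 1 /\ e <= V k0 c / (C + 1) by rewrite !ge_min !lexx orbT.
have : S (k0 + e).
  have Ve t : 0 <= t <= T -> 0 <= V (k0 + e) t.
    move=> tT; have := hC (k0 + e) k0 t; rewrite ger0_norm; last (clear - tT; lra).
    have tT' : t <= T by clear - tT; lra.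
    rewrite [k0 + e]addrC addrK (ger0_norm (ltW e0)) => /(_ tT').
    have : C * e <= V k0 c.
      move: e2; rewrite ler_pdivlMr// mulrDr mulr1 mulrC; clear - e0; lra.
    by have := hc t; rewrite in_itv/= => /(_ tT); rewrite ler_norml; lra_from.
  split=> [|t t0]; first (clear - e0 k00; lra).
  have [tT|/ltW Tt] := leP t T; first by apply: Ve; clear - tT t0; lra.
  by apply: le_trans (Vmono (k0 + e) t _ Tt); [apply: Ve|]; clear - T1 e1 e0 k00; lra.
move=> /(ub_le_sup Sbd); rewrite -/k0; clear - e0; lra.
Qed.

Lemma primn_even h n c t : continuous h -> primn n (fun s => c ^+ n * h (c * s)) t = primn n h (c * t).
Proof. by move=> ch; have /funeqP := primn_scale n c ch. Qed.

(** [v (- t)] satisfies the same Volterra equation, whose free term is even, and that equation has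
    one solution. *)
Lemma solution_even m lam k v : 0 <= m < r -> continuous v ->
  (forall t, v t = vjet m k (source m lam v) 0%N t) ->
  forall t, v (- t) = v t.
Proof.
move=> mr cv ev t; have m0 : 0 <= m by lra.
have [L L0 hL] := f_lipschitz mr.
pose g t := m - k * (t ^+ 2 / 2).
apply: (@volterra_unique _ (fun _ y => lam * f (clip m y)) g (`|lam| * L) _ _ _
  (`|t| : R) (fun t => v (- t)) v) => //.
- by rewrite mulr_ge0.
- move=> _ a b; rewrite -mulrBr normrM -mulrA; apply: ler_wpM2l => //.
  apply: le_trans (hL _ _ (clip_itv a m0) (clip_itv b m0)) _.
  apply: ler_wpM2l => //; have := clip_lip m m a b.
  by rewrite subrr normr0 addr0.
- by move=> y cy; apply: (@ct_source m lam y).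
- by apply: ct_comp => //; apply: ctN; exact: ct_id.
- move=> x _; rewrite ev /vjet /g sqrrN; congr (_ + _).
  by rewrite -primn4_opp//; exact: ct_source.
Qed.

Lemma profile_exists m : 0 < m < r -> exists lam k v, profile m lam k v.
Proof.
move=> mr; have mr' : 0 <= m < r by lra.
have [k [L [v [cv ev L0 vpos [vL v1L]]]]] := touching_exists mr.
pose h := source m 1 v; have ch : continuous h by apply: ct_source.
(* Scaling by [c] carries [[0, 1 / 2]] onto [[0, L]] and turns [lam = 1] into [c ^+ 4]. *)
pose c := 2 * L; have c0 : 0 < c by rewrite /c; lra.
pose w t := v (c * t).
have cw : continuous w by exact: ct_scale.
have hE : source m (c ^+ 4) w = fun t => c ^+ 4 * h (c * t).
  by apply/funext => t; rewrite /source /h /source mul1r.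
have cL : c * (1 / 2) = L by rewrite /c; field.
have f00 := f0_gt0.
have mono : forall x y, 0 < x -> x < y -> y < L ->
    vjet m k h 2%N x <= vjet m k h 2%N y.
  move=> x y x0 xy yL.
  apply: (@nondecr_le _ 0 L (vjet m k h 2%N) (vjet m k h 3%N)); try lra.
  - by move=> z _; exact: der_vjet.
  - by apply: cont_within; exact: ct_vjet.
  - move=> z zL; have h0 s : 0 < s < L -> 0 <= vjet m k h 4%N s.
      move=> _; rewrite /= /h /source mul1r.
      have := f_clip_bounds (v s) mr'; lra.
    have zL' : 0 <= z <= L by lra.
    have [+ _ _ _] := jet_taylor (jet_vjet L m k ch) h0 zL'.
    by have [_ _ _ ->] := vjet_at0 m k ch.
(* [v'] is convex on [[0, L]], because [v'''] is nonnegative there, and it vanishes at both ends. *)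
have v1 : forall t, 0 <= t <= L -> vjet m k h 1%N t <= 0.
  apply: (@convex_le0 _ 0 L _ (vjet m k h 2%N)) => //.
  - by move=> t _; exact: der_vjet.
  - by apply: cont_within; exact: ct_vjet.
  - by have [_ -> _ _] := vjet_at0 m k ch.
  - by rewrite v1L.
have vm t : 0 <= t <= L -> v t <= m.
  move=> tL; have := @nondecr_le _ 0 L (fun t => - v t) (fun t => - vjet m k h 1%N t).
  have v0m : v 0 = m by rewrite ev; have [-> _ _ _] := vjet_at0 m k ch.
  move=> H; rewrite -v0m -lerN2; apply: H; try lra.
  - by move=> x _; apply: derN; rewrite (_ : v = vjet m k h 0%N);
      [exact: der_vjet|apply/funext].
  - by apply: wctN; exact: cont_within.
  - by move=> x xL; rewrite oppr_ge0; apply: v1; lra.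
have veven := solution_even mr' cv ev.
exists (c ^+ 4), (k * c ^+ 2), w; split; first exact: cw.
- move=> t; rewrite /vjet hE primn_even// /w ev /vjet; congr (_ + _).
  by rewrite exprMn; ring.
- exact: exprn_gt0.
- move=> t tT; have E : w t = v (c * `|t|).
    rewrite /w; have [t0|t0] := ger0P t => //.
    by rewrite -veven; congr v; ring.
  have ct : 0 <= c * `|t| <= L.
    rewrite mulr_ge0 ?(ltW c0)//= -cL; exact: ler_wpM2l (ltW c0) _ _ tT.
  by rewrite E vm// andbT; apply: vpos; lra.
- by rewrite /w cL.
- have -> : vjet m (k * c ^+ 2) (source m (c ^+ 4) w) 1%N (1 / 2) =
     c * vjet m k h 1%N L.
    rewrite /vjet hE.
    have -> : (fun t => c ^+ 4 * h (c * t)) = (fun t => c * (c ^+ 3 * h (c * t))).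
      by apply/funext => t; rewrite exprS mulrA.
    rewrite primnZ ?primn_even// ?cL; last first.
      by apply: ctM; [exact: ct_cst|exact: ct_scale].
    by rewrite mulrDr; congr (_ + _); rewrite -cL; field.
  by rewrite v1L mulr0.
Qed.

(** The problem on [[0, 1 / 2]] alone, without truncation. Both a constructed profile and the right
    half of an arbitrary clamped solution are of this form, so uniqueness proved here identifies the
    two. *)
Record half_profile m lam (y : nat -> R -> R) : Prop := HalfProfile {
  hp_jet : jet (1 / 2) y;
  hp_lam : 0 < lam;
  hp_range : forall t, 0 <= t <= 1 / 2 -> 0 <= y 0%N t < r;
  hp_ode : forall t, 0 < t < 1 / 2 -> y 4%N t = lam * f (y 0%N t);
  hp_init : [/\ y 0%N 0 = m, y 1%N 0 = 0 & y 3%N 0 = 0];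
  hp_end : y 0%N (1 / 2) = 0 /\ y 1%N (1 / 2) = 0 }.

Lemma profile_half m lam k v : 0 < m < r -> profile m lam k v ->
  half_profile m lam (vjet m k (source m lam v)).
Proof.
move=> mr [cv ev l0 vi v0 v1].
have ch : continuous (source m lam v) by apply: ct_source => //; lra.
have vi' t : 0 <= t <= 1 / 2 -> 0 <= v t <= m.
  by move=> tT; apply: vi; rewrite ler_norml; lra.
split=> //.
- exact: jet_vjet.
- by move=> t tT; rewrite -ev; have := vi' t tT; lra.
- by move=> t tT; rewrite -ev /= /source clip_id//; apply: vi'; lra.
- by have [-> -> _ ->] := vjet_at0 m k ch.
- by rewrite -ev.
Qed.

Section half_profile_shape.
Variables (m lam : R) (y : nat -> R -> R).
Hypothesis hp : half_profile m lam y.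

Let dy := (hp_jet hp).1.
Let cy := (hp_jet hp).2.

Lemma half_y4_gt0 t : 0 < t < 1 / 2 -> 0 < y 4%N t.
Proof.
move=> tT; rewrite (hp_ode hp)// mulr_gt0// ?(hp_lam hp)// nl_f_gt0//.
by apply: (hp_range hp); lra.
Qed.

Lemma half_y3_incr s t : 0 <= s -> s < t -> t <= 1 / 2 -> y 3%N s < y 3%N t.
Proof.
move=> s0 st tT; apply: (@incr_lt _ 0 (1 / 2) (y 3%N) (y 4%N)) => //.
- exact: (dy (j := 3)).
- exact: (cy (j := 3)).
- exact: half_y4_gt0.
Qed.

Lemma half_y3_gt0 t : 0 < t <= 1 / 2 -> 0 < y 3%N t.
Proof.
move=> tT; have [_ _ <-] := hp_init hp; apply: half_y3_incr; lra.
Qed.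

Lemma half_y2_incr s t : 0 <= s -> s < t -> t <= 1 / 2 -> y 2%N s < y 2%N t.
Proof.
move=> s0 st tT; apply: (@incr_lt _ 0 (1 / 2) (y 2%N) (y 3%N)) => //.
- exact: (dy (j := 2)).
- exact: (cy (j := 2)).
- by move=> x xT; apply: half_y3_gt0; lra.
Qed.

Lemma half_y1_lt0 t : 0 < t < 1 / 2 -> y 1%N t < 0.
Proof.
have [_ y10 _] := hp_init hp; have [_ y11] := hp_end hp.
move: t; apply: (@convex_lt0 _ 0 (1 / 2) (y 1%N) (y 2%N)).
- exact: (dy (j := 1)).
- exact: (cy (j := 1)).
- by move=> s t s0 st tT; apply: half_y2_incr; lra.
- by rewrite y10.
- by rewrite y11.
Qed.

Lemma half_y1_le0 t : 0 <= t <= 1 / 2 -> y 1%N t <= 0.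
Proof.
have [_ y10 _] := hp_init hp; have [_ y11] := hp_end hp.
move=> tT; have [->|t0] := eqVneq t 0; first by rewrite y10.
have [->|t1] := eqVneq t (1 / 2); first by rewrite y11.
by apply/ltW/half_y1_lt0; rewrite !lt_neqAle eq_sym t0 t1; lra.
Qed.

Lemma half_y0_decr s t : 0 <= s -> s < t -> t <= 1 / 2 -> y 0%N t < y 0%N s.
Proof.
move=> s0 st tT; rewrite -ltrN2.
apply: (@incr_lt _ 0 (1 / 2) (fun t => - y 0%N t) (fun t => - y 1%N t)) => //.
- by move=> x xT; apply: derN; exact: dy.
- by apply: wctN; exact: cy.
- by move=> x xT; rewrite oppr_gt0; exact: half_y1_lt0.
Qed.

Lemma half_y0_gt0 t : 0 <= t < 1 / 2 -> 0 < y 0%N t.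
Proof.
by move=> tT; have [<- _] := hp_end hp; apply: half_y0_decr; lra.
Qed.

Lemma half_m_gt0 : 0 < m < r.
Proof.
have [<- _ _] := hp_init hp; rewrite half_y0_gt0; last lra.
by have /andP[_ ->] := hp_range hp (t := 0) ltac:(lra).
Qed.

Lemma half_y0_le t : 0 <= t <= 1 / 2 -> 0 <= y 0%N t <= m.
Proof.
move=> tT; have := hp_range hp tT; have [<- _ _] := hp_init hp.
have [->|t0] := eqVneq t 0; first by lra.
by have := @half_y0_decr 0 t; rewrite lt_neqAle eq_sym t0; lra.
Qed.

End half_profile_shape.

(** The two times are independent because one solution will be compared with a slowed-down copy of
    the other. *)
Lemma half_source_sub m lam lam' (y y' : nat -> R -> R) :
  half_profile m lam y -> half_profile m lam' y' ->
  exists2 L, 0 <= L & forall t t', 0 <= t <= 1 / 2 -> 0 <= t' <= 1 / 2 ->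
   - (L * Num.max 0 (- (y 0%N t - y' 0%N t'))) <= f (y 0%N t) - f (y' 0%N t').
Proof.
move=> hp hp'; have mr := half_m_gt0 hp; have mr' : 0 <= m < r by lra.
have [L L0 hL] := f_diff_lip mr'; exists L => // t t' tT tT'.
have := hL _ _ (half_y0_le hp tT) (half_y0_le hp' tT').
by move=> /andP[+ _]; rewrite opprB.
Qed.

Lemma jet_scale c T T' (y : nat -> R -> R) : 0 < c -> c * T <= T' -> jet T' y ->
  jet T (fun j t => c ^+ j * y j (c * t)).
Proof.
move=> c0 cT [dy cy]; split=> j j4.
  move=> t tT; apply: der_eq.
    apply: derZ; apply: (@der_comp _ (y j)); last by apply: derZ; exact: der_id.
    apply: dy => //; rewrite mulr_gt0//=; last lra.
    by apply: lt_le_trans cT; rewrite ltr_pM2l//; lra.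
  by rewrite exprS; ring.
apply: wctM; first exact: wct_cst.
apply/withinC_P => x /=; rewrite in_itv/= => xT e e0.
have cI z : 0 <= z <= T -> 0 <= c * z <= T'.
  move=> zT; rewrite mulr_ge0 ?(ltW c0)//=; last lra.
  by apply: le_trans cT; rewrite ler_pM2l//; lra.
have [|d d0 hd] := (withinC_P _ _).1 (cy j j4) (c * x) _ e e0.
  by rewrite /= in_itv/=; exact: cI.
exists (d / c); first by rewrite divr_gt0.
move=> z; rewrite /= in_itv/= => zT zd; apply: hd.
  by rewrite /= in_itv/=; exact: cI.
by rewrite -mulrBr normrM gtr0_norm// mulrC -ltr_pdivlMr.
Qed.

(* If [lam' < lam], slowing [y] down by [c = (lam' / lam)^(1/4)] gives a
   solution for [lam'] which is still positive and decreasing at [1/2]. *)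
Lemma half_profile_le m lam lam' (y y' : nat -> R -> R) :
  half_profile m lam y -> half_profile m lam' y' -> lam' <= lam ->
  lam = lam' /\ y' 2%N 0 = y 2%N 0.
Proof.
move=> hp hp' ll; have l0 := hp_lam hp; have l0' := hp_lam hp'.
pose c := Num.sqrt (Num.sqrt (lam' / lam)).
have q0 : 0 < lam' / lam by rewrite divr_gt0.
have c0 : 0 < c by rewrite !sqrtr_gt0.
have c4 : c ^+ 4 * lam = lam'.
  rewrite (exprM _ 2 2) !sqr_sqrtr ?sqrtr_ge0// ?(ltW q0)//.
  by rewrite divfK// gt_eqF.
have c1 : c <= 1.
  rewrite -[leRHS]sqrtr1 ler_wsqrtr// -[leRHS]sqrtr1 ler_wsqrtr//.
  by rewrite ler_pdivrMr// mul1r.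
have [L L0 hL] := half_source_sub hp hp'.
have [L' L0' hL'] := half_source_sub hp' hp.
have [y00 y10 y30] := hp_init hp; have [y00' y10' y30'] := hp_init hp'.
have [e0' e1'] := hp_end hp'; have [e0 e1] := hp_end hp.
pose z := fun j t => c ^+ j * y j (c * t).
have jz : jet (1 / 2) z by apply: jet_scale (hp_jet hp) => //; lra_from c1.
have ct t : 0 <= t <= 1 / 2 -> 0 <= c * t <= 1 / 2.
  move=> tT; rewrite mulr_ge0 ?(ltW c0)//=; last lra_from tT.
  by apply: le_trans (_ : 1 * t <= _); [apply: ler_wpM2r|]; clear - tT c1; lra.
have z4 t : 0 < t < 1 / 2 -> z 4%N t = lam' * f (z 0%N t).
  move=> tT; rewrite /z (hp_ode hp); last first.
    rewrite mulr_gt0//=; last lra_from tT.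
    by apply: le_lt_trans (_ : 1 * t < _); [apply: ler_wpM2r|]; clear - tT c1; lra.
  by rewrite mulrA c4 expr0 mul1r.
have half1 : 0 <= (1 / 2 : R) <= (1 / 2 : R) by rewrite lexx divr_ge0.
have halfo t : 0 < t < 1 / 2 -> 0 <= t <= 1 / 2 by lra_from.
pose kap := z 2%N 0 - y' 2%N 0.
have zE j : z j 0 = c ^+ j * y j 0 by rewrite /z mulr0.
have z0e t : z 0%N t = y 0%N (c * t) by rewrite /z expr0 mul1r.
(* If [z] started with the larger second derivative, growth would keep [z - y'] and its fourth
   derivative nonnegative. Its slope at [1 / 2] would then be positive, whereas [z] is nonincreasing
   and the slope of [y'] is zero there. *)
have k1 : ~ (0 < kap).
  move=> kp.
  have jd := jet_lin 1 (-1) jz (hp_jet hp').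
  have d4 t : 0 < t < 1 / 2 -> 1 * z 4%N t + -1 * y' 4%N t =
      lam' * (f (z 0%N t) - f (y' 0%N t)).
    by move=> tT; rewrite z4// (hp_ode hp')//; ring.
  have dge t : 0 <= t <= 1 / 2 -> 0 <= 1 * z 0%N t + -1 * y' 0%N t.
    apply: (jet_ge0 jd (L := lam' * L)) => //; first by rewrite mulr_ge0// ltW.
      move=> x xT; rewrite d4// -mulrA -mulrN ler_pM2l// mul1r mulN1r z0e.
      by apply: hL; [apply/ct/halfo|exact: halfo].
    move=> [|[|[|[|//]]]] _; rewrite !zE.
    - by rewrite y00 y00' expr0; lra_from.
    - by rewrite y10 y10' !mulr0 addr0.
    - by move: kp; rewrite /kap zE; lra_from.
    - by rewrite y30 y30' !mulr0 addr0.
  have d4ge t : 0 < t < 1 / 2 -> 0 <= 1 * z 4%N t + -1 * y' 4%N t.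
    move=> tT; rewrite d4// mulr_ge0 ?(ltW l0')// subr_ge0.
    have := dge t (halfo _ tT); rewrite mul1r mulN1r subr_ge0 => zy.
    apply: f_nd => //.
      by have := hp_range hp' (halfo _ tT); lra_from.
    by rewrite z0e; have := hp_range hp (ct _ (halfo _ tT)); lra_from.
  have [_ _ + _] := jet_taylor jd d4ge half1.
  rewrite !zE y10 y10' y30 y30' e1' /z expr1.
  have := half_y1_le0 hp (ct _ half1) => y1n.
  have : c * y 1%N (c * (1 / 2)) <= 0 by rewrite mulr_ge0_le0// ltW.
  by move: kp; rewrite /kap zE; lra_from.
(* With the opposite order of second derivatives, growth puts [y'] above [z], and [y'] vanishes at
   [1 / 2]. *)
have k2 : z 0%N (1 / 2) <= 0.
  rewrite leNgt; apply/negP => zp; apply: k1; rewrite ltNge; apply/negP => kn.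
  have jd := jet_lin 1 (-1) (hp_jet hp') jz.
  have : 0 <= 1 * y' 0%N (1 / 2) + -1 * z 0%N (1 / 2).
    apply: (jet_ge0 jd (L := lam' * L')) => //; first by rewrite mulr_ge0// ltW.
      move=> x xT; rewrite z4// (hp_ode hp')// !mul1r !mulN1r -mulrBr -mulrA -mulrN.
      rewrite ler_pM2l// z0e.
      by apply: hL'; [exact: halfo|apply/ct/halfo].
    move=> [|[|[|[|//]]]] _; rewrite !zE.
    - by rewrite y00 y00' expr0; lra_from.
    - by rewrite y10 y10' !mulr0 addr0.
    - by move: kn; rewrite /kap zE; lra_from.
    - by rewrite y30 y30' !mulr0 addr0.
  rewrite e0'; clear - zp; lra.
(* If [c < 1], then [z] at [1 / 2] is [y] at an earlier point, where it is positive. *)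
have {c1} c1 : c = 1.
  apply/eqP; rewrite eq_le c1 /= leNgt; apply/negP => cl1.
  have cT : 0 <= c * (1 / 2) < 1 / 2.
    by rewrite mulr_ge0 ?(ltW c0)//; clear - cl1; lra.
  by have := half_y0_gt0 hp cT; rewrite -z0e; clear - k2; lra.
split; first by rewrite -c4 c1 expr1n mul1r.
(* Now [z] is [y] itself: one inequality between the second derivatives is known, and the slope
   argument with the two solutions exchanged gives the other. *)
move: k1; rewrite /kap zE c1 expr1n mul1r => k1.
apply/eqP; rewrite eq_le; apply/andP; split; last by rewrite leNgt; apply/negP => h; apply: k1; clear - h; lra.
rewrite leNgt; apply/negP => kn.
have jd := jet_lin 1 (-1) (hp_jet hp') (hp_jet hp).
have ll' : lam = lam' by rewrite -c4 c1 expr1n mul1r.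
have d4 t : 0 < t < 1 / 2 -> 1 * y' 4%N t + -1 * y 4%N t =
    lam' * (f (y' 0%N t) - f (y 0%N t)).
  by move=> tT; rewrite (hp_ode hp)// (hp_ode hp')// ll'; ring.
have dge t : 0 <= t <= 1 / 2 -> 0 <= 1 * y' 0%N t + -1 * y 0%N t.
  apply: (jet_ge0 jd (L := lam' * L')) => //; first by rewrite mulr_ge0// ltW.
    move=> x xT; rewrite d4// -mulrA -mulrN ler_pM2l// mul1r mulN1r.
    by apply: hL'; exact: halfo.
  move=> [|[|[|[|//]]]] _.
  - by rewrite y00 y00'; lra_from.
  - by rewrite y10 y10' !mulr0 addr0.
  - by clear - k1; lra.
  - by rewrite y30 y30' !mulr0 addr0.
have d4ge t : 0 < t < 1 / 2 -> 0 <= 1 * y' 4%N t + -1 * y 4%N t.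
  move=> tT; rewrite d4// mulr_ge0 ?(ltW l0')// subr_ge0.
  have := dge t (halfo _ tT); rewrite mul1r mulN1r subr_ge0 => zy.
  apply: f_nd => //.
    by have := hp_range hp (halfo _ tT); lra_from.
  by have := hp_range hp' (halfo _ tT); lra_from.
have [_ _ + _] := jet_taylor jd d4ge half1.
by rewrite y10 y10' y30 y30' e1 e1'; clear - kn; lra.
Qed.

Lemma half_profile_unique m lam lam' (y y' : nat -> R -> R) :
  half_profile m lam y -> half_profile m lam' y' ->
  [/\ lam = lam', y' 2%N 0 = y 2%N 0 & forall t, 0 <= t <= 1 / 2 -> y 0%N t = y' 0%N t].
Proof.
move=> hp hp'; have [ll y2] : lam = lam' /\ y' 2%N 0 = y 2%N 0.
  have [l|/ltW l] := leP lam' lam; first exact: half_profile_le hp hp' l.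
  by have [-> ->] := half_profile_le hp' hp l.
split=> // t tT; apply/eqP; rewrite -subr_eq0.
have l0 := ltW (hp_lam hp).
have [L L0 hL] := half_source_sub hp hp'.
have [L' L0' hL'] := half_source_sub hp' hp.
have halfo x : 0 < x < 1 / 2 -> 0 <= x <= 1 / 2 by lra.
have [y00 y10 y30] := hp_init hp; have [y00' y10' y30'] := hp_init hp'.
have dge : 0 <= 1 * y 0%N t + -1 * y' 0%N t.
  apply: (jet_ge0 (jet_lin 1 (-1) (hp_jet hp) (hp_jet hp')) (L := lam * L)) tT => //.
  - by rewrite mulr_ge0.
  - move=> x xT; rewrite (hp_ode hp)// (hp_ode hp')// -ll !mul1r !mulN1r -mulrBr.
    rewrite -mulrA -mulrN; apply: ler_wpM2l => //.
    by apply: hL; exact: halfo.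
  - by move=> [|[|[|[|//]]]] _; rewrite ?y00 ?y00' ?y10 ?y10' ?y2 ?y30 ?y30' mul1r mulN1r subrr.
have dle : 0 <= 1 * y' 0%N t + -1 * y 0%N t.
  apply: (jet_ge0 (jet_lin 1 (-1) (hp_jet hp') (hp_jet hp)) (L := lam * L')) tT => //.
  - by rewrite mulr_ge0.
  - move=> x xT; rewrite (hp_ode hp)// (hp_ode hp')// -ll !mul1r !mulN1r -mulrBr.
    rewrite -mulrA -mulrN; apply: ler_wpM2l => //.
    by apply: hL'; exact: halfo.
  - by move=> [|[|[|[|//]]]] _; rewrite ?y00 ?y00' ?y10 ?y10' ?y2 ?y30 ?y30' mul1r mulN1r subrr.
by apply/eqP; lra.
Qed.

End profiles.

(** * Clamped solutions *)

Section relative_derivatives.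
Context {R : realType}.
Implicit Types (x a b d : R).

(** [derive_in] is a [lim], uninformative until convergence is known. Providing all candidate
    derivatives [G j] at once yields the regularity and their values together. *)
Lemma Cn_chain {V : normedModType R} (A : set R) k (G : nat -> R -> V) :
  A `<=` limit_point A ->
  (forall j, (j < k)%N -> forall x, A x ->
     slope_in (G j) x y @[y --> within A x^'] --> G j.+1 x) ->
  (forall j, (j <= k)%N -> {within A, continuous (G j)}) ->
  Cn A k (G 0%N) /\
  forall j, (j <= k)%N -> {in A, derive_in_n A j (G 0%N) =1 G j}.
Proof.
move=> Alim dG cG.
have E j : (j <= k)%N -> {in A, derive_in_n A j (G 0%N) =1 G j}.
  elim: j => [//|j ih] jk x xA.
  have /= -> := eq_derive_in (ih (ltnW jk)) xA.
  have Ax := set_mem xA; have PF := limit_point_within_proper (Alim _ Ax).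
  by apply: cvg_lim => //; exact: dG.
split=> //; split=> [j jk x Ax|j jk].
  apply: (eq_derivable_in (g := G j)) => // [y yA|]; first by rewrite E// ltnW.
  by apply/cvg_ex; exists (G j.+1 x); exact: dG.
apply: (@subspace_eq_continuous _ _ _ (G j : subspace A -> V)); last exact: cG.
by move=> y yA; apply/esym; exact: E.
Qed.

Lemma slope_in_cvgP {V : normedModType R} (A : set R) (g : R -> V) x (d : V) :
  slope_in g x y @[y --> within A x^'] --> d <->
  forall e, 0 < e -> exists2 del, 0 < del &
    forall y, A y -> `|y - x| < del -> `|g y - g x - (y - x) *: d| <= e * `|y - x|.
Proof.
rewrite within_dnbhs_cvgP; split=> h e e0.
  have [del del0 hd] := h e e0; exists del => // y Ay yx.
  have [->|yx0] := eqVneq y x; first by rewrite !subrr scale0r subrr !normr0 mulr0.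
  have := hd y Ay yx0 yx; have yx1 : y - x != 0 by rewrite subr_eq0.
  move=> /ltW; rewrite -(ler_pM2l (x := `|y - x|)) ?normr_gt0// -normrZ.
  by rewrite scalerBr /slope_in scalerA mulfV// scale1r [leRHS]mulrC.
have e2 : 0 < e / 2 by rewrite divr_gt0.
have [del del0 hd] := h _ e2; exists del => // y Ay yx0 yx.
have yx1 : y - x != 0 by rewrite subr_eq0.
apply: (@le_lt_trans _ _ (e / 2)); last by lra.
rewrite -(ler_pM2l (x := `|y - x|)) ?normr_gt0// -normrZ.
by rewrite scalerBr /slope_in scalerA mulfV// scale1r [leRHS]mulrC; exact: hd.
Qed.

Lemma der_slope_in (A : set R) (g : R -> R) x d : der g x d ->
  slope_in g x y @[y --> within A x^'] --> d.
Proof.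
move=> /derP h; apply/slope_in_cvgP => e /h[del d0 hd].
by exists del => // y _ /hd; rewrite [_ *: _]mulrC.
Qed.

Lemma slope_in_der (A : set R) (g : R -> R) a b x d : a < x < b ->
  (forall y, a < y < b -> A y) ->
  slope_in g x y @[y --> within A x^'] --> d -> der g x d.
Proof.
move=> xab AA /slope_in_cvgP h; apply/derP => e /h[del d0 hd].
exists (Num.min del (Num.min (x - a) (b - x))).
  rewrite !lt_min d0 /=; lra.
move=> y; rewrite !lt_min => /and3P[yd ya yb].
have := hd y; rewrite [_ *: _]mulrC; apply => //.
by apply: AA; move: ya yb; rewrite !ltr_norml; lra.
Qed.

Lemma derivable_in_cvg {V : normedModType R} (A : set R) (g : R -> V) x :
  derivable_in A g x -> slope_in g x y @[y --> within A x^'] --> derive_in A g x.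
Proof. by []. Qed.

Lemma Cn_der (A : set R) k (g : R -> R) a b j x : Cn A k g -> (j < k)%N ->
  a < x < b -> (forall y, a < y < b -> A y) ->
  der (derive_in_n A j g) x (derive_in_n A j.+1 g x).
Proof.
move=> [dg _] jk xab AA; apply: (slope_in_der xab AA).
by apply: derivable_in_cvg; apply: dg => //; exact: AA.
Qed.

End relative_derivatives.

Section jets2.
Context {R : realType}.
Implicit Types (y : nat -> R -> R) (T t : R).

Lemma wct_affine (g : R -> R) (a b : R) (c d p q : R) :
  {within `[a, b], continuous g} -> (forall x, c <= x <= d -> a <= p * x + q <= b) ->
  {within `[c, d], continuous (fun x => g (p * x + q))}.
Proof.
move=> /withinC_P cg hI; apply/withinC_P => x /=; rewrite in_itv/= => xI e e0.
have [|del d0 hd] := cg (p * x + q) _ e e0; first by rewrite /= in_itv/=; exact: hI.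
have p1 : 0 < `|p| + 1 by rewrite ltr_wpDl.
exists (del / (`|p| + 1)); first by rewrite divr_gt0.
move=> z; rewrite /= in_itv/= => zI zd; apply: hd.
  by rewrite /= in_itv/=; exact: hI.
rewrite opprD addrACA subrr addr0 -mulrBr normrM.
apply: (@le_lt_trans _ _ ((`|p| + 1) * `|z - x|)).
  by apply: ler_wpM2r => //; rewrite lerDl.
by rewrite mulrC -ltr_pdivlMr.
Qed.

Lemma jet_rev T y : jet T y -> jet T (fun j t => (-1) ^+ j * y j (T - t)).
Proof.
move=> [dy cy]; split=> j j4.
  move=> t tT; apply: der_eq.
    apply: derZ; apply: (@der_comp _ (y j)); last first.
      by apply: derD; [exact: der_cst|apply: derN; exact: der_id].
    by apply: dy => //; lra.
  by rewrite exprS; ring.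
apply: wctM; first exact: wct_cst.
have -> : (fun t => y j (T - t)) = (fun t => y j (-1 * t + T)).
  by apply/funext => t; congr (y j _); ring.
by apply: wct_affine (cy j j4) _ => x xT; lra.
Qed.

Lemma jet_shift T T' c y : 0 <= c -> c + T' <= T -> jet T y ->
  jet T' (fun j t => y j (c + t)).
Proof.
move=> c0 cT [dy cy]; split=> j j4.
  move=> t tT; apply: der_eq.
    apply: (@der_comp _ (y j)); last first.
      by apply: derD; [exact: der_cst|exact: der_id].
    by apply: dy => //; lra.
  by rewrite add0r mulr1.
have -> : (fun t => y j (c + t)) = (fun t => y j (1 * t + c)).
  by apply/funext => t; congr (y j _); ring.
by apply: wct_affine (cy j j4) _ => x xT; lra.
Qed.

Lemma jet_zero T y : jet T y -> (forall t, 0 < t < T -> y 0%N t = 0) ->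
  forall j, (j <= 4)%N -> forall t, 0 < t < T -> y j t = 0.
Proof.
move=> [dy _] y0; elim=> [//|j ih] j4 t tT.
apply: (der_uniq (f := y j) (x := t)); first exact: dy.
apply: (@der_near _ (fun=> 0) _ _ _ 0 T) => //; last exact: der_cst.
by move=> s sT; rewrite ih// ltnW.
Qed.

Lemma jet_start_ge0 T y : 0 < T -> jet T y -> (forall t, 0 <= t <= T -> 0 <= y 0%N t) ->
  y 0%N 0 = 0 -> y 1%N 0 = 0 -> 0 <= y 2%N 0.
Proof.
move=> T0 [dy cy] yge y0 y1; rewrite leNgt; apply/negP => y2.
have y2n : 0 < - y 2%N 0 by lra.
have I0 : `[0, T]%classic (0 : R) by rewrite /= in_itv/= lexx ltW.
have [d d0 hd] := (withinC_P _ _).1 (cy 2%N isT) 0 I0 _ y2n.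
pose e := Num.min (d / 2) T.
have e0 : 0 < e by rewrite lt_min T0 divr_gt0.
have [ed eT] : e <= d / 2 /\ e <= T by rewrite !ge_min !lexx orbT.
have y2lt t : 0 <= t <= e -> y 2%N t < 0.
  move=> te; have := hd t; rewrite /= in_itv/= subr0 ger0_norm; last lra.
  have tT : 0 <= t <= T by lra.
  have td : t < d by lra.
  by move=> /(_ tT td); rewrite ltr_norml; lra.
have y1lt t : 0 < t <= e -> y 1%N t < 0.
  move=> te; rewrite -y1 -ltrN2.
  apply: (@incr_lt _ 0 e (fun t => - y 1%N t) (fun t => - y 2%N t)); try lra.
  - by move=> x xe; apply: derN; apply: dy => //; lra.
  - by apply: wctN; exact: sub_cc (cy 1%N isT).
  - by move=> x xe; rewrite oppr_gt0; apply: y2lt; lra.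
have : y 0%N e < 0.
  rewrite -y0 -ltrN2.
  apply: (@incr_lt _ 0 e (fun t => - y 0%N t) (fun t => - y 1%N t)); try lra.
  - by move=> x xe; apply: derN; apply: dy => //; lra.
  - by apply: wctN; exact: sub_cc (cy 0%N isT).
  - by move=> x xe; rewrite oppr_gt0; apply: y1lt; lra.
by apply/negP; rewrite -leNgt; apply: yge; lra.
Qed.

End jets2.

Section clamped_solutions.
Context {R : realType} (F : nonlinearity R).
Local Notation r := (nl_r F).
Local Notation f := (nl_f F).
Local Notation I01 := (`[0%R, 1%R]%classic : set R).
Implicit Types (u v : clamped R) (lam : R).

Local Notation U u := (fun j => derive_in_n I01 j u).

Lemma clamped_jet u : jet 1 (U u).
Proof.
split=> j j4.
  move=> t t1; apply: (Cn_der (a := 0) (b := 1) (clamped_Cn u)) => //.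
  by move=> s s1; rewrite /= in_itv/=; lra.
by apply: (clamped_Cn u).2; exact: ltnW.
Qed.

Lemma clamped_bc u : [/\ u 0 = 0, u 1 = 0, derive_in I01 u 0 = 0 & derive_in I01 u 1 = 0].
Proof. by case: u => u /= /asboolP[_ [? ?] [? ?] _]. Qed.

Lemma clamped_out u x : ~ I01 x -> u x = 0.
Proof. by case: u => u /= /asboolP[_ _ _]; apply. Qed.

Lemma clamped_eq u v : (forall x, 0 <= x <= 1 -> u x = v x) -> u = v.
Proof.
move=> h; apply/val_inj/funext => x /=.
have [Ix|Ix] := pselect (I01 x); first by apply: h; move: Ix; rewrite /= in_itv.
by rewrite !clamped_out.
Qed.

(** The sign of [lam] is left open: a competing curve of solutions could a priori pass through
    [lam <= 0]. *)
Record clamped_jet_solution lam (y : nat -> R -> R) : Prop := ClampedJetSolution {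
  cjs_jet : jet 1 y;
  cjs_bc : [/\ y 0%N 0 = 0, y 0%N 1 = 0, y 1%N 0 = 0 & y 1%N 1 = 0];
  cjs_range : forall x, 0 <= x <= 1 -> 0 <= y 0%N x < r;
  cjs_ode : forall x, 0 < x < 1 -> y 4%N x = lam * f (y 0%N x) }.

Section clamped_jet_solutions.
Variables (lam : R) (y : nat -> R -> R).
Hypothesis hy : clamped_jet_solution lam y.

Let dy := (cjs_jet hy).1.
Let cy := (cjs_jet hy).2.

Lemma cjs_ends : 0 <= y 2%N 0 /\ 0 <= y 2%N 1.
Proof.
have jy := cjs_jet hy; have [y00 y01 y10 y11] := cjs_bc hy.
split; first by apply: (jet_start_ge0 ltr01 jy) => // t /(cjs_range hy) /andP[].
have := jet_start_ge0 ltr01 (jet_rev jy).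
rewrite !subr0 y01 mulr0 y11 mulr0 expr2 mulrNN !mulr1 mul1r; apply=> // t tT.
rewrite expr0 mul1r; have tT' : 0 <= 1 - t <= 1 by lra.
by have /andP[] := cjs_range hy tT'.
Qed.

Lemma cjs_max : exists2 M, 0 <= M < r & forall x, 0 <= x <= 1 -> 0 <= y 0%N x <= M.
Proof.
have [c] := EVT_max ler01 (cy (j := 0) isT); rewrite in_itv/= => cI hc.
exists (y 0%N c); first exact: (cjs_range hy).
move=> x xI; have := cjs_range hy xI; have := hc x.
by rewrite in_itv/= => /(_ xI); lra.
Qed.

(* The energy [y' y''' - y''^2 / 2 - lam * P(y)], [P] a primitive of [f],
   is constant. *)
Lemma cjs_energy : y 2%N 0 = y 2%N 1.
Proof.
have [y00 y01 y10 y11] := cjs_bc hy; have [M Mr yM] := cjs_max.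
have M0 : 0 <= M by lra.
pose P := prim (fun t => f (clip M t)).
have cP : continuous (fun t => f (clip M t)).
  exact: (ct_fclip Mr (@nl_cf _ F) (@ct_id _)).
have dP t : der P t (f (clip M t)) by exact: der_prim.
pose E x := y 1%N x * y 3%N x - y 2%N x * y 2%N x / 2 - lam * P (y 0%N x).
have dE x : 0 < x < 1 -> der E x 0.
  move=> x1; have x1' : 0 <= x <= 1 by lra.
  have d1 := dy (j := 1) isT x1; have d2 := dy (j := 2) isT x1.
  have d3 := dy (j := 3) isT x1; have d0 := dy (j := 0) isT x1.
  have dd := der_comp (dP (y 0%N x)) d0.
  apply: der_eq.
    apply: derD; last by apply: derN; apply: derZ; exact: dd.
    apply: derD; first by apply: derM; [exact: d1|exact: d3].
    by apply: derN; apply: derM; [apply: derM; exact: d2|exact: der_cst].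
  rewrite clip_id ?yM// (cjs_ode hy)//.
  move: (y 1%N x) (y 2%N x) (y 3%N x) (f _) => a b c d /=.
  by field.
have cE : {within `[0, 1], continuous E}.
  apply: wctD; last apply: wctN; last apply: wctM; last first.
  - apply: (proj2 (withinC_P _ _)) => z zI e e0.
    have [d d0 hd] := (contP _ _).1 (der_cont (dP (y 0%N z))) e e0.
    have [d' d'0 hd'] := (withinC_P _ _).1 (cy (j := 0) isT) z zI d d0.
    by exists d' => // x xI /(hd' x xI) /hd.
  - exact: wct_cst.
  apply: wctD; first by apply: wctM; exact: cy.
  by apply: wctN; apply: wctM; [apply: wctM; exact: cy|exact: wct_cst].
have [x xI] := MVT_in ltr01 dE cE.
(* At both ends [y] and [y'] vanish, so conservation of the energy equates the squares of [y''];
   both values are nonnegative by [cjs_ends]. *)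
rewrite mul0r => /eqP; rewrite subr_eq0 => /eqP; rewrite /E y00 y01 y10 y11 !mul0r.
have [h0 h1] := cjs_ends.
move: (P 0) (y 2%N 0) (y 2%N 1) h0 h1 => p a b h0 h1 H.
have {H} /eqP : a ^+ 2 = b ^+ 2 by rewrite !expr2; lra.
by rewrite eqrXn2// => /eqP.
Qed.

(** The difference of [y] and its reflection has zero data of order 0, 1 and, by [cjs_energy], 2 at
    [0]; its third derivative there is [y 3 0 + y 3 1]. A sign [s] makes this nonnegative, and
    growth then gives a sign to [s * (y x - y (1 - x))] for all [x]. Replacing [x] by [1 - x] gives
    the opposite sign. *)
Lemma cjs_symmetric x : 0 < lam -> 0 <= x <= 1 -> y 0%N (1 - x) = y 0%N x.
Proof.
move=> l0; have jy := cjs_jet hy; have jr := jet_rev jy.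
have [y00 y01 y10 y11] := cjs_bc hy; have e2 := cjs_energy.
have [M Mr yM] := cjs_max; have [L L0 hL] := f_diff_lip Mr.
pose z s j t := s * y j t + (- s) * ((-1) ^+ j * y j (1 - t)).
have jz s : jet 1 (z s) by exact: jet_lin.
have zge s : `|s| = 1 -> 0 <= s * (y 3%N 0 + y 3%N 1) ->
    forall x, 0 <= x <= 1 -> 0 <= s * (y 0%N x - y 0%N (1 - x)).
  move=> s1 s3 {}x xI.
  have -> : s * (y 0%N x - y 0%N (1 - x)) = z s 0%N x by rewrite /z expr0; ring.
  apply: (jet_ge0 (jz s) (L := lam * L)) xI; first by rewrite mulr_ge0// ltW.
    move=> t tI; rewrite /z expr0 mul1r !(cjs_ode hy); [|lra|lra].
    have tI1 : 0 <= t <= 1 by lra.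
    have tI2 : 0 <= 1 - t <= 1 by lra.
    have := hL _ _ (yM _ tI1) (yM _ tI2).
    move: (y 0%N t) (y 0%N (1 - t)) => a b.
    have -> : s * (lam * f a) + - s * ((-1) ^+ 4 * (lam * f b)) =
      lam * (s * (f a - f b)) by ring.
    rewrite -(mulrA lam L) -(mulrN lam) ler_pM2l//.
    have [sE|sE] : s = 1 \/ s = -1.
      by have [s0|s0] := ger0P s; move: s1; [rewrite ger0_norm//; left|rewrite ltr0_norm//; right]; lra.
    - rewrite sE; have -> : - (1 * a + - 1 * b) = b - a by ring.
      by move=> /andP[]; rewrite mul1r.
    - rewrite sE; have -> : - (-1 * a + - -1 * b) = a - b by ring.
      by move=> /andP[_]; rewrite mulN1r lerN2.
  move=> [|[|[|[|//]]]] _; rewrite /z ?subr0.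
  - by rewrite y00 y01 !mulr0 addr0.
  - by rewrite y10 y11 !mulr0 addr0.
  - by rewrite e2 expr2 mulrNN !mulr1 mul1r mulNr subrr.
  - have -> : (-1) ^+ 3 = -1 :> R by ring.
    by rewrite mulN1r mulrNN -mulrDr.
have sym0 s : `|s| = 1 -> 0 <= s * (y 3%N 0 + y 3%N 1) ->
    forall x, 0 <= x <= 1 -> s * (y 0%N x - y 0%N (1 - x)) = 0.
  move=> s1 s3 {}x xI; have h1 := zge s s1 s3 x xI.
  have xI' : 0 <= 1 - x <= 1 by lra.
  by have := zge s s1 s3 _ xI'; rewrite subKr; lra.
move=> xI; have [a0|a0] := leP 0 (y 3%N 0 + y 3%N 1).
  by have := sym0 1 (normr1 _) _ x xI; rewrite !mul1r => /(_ a0); lra.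
have := sym0 (-1) _ _ x xI; rewrite normrN1 !mulN1r => /(_ erefl) h.
have /h : 0 <= - (y 3%N 0 + y 3%N 1) by lra.
lra.
Qed.

Lemma cjs_half_profile : 0 < lam ->
  half_profile F (y 0%N (1 / 2)) lam (fun j t => y j (1 / 2 + t)).
Proof.
move=> l0; have jy := cjs_jet hy; have [y00 y01 y10 y11] := cjs_bc hy.
have jz := jet_lin 1 (-1) jy (jet_rev jy).
have z0 t : 0 < t < 1 -> 1 * y 0%N t + -1 * ((-1) ^+ 0 * y 0%N (1 - t)) = 0.
  by move=> tI; rewrite expr0 cjs_symmetric//; [ring|lra].
have zj := jet_zero jz z0.
have h2 : 0 < (1 / 2 : R) < 1 by lra.
have hE : 1 - 1 / 2 = 1 / 2 :> R by field.
have U1 : y 1%N (1 / 2) = 0 by have := zj 1%N isT _ h2; rewrite hE; lra.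
have U3 : y 3%N (1 / 2) = 0.
  have := zj 3%N isT _ h2; rewrite hE.
  have -> : (-1) ^+ 3 = -1 :> R by ring.
  lra.
have hE1 : 1 / 2 + 1 / 2 = 1 :> R by field.
split=> //.
- by apply: (jet_shift _ _ jy); lra.
- by move=> t tT; apply: (cjs_range hy); lra.
- by move=> t tT; apply: (cjs_ode hy); lra.
- by rewrite addr0.
- by rewrite hE1.
Qed.

(** Now [y''''] is nonpositive, so [y''] is concave with nonnegative ends and hence nonnegative.
    Thus [y'] is nondecreasing with zero ends, so [y] vanishes, and positivity of [f] forces
    [lam = 0]. *)
Lemma cjs_le0 : lam <= 0 -> lam = 0 /\ forall x, 0 <= x <= 1 -> y 0%N x = 0.
Proof.
move=> l0; have [y00 y01 y10 y11] := cjs_bc hy; have [e0 e1] := cjs_ends.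
have y4 x : 0 < x < 1 -> 0 <= - y 4%N x.
  move=> xI; rewrite (cjs_ode hy)// -mulNr mulr_ge0//; first lra.
  by apply/ltW/nl_f_gt0/(cjs_range hy); lra.
have y3 s t : 0 < s -> s < t -> t < 1 -> - y 3%N s <= - y 3%N t.
  move=> s0 st t1.
  apply: (@nondecr_le _ 0 1 (fun t => - y 3%N t) (fun t => - y 4%N t)); try lra.
  - by move=> x xI; apply: derN; exact: dy.
  - by apply: wctN; exact: cy.
  - exact: y4.
have y2 t : 0 <= t <= 1 -> - y 2%N t <= 0.
  move: t; apply: (@convex_le0 _ 0 1 (fun t => - y 2%N t) (fun t => - y 3%N t)).
  - by move=> t tI; apply: derN; exact: dy.
  - by apply: wctN; exact: cy.
  - exact: y3.
  - lra.
  - lra.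
have y1m s t : 0 <= s -> s <= t -> t <= 1 -> y 1%N s <= y 1%N t.
  apply: (@nondecr_le _ 0 1 (y 1%N) (y 2%N)).
  - exact: (dy (j := 1)).
  - exact: (cy (j := 1)).
  - by move=> x xI; have := y2 x; lra.
have y1 t : 0 <= t <= 1 -> y 1%N t = 0.
  move=> tI; have := y1m 0 t; have := y1m t 1; rewrite y10 y11; lra.
have y0 t : 0 <= t <= 1 -> y 0%N t = 0.
  move=> tI; have [->//|t0] := eqVneq t 0.
  have t0' : 0 < t by rewrite lt_neqAle eq_sym t0; lra.
  have d t' : 0 < t' < t -> der (y 0%N) t' (y 1%N t').
    by move=> ?; apply: (dy (j := 0)) => //; lra.
  have [|x xI] := MVT_in t0' d _; first by apply: sub_cc (cy (j := 0) isT); lra.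
  by rewrite y1; [rewrite mul0r y00 subr0|lra].
have h2 : 0 < (1 / 2 : R) < 1 by lra.
have y0' t : 0 < t < 1 -> y 0%N t = 0 by move=> tI; apply: y0; lra.
split=> //; have := jet_zero (cjs_jet hy) y0' (j := 4) isT h2.
rewrite (cjs_ode hy)// => /eqP.
rewrite mulf_eq0 => /orP[/eqP//|]; rewrite gt_eqF// nl_f_gt0//.
by apply: (cjs_range hy); lra.
Qed.

Lemma cjs_nonzero : 0 < lam -> exists2 x, 0 < x < 1 & y 0%N x != 0.
Proof.
move=> l0; apply: contrapT => H.
have y0 t : 0 < t < 1 -> y 0%N t = 0.
  by move=> tI; apply: contrapT => /eqP nz; apply: H; exists t.
have h2 : 0 < (1 / 2 : R) < 1 by lra.
have := jet_zero (cjs_jet hy) y0 (j := 4) isT h2.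
rewrite (cjs_ode hy)// => /eqP; rewrite mulf_eq0 !gt_eqF// nl_f_gt0//.
by apply: (cjs_range hy); lra.
Qed.

End clamped_jet_solutions.

Lemma solution_cjs lam u : solution r f lam u -> clamped_jet_solution lam (U u).
Proof.
move=> [hr ho]; split; [exact: clamped_jet|by have [] := clamped_bc u|exact: hr|exact: ho].
Qed.

Lemma solution_symmetric lam u x : 0 < lam -> solution r f lam u ->
  0 <= x <= 1 -> u (1 - x) = u x.
Proof. by move=> l0 /solution_cjs hu; exact: (cjs_symmetric hu). Qed.

Lemma solution_half_profile lam u : 0 < lam -> solution r f lam u ->
  half_profile F (u (1 / 2)) lam (fun j t => U u j (1 / 2 + t)).
Proof. by move=> l0 /solution_cjs hu; exact: (cjs_half_profile hu). Qed.

Lemma solution_cases lam u : solution r f lam u ->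
  (lam = 0 /\ u = 0) \/ positive_solution r f lam u.
Proof.
move=> su; have hu := solution_cjs su; have [l0|l0] := leP lam 0.
  have [-> u0] := cjs_le0 hu l0; left; split=> //.
  by apply: clamped_eq => x /u0.
by right; split=> //; exact: (cjs_nonzero hu).
Qed.

End clamped_solutions.

(** * Families depending on the maximum *)

Section uniform_continuity.
Context {R : realType}.
Implicit Types (a b e x M : R) (g : R -> R).

Lemma heine M g : 0 <= M -> {within `[0, M], continuous g} ->
  forall e, 0 < e -> exists2 d, 0 < d & forall a b, 0 <= a <= M -> 0 <= b <= M ->
    `|a - b| < d -> `|g a - g b| < e.
Proof.
move=> M0 /withinC_P cg e e0.
(* The points up to which one modulus [d] serves; continuity at the supremum pushes it to [M]. *)
pose S := [set x | 0 <= x <= M /\ exists2 d, 0 < d & forall a b,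
  0 <= a <= x -> 0 <= b <= x -> `|a - b| < d -> `|g a - g b| < e].
have S0 : S 0.
  split; first by rewrite lexx.
  exists 1 => // a b a0 b0 _; have -> : a = 0 by lra.
  have -> : b = 0 by lra.
  by rewrite subrr normr0.
have Sb : has_ubound S by exists M => x [/andP[]].
pose s := sup S.
have s0 : 0 <= s by exact: ub_le_sup.
have sM : s <= M by apply: ge_sup => [|x [/andP[]]//]; exists 0.
have e2 : 0 < e / 2 by rewrite divr_gt0.
have [|del del0 hd] := cg s _ _ e2; first by rewrite /= in_itv/= s0.
have del2 : 0 < del / 2 by rewrite divr_gt0.
have [x [xM [d d0 hx]] xs] := sup_adherent del2 (conj (ex_intro _ 0 S0) Sb).
rewrite -/s in xs.
have key : S (Num.min M (s + del / 2)).
  split; first by rewrite le_min M0 ge_min lexx andbT; lra_from s0 del2.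
  exists (Num.min d (del / 2)); first by rewrite lt_min d0.
  move=> a b; rewrite !le_min !lt_min => /and3P[a0 aM as_] /and3P[b0 bM bs] /andP[abd abdel].
  have near c : 0 <= c -> c <= M -> s - del < c -> c <= s + del / 2 ->
      `|g c - g s| < e / 2.
    move=> c0 cM cs cs'; apply: hd; first by rewrite /= in_itv/= c0.
    by rewrite ltr_norml; lra_from cs cs'.
  have nearS : s - del < a -> s - del < b -> `|g a - g b| < e.
    move=> sa sb; rewrite (splitr e) -[g a](subrK (g s)) -addrA.
    apply: le_lt_trans (ler_normD _ _) (ltrD (near a a0 aM sa as_) _).
    by rewrite distrC; exact: near.
  have := abdel; rewrite ltr_norml => /andP[ab1 ab2].
  have [ax|ax] := leP a x; have [bx|bx] := leP b x.
  - by apply: hx; rewrite ?a0 ?b0.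
  - by apply: nearS; generalize ab1 xs bx ax del2; clear_order; lra.
  - by apply: nearS; generalize ab2 xs bx ax del2; clear_order; lra.
  - by apply: nearS; generalize xs ax bx del2; clear_order; lra.
have := ub_le_sup Sb key; rewrite -/s ge_min => /orP[Ms|]; last lra_from del2.
move: key; rewrite min_l; last lra_from del2 Ms.
by move=> [_ [d' d'0 H]]; exists d'.
Qed.

(** The mean value theorem with the uniform continuity of [g1]. Uniformity in the base point is what
    allows [f] to be composed with a whole function of [t]. *)
Lemma taylor_uniform M g g1 : 0 <= M -> {within `[0, M], continuous g} ->
  {within `[0, M], continuous g1} -> (forall x, 0 < x < M -> der g x (g1 x)) ->
  forall e, 0 < e -> exists2 d, 0 < d & forall a b, 0 <= a <= M -> 0 <= b <= M ->
    `|b - a| < d -> `|g b - g a - g1 a * (b - a)| <= e * `|b - a|.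
Proof.
move=> M0 cg cg1 dg e e0; have [d d0 hd] := heine M0 cg1 e0.
exists d => // a b aM bM ab.
have [x [xM xab] E] : exists2 x, 0 <= x <= M /\ `|x - a| <= `|b - a|
    & g b - g a = g1 x * (b - a).
  have [h|h|->] := ltgtP a b.
  - have dg' x : a < x < b -> der g x (g1 x) by move=> ?; apply: dg; lra.
    have [|x xab E] := MVT_in h dg' _; first by apply: sub_cc cg; lra_from aM bM.
    by exists x => //; split; [|rewrite !ger0_norm]; lra.
  - have dg' x : b < x < a -> der g x (g1 x) by move=> ?; apply: dg; lra.
    have [|x xab E] := MVT_in h dg' _; first by apply: sub_cc cg; lra_from bM aM.
    exists x; first by split; [|rewrite !ler0_norm]; lra.
    by rewrite -opprB E; ring.
  - by exists b; rewrite ?subrr ?normr0 ?mulr0.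
rewrite E -mulrBl normrM; apply: ler_wpM2r => //.
by apply/ltW/hd => //; exact: le_lt_trans ab.
Qed.

End uniform_continuity.

Section families.
Context {R : realType} (r : R) (r_gt0 : 0 < r).
Implicit Types (F G H p y : R -> R -> R) (m t e c : R).

Local Notation half t := (`|t| <= 1 / 2).
Local Notation D m := (0 <= m < r).

(** One-sided at [m0 = 0], so that the family is differentiated up to the trivial solution. *)
Definition ND m0 := within `[0, r[%classic (nbhs m0).

Lemma ND_filter m0 : Filter (ND m0).
Proof. exact: within_filter. Qed.
Local Existing Instance ND_filter.

Lemma ND_in m0 : \forall m \near ND m0, D m.
Proof. by apply: withinT => m /=; rewrite in_itv. Qed.

Lemma NDP m0 (P : R -> Prop) : (\forall m \near ND m0, P m) <->
  exists2 d, 0 < d & forall m, D m -> `|m - m0| < d -> P m.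
Proof.
split=> [|[d d0 h]].
  rewrite /ND /within => /nbhs_ballP[d /= d0 h]; exists d => // m Dm md.
  by apply: h; rewrite /ball/= ?in_itv// distrC.
rewrite /ND /within; apply/nbhs_ballP; exists d => //= m.
by rewrite /ball/= in_itv/= distrC => md Dm; exact: h.
Qed.

Lemma ND_close m0 e : 0 < e -> \forall m \near ND m0, `|m - m0| < e.
Proof. by move=> e0; apply/NDP; exists e. Qed.

(** A calculus of families [F m t], with estimates uniform over [|t| <= 1 / 2]: [C1 F G] makes [G]
    the derivative of [F] in [m]. Continuity in [t] is asked on the whole line since [prim] acts
    there. Functions of [m] alone are treated as families constant in [t]. *)
Definition fct F := forall m, D m -> continuous (F m).

Definition ucont F := forall m0, D m0 -> forall e, 0 < e ->
  \forall m \near ND m0, forall t, half t -> `|F m t - F m0 t| <= e.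

Definition uder F G := forall m0, D m0 -> forall e, 0 < e ->
  \forall m \near ND m0, forall t, half t ->
    `|F m t - F m0 t - (m - m0) * G m0 t| <= e * `|m - m0|.

Definition C0 F := fct F /\ ucont F.
Definition C1 F G := [/\ C0 F, C0 G & uder F G].

Lemma C1_C0 F G : C1 F G -> C0 F. Proof. by case. Qed.
Lemma C1_C0' F G : C1 F G -> C0 G. Proof. by case. Qed.

Lemma fct_bound F m : fct F -> D m -> exists2 M, 0 < M & forall t, half t -> `|F m t| <= M.
Proof.
move=> cF Dm; have hh : - (1 / 2) <= 1 / 2 :> R by lra.
have [M M0 hM] := EVT_bound hh (@cont_within _ _ _ (cF m Dm)).
by exists M => // t; rewrite ler_norml; exact: hM.
Qed.

Lemma C0_eq F G : C0 F -> fct G -> (forall m t, D m -> half t -> F m t = G m t) -> C0 G.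
Proof.
move=> [cF uF] cG FG; split=> // m0 Dm0 e e0.
by apply: filterS2 (ND_in m0) (uF _ Dm0 _ e0) => m Dm h t tI; rewrite -!FG//; exact: h.
Qed.

Lemma C1_eq F G F' G' : C1 F G -> fct F' -> fct G' ->
  (forall m t, D m -> half t -> F m t = F' m t) ->
  (forall m t, D m -> half t -> G m t = G' m t) -> C1 F' G'.
Proof.
move=> [hF hG dF] cF' cG' FF' GG'; split; [exact: C0_eq FF'|exact: C0_eq GG'|].
move=> m0 Dm0 e e0.
by apply: filterS2 (ND_in m0) (dF _ Dm0 _ e0) => m Dm h t tI; rewrite -!FF'// -GG'//; exact: h.
Qed.

Lemma C0_cst (g : R -> R) : continuous g -> C0 (fun=> g).
Proof.
move=> cg; split=> // m0 _ e e0; apply: filterE => m t _.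
by rewrite subrr normr0 ltW.
Qed.

Lemma C1_cst (g : R -> R) : continuous g -> C1 (fun=> g) (fun _ _ => 0).
Proof.
move=> cg; split; [exact: C0_cst|exact/C0_cst/ct_cst|].
move=> m0 _ e e0; apply: filterE => m t _.
by rewrite subrr mulr0 subr0 normr0 mulr_ge0// ltW.
Qed.

Lemma C1_id : C1 (fun m _ => m) (fun _ _ => 1).
Proof.
split; [split=> [m Dm|m0 Dm0 e e0]|exact/C0_cst/ct_cst|].
- exact: ct_cst.
- by apply: filterS (ND_close m0 e0) => m /ltW h t _.
- move=> m0 _ e e0; apply: filterE => m t _.
  by rewrite mulr1 subrr normr0 mulr_ge0// ltW.
Qed.

Lemma C0D F G : C0 F -> C0 G -> C0 (fun m t => F m t + G m t).
Proof.
move=> [cF uF] [cG uG]; split=> [m Dm|m0 Dm0 e e0].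
  by apply: ctD; [exact: cF|exact: cG].
have e2 : 0 < e / 2 by rewrite divr_gt0.
apply: filterS2 (uF _ Dm0 _ e2) (uG _ Dm0 _ e2) => m hF hG t tI.
have := hF t tI; have := hG t tI; rewrite !ler_norml; lra.
Qed.

Lemma C1D F G F' G' : C1 F F' -> C1 G G' ->
  C1 (fun m t => F m t + G m t) (fun m t => F' m t + G' m t).
Proof.
move=> [hF hF' dF] [hG hG' dG]; split; [exact: C0D|exact: C0D|].
move=> m0 Dm0 e e0; have e2 : 0 < e / 2 by rewrite divr_gt0.
apply: filterS2 (dF _ Dm0 _ e2) (dG _ Dm0 _ e2) => m h1 h2 t tI.
have -> : F m t + G m t - (F m0 t + G m0 t) - (m - m0) * (F' m0 t + G' m0 t) =
 (F m t - F m0 t - (m - m0) * F' m0 t) + (G m t - G m0 t - (m - m0) * G' m0 t) by ring.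
apply: le_trans (ler_normD _ _) _.
have := h1 t tI; have := h2 t tI; lra.
Qed.

Lemma uder_lip F F' m0 : C1 F F' -> D m0 -> exists2 K, 0 < K &
  \forall m \near ND m0, forall t, half t -> `|F m t - F m0 t| <= K * `|m - m0|.
Proof.
move=> [hF [cF' _] dF] Dm0; have [K K0 hK] := fct_bound cF' Dm0.
exists (K + 1); first lra.
apply: filterS (dF _ Dm0 _ ltr01) => m h t tI.
have := ler_normD (F m t - F m0 t - (m - m0) * F' m0 t) ((m - m0) * F' m0 t).
rewrite subrK normrM => h1; apply: le_trans h1 _.
have := h t tI; have := ler_wpM2r (normr_ge0 (m - m0)) (hK t tI).
by rewrite mulrDl [`|m - m0| * _]mulrC; lra.
Qed.

Lemma C0M F G : C0 F -> C0 G -> C0 (fun m t => F m t * G m t).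
Proof.
move=> [cF uF] [cG uG]; split=> [m Dm|m0 Dm0 e e0].
  by apply: ctM; [exact: cF|exact: cG].
have [A A0 hA] := fct_bound cF Dm0; have [B B0 hB] := fct_bound cG Dm0.
pose e1 := Num.min 1 (e / (A + B + 1)).
have S0 : 0 < A + B + 1 by lra.
have e10 : 0 < e1 by rewrite lt_min ltr01 divr_gt0.
have [e11 e12] : e1 <= 1 /\ e1 <= e / (A + B + 1) by rewrite !ge_min !lexx orbT.
apply: filterS2 (uF _ Dm0 _ e10) (uG _ Dm0 _ e10) => m hF hG t tI.
have -> : F m t * G m t - F m0 t * G m0 t = F m0 t * (G m t - G m0 t)
  + (F m t - F m0 t) * G m0 t + (F m t - F m0 t) * (G m t - G m0 t) by ring.
apply: le_trans (ler_normD _ _) _; apply: le_trans (lerD (ler_normD _ _) (lexx _)) _.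
rewrite !normrM.
have h1 : `|F m0 t| * `|G m t - G m0 t| <= A * e1 by apply: ler_pM; [| |exact: hA|exact: hG].
have h2 : `|F m t - F m0 t| * `|G m0 t| <= e1 * B by apply: ler_pM; [| |exact: hF|exact: hB].
have h3 : `|F m t - F m0 t| * `|G m t - G m0 t| <= 1 * e1.
  by apply: ler_pM => //; [apply: le_trans (hF t tI) _|exact: hG].
have : (A + B + 1) * e1 <= e by rewrite mulrC -ler_pdivlMr.
lra.
Qed.

Lemma C1M F G F' G' : C1 F F' -> C1 G G' ->
  C1 (fun m t => F m t * G m t) (fun m t => F m t * G' m t + F' m t * G m t).
Proof.
move=> C1F C1G; have [hF hF' dF] := C1F; have [hG hG' dG] := C1G.
split; [exact: C0M|by apply: C0D; exact: C0M|].
move=> m0 Dm0 e e0.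
have [A A0 hA] := fct_bound hF.1 Dm0; have [B B0 hB] := fct_bound hG.1 Dm0.
have [K K0 hK] := uder_lip C1G Dm0.
have S0 : 0 < A + B + K by lra.
pose e1 := e / (A + B + K).
have e10 : 0 < e1 by rewrite divr_gt0.
apply: filterS2 (filterI (dF _ Dm0 _ e10) (dG _ Dm0 _ e10)) (filterI hK (hF.2 _ Dm0 _ e10)).
move=> m [h1 h2] [h3 h4] t tI.
have -> : F m t * G m t - F m0 t * G m0 t - (m - m0) * (F m0 t * G' m0 t + F' m0 t * G m0 t) =
  F m0 t * (G m t - G m0 t - (m - m0) * G' m0 t)
  + (F m t - F m0 t - (m - m0) * F' m0 t) * G m0 t
  + (F m t - F m0 t) * (G m t - G m0 t) by ring.
apply: le_trans (ler_normD _ _) _; apply: le_trans (lerD (ler_normD _ _) (lexx _)) _.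
rewrite !normrM.
have g1 : `|F m0 t| * `|G m t - G m0 t - (m - m0) * G' m0 t| <= A * (e1 * `|m - m0|).
  by apply: ler_pM => //; [exact: hA|exact: h2].
have g2 : `|F m t - F m0 t - (m - m0) * F' m0 t| * `|G m0 t| <= (e1 * `|m - m0|) * B.
  by apply: ler_pM => //; [exact: h1|exact: hB].
have g3 : `|F m t - F m0 t| * `|G m t - G m0 t| <= e1 * (K * `|m - m0|).
  by apply: ler_pM => //; [exact: h4|exact: h3].
have -> : e = (A + B + K) * e1 by rewrite mulrC divfK// gt_eqF.
lra.
Qed.

Lemma C0_prim G : C0 G -> C0 (fun m => prim (G m)).
Proof.
move=> [cG uG]; split=> [m Dm|m0 Dm0 e e0]; first by apply: continuous_prim; exact: cG.
apply: filterS2 (ND_in m0) (uG _ Dm0 _ e0) => m Dm h t tI.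
have cd : continuous (fun t => G m t - G m0 t).
  by apply: ctD; [exact: cG|apply: ctN; exact: cG].
have /funeqP/(_ t) <- := primnB 1 (cG m Dm) (cG m0 Dm0).
have := primn_bound 1 cd (_ : 1 / 2 <= 1) (ltW e0) h tI; apply; lra.
Qed.

Lemma C0_primn n F : C0 F -> C0 (fun m => primn n (F m)).
Proof. by move=> h; elim: n => [//|n ih]; exact: (C0_prim ih). Qed.

Lemma C1_prim F F' : C1 F F' -> C1 (fun m => prim (F m)) (fun m => prim (F' m)).
Proof.
move=> [hF hF' dF]; split; [exact: C0_prim|exact: C0_prim|].
move=> m0 Dm0 e e0; apply: filterS2 (ND_in m0) (dF _ Dm0 _ e0) => m Dm h t tI.
have cd1 : continuous (fun t => F m t - F m0 t).
  by apply: ctD; [exact: hF.1|apply: ctN; exact: hF.1].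
have cd2 : continuous (fun t => (m - m0) * F' m0 t).
  by apply: ctM; [exact: ct_cst|exact: hF'.1].
have cd : continuous (fun t => F m t - F m0 t - (m - m0) * F' m0 t).
  by apply: ctD => //; exact: ctN.
have /funeqP/(_ t) E1 := primnB 1 (hF.1 m Dm) (hF.1 m0 Dm0).
have /funeqP/(_ t) E2 := primnZ 1 (m - m0) (hF'.1 m0 Dm0).
have /funeqP/(_ t) E3 := primnB 1 cd1 cd2.
rewrite /primn /= in E1 E2 E3; rewrite -E1 -E2 -E3.
have eK : 0 <= e * `|m - m0| by rewrite mulr_ge0// ltW.
have := primn_bound 1 cd (_ : 1 / 2 <= 1) eK h tI; apply; lra.
Qed.

Lemma C1_primn n F F' : C1 F F' -> C1 (fun m => primn n (F m)) (fun m => primn n (F' m)).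
Proof. by move=> h; elim: n => [//|n ih]; exact: (C1_prim ih). Qed.

Lemma C0_eval F t0 : half t0 -> C0 F -> C0 (fun m _ => F m t0).
Proof.
move=> t0I [cF uF]; split=> [m Dm|m0 Dm0 e e0]; first exact: ct_cst.
by apply: filterS (uF _ Dm0 _ e0) => m h t _; exact: h.
Qed.

Lemma C1_eval F F' t0 : half t0 -> C1 F F' -> C1 (fun m _ => F m t0) (fun m _ => F' m t0).
Proof.
move=> t0I [hF hF' dF]; split; [exact: C0_eval|exact: C0_eval|].
by move=> m0 Dm0 e e0; apply: filterS (dF _ Dm0 _ e0) => m h t _; exact: h.
Qed.

Lemma C0V (a : R -> R) : (forall m, D m -> a m != 0) ->
  C0 (fun m _ => a m) -> C0 (fun m _ => (a m)^-1).
Proof.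
move=> a0 ha; have half0 : `|0 : R| <= 1 / 2 by rewrite normr0; lra.
split=> [m Dm|m0 Dm0 e e0]; first exact: ct_cst.
have A0 : 0 < `|a m0| by rewrite normr_gt0 a0.
pose e1 := Num.min (`|a m0| / 2) (e * `|a m0| ^+ 2 / 2).
have [e11 e12] : e1 <= `|a m0| / 2 /\ e1 <= e * `|a m0| ^+ 2 / 2 by rewrite !ge_min !lexx orbT.
have e10 : 0 < e1 by rewrite lt_min !divr_gt0// mulr_gt0// exprn_gt0.
apply: filterS2 (ND_in m0) (ha.2 _ Dm0 _ e10) => m Dm h t _.
have {}h := h 0 half0.
have am : `|a m0| / 2 <= `|a m|.
  have := ler_normD (a m) (a m0 - a m); rewrite addrC subrK distrC; lra_from e11 h.
have am0 := a0 m Dm; have am00 := a0 m0 Dm0.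
have -> : (a m)^-1 - (a m0)^-1 = - (a m - a m0) / (a m * a m0).
  by field; rewrite am0 am00.
rewrite normrM normrN normfV normrM ler_pdivrMr ?mulr_gt0 ?normr_gt0//.
apply: le_trans h _; apply: le_trans e12 _.
rewrite -mulrA; apply: ler_wpM2l; first exact: ltW.
by rewrite expr2 mulrAC; apply: ler_wpM2r.
Qed.

Lemma C1V (a a' : R -> R) : (forall m, D m -> a m != 0) ->
  C1 (fun m _ => a m) (fun m _ => a' m) ->
  C1 (fun m _ => (a m)^-1) (fun m _ => - a' m / a m ^+ 2).
Proof.
move=> a0 C1a; have [ha ha' da] := C1a; have aV := C0V a0 ha.
have cst F : (forall m, D m -> forall t s, F m t = F m s) -> fct F.
  move=> h m Dm; have -> : F m = fun=> F m 0 by apply/funext => t; exact: h.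
  exact: ct_cst.
have aVV : C0 (fun m _ => - a' m / a m ^+ 2).
  have hm : C0 (fun m _ => -1 * a' m * ((a m)^-1 * (a m)^-1)).
    apply: C0M; last exact: C0M.
    by apply: C0M => //; apply/C0_cst/ct_cst.
  apply: C0_eq hm _ _; first exact: cst.
  by move=> m t Dm _; rewrite -invfM expr2 mulN1r.
split=> //; move=> m0 Dm0 e e0.
have [K K0 hK] := uder_lip C1a Dm0.
have am00 := a0 m0 Dm0.
have B0 : 0 < `|a m0|^-1 by rewrite invr_gt0 normr_gt0.
have [hb1 hb2] := aV.
set q := `|a m0|^-1 in B0 *.
pose e1 := e / (K * q + q * q + 1).
have S0 : 0 < K * q + q * q + 1 by have : 0 < K * q := mulr_gt0 K0 B0; have : 0 <= q * q := mulr_ge0 (ltW B0) (ltW B0); lra_from.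
have e10 : 0 < e1 by rewrite divr_gt0.
apply: filterS2 (filterI (ND_in m0) hK) (filterI (da _ Dm0 _ e10) (hb2 _ Dm0 _ e10)).
move=> m [Dm h1] [h2 h3] t tI; have am0 := a0 m Dm.
have -> : (a m)^-1 - (a m0)^-1 - (m - m0) * (- a' m0 / a m0 ^+ 2) =
  - ((a m - a m0) * ((a m)^-1 - (a m0)^-1) * (a m0)^-1)
  - (a m - a m0 - (m - m0) * a' m0) * ((a m0)^-1 * (a m0)^-1) by field; rewrite am0 am00.
apply: le_trans (ler_normB _ _) _; rewrite normrN !normrM !normfV -/q.
have g1 : `|a m - a m0| * `|(a m)^-1 - (a m0)^-1| <= K * `|m - m0| * e1.
  by apply: ler_pM => //; [exact: (h1 t tI)|exact: (h3 t tI)].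
have g2 := ler_wpM2r (ltW B0) g1.
have g3 := ler_wpM2r (sqr_ge0 q) (h2 t tI).
rewrite expr2 in g3.
have -> : e = (K * q + q * q + 1) * e1 by rewrite mulrC divfK// gt_eqF.
have : 0 <= e1 * `|m - m0| by rewrite mulr_ge0// ltW.
lra_from g2 g3.
Qed.

Lemma uder_uniq F G G' : C1 F G -> C1 F G' -> forall m t, D m -> half t ->
  G m t = G' m t.
Proof.
move=> [_ _ d1] [_ _ d2] m0 t Dm0 tI.
apply/eqP; rewrite -subr_eq0 -normr_le0; apply/ler_addgt0Pr => e e0.
have e2 : 0 < e / 2 by rewrite divr_gt0.
have [d d0 hd] := (NDP _ _).1 (filterI (d1 _ Dm0 _ e2) (d2 _ Dm0 _ e2)).
(* The increment goes to the right, which stays inside [[0, r[] even when [m0 = 0]. *)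
pose h := Num.min (d / 2) ((r - m0) / 2).
have h0 : 0 < h by rewrite lt_min; lra.
have [h1 h2] : h <= d / 2 /\ h <= (r - m0) / 2 by rewrite !ge_min !lexx orbT.
have [||g1 g2] := hd (m0 + h); [lra|by rewrite addrC addKr gtr0_norm//; lra_from h0 h1|].
have := g1 t tI; have := g2 t tI; rewrite [m0 + h]addrC addrK (gtr0_norm h0) add0r.
set A := F (h + m0) t - F m0 t => k1 k2.
have : h * `|G m0 t - G' m0 t| <= h * e.
  rewrite -{1}(gtr0_norm h0) -normrM.
  have -> : h * (G m0 t - G' m0 t) = (A - h * G' m0 t) - (A - h * G m0 t) by ring.
  by apply: le_trans (ler_normB _ _) _; lra_from k1 k2.
by rewrite ler_pM2l.
Qed.

Section compositions.
Variables (v : R -> R -> R).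
Hypothesis v_itv : forall m t, D m -> half t -> 0 <= v m t <= m.

Lemma fct_comp (g : R -> R) : {within `[0, r[, continuous g} -> fct v ->
  fct (fun m t => g (clip m (v m t))).
Proof.
move=> /withinC_P cg cv m Dm x; apply/contP => e e0.
have cI z : 0 <= clip m z < r by have := @clip_itv _ m z; lra.
have [|d d0 hd] := cg (clip m (v m x)) _ e e0; first by rewrite /= in_itv/=.
have [d' d'0 hd'] := (contP _ _).1 (@ct_comp _ _ _ (@ct_clip _ m) (cv m Dm) x) d d0.
by exists d' => // z /hd'; apply: hd; rewrite /= in_itv/=.
Qed.

Lemma C0_comp (g : R -> R) : {within `[0, r[, continuous g} -> C0 v ->
  C0 (fun m t => g (clip m (v m t))).
Proof.
move=> cg [cv uv]; split=> [|m0 Dm0 e e0]; first exact: fct_comp.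
pose M := (m0 + r) / 2; have M0 : 0 <= M by rewrite /M; lra.
have cgM : {within `[0, M], continuous g}.
  by apply: sub_within cg => x /=; rewrite !in_itv/= /M; lra.
have [d d0 hd] := heine M0 cgM e0.
have d2 : 0 < d / 2 by rewrite divr_gt0.
have Mm : 0 < M - m0 by rewrite /M; lra.
apply: filterS2 (filterI (ND_in m0) (ND_close m0 Mm)) (uv _ Dm0 _ d2) => m [Dm mM] h t tI.
have := v_itv Dm tI; have := v_itv Dm0 tI; have := h t tI; move: mM.
rewrite ltr_norml => mM hh i1 i2.
rewrite !clip_id//; apply/ltW/hd; [lra_from mM i2|lra_from mM i1|].
by apply: le_lt_trans hh _; lra_from d2.
Qed.

(** For [|t| <= 1 / 2] the truncation is the identity on the values of [v], so its corners and its
    dependence on [m] contribute nothing to the derivative; elsewhere it only keeps the argument in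
    the domain of [g]. *)
Lemma C1_comp (g g1 : R -> R) v' : {within `[0, r[, continuous g} ->
  {within `[0, r[, continuous g1} -> (forall u, 0 < u < r -> der g u (g1 u)) ->
  C1 v v' -> C1 (fun m t => g (clip m (v m t)))
    (fun m t => g1 (clip m (v m t)) * v' m t).
Proof.
move=> cg cg1 dg C1v; have [hv hv' dv] := C1v.
have Cg := C0_comp cg hv; have Cg1 := C0_comp cg1 hv.
split; [by []|exact: C0M|].
move=> m0 Dm0 e e0.
pose M := (m0 + r) / 2; have M0 : 0 <= M by rewrite /M; lra.
have sub (h : R -> R) : {within `[0, r[, continuous h} -> {within `[0, M], continuous h}.
  by apply: sub_within => x /=; rewrite !in_itv/= /M; lra.
have dgM x : 0 < x < M -> der g x (g1 x) by move=> xM; apply: dg; move: xM; rewrite /M; lra.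
have [K K0 hK] := uder_lip C1v Dm0.
have [B B0 hB] := fct_bound Cg1.1 Dm0.
pose e1 := e / (K + B); have KB : 0 < K + B by lra_from K0 B0.
have e10 : 0 < e1 by rewrite divr_gt0.
have [d d0 hd] := taylor_uniform M0 (sub _ cg) (sub _ cg1) dgM e10.
have d2 : 0 < d / 2 by rewrite divr_gt0.
have Mm : 0 < M - m0 by rewrite /M; lra_from Dm0.
apply: filterS2 (filterI (filterI (ND_in m0) (ND_close m0 Mm)) (hv.2 _ Dm0 _ d2))
  (filterI hK (dv _ Dm0 _ e10)) => m [[Dm mM] h] [h1 h2] t tI.
have i1 := v_itv Dm tI; have i2 := v_itv Dm0 tI.
move: mM; rewrite ltr_norml => mM.
have iM1 : 0 <= v m0 t <= M by lra_from i2 mM.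
have iM2 : 0 <= v m t <= M by lra_from i1 mM.
have vd : `|v m t - v m0 t| < d by apply: le_lt_trans (h t tI) _; lra_from d2.
have := hd _ _ iM1 iM2 vd.
have := hB t tI; rewrite !clip_id// => hB'.
set x := v m t; set y := v m0 t => hT.
have -> : g x - g y - (m - m0) * (g1 y * v' m0 t) =
  (g x - g y - g1 y * (x - y)) + g1 y * (x - y - (m - m0) * v' m0 t) by ring.
apply: le_trans (ler_normD _ _) _; rewrite normrM.
have g1' : `|g1 y| * `|x - y - (m - m0) * v' m0 t| <= B * (e1 * `|m - m0|).
  by apply: ler_pM => //; exact: h2.
have g2 := ler_wpM2l (ltW e10) (h1 t tI).
have -> : e = (K + B) * e1 by rewrite mulrC divfK// gt_eqF.
move: hT g2; rewrite -/x -/y; lra_from g1'.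
Qed.

End compositions.

Section linear_volterra.
Variables (g p y : R -> R -> R).
Hypothesis yE : forall m, D m -> forall t,
  y m t = g m t + primn 4 (fun s => p m s * y m s) t.
Hypothesis cy : fct y.

Lemma linear_volterra_C0 : C0 g -> C0 p -> C0 y.
Proof.
move=> [cg ug] [cp up]; split=> // m0 Dm0 e e0.
have [P P0 hP] := fct_bound cp Dm0; have [Y Y0 hY] := fct_bound cy Dm0.
have h0 : 0 <= 1 / 2 :> R by lra.
pose W := expR (wrate (P + 1) * (1 / 2)); have W0 : 0 < W by exact: expR_gt0.
pose e1 := Num.min 1 (e / (2 * (1 + Y) * W)).
have S0 : 0 < 2 * (1 + Y) * W by rewrite !mulr_gt0//; lra_from Y0.
have e10 : 0 < e1 by rewrite lt_min ltr01 divr_gt0.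
have [e11 e12] : e1 <= 1 /\ e1 <= e / (2 * (1 + Y) * W) by rewrite !ge_min !lexx orbT.
apply: filterS2 (filterI (ND_in m0) (ug _ Dm0 _ e10)) (up _ Dm0 _ e10).
move=> m [Dm hg] hp t tI.
have cpy m' : D m' -> continuous (fun s => p m' s * y m' s).
  by move=> Dm'; apply: ctM; [exact: cp|exact: cy].
have P1 : 0 <= P + 1 by lra_from P0.
have c0 : 0 <= e1 * Y by rewrite mulr_ge0// ltW.
have := @volterra_gronwall _ (fun t => y m t - y m0 t) (fun t => g m t - g m0 t)
  (fun s => p m s * y m s - p m0 s * y m0 s) (1 / 2) (P + 1) e1 (e1 * Y) h0 P1 (ltW e10) c0.
move=> /(_ _ _ _ _ _ t tI) H; apply: le_trans (H _ _ _ _ _) _.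
- by apply: ctD; [exact: cy|apply: ctN; exact: cy].
- by apply: ctD; [exact: cpy|apply: ctN; exact: cpy].
- move=> s _; have /funeqP/(_ s) -> := primnB 4 (cpy m Dm) (cpy m0 Dm0).
  by rewrite {1}(yE Dm) {1}(yE Dm0); ring.
- exact: hg.
- move=> s sI.
  have -> : p m s * y m s - p m0 s * y m0 s =
    (p m0 s + (p m s - p m0 s)) * (y m s - y m0 s) + (p m s - p m0 s) * y m0 s by ring.
  apply: le_trans (ler_normD _ _) _; rewrite !normrM; apply: lerD.
    apply: ler_wpM2r => //; apply: le_trans (ler_normD _ _) _.
    by apply: lerD; [exact: hP|apply: le_trans (hp s sI) _].
  by apply: ler_pM => //; [exact: hp|exact: hY].
- apply: (@le_trans _ _ (2 * (e1 + e1 * Y) * W)).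
    apply: ler_wpM2l; first by rewrite mulr_ge0// addr_ge0// ltW.
    by rewrite ler_expR ler_wpM2l// ltW// wrate_gt0.
  have -> : 2 * (e1 + e1 * Y) * W = e1 * (2 * (1 + Y) * W) by ring.
  by rewrite -ler_pdivlMr.
Qed.

End linear_volterra.

Section linear_volterra_diff.
Variables (g p y g' p' : R -> R -> R).
Hypothesis yE : forall m, D m -> forall t,
  y m t = g m t + primn 4 (fun s => p m s * y m s) t.
Hypothesis cy : fct y.
Hypothesis pb : forall m, D m -> exists P, forall t, `|p m t| <= P.

Lemma linear_volterra_C1 : C1 g g' -> C1 p p' -> exists2 y', C1 y y' &
  forall m, D m -> forall t,
    y' m t = g' m t + primn 4 (fun s => p m s * y' m s + p' m s * y m s) t.
Proof.
move=> C1g C1p; have [hg hg' dg] := C1g; have [hp hp' dp] := C1p.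
have C0y := linear_volterra_C0 yE cy hg hp.
have ex m : exists z, D m -> continuous z /\
    forall t, z t = g' m t + primn 4 (fun s => p m s * z s + p' m s * y m s) t.
  have [Dm|nDm] := pselect (D m); last by exists (fun=> 0).
  have [P hP] := pb Dm.
  have P0 : 0 <= P := le_trans (normr_ge0 _) (hP 0).
  have [|||z cz ez] := @volterra_exists _ (fun s a => p m s * a + p' m s * y m s)
    (g' m) P P0; last by exists z.
  - move=> t a b; rewrite opprD addrACA subrr addr0 -mulrBr normrM.
    exact: ler_wpM2r.
  - move=> z cz; apply: ctD; first by apply: ctM => //; exact: hp.1.
    by apply: ctM; [exact: hp'.1|exact: cy].
  - exact: hg'.1.
have [y' hy'] := choice ex.
have cy' : fct y' by move=> m Dm; have [] := hy' m Dm.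
have y'E m : D m -> forall t, y' m t = g' m t + primn 4 (fun s => p m s * y' m s + p' m s * y m s) t.
  by move=> Dm; have [] := hy' m Dm.
have h0 : 0 <= 1 / 2 :> R by lra.
have cpy' m : D m -> continuous (fun s => p m s * y' m s).
  by move=> Dm; apply: ctM; [exact: hp.1|exact: cy'].
have cp'y m : D m -> continuous (fun s => p' m s * y m s).
  by move=> Dm; apply: ctM; [exact: hp'.1|exact: cy].
exists y'; last exact: y'E.
split; first exact: C0y.
  apply: (@linear_volterra_C0 (fun m t => g' m t + primn 4 (fun s => p' m s * y m s) t) p _ _ cy' _ hp).
    move=> m Dm t; rewrite (y'E m Dm); have /funeqP/(_ t) -> := primnD 4 (cpy' m Dm) (cp'y m Dm).
    by ring.
  by exact: C0D hg' (C0_primn 4 (C0M hp' C0y)).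
move=> m0 Dm0 e e0.
have [P P0 hP] := fct_bound hp.1 Dm0; have [Y Y0 hY] := fct_bound cy Dm0.
have [K K0 hK] := uder_lip C1p Dm0.
pose W := expR (wrate P * (1 / 2)); have W0 : 0 < W by exact: expR_gt0.
pose q := 2 * (1 + Y + K) * W.
have q0 : 0 < q by rewrite !mulr_gt0//; lra_from Y0 K0.
pose e1 := e / q; have e10 : 0 < e1 by rewrite divr_gt0.
apply: filterS2 (filterI (filterI (ND_in m0) hK) (dg _ Dm0 _ e10))
  (filterI (dp _ Dm0 _ e10) (C0y.2 _ Dm0 _ e10)) => m [[Dm h1] h2] [h3 h4] t tI.
set dm := `|m - m0| in h1 h2 h3 *.
have dm0 : 0 <= dm by exact: normr_ge0.
have cpy m' : D m' -> continuous (fun s => p m' s * y m' s).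
  by move=> Dm'; apply: ctM; [exact: hp.1|exact: cy].
have cs (c : R) (h : R -> R) : continuous h -> continuous (fun s => c * h s).
  by move=> ch; apply: ctM => //; exact: ct_cst.
pose h0' := fun s => p m0 s * y' m0 s + p' m0 s * y m0 s.
have ch0' : continuous h0' by apply: ctD; [exact: cpy'|exact: cp'y].
pose h := fun s => p m s * y m s - p m0 s * y m0 s.
have ch : continuous h by apply: ctD; [exact: cpy|apply: ctN; exact: cpy].
have a0 : 0 <= e1 * dm by rewrite mulr_ge0// ltW.
have c0 : 0 <= e1 * dm * Y + K * dm * e1 by apply: addr_ge0; [exact: mulr_ge0 (ltW Y0)|apply: mulr_ge0 (ltW e10); exact: mulr_ge0 (ltW K0) dm0].
have := @volterra_gronwall _ (fun t => y m t - y m0 t - (m - m0) * y' m0 t)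
  (fun t => g m t - g m0 t - (m - m0) * g' m0 t)
  (fun s => h s - (m - m0) * h0' s) (1 / 2) P (e1 * dm) _ h0 (ltW P0) a0 c0.
move=> /(_ _ _ _ _ _ t tI) H; apply: le_trans (H _ _ _ _ _) _.
- apply: ctD; first by apply: ctD; [exact: cy|apply: ctN; exact: cy].
  by apply/ctN/cs; exact: cy'.
- by apply: ctD; [exact: ch|apply/ctN/cs; exact: ch0'].
- move=> s _; have /funeqP/(_ s) -> := primnB 4 ch (cs (m - m0) _ ch0').
  have /funeqP/(_ s) -> := primnZ 4 (m - m0) ch0'.
  have /funeqP/(_ s) -> := primnB 4 (cpy m Dm) (cpy m0 Dm0).
  by rewrite {1}(yE Dm) {1}(yE Dm0) {1}(y'E m0 Dm0) -/h0'; ring.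
- exact: h2.
- move=> s sI.
  have -> : h s - (m - m0) * h0' s = p m0 s * (y m s - y m0 s - (m - m0) * y' m0 s) +
    ((p m s - p m0 s - (m - m0) * p' m0 s) * y m0 s + (p m s - p m0 s) * (y m s - y m0 s)).
    by rewrite /h /h0'; ring.
  apply: le_trans (ler_normD _ _) _; rewrite normrM; apply: lerD.
    by apply: ler_wpM2r => //; exact: hP.
  apply: le_trans (ler_normD _ _) _; rewrite !normrM; apply: lerD.
    by apply: ler_pM => //; [exact: h3|exact: hY].
  by apply: ler_pM => //; [exact: h1|exact: h4].
- apply: (@le_trans _ _ (2 * (e1 * dm + (e1 * dm * Y + K * dm * e1)) * W)).
    apply: ler_wpM2l; first by rewrite mulr_ge0// addr_ge0.
    by rewrite ler_expR ler_wpM2l// ltW// wrate_gt0// ltW.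
  have -> : e = q * e1 by rewrite mulrC divfK// gt_eqF.
  by rewrite le_eqVlt; apply/orP; left; apply/eqP; rewrite /q; ring.
Qed.

End linear_volterra_diff.
End families.

Section half_profile_green.
Context {R : realType} (F : nonlinearity R).
Variables (m lam : R) (y : nat -> R -> R).
Hypothesis hp : half_profile F m lam y.
Local Notation f := (nl_f F).
Implicit Types t : R.

(* [q] is the Green function of the clamped half-problem seen from [t = 0]:
   [q'''' = 0], [q' 0 = 0], [q''' = 1] and [q = q' = 0] at [1/2]. *)
Definition green_q t : R := (1 / 2 - t) ^+ 2 / 8 - (1 / 2 - t) ^+ 3 / 6.

(** The bilinear concomitant of [y] and [green_q]: the bracketed factors are [q'] and [q'']. Since
    [q'''' = 0] its derivative is [y'''' * q], and its end values say that the integral of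
    [y'''' * q] is [m]. *)
Definition green_P t : R := y 3%N t * green_q t
  - y 2%N t * ((1 / 2 - t) ^+ 2 / 2 - (1 / 2 - t) / 4)
  + y 1%N t * (1 / 4 - (1 / 2 - t)) - y 0%N t.

Lemma der_green_P t : 0 < t < 1 / 2 -> der green_P t (y 4%N t * green_q t).
Proof.
move=> tI; have [dy _] := hp_jet hp.
have d0 := dy 0%N isT t tI; have d1 := dy 1%N isT t tI.
have d2 := dy 2%N isT t tI; have d3 := dy 3%N isT t tI.
apply: der_eq; first by rewrite /green_P /green_q; der_auto.
rewrite /green_q; move: (y 0%N t) (y 1%N t) (y 2%N t) (y 3%N t) (y 4%N t) => a b c d e.
by rewrite /=; field.
Qed.

Lemma ct_green_P : {within `[0, 1 / 2], continuous green_P}.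
Proof.
have [_ cy] := hp_jet hp.
have cl : continuous (fun t : R => 1 / 2 - t).
  by apply: ctD; [exact: ct_cst|apply: ctN; exact: ct_id].
have cs (c : R) n : {within `[0, 1 / 2], continuous (fun t : R => (1 / 2 - t) ^+ n / c)}.
  by apply: cont_within; apply: ctM; [exact: ctX|exact: ct_cst].
apply: wctD; last by apply: wctN; exact: cy.
apply: wctD; last first.
  apply: wctM; first exact: cy.
  by apply: cont_within; apply: ctD; [exact: ct_cst|exact: ctN].
apply: wctD.
  by apply: wctM; [exact: cy|apply: wctD; [exact: cs|apply: wctN; exact: cs]].
apply: wctN; apply: wctM; first exact: cy.
apply: wctD; first exact: cs.
by apply: wctN; apply: cont_within; apply: ctM => //; exact: ct_cst.
Qed.

Lemma green_P_ends : green_P 0 = - m /\ green_P (1 / 2) = 0.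
Proof.
have [y00 y10 y30] := hp_init hp; have [e0 e1] := hp_end hp.
rewrite /green_P /green_q y00 y10 y30 e0 e1; split; first by field.
by rewrite subrr !expr0n/=; field.
Qed.

Lemma green_q_ge0 t : 0 <= t <= 1 / 2 -> 0 <= green_q t.
Proof.
move=> tI; have -> : green_q t = (1 / 2 - t) ^+ 2 * (1 / 24 + t / 6).
  by rewrite /green_q; field.
by rewrite mulr_ge0 ?sqr_ge0//; lra.
Qed.

(** In the identity integral of [lam * f y * q] equal to [m], [f y] is at least [f 0], and [green_q]
    has integral [1 / 384] over [[0, 1 / 2]]. *)
Lemma half_lam_le : lam * f 0 <= 384 * m.
Proof.
have l0 := hp_lam hp; have f00 := f0_gt0 F.
pose Q t : R := - ((1 / 2 - t) ^+ 3 / 24 - (1 / 2 - t) ^+ 4 / 24).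
have dQ t : der Q t (green_q t).
  apply: der_eq; first by rewrite /Q; der_auto.
  by rewrite /green_q /=; field.
have h12 : 0 <= 1 / 2 :> R by lra.
have h13 : 1 / 2 <= 1 / 2 :> R by rewrite lexx.
have := @nondecr_le _ 0 (1 / 2) (fun t => green_P t - lam * f 0 * Q t)
  (fun t => y 4%N t * green_q t - lam * f 0 * green_q t) _ _ _ 0 (1 / 2) (lexx _) h12 h13.
have [-> ->] := green_P_ends.
have -> : Q 0 = - (1 / 384) by rewrite /Q; field.
have -> : Q (1 / 2) = 0 by rewrite /Q; field.
move=> H; suff : - m - lam * f 0 * - (1 / 384) <= 0 - lam * f 0 * 0 by lra.
apply: H.
- by move=> x xI; apply: derD; [exact: der_green_P|apply/derN/derZ/dQ].
- by apply: wctD; [exact: ct_green_P|apply/wctN/wctM; [exact: wct_cst|exact: der_within dQ]].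
- move=> x xI; rewrite -mulrBl mulr_ge0 ?green_q_ge0//; last lra.
  rewrite (hp_ode hp)// -mulrBr mulr_ge0 ?(ltW l0)// subr_ge0.
  have xI' : 0 <= x <= 1 / 2 by lra.
  by apply: f_nd => //; have := hp_range hp xI'; lra.
Qed.

End half_profile_green.

Section profile_family.
Context {R : realType} (F : nonlinearity R).
Local Notation r := (nl_r F).
Local Notation f := (nl_f F).
Local Notation f1 := (nl_f1 F).
Local Notation f2 := (nl_f2 F).
Implicit Types (m t : R).
Local Notation half t := (`|t| <= 1 / 2).
Local Notation D m := (0 <= m < r).

(** The family is closed at [m = 0] by the trivial solution, with [lam] and [k] zero, so that
    smoothness up to the start of the curve can be stated. *)
Record profile_family (lam k : R -> R) (v : R -> R -> R) : Prop := ProfileFamily {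
  pf_ct : forall m, D m -> continuous (v m);
  pf_eq : forall m, D m -> forall t, v m t = vjet m (k m) (source F m (lam m) (v m)) 0%N t;
  pf_itv : forall m t, D m -> half t -> 0 <= v m t <= m;
  pf_v0 : forall m, D m -> v m (1 / 2) = 0;
  pf_v1 : forall m, D m -> vjet m (k m) (source F m (lam m) (v m)) 1%N (1 / 2) = 0;
  pf_lam : forall m, 0 < m < r -> 0 < lam m;
  pf_lam0 : lam 0 = 0;
  pf_k0 : k 0 = 0 }.

Lemma profile_family_exists : exists lam k v, profile_family lam k v.
Proof.
have r0 := nl_r_gt0 F.
have D0 : D (0 : R) by rewrite lexx.
have ex m : exists q : R * R * (R -> R), if m == 0 then q = (0, 0, fun=> 0)
    else D m -> profile F m q.1.1 q.1.2 q.2.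
  have [m0|m0] := eqVneq m 0; first by exists (0, 0, fun=> 0).
  have [Dm|nDm] := pselect (D m); last by exists (0, 0, fun=> 0).
  have mr : 0 < m < r by rewrite lt_neqAle eq_sym m0.
  by have [l [k [v h]]] := profile_exists mr; exists (l, k, v).
have [q hq] := choice ex.
have q0 : q 0 = (0, 0, fun=> 0) by have := hq 0; rewrite eqxx.
have qm m : 0 < m < r -> profile F m (q m).1.1 (q m).1.2 (q m).2.
  by move=> mr; have := hq m; rewrite gt_eqF; [apply; lra|lra].
have cases m : D m -> m = 0 \/ 0 < m < r.
  move=> Dm; have [->|m0] := eqVneq m 0; first by left.
  by right; rewrite lt_neqAle eq_sym m0.
have s0 j : (j <= 1)%N -> vjet 0 0 (source F 0 0 (fun=> 0)) j = fun=> 0 :> R.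
  have cf : continuous (fun t : R => f (clip 0 0)) by exact: ct_cst.
  move=> j1; apply/funext => t; rewrite /source.
  have E n : primn n (fun _ : R => 0 * f (clip 0 0)) t = 0.
    by have /funeqP/(_ t) -> := primnZ n 0 cf; rewrite mul0r.
  by case: j j1 => [|[|//]] _; rewrite /vjet E; ring.
exists (fun m => (q m).1.1), (fun m => (q m).1.2), (fun m => (q m).2); split.
- by move=> m /cases[->|/qm[]//]; rewrite q0; exact: ct_cst.
- move=> m /cases[->|/qm[]//] t; rewrite q0.
  exact: (esym (congr1 (fun g => g t) (s0 0%N isT))).
- move=> m t /cases[->|/qm[_ _ _ h _ _]] tI; last exact: h.
  by rewrite q0 lexx.
- by move=> m /cases[->|/qm[]//]; rewrite q0.
- by move=> m /cases[->|/qm[]//]; rewrite q0; exact: (congr1 (fun g => g _) (s0 1%N isT)).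
- by move=> m /qm[].
- by rewrite q0.
- by rewrite q0.
Qed.

(** One constant for all data with [m], [m'] at most [M]. Only [l] has to be bounded: it multiplies
    the Lipschitz part, while [l'] enters through [|l - l'|]. *)
Lemma source_stable_half M Lam : 0 <= M < r -> 0 <= Lam -> exists2 C, 0 <= C &
  forall m m' l l' k k' (v v' : R -> R), 0 <= m <= M -> 0 <= m' <= M -> 0 <= l <= Lam ->
    continuous v -> continuous v' ->
    (forall t, v t = vjet m k (source F m l v) 0%N t) ->
    (forall t, v' t = vjet m' k' (source F m' l' v') 0%N t) ->
    forall t, half t ->
    `|v t - v' t| <= C * (`|m - m'| + `|k - k'| + `|l - l'|) /\
    `|source F m l v t - source F m' l' v' t| <= C * (`|m - m'| + `|k - k'| + `|l - l'|).
Proof.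
move=> Mr Lam0; have M0 : 0 <= M by lra.
have [L L0 hL] := f_lipschitz Mr.
have fM0 : 0 < f M by apply: nl_f_gt0.
pose W := expR (wrate (Lam * L) * (1 / 2)).
pose C1 := 2 * (1 + Lam * L + f M) * W.
have LL0 : 0 <= Lam * L by rewrite mulr_ge0.
have W1 : 1 <= W by rewrite /W -{1}expR0 ler_expR; have := wrate_gt0 LL0 => w0; apply: mulr_ge0; lra.
have C10 : 0 <= C1 by rewrite /C1 !mulr_ge0//; lra_from fM0 LL0 W1.
have LC0 : 0 <= Lam * L * (C1 + 1) by rewrite mulr_ge0//; lra.
exists (C1 + Lam * L * (C1 + 1) + f M); first lra.
move=> m m' l l' k k' v v' mM m'M lL cv cv' ev ev' t tI.
have mr : 0 <= m < r by lra_from Mr mM.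
have mr' : 0 <= m' < r by lra_from Mr m'M.
have m0 : 0 <= m by lra_from mr.
have m0' : 0 <= m' by lra_from mr'.
have l0 : 0 <= l by lra_from lL.
set rho := `|m - m'| + `|k - k'| + `|l - l'|.
have [r1 [r2 r3]] : 0 <= `|m - m'| /\ (0 <= `|k - k'| /\ 0 <= `|l - l'|).
  by rewrite !normr_ge0.
have [rm rl] : `|m - m'| <= rho /\ `|l - l'| <= rho.
  by rewrite /rho; clear - r1 r2 r3; split; lra.
have rho0 : 0 <= rho := le_trans r1 rm.
have clipM x n : 0 <= n <= M -> 0 <= clip n x <= M.
  by move=> nM; have := @clip_itv _ n x; lra_from nM.
have hf s : `|f (clip m (v s)) - f (clip m' (v' s))| <= L * (`|v s - v' s| + `|m - m'|).
  apply: le_trans (hL _ _ (clipM _ _ mM) (clipM _ _ m'M)) _.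
  by apply: ler_wpM2l => //; exact: clip_lip.
have hfM s : `|f (clip m' (v' s))| <= f M.
  have c0 := clipM (v' s) m' m'M.
  rewrite gtr0_norm; last by apply: nl_f_gt0; clear - c0 Mr; lra.
  by case/andP: c0 => ? ?; apply: f_nd => //; case/andP: Mr.
have h12 : 0 <= 1 / 2 :> R by clear; lra.
have := source_stable mr mr' L0 l0 hf hfM cv cv' ev ev' h12 tI.
set X := 2 * _ => hv.
have ll : l * L <= Lam * L by apply: ler_wpM2r => //; clear - lL; lra.
have X0 : 0 <= X.
  have x1 : 0 <= `|k - k'| * (1 / 2) ^+ 2 by rewrite mulr_ge0// sqr_ge0.
  have x2 : 0 <= l * L * `|m - m'| by rewrite !mulr_ge0.
  have x3 : 0 <= `|l - l'| * f M by rewrite mulr_ge0// ltW.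
  by rewrite /X; lra.
have XW : X * expR (wrate (l * L) * `|t|) <= X * W.
  apply: ler_wpM2l => //; rewrite ler_expR; apply: ler_pM => //.
    by rewrite ltW ?wrate_gt0// mulr_ge0.
  by rewrite /wrate; clear - ll; lra.
have Xr : X <= 2 * ((1 + Lam * L + f M) * rho).
  rewrite /X; apply: ler_wpM2l => //.
  have g1 : l * L * `|m - m'| <= Lam * L * rho.
    by apply: ler_pM => //; rewrite mulr_ge0.
  have g2 : `|l - l'| * f M <= rho * f M by apply: ler_wpM2r; [exact: ltW|exact: rl].
  have g3 : `|k - k'| * (1 / 2) ^+ 2 <= `|k - k'|.
    by rewrite -[leRHS]mulr1; apply: ler_wpM2l => //; rewrite expr2; clear; lra.
  have -> : (1 + Lam * L + f M) * rho = rho + Lam * L * rho + rho * f M by ring.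
  have rE : rho = `|m - m'| + `|k - k'| + `|l - l'| by [].
  clear - rE g1 g2 g3 r1 r2 r3; lra.
have hv1 : `|v t - v' t| <= C1 * rho.
  apply: le_trans hv _; apply: le_trans XW _.
  have := ler_wpM2r (le_trans ler01 W1) Xr; rewrite /C1.
  move/le_trans; apply; rewrite le_eqVlt; apply/orP; left; apply/eqP; ring.
have hs : `|source F m l v t - source F m' l' v' t| <= Lam * L * (C1 + 1) * rho + f M * rho.
  rewrite /source.
  have -> : l * f (clip m (v t)) - l' * f (clip m' (v' t)) =
    l * (f (clip m (v t)) - f (clip m' (v' t))) + (l - l') * f (clip m' (v' t)) by ring.
  apply: le_trans (ler_normD _ _) _; rewrite !normrM (ger0_norm l0); apply: lerD; last first.
    by rewrite mulrC; apply: ler_pM.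
  rewrite -!mulrA; apply: ler_pM => //; first by case/andP: lL.
  apply: le_trans (hf t) _; apply: ler_wpM2l => //; rewrite mulrDl mul1r.
  by apply: lerD.
have e1 : 0 <= C1 * rho by rewrite mulr_ge0.
have e2 : 0 <= Lam * L * (C1 + 1) * rho by rewrite mulr_ge0// mulr_ge0//; clear - C10; lra.
have e3 : 0 <= f M * rho by rewrite mulr_ge0// ltW.
rewrite !mulrDl; split; clear - e1 e2 e3 hv1 hs; lra.
Qed.

End profile_family.

Section family.
Context {R : realType} (F : nonlinearity R).
Local Notation r := (nl_r F).
Local Notation f := (nl_f F).
Local Notation f1 := (nl_f1 F).
Local Notation f2 := (nl_f2 F).
Implicit Types (m t : R).
Local Notation half t := (`|t| <= 1 / 2).
Local Notation D m := (0 <= m < r).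

Variables (lam k : R -> R) (v : R -> R -> R).
Hypothesis pf : profile_family F lam k v.

Definition profile_source m := source F m (lam m) (v m).
Local Notation h := profile_source.

Lemma ct_h m : D m -> continuous (h m).
Proof. by move=> Dm; apply: ct_source => //; exact: (pf_ct pf). Qed.

Lemma pf_profile m : 0 < m < r -> profile F m (lam m) (k m) (v m).
Proof.
move=> mr; have Dm : D m by lra.
by split; [exact: (pf_ct pf)|exact: (pf_eq pf)|exact: (pf_lam pf)|
  move=> t tI; exact: (pf_itv pf)|exact: (pf_v0 pf)|exact: (pf_v1 pf)].
Qed.

Lemma pf_half m : 0 < m < r -> half_profile F m (lam m) (vjet m (k m) (h m)).
Proof. by move=> mr; apply: profile_half => //; exact: pf_profile. Qed.

Lemma lam_le m : D m -> lam m * f 0 <= 384 * m.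
Proof.
move=> Dm; have [->|m0] := eqVneq m 0; first by rewrite (pf_lam0 pf) mul0r mulr0.
by apply: (half_lam_le (pf_half _)); rewrite lt_neqAle eq_sym m0.
Qed.

Lemma lam_ge0 m : D m -> 0 <= lam m.
Proof.
move=> Dm; have [->|m0] := eqVneq m 0; first by rewrite (pf_lam0 pf).
by apply/ltW/(pf_lam pf); rewrite lt_neqAle eq_sym m0.
Qed.

Lemma h_bounds m t : D m -> 0 <= h m t <= lam m * f m.
Proof.
move=> Dm; have := f_clip_bounds (v m t) Dm; have := f0_gt0 F; have l0 := lam_ge0 Dm.
move=> f0 fb; rewrite /h /source mulr_ge0//=; last lra.
by apply: ler_wpM2l => //; lra.
Qed.

Lemma k_le m : D m -> `|k m| <= 2 * (lam m * f m).
Proof.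
move=> Dm; have hb x : half x -> `|h m x| <= lam m * f m.
  by move=> _; have := h_bounds x Dm; rewrite ler_norml; lra.
have h12 : half (1 / 2 : R) by rewrite ger0_norm//; lra.
have h1 : 1 / 2 <= 1 :> R by lra.
have l0 : 0 <= lam m * f m by have := h_bounds 0 Dm; lra.
have := primn_bound 3 (ct_h Dm) h1 l0 hb h12.
have := pf_v1 pf Dm; rewrite /vjet -/(h m) => E.
have -> : primn 3 (h m) (1 / 2) = k m / 2 by lra.
by rewrite normrM [`|2^-1|]gtr0_norm //; lra.
Qed.

Lemma half_half : half (1 / 2 : R).
Proof. by rewrite ger0_norm//; lra. Qed.

(** The solution [w] with data [m0], [l], [kap] is a limit of the [v m], so it inherits their bounds
    and end conditions. It is therefore a profile of height [m0], and uniqueness identifies its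
    data. *)
Lemma cluster_profile m0 l kap : 0 < m0 < r ->
  (forall e, 0 < e -> exists m, [/\ D m, `|m - m0| < e, `|lam m - l| < e & `|k m - kap| < e]) ->
  l = lam m0 /\ kap = k m0.
Proof.
move=> m0r hcl; have Dm0 : D m0 by lra.
have l0 : 0 <= l.
  rewrite leNgt; apply/negP => ln; have e0 : 0 < - l by lra.
  have [m [Dm _ lm _]] := hcl _ e0; have := lam_ge0 Dm.
  by move: lm; rewrite ltr_norml; lra.
have [w cw ew] := source_exists l kap Dm0.
pose M := (m0 + r) / 2; have Mr : 0 <= M < r by rewrite /M; lra.
have [C C0 hC] := source_stable_half Mr l0.
have Mm0 : 0 < M - m0 by rewrite /M; lra_from Dm0.
have approx e : 0 < e -> exists m, [/\ D m, `|m - m0| <= e,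
    forall t, half t -> `|w t - v m t| <= e &
    `|vjet m0 kap (source F m0 l w) 1%N (1 / 2)| <= e].
  move=> e0; pose e1 := Num.min (M - m0) (e / (3 * C + 1)).
  have C31 : 0 < 3 * C + 1 by lra_from C0.
  have e10 : 0 < e1 by rewrite lt_min Mm0 divr_gt0.
  have [e11 e12] : e1 <= M - m0 /\ e1 <= e / (3 * C + 1) by rewrite !ge_min !lexx orbT.
  move: e12; rewrite ler_pdivlMr// => e12.
  have Ce1 : 0 <= C * e1 by rewrite mulr_ge0// ltW.
  have [m [Dm mm lm km]] := hcl _ e10; exists m.
  have mM : 0 <= m <= M by move: mm; rewrite ltr_norml; clear - Dm e11; lra.
  have m0M : 0 <= m0 <= M by clear - Mm0 m0r; lra.
  have lL : 0 <= l <= l by rewrite l0 lexx.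
  have H t (tI : half t) := hC m0 m l (lam m) kap (k m) w (v m) m0M mM lL cw (pf_ct pf Dm)
    ew (pf_eq pf Dm) t tI.
  have sum3 : C * (`|m0 - m| + `|kap - k m| + `|l - lam m|) <= C * (3 * e1).
    apply: ler_wpM2l => //; rewrite (distrC m0) (distrC kap) (distrC l).
    by move: mm lm km; clear; lra.
  split=> //.
  - by apply: ltW; apply: lt_le_trans mm _; clear - Ce1 e12; lra.
  - by move=> t tI; have [g1 _] := H t tI; clear - g1 sum3 e12 e10; lra.
  - have v1 := pf_v1 pf Dm; rewrite -/(h m) in v1.
    have -> : vjet m0 kap (source F m0 l w) 1%N (1 / 2) =
      - ((kap - k m) / 2) + primn 3 (fun t => source F m0 l w t - h m t) (1 / 2).
      have /funeqP/(_ (1 / 2)) -> := primnB 3 (@ct_source _ F m0 l w Dm0 cw) (ct_h Dm).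
      by move: v1; rewrite /vjet; lra_from.
    have hd x : half x -> `|source F m0 l w x - h m x| <= C * (3 * e1).
      by move=> xI; have [_ g2] := H x xI; apply: le_trans g2 sum3.
    have cd : continuous (fun t => source F m0 l w t - h m t).
      by apply: ctD; [exact: ct_source|apply: ctN; exact: ct_h].
    have h1 : 1 / 2 <= 1 :> R by lra_from.
    have c30 : 0 <= C * (3 * e1) by clear - Ce1; lra.
    have := primn_bound 3 cd h1 c30 hd half_half.
    have : `|(kap - k m) / 2| <= e1.
      by rewrite normrM distrC [`|2^-1|]gtr0_norm//; clear - km e10; lra.
    rewrite !ler_norml; clear - e12; lra.
have small (x : R) : (forall e, 0 < e -> x <= e) -> x <= 0.
  by move=> hx; apply/ler_addgt0Pr => e e0; rewrite add0r; exact: hx.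
have w0 : w (1 / 2) = 0.
  apply/eqP; rewrite -normr_le0; apply: small => e /approx[m [Dm _ h1 _]].
  by have := h1 _ half_half; rewrite (pf_v0 pf)// subr0.
have w1 : vjet m0 kap (source F m0 l w) 1%N (1 / 2) = 0.
  by apply/eqP; rewrite -normr_le0; apply: small => e /approx[m []].
have wI t : half t -> 0 <= w t <= m0.
  move=> tI; apply/andP; split.
    rewrite -oppr_le0; apply: small => e e0.
    have [m [Dm _ h1 _]] := approx e e0.
    by have := h1 t tI; have := pf_itv pf Dm tI; rewrite ler_norml; lra_from.
  rewrite -subr_le0; apply: small => e e0.
  have e2 : 0 < e / 2 by lra_from e0.
  have [m [Dm mm h1 _]] := approx _ e2.
  by have := h1 t tI; have := pf_itv pf Dm tI; move: mm; rewrite !ler_norml; lra_from.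
(* With [l = 0] the solution is [m0 - kap * t ^+ 2 / 2], which cannot have both value and slope zero
   at [1 / 2] when [m0 > 0]. *)
have lp : 0 < l.
  rewrite lt_neqAle l0 andbT; apply/eqP => l0'.
  have cf : continuous (fun t => f (clip m0 (w t))) by exact: ct_fclip (@nl_cf _ F) cw.
  have E n t : primn n (source F m0 l w) t = 0.
    by have /funeqP/(_ t) -> := primnZ n l cf; rewrite -l0' mul0r.
  by move: w0 w1; rewrite ew /vjet !E expr2; clear - m0r; lra.
have pw : profile F m0 l kap w by [].
have [le ke _] := half_profile_unique (profile_half m0r pw) (pf_half m0r).
split=> //; move: ke.
have [_ _ -> _] := vjet_at0 m0 (k m0) (ct_h Dm0).
have [_ _ -> _] := vjet_at0 m0 kap (@ct_source _ F m0 l w Dm0 cw); lra_from.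
Qed.

(** For [m0 > 0]: near [m0] the pairs [(lam m, k m)] stay in a compact rectangle and have a single
    cluster point, so they converge to it. At [m0 = 0], where [cluster_profile] does not apply,
    explicit bounds are used. *)
Lemma pf_continuous m0 e : D m0 -> 0 < e ->
  \forall m \near ND r m0, `|lam m - lam m0| < e /\ `|k m - k m0| < e.
Proof.
move=> Dm0 e0; have r0 := nl_r_gt0 F; have f00 := f0_gt0 F.
have [m00|m00] := eqVneq m0 0.
  rewrite m00 (pf_lam0 pf) (pf_k0 pf).
  pose fr := f (r / 2); have fr0 : 0 < fr by apply: nl_f_gt0; lra.
  (* Comes from [lam_le] and [k_le]: [lam m * f 0 <= 384 * m], and [|k m|] is at most [2 * fr] times
     [lam m] when [m <= r / 2]. *)
  pose d := Num.min (r / 2) (e / 2 * (f 0 / (384 * (1 + 2 * fr)))).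
  have P0 : 0 < 384 * (1 + 2 * fr) by lra.
  have e2 : 0 < e / 2 by lra.
  have d0 : 0 < d.
    by rewrite lt_min; apply/andP; split; [lra|exact: (mulr_gt0 e2 (divr_gt0 f00 P0))].
  have [d1 d2] : d <= r / 2 /\ d <= e / 2 * (f 0 / (384 * (1 + 2 * fr))) by rewrite !ge_min !lexx orbT.
  apply/NDP; exists d => // m Dm; rewrite !subr0 => md.
  have mr2 : m <= r / 2 by move: md; rewrite ltr_norml; clear - d1; lra.
  have fm : f m <= fr by apply: f_nd; clear - Dm mr2 Dm0; lra.
  have l0 := lam_ge0 Dm; have kb := k_le Dm; have lb := lam_le Dm.
  have lfr : lam m * (1 + 2 * fr) <= e / 2.
    rewrite -(ler_pM2r f00).
    have -> : lam m * (1 + 2 * fr) * f 0 = lam m * f 0 * (1 + 2 * fr) by ring.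
    have p1 : 0 <= 1 + 2 * fr by lra_from P0.
    apply: le_trans (ler_wpM2r p1 lb) _.
    have : m <= e / 2 * (f 0 / (384 * (1 + 2 * fr))).
      by apply: le_trans d2; apply: ltW; move: md; rewrite ltr_norml; lra_from.
    rewrite mulrA (ler_pdivlMr _ _ P0); lra_from.
  have lfm : lam m * f m <= lam m * fr by apply: ler_wpM2l.
  have lfr0 : 0 <= lam m * fr by rewrite mulr_ge0// ltW.
  by rewrite ger0_norm//; split; clear - lfr0 lfr e0 lfm kb l0; lra.
have m0r : 0 < m0 < r by rewrite lt_neqAle eq_sym m00.
pose q m : R * R := (lam m, k m).
pose M := (m0 + r) / 2; have Mr : 0 <= M < r by rewrite /M; lra.
have Mm0 : 0 < M - m0 by rewrite /M; lra.
pose A := 384 * M / f 0; pose B := 2 * (A * f M).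
have A0 : 0 <= A by apply: divr_ge0; lra_from Mr f00.
have fM0 : 0 < f M by apply: nl_f_gt0.
have AM0 : 0 <= A * f M by apply: mulr_ge0 => //; exact: ltW.
have B0 : 0 <= B by rewrite /B; lra_from AM0.
have bound m : D m -> m <= M -> 0 <= lam m <= A /\ `|k m| <= B.
  move=> Dm mM; have l0 := lam_ge0 Dm; have lb := lam_le Dm; have kb := k_le Dm.
  have lA : lam m <= A by rewrite /A ler_pdivlMr//; clear - lb mM; lra.
  split; first (clear - lA l0; lra); apply: le_trans kb _; rewrite /B; apply: ler_wpM2l => //.
  by apply: ler_pM => //; [apply/ltW/nl_f_gt0|apply: f_nd; clear - Dm mM Mr; lra].
pose V : set (R * R) := `[-1, A + 1]%classic `*` `[- B - 1, B + 1]%classic.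
have Dnear m : `|m - m0| < Num.min m0 (M - m0) -> D m /\ m <= M.
  by rewrite lt_min !ltr_norml; clear - Mr; lra.
have mn0 : 0 < Num.min m0 (M - m0) by rewrite lt_min Mm0 andbT; clear - m00 Dm0; lra.
(* The values at [m0] lie inside the rectangle [V], whose margin of [1] around the bounds makes it a
   neighbourhood of [q m0]. *)
have : q @ m0 --> q m0.
  apply: (@compact_cluster_set1 _ _ _ V).
  - exact: norm_hausdorff.
  - by apply: compact_setX; exact: segment_compact.
  - have [b1 b2] := bound m0 Dm0 ltac:((clear - Mm0; lra)).
    apply/nbhs_ballP; exists 1 => //= -[a b] [/=]; rewrite /ball/= !ltr_norml => ha hb.
    by move: b2; rewrite ler_norml => b2; split; rewrite /= in_itv/=; clear - ha b1 b2 hb; lra.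
  - exact: (@fmap_proper_filter _ _ q (nbhs m0) _).
  - apply/nbhs_ballP; exists (Num.min m0 (M - m0)) => // m; rewrite /ball/= distrC => /Dnear[Dm mM].
    have [b1 b2] := bound m Dm mM; move: b2; rewrite ler_norml => b2.
    by split; rewrite /= in_itv/=; clear - b1 b2; lra.
  - apply/seteqP; split=> [[l kap] hcl|_ ->]; last first.
      move=> A' B' hA hB; exists (q m0).
      by split; [exact: nbhs_singleton hA|exact: nbhs_singleton hB].
    have [|-> ->//] := @cluster_profile m0 l kap m0r.
    move=> d d0.
    have dd : 0 < Num.min d (Num.min m0 (M - m0)) by rewrite lt_min d0.
    have [] := hcl [set p | exists m, [/\ D m, `|m - m0| < d & p = q m]]
      (ball l d `*` ball kap d).
    - apply/nbhs_ballP; exists (Num.min d (Num.min m0 (M - m0))) => // m.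
      rewrite /ball/= distrC lt_min => /andP[md /Dnear[Dm _]].
      by exists m.
    - by apply/nbhs_ballP; exists d.
    - move=> p [[m [Dm md ->]]] [/= h1 h2]; exists m; split=> //.
        by rewrite distrC.
      by rewrite distrC.
move=> hq; have hE : nbhs (q m0) (ball (lam m0) e `*` ball (k m0) e).
  by apply/nbhs_ballP; exists e.
have /nbhs_ballP[d /= d0 hd] := hq _ hE.
apply/NDP; exists d => // m _ md.
have [|h1 h2] := hd m; first by rewrite /ball/= distrC.
by rewrite (distrC (lam m)) (distrC (k m)).
Qed.

Lemma pf_stable m0 : D m0 -> exists2 C, 0 < C & \forall m \near ND r m0, forall t, half t ->
    `|v m t - v m0 t| <= C * (`|m - m0| + `|k m - k m0| + `|lam m - lam m0|) /\
    `|h m t - h m0 t| <= C * (`|m - m0| + `|k m - k m0| + `|lam m - lam m0|).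
Proof.
move=> Dm0; pose M := (m0 + r) / 2; have Mr : 0 <= M < r by rewrite /M; lra.
have Mm0 : 0 < M - m0 by rewrite /M; lra.
have [C C0 hC] := source_stable_half Mr (lam_ge0 Dm0).
exists (C + 1); first lra.
apply/NDP; exists (M - m0) => // m Dm mm t tI.
have mM : 0 <= m <= M by move: mm; rewrite ltr_norml; lra.
have m0M : 0 <= m0 <= M by lra_from Dm0 Mm0.
have lL : 0 <= lam m0 <= lam m0 by rewrite lam_ge0 ?lexx.
have := hC m0 m _ (lam m) (k m0) (k m) (v m0) (v m) m0M mM lL (pf_ct pf Dm0)
  (pf_ct pf Dm) (pf_eq pf Dm0) (pf_eq pf Dm) t tI.
rewrite !(distrC _ (v m t)) !(distrC _ m) !(distrC _ (k m)) !(distrC _ (lam m)).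
rewrite -/(h m0) -/(h m) !(distrC _ (h m t)).
set q := _ + _ + _; move=> [h1 h2].
have q0 : 0 <= q by rewrite /q !addr_ge0.
by rewrite mulrDl mul1r; split; [move: h1|move: h2]; move: q0; clear; lra.
Qed.

Lemma v_C0 : C0 r v.
Proof.
split=> [m Dm|m0 Dm0 e e0]; first exact: (pf_ct pf).
have [C C_0 hC] := pf_stable Dm0.
have e3 : 0 < e / (3 * C) by rewrite divr_gt0//; lra.
apply: filterS2 (filterI hC (pf_continuous Dm0 e3)) (ND_close r m0 e3).
move=> m [h1 [h2 h3]] h4 t tI; have [+ _] := h1 t tI.
move=> /le_trans; apply.
have : C * (`|m - m0| + `|k m - k m0| + `|lam m - lam m0|) <= C * (3 * (e / (3 * C))).
  by apply: ler_wpM2l; [exact: ltW|move: h2 h3 h4; clear; lra].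
by have -> : C * (3 * (e / (3 * C))) = e by field; rewrite gt_eqF.
Qed.

Lemma scalar_C0 (a : R -> R) : (forall m0 e, D m0 -> 0 < e ->
  \forall m \near ND r m0, `|a m - a m0| < e) -> C0 r (fun m _ => a m).
Proof.
move=> ha; split=> [m Dm|m0 Dm0 e e0]; first exact: ct_cst.
by apply: filterS (ha _ _ Dm0 e0) => m /ltW am t _.
Qed.

Lemma lam_C0 : C0 r (fun m _ => lam m).
Proof.
by apply: scalar_C0 => m0 e Dm0 e0; apply: filterS (pf_continuous Dm0 e0) => m [].
Qed.

Lemma k_C0 : C0 r (fun m _ => k m).
Proof.
by apply: scalar_C0 => m0 e Dm0 e0; apply: filterS (pf_continuous Dm0 e0) => m [].
Qed.

End family.

(** * Derivatives of the family *)

Section linearization.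
Context {R : realType} (F : nonlinearity R).
Local Notation r := (nl_r F).
Local Notation f := (nl_f F).
Local Notation f1 := (nl_f1 F).
Local Notation f2 := (nl_f2 F).
Implicit Types (m t : R) (g y : R -> R -> R).
Local Notation half t := (`|t| <= 1 / 2).
Local Notation D m := (0 <= m < r).

Variables (lam k : R -> R) (v : R -> R -> R).
Hypothesis pf : profile_family F lam k v.

Definition profile_f m t := f (clip m (v m t)).
Definition potential m t := lam m * f1 (clip m (v m t)).
Local Notation phi := profile_f.
Local Notation pot := potential.

Lemma phi_C0 : C0 r phi.
Proof. exact: (C0_comp (pf_itv pf) (@nl_cf _ F) (v_C0 pf)). Qed.

Lemma pot_C0 : C0 r pot.
Proof.
apply: C0M; first exact: lam_C0 pf.
exact: (C0_comp (pf_itv pf) (@nl_cf1 _ F) (v_C0 pf)).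
Qed.

Lemma pot_bound m : D m -> exists P, forall t, `|pot m t| <= P.
Proof.
move=> Dm; have m0 : 0 <= m by lra.
have mr : m < r by lra.
have [K K0 hK] := EVT_bound m0 (sub_r (lexx 0) mr (@nl_cf1 _ F)).
exists (`|lam m| * K) => t; rewrite /pot normrM; apply: ler_wpM2l => //.
exact/hK/clip_itv.
Qed.

Lemma pot_ge0 m t : D m -> 0 <= pot m t.
Proof.
move=> Dm; rewrite /pot mulr_ge0 ?(lam_ge0 pf)//; apply: f1_ge0.
exact: clip_lt.
Qed.

Definition lin_solution g y := fct r y /\ forall m, D m -> forall t,
  y m t = g m t + primn 4 (fun s => pot m s * y m s) t.

Lemma lin_solution_exists g : fct r g -> exists y, lin_solution g y.
Proof.
move=> cg; have ex m : exists z, D m -> continuous z /\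
    forall t, z t = g m t + primn 4 (fun s => pot m s * z s) t.
  have [Dm|nDm] := pselect (D m); last by exists (fun=> 0).
  have [P hP] := pot_bound Dm; have P0 : 0 <= P := le_trans (normr_ge0 _) (hP 0).
  have [|||z cz ez] := @volterra_exists _ (fun s a => pot m s * a) (g m) P P0.
  - by move=> t a b; rewrite -mulrBr normrM; exact: ler_wpM2r.
  - by move=> z cz; apply: ctM => //; exact: pot_C0.1.
  - exact: cg.
  - by exists z.
have [y hy] := choice ex; exists y; split.
  by move=> m Dm; have [] := hy m Dm.
by move=> m Dm; have [] := hy m Dm.
Qed.

Lemma ct_pot_mul y m : fct r y -> D m -> continuous (fun s => pot m s * y m s).
Proof. by move=> cy Dm; apply: ctM; [exact: pot_C0.1|exact: cy]. Qed.

(* The derivatives of [v] with respect to its height, to [k] and to [lam]. *)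
Variables (A B C : R -> R -> R).
Hypothesis hA : lin_solution (fun _ _ => 1) A.
Hypothesis hB : lin_solution (fun _ t => - (t ^+ 2 / 2)) B.
Hypothesis hC : lin_solution (fun m => primn 4 (phi m)) C.

(** The slopes of [A], [B], [C] at [1 / 2]. With their values there they are the coefficients of the
    system that the end conditions impose on the derivatives of [k] and [lam]; [wronskian] is its
    determinant. *)
Definition end_slopeA m := primn 3 (fun s => pot m s * A m s) (1 / 2).
Definition end_slopeB m := - (1 / 2) + primn 3 (fun s => pot m s * B m s) (1 / 2).
Definition end_slopeC m := primn 3 (fun s => pot m s * C m s + phi m s) (1 / 2).
Local Notation A1 := end_slopeA.
Local Notation B1 := end_slopeB.
Local Notation C1h := end_slopeC.
Definition wronskian m := B m (1 / 2) * C1h m - B1 m * C m (1 / 2).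

Lemma ct_phi m : D m -> continuous (phi m). Proof. exact: phi_C0.1. Qed.

Lemma B_vjet m t : D m -> B m t = vjet 0 1 (fun s => pot m s * B m s) 0%N t.
Proof. by move=> Dm; rewrite (hB.2 m Dm) /vjet; ring. Qed.

Lemma B1_vjet m : B1 m = vjet 0 1 (fun s => pot m s * B m s) 1%N (1 / 2).
Proof. by rewrite /vjet mul1r. Qed.

Lemma C_vjet m t : D m -> C m t = vjet 0 0 (fun s => pot m s * C m s + phi m s) 0%N t.
Proof.
move=> Dm; rewrite (hC.2 m Dm) /vjet.
have /funeqP/(_ t) -> := primnD 4 (ct_pot_mul hC.1 Dm) (ct_phi Dm).
by ring.
Qed.

Lemma ct_Csource m : D m -> continuous (fun s => pot m s * C m s + phi m s).
Proof. by move=> Dm; apply: ctD; [exact: ct_pot_mul hC.1 Dm|exact: ct_phi]. Qed.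

Lemma B_half_lt0 m : D m -> B m (1 / 2) < 0.
Proof.
move=> Dm; have cb := ct_pot_mul hB.1 Dm.
pose y := vjet 0 1 (fun s => pot m s * B m s).
have jy : jet (1 / 2) y by exact: jet_vjet.
have jN := jet_lin (-1) 0 jy jy.
have [P hP] := pot_bound Dm; have P0 : 0 <= P := le_trans (normr_ge0 _) (hP 0).
have yE t : y 0%N t = B m t by rewrite B_vjet.
have y4 t : y 4%N t = pot m t * B m t by [].
have [i0 i1 i2 i3] := vjet_at0 0 1 cb; rewrite -/y in i0 i1 i2 i3.
have h12 : 0 <= (1 / 2 : R) <= (1 / 2 : R) by rewrite lexx divr_ge0.
have ge t : 0 <= t <= 1 / 2 -> 0 <= -1 * y 0%N t + 0 * y 0%N t.
  apply: (jet_ge0 jN (L := P)) => //.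
    move=> x xI; rewrite !mul0r !addr0 !mulN1r y4 yE opprK.
    have p0 := pot_ge0 x Dm; have := hP x; rewrite (ger0_norm p0) => pP.
    rewrite lerN2; have [b0|b0] := leP 0 (B m x).
      by apply: ler_wpM2r.
    by rewrite mulr0 mulr_ge0_le0// ltW.
  by move=> [|[|[|[|//]]]] _; rewrite ?i0 ?i1 ?i2 ?i3; lra.
have ge4 t : 0 < t < 1 / 2 -> 0 <= -1 * y 4%N t + 0 * y 4%N t.
  move=> tI; have tI' : 0 <= t <= 1 / 2 by lra.
  have := ge t tI'; rewrite yE y4 !mul0r !addr0 !mulN1r => b0.
  by rewrite -mulrN mulr_ge0// pot_ge0.
have [_ _ _] := jet_taylor jN ge4 h12; rewrite i0 i1 i2 i3 yE !expr2; lra.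
Qed.

Lemma primn_cst4 n (c : R) : primn n (fun=> c) = fun t => c / n`!%:R * t ^+ n.
Proof.
elim: n => [|n ih]; first by apply/funext => t; rewrite /primn/= divr1 mulr1.
rewrite primnS ih prim_pow; apply/funext => t; rewrite factS natrM.
by congr (_ * _); rewrite -mulrA -invfM [X in _ / X = _]mulrC.
Qed.

(** The scaling argument is void here since [lam 0 = 0], but the potential vanishes too: [B] is
    [- t ^+ 2 / 2], [C] is [f 0 * t ^+ 4 / 24], and the determinant is explicit. *)
Lemma wronskian_neq0_at0 : wronskian 0 != 0.
Proof.
have D0 : D (0 : R) by rewrite lexx nl_r_gt0.
have f0 := f0_gt0 F.
have p0 t : pot 0 t = 0 by rewrite /pot (pf_lam0 pf) mul0r.
have z0 n (y : R -> R) t : continuous y -> primn n (fun s => pot 0 s * y s) t = 0.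
  move=> cy; have -> : (fun s => pot 0 s * y s) = (fun s => 0 * y s).
    by apply/funext => s; rewrite p0.
  by have /funeqP/(_ t) -> := primnZ n 0 cy; rewrite mul0r.
have c0 (x : R) : clip 0 x = 0 by have := @clip_itv _ 0 x (lexx _); lra.
have phi0 : phi 0 = fun=> f 0 by apply/funext => t; rewrite /phi c0.
have -> : wronskian 0 = - (f 0 / 768).
  rewrite /wronskian /B1 /C1h (z0 3%N _ _ (hB.1 0 D0)) (hB.2 0 D0) (hC.2 0 D0).
  rewrite (z0 4%N _ _ (hB.1 0 D0)) (z0 4%N _ _ (hC.1 0 D0)).
  have /funeqP/(_ (1 / 2)) -> := primnD 3 (ct_pot_mul hC.1 D0) (ct_phi D0).
  rewrite (z0 3%N _ _ (hC.1 0 D0)) phi0 !primn_cst4.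
  have -> : (4`! = 24)%N by [].
  have -> : (3`! = 6)%N by [].
  by field.
have f768 : 0 < f 0 / 768 by have := f0_gt0 F; lra.
by rewrite oppr_eq0 gt_eqF.
Qed.

Lemma der_h m t : 0 < m < r -> 0 < t < 1 / 2 ->
  der (profile_source F lam v m) t (pot m t * vjet m (k m) (profile_source F lam v m) 1%N t).
Proof.
move=> mr tI; have Dm : D m by lra.
have hp := pf_half pf mr; set y := vjet m (k m) (profile_source F lam v m) in hp *.
have [dy cy] := hp_jet hp.
have yv s : y 0%N s = v m s by rewrite (pf_eq pf Dm).
have cl : clip m (v m t) = y 0%N t.
  rewrite clip_id ?yv//; apply: (pf_itv pf) => //.
  by rewrite ler_norml; lra.
have tI' : 0 <= t <= 1 / 2 by lra.
have tI'' : 0 <= t < 1 / 2 by lra.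
have yI := hp_range hp tI'; have yp := half_y0_gt0 hp tI''.
apply: (@der_near _ (fun s => lam m * f (y 0%N s)) _ _ _ 0 (1 / 2)) => //.
  by move=> s sI; rewrite -(hp_ode hp).
rewrite /pot cl -mulrA; apply: derZ; apply: der_comp; last exact: dy.
by apply: nl_df; lra.
Qed.

(* [t v'] solves the equation linearized at [v] with right-hand side
   [4 lam f(v)]: this comes from differentiating the rescalings of [v]. *)
Lemma scaling_solution m : 0 < m < r ->
  2 * k m * B m (1 / 2) + 4 * lam m * C m (1 / 2) = 0 /\
  2 * k m * B1 m + 4 * lam m * C1h m = vjet m (k m) (profile_source F lam v m) 2%N (1 / 2) / 2.
Proof.
move=> mr; have Dm : D m by lra.
have hp := pf_half pf mr; set y := vjet m (k m) (profile_source F lam v m) in hp *.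
have [dy cy] := hp_jet hp; have [y00 y10 y30] := hp_init hp; have [e0 e1] := hp_end hp.
have ch := ct_h pf Dm.
have y4E : y 4%N = profile_source F lam v m by [].
have yv t : y 0%N t = v m t by rewrite (pf_eq pf Dm).
have cl t : 0 < t < 1 / 2 -> clip m (v m t) = y 0%N t.
  move=> tI; rewrite clip_id ?yv//; apply: (pf_itv pf) => //.
  by rewrite ler_norml; lra.
pose xi (j : nat) t := match j with
  | 0 => t * y 1%N t | 1 => y 1%N t + t * y 2%N t | 2 => 2 * y 2%N t + t * y 3%N t
  | 3 => 3 * y 3%N t + t * y 4%N t
  | _ => 4 * y 4%N t + t * (pot m t * y 1%N t) end.
have dh t : 0 < t < 1 / 2 -> der (y 4%N) t (pot m t * y 1%N t) by exact: der_h.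
have jxi : jet (1 / 2) xi.
  split=> [[|[|[|[|//]]]] _ t tI|[|[|[|[|//]]]] _]; rewrite /xi.
  - by apply: der_eq; [apply: derM; [exact: der_id|exact: dy]|rewrite /=; ring].
  - apply: der_eq; [apply: derD; [exact: dy|apply: derM; [exact: der_id|exact: dy]]|].
    by rewrite /=; ring.
  - apply: der_eq; first by apply: derD; [apply: derZ; exact: dy|apply: derM; [exact: der_id|exact: dy]].
    by rewrite /=; ring.
  - apply: der_eq; first by apply: derD; [apply: derZ; exact: dy|apply: derM; [exact: der_id|exact: dh]].
    by rewrite /=; ring.
  - by apply: wctM; [exact: cont_within (@ct_id _)|exact: cy].
  - by apply: wctD; [exact: cy|apply: wctM; [exact: cont_within (@ct_id _)|exact: cy]].
  - by apply: wctD; apply: wctM; [exact: wct_cst|exact: cy|exact: cont_within (@ct_id _)|exact: cy].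
  - apply: wctD; apply: wctM; [exact: wct_cst|exact: cy|exact: cont_within (@ct_id _)|].
    by rewrite y4E; exact: cont_within.
have cb := ct_pot_mul hB.1 Dm; have cc := ct_Csource Dm.
pose yB := vjet 0 1 (fun s => pot m s * B m s).
pose yC := vjet 0 0 (fun s => pot m s * C m s + phi m s).
have jB : jet (1 / 2) yB by exact: jet_vjet.
have jC : jet (1 / 2) yC by exact: jet_vjet.
(* The coefficients match [t v']: its second derivative at [0] is [- 2 * k m] while that of [B] is
   [-1], and its equation has the extra source [4 * lam * f v] while that of [C] has [f v]. So [Z]
   solves the homogeneous equation with zero data. *)
pose Z j t := 1 * xi j t + -1 * (2 * k m * yB j t + 4 * lam m * yC j t).
have jZ : jet (1 / 2) Z by exact: jet_lin jxi (jet_lin (2 * k m) (4 * lam m) jB jC).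
have yBE t : yB 0%N t = B m t by rewrite B_vjet.
have yCE t : yC 0%N t = C m t by rewrite C_vjet.
have Z4 t : 0 < t < 1 / 2 -> Z 4%N t = pot m t * Z 0%N t.
  move=> tI; rewrite /Z yBE yCE /xi (hp_ode hp)// -(cl t tI) -/(phi m t).
  rewrite {1}/yB {1}/yC /vjet -/(phi m t).
  by move: (pot m t) (B m t) (C m t) (phi m t) (y 1%N t) => a b c d e; ring.
have [b0 b1 b2 b3] := vjet_at0 0 1 cb; rewrite -/yB in b0 b1 b2 b3.
have [c0 c1 c2 c3] := vjet_at0 0 0 cc; rewrite -/yC in c0 c1 c2 c3.
have y2E : y 2%N 0 = - k m by have [_ _ E _] := vjet_at0 m (k m) ch; exact: E.
have [P hP] := pot_bound Dm; have P0 : 0 <= P := le_trans (normr_ge0 _) (hP 0).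
have Z0 t : 0 <= t <= 1 / 2 -> Z 0%N t = 0.
  apply: (jet_eq0 jZ P0).
  - move=> x xI; rewrite Z4//; have p0 := pot_ge0 x Dm; have := hP x.
    rewrite (ger0_norm p0) lerNl -mulrN => pP; have [z0|z0] := leP 0 (- Z 0%N x).
      by apply: ler_wpM2r.
    by rewrite mulr0 mulr_ge0_le0// ltW.
  - move=> x xI; rewrite Z4//; have p0 := pot_ge0 x Dm; have := hP x.
    rewrite (ger0_norm p0) => pP; have [z0|z0] := leP 0 (Z 0%N x).
      by apply: ler_wpM2r.
    by rewrite mulr0 mulr_ge0_le0// ltW.
  - move=> [|[|[|[|//]]]] _; rewrite /Z /xi ?y10 ?y2E ?y30 ?b0 ?b1 ?b2 ?b3 ?c0 ?c1 ?c2 ?c3.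
    + by ring.
    + by ring.
    + by ring.
    + by ring.
have Z1 : Z 1%N (1 / 2) = 0.
  have h12 : 0 < 1 / 2 :> R by lra.
  have [dZ cZ] := jZ.
  have Zin t : 0 < t < 1 / 2 -> Z 0%N t = 0 by move=> tI; apply: Z0; lra.
  have [c cI] := MVT_in h12 (dZ 1%N isT) (cZ 1%N isT).
  rewrite (jet_zero jZ Zin (j := 2) isT cI) mul0r => /eqP; rewrite subr_eq0 => /eqP ->.
  by rewrite /Z /xi y10 b1 c1; ring.
have h12 : 0 <= (1 / 2 : R) <= (1 / 2 : R) by rewrite lexx divr_ge0.
have := Z0 _ h12; move: Z1; rewrite /Z /xi yBE yCE e1 B1_vjet -/yB.
have -> : C1h m = yC 1%N (1 / 2) by rewrite /C1h /yC /vjet mul0r oppr0 add0r.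
move: (yB 1%N (1 / 2)) (yC 1%N (1 / 2)) (B m (1 / 2)) (C m (1 / 2)) (y 2%N (1 / 2)).
by move=> a b c d e; split; lra.
Qed.

Lemma half_y2_end_gt0 m l (y : nat -> R -> R) : half_profile F m l y -> 0 < y 2%N (1 / 2).
Proof.
move=> hp; have [dy cy] := hp_jet hp; have [_ y10 _] := hp_init hp; have [_ y11] := hp_end hp.
have h12 : 0 < 1 / 2 :> R by lra.
have [c cI] := MVT_in h12 (dy 1%N isT) (cy 1%N isT); rewrite y10 y11 => E.
have yc : y 2%N c = 0 by lra.
by rewrite -yc; apply: half_y2_incr hp _ _ _ _ _; lra.
Qed.

(** At [1 / 2] the function [t v'] has value zero and slope [v'' / 2]. Eliminating between the two
    relations of [scaling_solution] gives [4 * lam * wronskian = B (1 / 2) * v'' (1 / 2) / 2], with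
    negative [B] and positive [v'']. *)
Lemma wronskian_neq0 m : D m -> wronskian m != 0.
Proof.
move=> Dm; have [->|m0] := eqVneq m 0; first exact: wronskian_neq0_at0.
have mr : 0 < m < r by rewrite lt_neqAle eq_sym m0.
have [s1 s2] := scaling_solution mr.
have y2 := half_y2_end_gt0 (pf_half pf mr); have b := B_half_lt0 Dm.
have l0 := pf_lam pf mr.
set z := vjet _ _ _ _ _ in s2 y2.
have E : 4 * lam m * wronskian m = B m (1 / 2) * (z / 2).
  rewrite /wronskian -s2.
  have -> : 4 * lam m * (B m (1 / 2) * C1h m - B1 m * C m (1 / 2)) =
    B m (1 / 2) * (4 * lam m * C1h m) - B1 m * (4 * lam m * C m (1 / 2)) by ring.
  have -> : 4 * lam m * C m (1 / 2) = - (2 * k m * B m (1 / 2)) by lra.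
  by ring.
apply/eqP => w0; move: E; rewrite w0 mulr0 => /esym/eqP.
by rewrite mulf_eq0 (lt_eqF b) /= gt_eqF// divr_gt0.
Qed.

End linearization.

(** * First derivatives in the height *)

Section first_derivative.
Context {R : realType} (F : nonlinearity R).
Local Notation r := (nl_r F).
Local Notation f := (nl_f F).
Local Notation f1 := (nl_f1 F).
Local Notation f2 := (nl_f2 F).
Implicit Types (m t : R).
Local Notation half t := (`|t| <= 1 / 2).
Local Notation D m := (0 <= m < r).

Lemma primn_lin3 n (g x y z : R -> R) (a b c t : R) :
  continuous g -> continuous x -> continuous y -> continuous z ->
  primn n (fun s => g s - (a * x s + (b * y s + c * z s))) t =
  primn n g t - (a * primn n x t + (b * primn n y t + c * primn n z t)).
Proof.
move=> cg cx cy cz.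
have cs (d : R) (w : R -> R) : continuous w -> continuous (fun s => d * w s).
  by move=> cw; apply: ctM => //; exact: ct_cst.
have c1 := cs a x cx; have c2 := cs b y cy; have c3 := cs c z cz.
have c23 := ctD c2 c3; have c123 := ctD c1 c23.
have /funeqP/(_ t) -> := primnB n cg c123.
have /funeqP/(_ t) -> := primnD n c1 c23.
have /funeqP/(_ t) -> := primnD n c2 c3.
have /funeqP/(_ t) -> := primnZ n a cx.
have /funeqP/(_ t) -> := primnZ n b cy.
by have /funeqP/(_ t) -> := primnZ n c cz.
Qed.

Variables (lam k : R -> R) (v : R -> R -> R).
Hypothesis pf : profile_family F lam k v.
Variables (A B C : R -> R -> R).
Hypothesis hA : lin_solution F lam v (fun _ _ => 1) A.
Hypothesis hB : lin_solution F lam v (fun _ t => - (t ^+ 2 / 2)) B.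
Hypothesis hC : lin_solution F lam v (fun m => primn 4 (profile_f F v m)) C.

Local Notation phi := (profile_f F v).
Local Notation pot := (potential F lam v).
Local Notation h := (profile_source F lam v).
Local Notation A1 := (end_slopeA F lam v A).
Local Notation B1 := (end_slopeB F lam v B).
Local Notation C1h := (end_slopeC F lam v C).
Local Notation W := (wronskian F lam v B C).

(** Nothing is known yet about the size of the increments of [k] and [lam] compared with [m - m0].
    The expansion is therefore made in all three, with an error small relative to their sum [N]. *)
Lemma remainder m0 e : D m0 -> 0 < e -> \forall m \near ND r m0,
  let N := `|m - m0| + `|k m - k m0| + `|lam m - lam m0| in
  (forall t, half t -> `|v m t - v m0 t - ((m - m0) * A m0 t +
     ((k m - k m0) * B m0 t + (lam m - lam m0) * C m0 t))| <= e * N) /\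
  `|(m - m0) * A1 m0 + ((k m - k m0) * B1 m0 + (lam m - lam m0) * C1h m0)| <= e * N.
Proof.
move=> Dm0 e0.
have [P hP] := pot_bound lam v Dm0; have P0 : 0 <= P := le_trans (normr_ge0 _) (hP 0).
have [K K0 hK] := pf_stable pf Dm0.
pose E := expR (wrate P * (1 / 2)); have E0 : 0 < E by exact: expR_gt0.
have l0 := lam_ge0 pf Dm0.
have lK0 : 0 <= lam m0 * K by rewrite mulr_ge0// ltW.
pose q := (lam m0 * K + 1) * (2 * E * (P + 1) + 1).
have EP : 0 <= E * P by rewrite mulr_ge0// ltW.
have q0 : 0 < q by rewrite mulr_gt0//; lra_from lK0 E0 EP.
pose ep := e / q; have ep0 : 0 < ep by rewrite divr_gt0.
pose M := (m0 + r) / 2; have M0 : 0 <= M by rewrite /M; lra_from Dm0.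
have Mr : M < r by rewrite /M; lra_from Dm0.
have Mm : 0 < M - m0 by rewrite /M; lra_from Dm0.
have dfM x : 0 < x < M -> der f x (f1 x) by move=> xM; apply: nl_df; lra_from Mr xM.
have [d d0 hd] := taylor_uniform M0 (sub_r (lexx 0) Mr (@nl_cf _ F))
  (sub_r (lexx 0) Mr (@nl_cf1 _ F)) dfM ep0.
have d2 : 0 < d / 2 by rewrite divr_gt0.
apply: filterS2 (filterI (filterI (ND_in r m0) (ND_close r m0 Mm)) hK)
  (filterI ((v_C0 pf).2 _ Dm0 _ d2) ((phi_C0 pf).2 _ Dm0 _ ep0)) => m [[Dm mM] g1] [g2 g3].
set dm := m - m0; set dk := k m - k m0; set dl := lam m - lam m0.
set N := `|dm| + _ + _ => /=.
have N0 : 0 <= N by rewrite !addr_ge0.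
have dlN : `|dl| <= N by rewrite /N lerDr addr_ge0.
have cA : continuous (fun s => pot m0 s * A m0 s) := ct_pot_mul pf hA.1 Dm0.
have cB : continuous (fun s => pot m0 s * B m0 s) := ct_pot_mul pf hB.1 Dm0.
have cC : continuous (fun s => pot m0 s * C m0 s + phi m0 s) := ct_Csource pf hC Dm0.
have chm := ct_h pf Dm; have chm0 := ct_h pf Dm0.
have chh : continuous (fun s => h m s - h m0 s) by apply: ctD => //; exact: ctN.
pose H s := h m s - h m0 s - (dm * (pot m0 s * A m0 s) +
  (dk * (pot m0 s * B m0 s) + dl * (pot m0 s * C m0 s + phi m0 s))).
pose Z t := v m t - v m0 t - (dm * A m0 t + (dk * B m0 t + dl * C m0 t)).
have ZE t : Z t = 0 + primn 4 H t.
  rewrite /Z /H (primn_lin3 4 dm dk dl t chh cA cB cC).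
  have /funeqP/(_ t) -> := primnB 4 chm chm0.
  have /funeqP/(_ t) -> := primnD 4 (ct_pot_mul pf hC.1 Dm0) (ct_phi pf Dm0).
  rewrite (pf_eq pf Dm) (pf_eq pf Dm0) {1}(hA.2 m0 Dm0) {1}(hB.2 m0 Dm0) {1}(hC.2 m0 Dm0).
  rewrite /vjet /dm /dk; set x1 := primn 4 _ t; set x2 := primn 4 _ t; set x3 := primn 4 _ t.
  set x4 := primn 4 _ t; set x5 := primn 4 _ t; set x6 := primn 4 _ t.
  move: x1 x2 x3 x4 x5 x6 => *; ring.
have cs (c : R) (w : R -> R) : continuous w -> continuous (fun s => c * w s).
  by move=> cw; apply: ctM => //; exact: ct_cst.
have cH : continuous H.
  by apply: ctD => //; apply: ctN; apply: ctD; [exact: cs|apply: ctD; exact: cs].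
have cZ : continuous Z.
  apply: ctD; first by apply: ctD; [|apply: ctN]; exact: (pf_ct pf).
  by apply: ctN; apply: ctD; [apply: cs; exact: hA.1|apply: ctD; apply: cs; [exact: hB.1|exact: hC.1]].
pose rho := ep * (lam m0 * K + 1) * N.
have lK1 : 0 <= lam m0 * K + 1 by move: lK0; clear - dlN; lra.
have rho0 : 0 <= rho by apply: mulr_ge0 => //; apply: mulr_ge0 => //; exact: ltW.
have HZ s : half s -> `|H s| <= P * `|Z s| + rho.
  move=> sI.
  have i1 := pf_itv pf Dm sI; have i2 := pf_itv pf Dm0 sI.
  have iM1 : 0 <= v m0 s <= M by rewrite /M; clear - pf hA hB hC i2 Dm0; lra.
  have iM2 : 0 <= v m s <= M by move: mM; rewrite ltr_norml; clear - pf hA hB hC i1; lra.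
  have vd : `|v m s - v m0 s| < d by apply: le_lt_trans (g2 s sI) _; lra_from d2.
  have T := hd _ _ iM1 iM2 vd.
  have [S _] := g1 s sI; have Ph := g3 s sI.
  have phE n : D n -> phi n s = f (v n s).
    by move=> Dn; rewrite /phi clip_id//; exact: (pf_itv pf).
  have potE : pot m0 s = lam m0 * f1 (v m0 s) by rewrite /pot clip_id.
  have -> : H s = pot m0 s * Z s + (lam m0 * (f (v m s) - f (v m0 s) - f1 (v m0 s) * (v m s - v m0 s))
      + dl * (phi m s - phi m0 s)).
    rewrite /H /Z potE -!phE// /profile_source /source -/(phi m s) -/(phi m0 s) /dl.
    move: (A m0 s) (B m0 s) (C m0 s) (phi m s) (phi m0 s) (v m s) (v m0 s) (f1 _).
    by move=> a b c p p0 x x0 fx; ring.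
  apply: le_trans (ler_normD _ _) _; rewrite normrM; apply: lerD.
    by apply: ler_wpM2r => //; exact: hP.
  apply: le_trans (ler_normD _ _) _; rewrite !normrM (ger0_norm l0).
  have t1 : lam m0 * `|f (v m s) - f (v m0 s) - f1 (v m0 s) * (v m s - v m0 s)| <=
    lam m0 * (ep * (K * N)).
    apply: ler_wpM2l => //; apply: le_trans T _; apply: ler_wpM2l; first exact: ltW.
    exact: S.
  have t2 : `|dl| * `|phi m s - phi m0 s| <= N * ep by apply: ler_pM.
  have -> : rho = lam m0 * (ep * (K * N)) + N * ep by rewrite /rho; ring.
  exact: lerD.
have h0 : 0 <= 1 / 2 :> R by clear - rho0; lra.
have Zb t : half t -> `|Z t| <= 2 * rho * E.
  move=> tI; have := @volterra_gronwall _ Z (fun=> 0) H (1 / 2) P 0 rho h0 P0 (lexx _) rho0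
    cZ cH (fun t _ => ZE t) _ HZ t tI.
  rewrite add0r => hZ; apply: le_trans (hZ _) _; first by move=> s _; rewrite normr0.
  apply: ler_wpM2l; first by rewrite mulr_ge0.
  by rewrite ler_expR ler_wpM2l// ltW// wrate_gt0.
have eq : e = ep * q by rewrite /ep divfK// gt_eqF.
have rE : 0 <= rho * E by rewrite mulr_ge0// ltW.
have rEP : 0 <= rho * (E * P) by rewrite mulr_ge0.
have eN : e * N = 2 * rho * E + (2 * (rho * (E * P)) + rho) by rewrite eq /q /rho; ring.
split=> [t tI|]; first by apply: le_trans (Zb t tI) _; rewrite eN; clear - rho0 rEP; lra.
have Hb s : half s -> `|H s| <= P * (2 * rho * E) + rho.
  move=> sI; apply: le_trans (HZ s sI) _; rewrite lerD2r.
  by apply: ler_wpM2l => //; exact: Zb.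
have PH0 : 0 <= P * (2 * rho * E) + rho.
  have -> : P * (2 * rho * E) + rho = 2 * (rho * (E * P)) + rho by ring.
  (clear - rho0 rEP; lra).
have h1 : 1 / 2 <= 1 :> R by clear - PH0; lra.
have := primn_bound 3 cH h1 PH0 Hb half_half.
rewrite /H (primn_lin3 3 dm dk dl (1 / 2) chh cA cB cC).
have /funeqP/(_ (1 / 2)) -> := primnB 3 chm chm0.
have v1 := pf_v1 pf Dm; have v10 := pf_v1 pf Dm0.
rewrite /vjet -/(h m) in v1; rewrite /vjet -/(h m0) in v10.
set X := _ - _.
have -> : X = - (dm * A1 m0 + (dk * B1 m0 + dl * C1h m0)).
  rewrite /X /end_slopeA /end_slopeB /end_slopeC /dk.
  move: v1 v10; move: (primn 3 (h m) _) (primn 3 (h m0) _) => a b v1 v10.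
  have -> : a = k m * (1 / 2) by move: v1; clear - pf hA hB hC; lra.
  have -> : b = k m0 * (1 / 2) by move: v10; clear - pf hA hB hC; lra.
  by ring.
rewrite normrN => hX; apply: le_trans hX _; rewrite eN.
have -> : P * (2 * rho * E) + rho = 2 * (rho * (E * P)) + rho by ring.
by move: rE; clear - v10; lra.
Qed.

(** Cramer's rule for the two equations stating that [A + dk * B + dlam * C] has zero value and zero
    slope at [1 / 2]. *)
Definition dlam m := (A m (1 / 2) * B1 m - A1 m * B m (1 / 2)) / W m.
Definition dk m := (A1 m * C m (1 / 2) - A m (1 / 2) * C1h m) / W m.
Definition dv m t := A m t + (dk m * B m t + dlam m * C m t).

Lemma cramer m0 (dm dK dL eN : R) : W m0 != 0 ->
  `|dm * A m0 (1 / 2) + (dK * B m0 (1 / 2) + dL * C m0 (1 / 2))| <= eN ->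
  `|dm * A1 m0 + (dK * B1 m0 + dL * C1h m0)| <= eN ->
  let S := (`|B m0 (1 / 2)| + `|B1 m0| + `|C m0 (1 / 2)| + `|C1h m0|) / `|W m0| in
  `|dK - dm * dk m0| <= S * eN /\ `|dL - dm * dlam m0| <= S * eN.
Proof.
move=> W0 h1 h2 S.
have eN0 : 0 <= eN := le_trans (normr_ge0 _) h1.
have Wp : 0 < `|W m0| by rewrite normr_gt0.
have key (x y z : R) : x * W m0 = y * (dm * A m0 (1 / 2) + (dK * B m0 (1 / 2) + dL * C m0 (1 / 2)))
   - z * (dm * A1 m0 + (dK * B1 m0 + dL * C1h m0)) ->
   `|y| + `|z| <= `|B m0 (1 / 2)| + `|B1 m0| + `|C m0 (1 / 2)| + `|C1h m0| -> `|x| <= S * eN.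
  move=> E yz; rewrite /S mulrAC ler_pdivlMr// -normrM E.
  apply: le_trans (ler_normB _ _) _; rewrite !normrM.
  apply: le_trans (ler_wpM2r eN0 yz); rewrite mulrDl.
  by apply: lerD; apply: ler_wpM2l.
have nn (x : R) : 0 <= `|x| by [].
split.
- apply: (key _ (C1h m0) (C m0 (1 / 2))).
    by rewrite mulrBl /dk -!mulrA mulVf// mulr1 /wronskian; ring.
  by have := nn (B m0 (1 / 2)); have := nn (B1 m0); lra_from.
- apply: (key _ (- B1 m0) (- B m0 (1 / 2))).
    by rewrite mulrBl /dlam -!mulrA mulVf// mulr1 /wronskian; ring.
  rewrite !normrN.
  by have := nn (C m0 (1 / 2)); have := nn (C1h m0); lra_from.
Qed.

(** The end conditions and [cramer] bound the deviations of the increments of [k] and [lam] from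
    linearity by a small multiple of [N]. Absorbing it shows that [N] is of order [|m - m0|], so an
    error small relative to [N] is small relative to [|m - m0|]. *)
Lemma pf_diff m0 e : D m0 -> 0 < e -> \forall m \near ND r m0,
  [/\ `|lam m - lam m0 - (m - m0) * dlam m0| <= e * `|m - m0|,
      `|k m - k m0 - (m - m0) * dk m0| <= e * `|m - m0|
    & forall t, half t -> `|v m t - v m0 t - (m - m0) * dv m0 t| <= e * `|m - m0|].
Proof.
move=> Dm0 e0; have W0 := wronskian_neq0 pf hB hC Dm0.
pose S := (`|B m0 (1 / 2)| + `|B1 m0| + `|C m0 (1 / 2)| + `|C1h m0|) / `|W m0|.
have S0 : 0 <= S by rewrite divr_ge0// !addr_ge0.
have [Kb Kb0 hKb] := fct_bound hB.1 Dm0; have [Kc Kc0 hKc] := fct_bound hC.1 Dm0.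
pose Q := 2 * (1 + `|dk m0| + `|dlam m0|).
have Q0 : 0 < Q by rewrite /Q; have := normr_ge0 (dk m0); have := normr_ge0 (dlam m0); lra.
pose T := 1 + S + S * (Kb + Kc).
have SK : 0 <= S * (Kb + Kc) by rewrite mulr_ge0//; lra.
have T0 : 0 < T by rewrite /T; lra_from S0 SK.
(* The first bound is for the absorption of [N], as it makes [S * ep] at most [1 / 4]; the second
   yields the final precision [e]. *)
pose ep := Num.min (4 * (1 + S))^-1 (e / (T * Q)).
have S1 : 0 < 4 * (1 + S) by lra_from S0.
have ep0 : 0 < ep by rewrite lt_min invr_gt0 S1 divr_gt0// mulr_gt0.
have [ep1 ep2] : ep <= (4 * (1 + S))^-1 /\ ep <= e / (T * Q) by rewrite !ge_min !lexx orbT.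
apply: filterS2 (ND_in r m0) (remainder Dm0 ep0) => m Dm /=.
set dm := m - m0; set dK := k m - k m0; set dL := lam m - lam m0.
set N := `|dm| + _ + _; move=> [h1 h2].
have N0 : 0 <= N by rewrite !addr_ge0.
have h1' : `|dm * A m0 (1 / 2) + (dK * B m0 (1 / 2) + dL * C m0 (1 / 2))| <= ep * N.
  have := h1 _ half_half; rewrite (pf_v0 pf Dm) (pf_v0 pf Dm0) subrr sub0r.
  by rewrite normrN.
have [c1 c2] := cramer W0 h1' h2; rewrite -/S in c1 c2.
have epS : S * ep <= 1 / 4.
  have : (1 + S) * ep <= (1 + S) * (4 * (1 + S))^-1 by apply: ler_wpM2l => //; lra_from S1.
  have -> : (1 + S) * (4 * (1 + S))^-1 = 1 / 4 by field; lra_from S1.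
  by move: ep0; clear - c2; lra.
have NQ : N <= Q * `|dm|.
  have b1 : `|dK| <= `|dm| * `|dk m0| + S * (ep * N).
    by have := ler_normD (dm * dk m0) (dK - dm * dk m0); rewrite addrC subrK normrM; clear - c1; lra.
  have b2 : `|dL| <= `|dm| * `|dlam m0| + S * (ep * N).
    by have := ler_normD (dm * dlam m0) (dL - dm * dlam m0); rewrite addrC subrK normrM; clear - c2; lra.
  have b3 : S * (ep * N) <= 1 / 4 * N by rewrite mulrA; apply: ler_wpM2r.
  have NE : N = `|dm| + `|dK| + `|dL| by [].
  by rewrite /Q; clear - pf hA hB hC b1 b2 b3 NE; lra.
have fin : T * (ep * N) <= e * `|dm|.
  have : ep * (T * Q) <= e by rewrite -ler_pdivlMr// mulr_gt0.
  move=> /(ler_wpM2r (normr_ge0 dm)); apply: le_trans.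
  have -> : ep * (T * Q) * `|dm| = T * (ep * (Q * `|dm|)) by ring.
  apply: ler_wpM2l; first exact: ltW.
  by apply: ler_wpM2l => //; exact: ltW.
have epN : 0 <= ep * N by rewrite mulr_ge0// ltW.
have SepN : 0 <= S * (ep * N) by rewrite mulr_ge0.
have SKN : 0 <= S * (Kb + Kc) * (ep * N) by rewrite mulr_ge0.
have TE : T * (ep * N) = ep * N + S * (ep * N) + S * (Kb + Kc) * (ep * N) by rewrite /T; ring.
split.
- by apply: le_trans c2 _; clear - pf hA hB hC fin TE epN SepN SKN; lra.
- by apply: le_trans c1 _; clear - pf hA hB hC fin TE epN SepN SKN; lra.
- move=> t tI.
  have -> : v m t - v m0 t - dm * dv m0 t = (v m t - v m0 t - (dm * A m0 t + (dK * B m0 t + dL * C m0 t)))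
    + ((dK - dm * dk m0) * B m0 t + (dL - dm * dlam m0) * C m0 t) by rewrite /dv; ring.
  apply: le_trans (ler_normD _ _) _; apply: le_trans (lerD (h1 t tI) (ler_normD _ _)) _.
  rewrite !normrM.
  have t1 : `|dK - dm * dk m0| * `|B m0 t| <= S * (ep * N) * Kb by apply: ler_pM => //; exact: hKb.
  have t2 : `|dL - dm * dlam m0| * `|C m0 t| <= S * (ep * N) * Kc by apply: ler_pM => //; exact: hKc.
  by clear - pf hA hB hC fin TE t1 t2 SepN; lra.
Qed.

End first_derivative.

(** * Second derivatives in the height *)

Section smooth_family.
Context {R : realType} (F : nonlinearity R).
Local Notation r := (nl_r F).
Local Notation f := (nl_f F).
Local Notation f1 := (nl_f1 F).
Local Notation f2 := (nl_f2 F).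
Implicit Types (m t : R).
Local Notation half t := (`|t| <= 1 / 2).
Local Notation D m := (0 <= m < r).
Local Notation scal a := (fun (m : R) (_ : R) => a m).

Record smooth_family (lam k : R -> R) (v : R -> R -> R)
    (l1 l2 k1 k2 : R -> R) (v1 v2 : R -> R -> R) : Prop := SmoothFamily {
  sf_pf : profile_family F lam k v;
  sf_l1 : C1 r (scal lam) (scal l1);
  sf_l2 : C1 r (scal l1) (scal l2);
  sf_k1 : C1 r (scal k) (scal k1);
  sf_k2 : C1 r (scal k1) (scal k2);
  sf_v1 : C1 r v v1;
  sf_v2 : C1 r v1 v2 }.

Lemma C1_scal_near (a a' : R -> R) : C0 r (scal a) -> C0 r (scal a') ->
  (forall m0 e, D m0 -> 0 < e -> \forall m \near ND r m0,
    `|a m - a m0 - (m - m0) * a' m0| <= e * `|m - m0|) -> C1 r (scal a) (scal a').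
Proof.
move=> ha ha' hd; split=> // m0 Dm0 e e0.
by apply: filterS (hd m0 e Dm0 e0) => m h t _.
Qed.

Lemma C0_ext (G H : R -> R -> R) : C0 r G -> (forall m t, G m t = H m t) -> C0 r H.
Proof.
by move=> hG GH; rewrite (_ : H = G)//; apply/funext => m; apply/funext => t.
Qed.

Lemma C1_ext (G G' H H' : R -> R -> R) : C1 r G G' -> (forall m t, G m t = H m t) ->
  (forall m t, G' m t = H' m t) -> C1 r H H'.
Proof.
move=> hG GH GH'.
have <- : G = H by apply/funext => m; apply/funext => t.
by have <- : G' = H' by apply/funext => m; apply/funext => t.
Qed.

Lemma C0Z (c : R) G : C0 r G -> C0 r (fun m t => c * G m t).
Proof. by move=> hG; apply: C0M => //; apply/C0_cst/ct_cst. Qed.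

Lemma C0B G H : C0 r G -> C0 r H -> C0 r (fun m t => G m t - H m t).
Proof.
move=> hG hH; apply: C0_ext (C0D hG (C0Z (-1) hH)) _ => m t.
by rewrite mulN1r.
Qed.

Lemma C1Z (c : R) G G' : C1 r G G' -> C1 r (fun m t => c * G m t) (fun m t => c * G' m t).
Proof.
move=> hG; apply: C1_ext (C1M (C1_cst r (@ct_cst _ c)) hG) _ _ => // m t.
by ring.
Qed.

Lemma C1B G G' H H' : C1 r G G' -> C1 r H H' ->
  C1 r (fun m t => G m t - H m t) (fun m t => G' m t - H' m t).
Proof.
move=> hG hH; apply: C1_ext (C1D hG (C1Z (-1) hH)) _ _ => m t; by rewrite mulN1r.
Qed.

(** Once [v] and [lam] are C^1, so is the potential [lam * f' v], because [f] is C^2. Hence [A],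
    [B], [C] solve linear equations with C^1 coefficients, and the formulas for the first
    derivatives, rational in their end values, can be differentiated once more. *)
Lemma smooth_family_exists lam k v : profile_family F lam k v ->
  exists l1 l2 k1 k2 v1 v2, smooth_family lam k v l1 l2 k1 k2 v1 v2.
Proof.
move=> pf.
have cq : continuous (fun t : R => - (t ^+ 2 / 2)).
  by apply: ctN; apply: ctM; [apply: ctX; exact: ct_id|exact: ct_cst].
have g1 : C0 r (fun _ _ : R => 1) by apply/C0_cst/ct_cst.
have g2 : C0 r (fun _ t : R => - (t ^+ 2 / 2)) by exact: C0_cst.
have p0 := pot_C0 pf; have ph0 := phi_C0 pf.
have g3 : C0 r (fun m => primn 4 (profile_f F v m)) by exact: C0_primn.
have [A hA] := lin_solution_exists pf g1.1.
have [B hB] := lin_solution_exists pf g2.1.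
have [C hC] := lin_solution_exists pf g3.1.
have A0 : C0 r A := linear_volterra_C0 hA.2 hA.1 g1 p0.
have B0 : C0 r B := linear_volterra_C0 hB.2 hB.1 g2 p0.
have C0_ : C0 r C := linear_volterra_C0 hC.2 hC.1 g3 p0.
have hh : half (1 / 2 : R) := half_half.
have ev := fun G => @C0_eval _ r G _ hh.
have A10 : C0 r (scal (end_slopeA F lam v A)) := ev _ (C0_primn 3 (C0M p0 A0)).
have B10 : C0 r (scal (end_slopeB F lam v B)).
  exact: C0D (C0_cst r (@ct_cst _ (- (1 / 2)))) (ev _ (C0_primn 3 (C0M p0 B0))).
have C10 : C0 r (scal (end_slopeC F lam v C)) := ev _ (C0_primn 3 (C0D (C0M p0 C0_) ph0)).
have Ae0 := ev _ A0; have Be0 := ev _ B0; have Ce0 := ev _ C0_.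
have W0 m : D m -> wronskian F lam v B C m != 0 by exact: (wronskian_neq0 pf hB hC).
have WC0 : C0 r (scal (wronskian F lam v B C)).
  exact: C0B (C0M Be0 C10) (C0M B10 Ce0).
have WV0 := C0V W0 WC0.
pose dl := dlam F lam v A B C; pose dk_ := dk F lam v A B C.
pose dv_ := dv F lam v A B C.
have dl0 : C0 r (scal dl) := C0M (C0B (C0M Ae0 B10) (C0M A10 Be0)) WV0.
have dk0 : C0 r (scal dk_) := C0M (C0B (C0M A10 Ce0) (C0M Ae0 C10)) WV0.
have dv0 : C0 r dv_ := C0D A0 (C0D (C0M dk0 B0) (C0M dl0 C0_)).
have lam1 : C1 r (scal lam) (scal dl).
  apply: C1_scal_near => //; first exact: lam_C0 pf.
  by move=> m0 e Dm0 e0; apply: filterS (pf_diff pf hA hB hC Dm0 e0) => m [].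
have k1 : C1 r (scal k) (scal dk_).
  apply: C1_scal_near => //; first exact: k_C0 pf.
  by move=> m0 e Dm0 e0; apply: filterS (pf_diff pf hA hB hC Dm0 e0) => m [].
have v1 : C1 r v dv_.
  split=> //; first exact: v_C0 pf.
  by move=> m0 Dm0 e e0; apply: filterS (pf_diff pf hA hB hC Dm0 e0) => m [].
have ph1 := C1_comp (pf_itv pf) (@nl_cf _ F) (@nl_cf1 _ F) (@nl_df _ F) v1.
have fp1 := C1_comp (pf_itv pf) (@nl_cf1 _ F) (@nl_cf2 _ F) (@nl_df1 _ F) v1.
have pot1 := C1M lam1 fp1.
have pb m : D m -> exists P, forall t, `|potential F lam v m t| <= P by move=> Dm; exact: pot_bound.
have h1 := C1_cst r (@ct_cst _ 1).
have h2 := C1_cst r cq.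
have h3 := C1_primn 4 ph1.
have [A' A1_ _] := linear_volterra_C1 hA.2 hA.1 pb h1 pot1.
have [B' B1_ _] := linear_volterra_C1 hB.2 hB.1 pb h2 pot1.
have [C' C1_ _] := linear_volterra_C1 hC.2 hC.1 pb h3 pot1.
have ev1 := fun G G' => @C1_eval _ r G G' _ hh.
have [A1' A11] : exists A1' : R -> R, C1 r (scal (end_slopeA F lam v A)) (scal A1').
  by eexists; exact: (ev1 _ _ (C1_primn 3 (C1M pot1 A1_))).
have [B1' B11] : exists B1' : R -> R, C1 r (scal (end_slopeB F lam v B)) (scal B1').
  by eexists; exact: (C1D (C1_cst r (@ct_cst _ (- (1 / 2)))) (ev1 _ _ (C1_primn 3 (C1M pot1 B1_)))).
have [C1' C11] : exists C1' : R -> R, C1 r (scal (end_slopeC F lam v C)) (scal C1').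
  by eexists; exact: (ev1 _ _ (C1_primn 3 (C1D (C1M pot1 C1_) ph1))).
have Ae := ev1 _ _ A1_; have Be := ev1 _ _ B1_; have Ce := ev1 _ _ C1_.
have [W' W1] : exists W' : R -> R, C1 r (scal (wronskian F lam v B C)) (scal W').
  by eexists; exact: C1B (C1M Be C11) (C1M B11 Ce).
have WV1 := C1V W0 W1.
have [l2 l21] : exists l2 : R -> R, C1 r (scal dl) (scal l2).
  by eexists; exact: C1M (C1B (C1M Ae B11) (C1M A11 Be)) WV1.
have [k2 k21] : exists k2 : R -> R, C1 r (scal dk_) (scal k2).
  by eexists; exact: C1M (C1B (C1M A11 Ce) (C1M Ae C11)) WV1.
by do 6 eexists; split; [exact: pf|exact: lam1|exact: l21|exact: k1|exact: k21|exact: v1|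
  exact: C1D A1_ (C1D (C1M k21 B1_) (C1M l21 C1_))].
Qed.

Section consequences.
Variables (lam k : R -> R) (v : R -> R -> R).
Variables (l1 l2 k1 k2 : R -> R) (v1 v2 : R -> R -> R).
Hypothesis sf : smooth_family lam k v l1 l2 k1 k2 v1 v2.

Local Notation fv m t := (f (clip m (v m t))).
Local Notation f1v m t := (f1 (clip m (v m t))).
Local Notation f2v m t := (f2 (clip m (v m t))).
Local Notation h := (profile_source F lam v).

Definition profile_source1 m t := lam m * (f1v m t * v1 m t) + l1 m * fv m t.
Definition profile_source2 m t := lam m * (f1v m t * v2 m t + f2v m t * v1 m t * v1 m t)
  + l1 m * (f1v m t * v1 m t) + (l1 m * (f1v m t * v1 m t) + l2 m * fv m t).

Local Notation h1 := profile_source1.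
Local Notation h2 := profile_source2.

Let pf := sf_pf sf.

Lemma h_C1 : C1 r h h1.
Proof.
exact: C1M (sf_l1 sf) (C1_comp (pf_itv pf) (@nl_cf _ F) (@nl_cf1 _ F) (@nl_df _ F) (sf_v1 sf)).
Qed.

Lemma h1_C1 : C1 r h1 h2.
Proof.
have fp := C1_comp (pf_itv pf) (@nl_cf _ F) (@nl_cf1 _ F) (@nl_df _ F) (sf_v1 sf).
have fpp := C1_comp (pf_itv pf) (@nl_cf1 _ F) (@nl_cf2 _ F) (@nl_df1 _ F) (sf_v1 sf).
exact: C1D (C1M (sf_l1 sf) (C1M fpp (sf_v2 sf))) (C1M (sf_l2 sf) fp).
Qed.

Lemma vjet_C1 (a a' b b' : R -> R) (g g' : R -> R -> R) j : C1 r (scal a) (scal a') ->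
  C1 r (scal b) (scal b') -> C1 r g g' ->
  C1 r (fun m => vjet (a m) (b m) (g m) j) (fun m => vjet (a' m) (b' m) (g' m) j).
Proof.
move=> ha hb hg.
have ct2 : continuous (fun t : R => t ^+ 2 / 2).
  by apply: ctM; [apply: ctX; exact: ct_id|exact: ct_cst].
case: j => [|[|[|[|j]]]]; rewrite /vjet.
- apply: C1D (C1_primn 4 hg); apply: C1B => //.
  by apply: C1_ext (C1M hb (C1_cst r ct2)) _ _ => // m t; rewrite mulr0 add0r.
- apply: C1D (C1_primn 3 hg).
  apply: (C1_ext (C1Z (-1) (C1M hb (C1_cst r (@ct_id R))))) => m t; rewrite ?mulr0 ?add0r mulN1r//.
- apply: C1D (C1_primn 2 hg).
  by apply: (C1_ext (C1Z (-1) hb)) => m t; rewrite mulN1r.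
- by apply: C1_ext (C1_primn 1 hg) _ _.
- by apply: C1_ext hg _ _.
Qed.

(** A derivative in [m] is unique, so [v1] equals the expression obtained by differentiating the
    integral equation of [v]. This gives [v1] its derivatives in [t]. *)
Lemma v1_vjet m t : D m -> half t -> v1 m t = vjet 1 (k1 m) (h1 m) 0%N t.
Proof.
move=> Dm tI.
suff H1 : C1 r v (fun m => vjet 1 (k1 m) (h1 m) 0%N).
  exact: (uder_uniq (sf_v1 sf) H1 Dm tI).
have := vjet_C1 0 (C1_id r) (sf_k1 sf) h_C1.
move=> H; apply: (C1_eq H).
- by have [[hh _] _ _] := sf_v1 sf.
- by have [_ []] := H.
- by move=> n s Dn sI; rewrite (pf_eq pf).
- by [].
Qed.

Lemma v2_vjet m t : D m -> half t -> v2 m t = vjet 0 (k2 m) (h2 m) 0%N t.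
Proof.
move=> Dm tI.
suff H1 : C1 r v1 (fun m => vjet 0 (k2 m) (h2 m) 0%N).
  exact: (uder_uniq (sf_v2 sf) H1 Dm tI).
have := vjet_C1 0 (C1_cst r (@ct_cst _ 1)) (sf_k2 sf) h1_C1.
move=> H; apply: (C1_eq H).
- by have [[hh _] _ _] := sf_v2 sf.
- by have [_ []] := H.
- by move=> n s Dn sI; rewrite v1_vjet.
- by [].
Qed.

(* Differentiating the boundary conditions at [1/2] in [m]. *)
Lemma C1_zero (g g' : R -> R -> R) t0 m : C1 r g g' -> half t0 ->
  (forall n, D n -> g n t0 = 0) -> D m -> g' m t0 = 0.
Proof.
move=> hg t0I g0 Dm.
suff H1 : C1 r (fun n _ => g n t0) (fun _ _ => 0).
  exact: (uder_uniq (C1_eval t0I hg) H1 Dm t0I).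
apply: (C1_eq (C1_cst r (@ct_cst _ 0))) => //.
- by move=> n Dn; exact: ct_cst.
- by move=> n Dn; exact: ct_cst.
- by move=> n t Dn _; rewrite g0.
Qed.

Lemma v1_end m j : D m -> (j <= 1)%N -> vjet 1 (k1 m) (h1 m) j (1 / 2) = 0.
Proof.
move=> Dm j1; apply: (C1_zero (vjet_C1 j (C1_id r) (sf_k1 sf) h_C1) half_half) => //.
move=> n Dn; case: j j1 => [|[|//]] _; last exact: (pf_v1 pf).
by rewrite -(pf_eq pf)// (pf_v0 pf).
Qed.

Lemma v2_end m j : D m -> (j <= 1)%N -> vjet 0 (k2 m) (h2 m) j (1 / 2) = 0.
Proof.
move=> Dm j1.
apply: (C1_zero (vjet_C1 j (C1_cst r (@ct_cst _ 1)) (sf_k2 sf) h1_C1) half_half) => //.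
by move=> n Dn; exact: v1_end.
Qed.

End consequences.
End smooth_family.

(** * The turn *)

Section linearized_sign.
Context {R : realType}.
Implicit Types (t s x : R).
Variables (p : R -> R) (P : R) (z phi : nat -> R -> R).
Hypotheses (p0 : forall t, 0 <= p t) (pP : forall t, p t <= P).
Hypotheses (jz : jet (1 / 2) z) (jphi : jet (1 / 2) phi).
Hypothesis z4 : forall t, 0 < t < 1 / 2 -> z 4%N t = p t * z 0%N t.
Hypothesis phi4 : forall t, 0 < t < 1 / 2 -> phi 4%N t = p t * phi 0%N t.
Hypotheses (z00 : z 0%N 0 = 1) (z10 : z 1%N 0 = 0) (z30 : z 3%N 0 = 0).
Hypotheses (z01 : z 0%N (1 / 2) = 0) (z11 : z 1%N (1 / 2) = 0).
Hypothesis phi_gt0 : forall t, 0 < t < 1 / 2 -> 0 < phi 0%N t.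
Hypotheses (phi00 : phi 0%N 0 = 0) (phi20 : phi 2%N 0 = 0).
Hypotheses (phi01 : phi 0%N (1 / 2) = 0) (phi11 : phi 1%N (1 / 2) < 0).

Lemma linear_growth T y : jet T y -> (forall t, 0 < t < T ->
    exists2 q, 0 <= q <= P & y 4%N t = q * y 0%N t) ->
  (forall j, (j < 4)%N -> 0 <= y j 0) -> forall t, 0 <= t <= T ->
  y 2%N 0 + y 3%N 0 * t <= y 2%N t /\
  y 0%N 0 + y 1%N 0 * t + y 2%N 0 * (t ^+ 2 / 2) + y 3%N 0 * (t ^+ 3 / 6) <= y 0%N t.
Proof.
move=> jy y4 y0 t tI; have P0 : 0 <= P := le_trans (p0 0) (pP 0).
have ge x : 0 <= x <= T -> 0 <= y 0%N x.
  apply: (jet_ge0 jy P0) => // u uI; have [q qI ->] := y4 u uI.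
  have [u0|u0] := leP 0 (- y 0%N u); last first.
    by rewrite mulr0 oppr0 mulr_ge0//; lra.
  by rewrite -mulrN opprK; apply: ler_wnM2r; lra.
have ge4 x : 0 < x < T -> 0 <= y 4%N x.
  move=> xI; have [q qI ->] := y4 x xI; rewrite mulr_ge0//; first lra.
  by apply: ge; lra.
by have [_ ? _ ?] := jet_taylor jy ge4 tI.
Qed.

(** Otherwise all data at [0] are nonnegative and growth gives [z (1 / 2) >= 1]. *)
Lemma z20_lt0 : z 2%N 0 < 0.
Proof.
rewrite ltNge; apply/negP => z20.
have h12 : 0 <= (1 / 2 : R) <= (1 / 2 : R) by rewrite lexx divr_ge0.
have [||_] := linear_growth jz _ _ h12.
- by move=> t tI; exists (p t); rewrite ?p0 ?pP//; exact: z4.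
- by move=> [|[|[|[|//]]]] _; rewrite ?z00 ?z10 ?z30//; exact: ler01.
rewrite z00 z10 z30 z01 !expr2; lra.
Qed.

(* A nonnegative combination [z + s phi] cannot vanish at an interior point:
   its third derivative there would force growth either up to [1/2] or down
   to [0], against [z (1/2) = 0], respectively [z'' 0 < 0]. *)
Lemma no_touching s x : 0 <= s -> 0 < x < 1 / 2 ->
  (forall t, 0 <= t <= 1 / 2 -> 0 <= z 0%N t + s * phi 0%N t) ->
  z 0%N x + s * phi 0%N x <> 0.
Proof.
move=> s0 xI yge yx.
pose y j t := 1 * z j t + s * phi j t.
have jy : jet (1 / 2) y by exact: jet_lin.
have y0E t : y 0%N t = z 0%N t + s * phi 0%N t by rewrite /y mul1r.
have y4 t : 0 < t < 1 / 2 -> y 4%N t = p t * y 0%N t.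
  by move=> tI; rewrite /y z4// phi4//; ring.
have [dy cy] := jy.
have y1x : y 1%N x = 0.
  apply: (@der_min _ (y 0%N) 0 (1 / 2) x) => //; first exact: dy.
  by move=> t tI; rewrite !y0E yx; apply: yge; lra.
have jf : jet (1 / 2 - x) (fun j t => y j (x + t)) by apply: jet_shift jy; lra.
have jx : jet x y by apply: jet_sub jy; lra.
have jb := jet_rev jx.
have xT : 0 < 1 / 2 - x by lra.
have y2x : 0 <= y 2%N x.
  have := jet_start_ge0 xT jf; rewrite !addr0; apply => //.
    by move=> t tI; rewrite y0E; apply: yge; lra.
  by rewrite y0E.
have [y3x|y3x] := leP (y 3%N x) 0.
- have xx : 0 <= x <= x by rewrite lexx andbT; lra.
  have [||+ _] := linear_growth jb _ _ xx.
  + move=> t tI; exists (p (x - t)); first by rewrite p0 pP.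
    by rewrite y4; [rewrite expr0 -signr_odd/= expr0; ring|lra].
  + have e2 : (-1) ^+ 2 = 1 :> R by ring.
    have e3 : (-1) ^+ 3 = -1 :> R by ring.
    move=> [|[|[|[|//]]]] _; rewrite subr0 ?y1x ?expr0 ?mulr0 ?mul1r ?e2 ?e3 ?mul1r ?mulN1r ?oppr_ge0//.
    by rewrite y0E yx.
  + have e2 : (-1) ^+ 2 = 1 :> R by ring.
    have e3 : (-1) ^+ 3 = -1 :> R by ring.
    rewrite subrr subr0 e2 e3 !mul1r {3}/y phi20 => h.
    have : 0 <= -1 * y 3%N x * x by rewrite mulr_ge0//; lra.
    by have := z20_lt0; lra.
- have xx : 0 <= 1 / 2 - x <= 1 / 2 - x by rewrite lexx andbT; lra.
  have [||_] := linear_growth jf _ _ xx.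
  + move=> t tI; exists (p (x + t)); first by rewrite p0 pP.
    by rewrite y4//; lra.
  + move=> [|[|[|[|//]]]] _; rewrite addr0 ?y1x//; last exact: ltW.
    by rewrite y0E yx.
  + have -> : x + (1 / 2 - x) = 1 / 2 by ring.
    rewrite !addr0 !y0E yx y1x z01 phi01 mulr0 mul0r.
    have : 0 < y 3%N x * ((1 / 2 - x) ^+ 3 / 6) by rewrite !mulr_gt0 ?exprn_gt0// invr_gt0.
    have : 0 <= y 2%N x * ((1 / 2 - x) ^+ 2 / 2) by rewrite mulr_ge0// divr_ge0// sqr_ge0.
    lra.
Qed.

(** If [z] were negative somewhere, let [- s] be the minimum of [z / phi]. Then [z + s * phi] is
    nonnegative and touches zero inside, against [no_touching]. The quotient is singular at both
    ends, so the minimum is first taken over an inner interval [[a, b]], and the end zones are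
    treated apart. *)
Lemma linearized_ge0 t : 0 <= t <= 1 / 2 -> 0 <= z 0%N t.
Proof.
move=> tI; rewrite leNgt; apply/negP => zt.
have half_le (u : R) : 0 <= u -> u / 2 <= u by move=> u0; rewrite ler_pdivrMr// ler_peMr// ler1n.
have t1 : 0 < t < 1 / 2.
  rewrite !lt_neqAle; have [? ?] : 0 <= t /\ t <= 1 / 2 by lra.
  apply/andP; split; apply/andP; split => //; apply/eqP => E.
    by move: zt; rewrite -E z00; lra.
  by move: zt; rewrite E z01; lra.
have [dz cz] := jz; have [dphi cphi] := jphi.
pose s1 := - z 0%N t / phi 0%N t.
have pt := phi_gt0 t1.
have s10 : 0 < s1 by rewrite divr_gt0//; lra.
have I0 : `[0, 1 / 2]%classic (0 : R) by rewrite /= in_itv/=; lra.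
have I1 : `[0, 1 / 2]%classic (1 / 2 : R) by rewrite /= in_itv/= lexx andbT; lra.
have [d d0 hd] := (withinC_P _ _).1 (cz 0%N isT) 0 I0 1 ltr01.
have za x : 0 <= x <= 1 / 2 -> x < d -> 0 < z 0%N x.
  move=> xI xd; have := hd x; rewrite /= in_itv/= subr0 z00 ger0_norm; last lra.
  by move=> /(_ xI xd); rewrite ltr_norml; lra.
have cw : {within `[0, 1 / 2], continuous (fun x => z 1%N x + s1 / 2 * phi 1%N x)}.
  by apply: wctD; [exact: cz|apply: wctM; [exact: wct_cst|exact: cphi]].
have e0 : 0 < - (s1 / 2 * phi 1%N (1 / 2)) by rewrite oppr_gt0 pmulr_rlt0//; lra.
have [d' d'0 hd'] := (withinC_P _ _).1 cw (1 / 2) I1 _ e0.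
(* Near [1 / 2] both [z] and [z'] tend to zero, so the negative slope of [phi] decides. Half of [s1]
   is already enough, and [s] will be at least [s1]. *)
have zb x : 0 <= x -> 1 / 2 - d' < x -> x < 1 / 2 -> 0 < z 0%N x + s1 / 2 * phi 0%N x.
  move=> x0 xd x1.
  have y1 u : x < u < 1 / 2 -> z 1%N u + s1 / 2 * phi 1%N u < 0.
    move=> uI; have := hd' u; rewrite /= in_itv/= z11 add0r.
    have uI' : 0 <= u <= 1 / 2 by lra_from x0 uI.
    have ud : `|u - 1 / 2| < d' by rewrite ltr_norml; lra_from xd uI d'0.
    by move=> /(_ uI' ud); rewrite ltr_norml; lra_from.
  have := @incr_lt _ x (1 / 2) (fun u => - (z 0%N u + s1 / 2 * phi 0%N u))
    (fun u => - (z 1%N u + s1 / 2 * phi 1%N u)) _ _ _ x (1 / 2) (lexx _) x1 (lexx _).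
  rewrite z01 phi01 mulr0 addr0 oppr0 oppr_lt0; apply.
  - move=> u uI; apply/derN/derD; first by apply: dz => //; lra_from x0 uI.
    by apply: derZ; apply: dphi => //; lra_from x0 uI.
  - apply: wctN; apply: wctD; first exact: sub_cc (cz 0%N isT).
    by apply: wctM; [exact: wct_cst|exact: sub_cc (cphi 0%N isT)].
  - by move=> u /y1; rewrite oppr_gt0.
pose a := Num.min (d / 2) t; pose b := Num.max (1 / 2 - d' / 2) t.
have [ad at_] : a <= d / 2 /\ a <= t by rewrite !ge_min !lexx orbT.
have [bd bt] : 1 / 2 - d' / 2 <= b /\ t <= b by rewrite !le_max !lexx orbT.
have a0 : 0 < a by rewrite lt_min divr_gt0//=; case/andP: t1.
have b1 : b < 1 / 2 by rewrite gt_max gtrBl divr_gt0//=; case/andP: t1.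
have ab : a <= b by lra.
have cr : {within `[a, b], continuous (fun x => z 0%N x * (phi 0%N x)^-1)}.
  apply: wctM; first exact: sub_cc (ltW a0) (ltW b1) (cz 0%N isT).
  apply/withinC_P => x /=; rewrite in_itv/= => xI e epos.
  have x1 : 0 < x < 1 / 2.
    by case/andP: xI => ax xb; rewrite (lt_le_trans a0 ax) (le_lt_trans xb b1).
  have px := phi_gt0 x1.
  have cv : {for x, continuous (fun x => (phi 0%N x)^-1)}.
    apply: continuousV; first by rewrite gt_eqF.
    exact: within_cont_at x1 (cphi 0%N isT).
  have [c c0 hc] := (contP _ _).1 cv e epos.
  by exists c => // u _; exact: hc.
(* [[a, b]] contains the point where [z] is negative, so the minimal quotient is at most [- s1] and
   [s] is positive. *)
have [x0] := EVT_min ab cr; rewrite in_itv/= => x0I hx0.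
pose s := - (z 0%N x0 * (phi 0%N x0)^-1).
have x0I' : 0 < x0 < 1 / 2.
  by case/andP: x0I => ax xb; rewrite (lt_le_trans a0 ax) (le_lt_trans xb b1).
have px0 := phi_gt0 x0I'.
have s1s : s1 <= s.
  have := hx0 t; rewrite in_itv/= => /(_ _); rewrite /s /s1 mulNr.
  by move=> h; rewrite lerN2; apply: h; rewrite at_ bt.
have s0 : 0 <= s := le_trans (ltW s10) s1s.
apply: (@no_touching s x0) => //; last first.
  by rewrite /s mulNr -mulrA mulVf ?gt_eqF// mulr1 subrr.
move=> x xI.
have [->|x_0] := eqVneq x 0; first by rewrite z00 phi00 mulr0 addr0 ler01.
have [->|x_1] := eqVneq x (1 / 2); first by rewrite z01 phi01 mulr0 addr0.
have [x_ge0 x_le] := andP xI.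
have xo : 0 < x < 1 / 2 by rewrite !lt_neqAle x_1 eq_sym x_0 x_ge0.
have px := phi_gt0 xo.
have [xa|xa] := ltP x a.
  have zx : 0 < z 0%N x by apply: za => //; exact: lt_le_trans xa (le_trans ad (half_le _ (ltW d0))).
  by apply: addr_ge0; [exact: ltW|rewrite mulr_ge0// ltW].
have [xb|xb] := leP x b.
  have := hx0 x; rewrite in_itv/= xa xb => /(_ isT).
  rewrite -lerN2 -/s -mulNr ler_pdivrMr// => h.
  by rewrite -lerBlDl sub0r.
have := zb x _ _ _.
have xd : 1 / 2 - d' < x.
  by apply: le_lt_trans (le_trans _ bd) xb; rewrite lerD2l lerN2 half_le// ltW.
have x_lt : x < 1 / 2 by case/andP: xo.
move=> /(_ x_ge0 xd x_lt).
have : s1 / 2 * phi 0%N x <= s * phi 0%N x.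
  by apply: ler_wpM2r; [exact: ltW|exact: le_trans (half_le _ (ltW s10)) s1s].
by move=> sl zl; apply: ltW; apply: lt_le_trans zl _; rewrite lerD2l.
Qed.

End linearized_sign.

Section turning.
Context {R : realType} (F : nonlinearity R).
Local Notation r := (nl_r F).
Local Notation f := (nl_f F).
Local Notation f1 := (nl_f1 F).
Local Notation f2 := (nl_f2 F).
Implicit Types (m t : R).
Local Notation half t := (`|t| <= 1 / 2).
Local Notation D m := (0 <= m < r).
Variables (lam k : R -> R) (v : R -> R -> R).
Variables (l1 l2 k1 k2 : R -> R) (v1 v2 : R -> R -> R).
Hypothesis sf : smooth_family F lam k v l1 l2 k1 k2 v1 v2.
Let pf := sf_pf sf.
Local Notation h1 := (profile_source1 F lam v l1 v1).
Local Notation h2 := (profile_source2 F lam v l1 l2 v1 v2).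
Local Notation pot := (potential F lam v).

Section at_critical.
Variable m : R.
Hypotheses (mr : 0 < m < r) (l1m : l1 m = 0).
Let Dm : D m. Proof. by move: mr => /andP[/ltW -> ->]. Qed.
Let y := vjet m (k m) (profile_source F lam v m).
Let z := vjet 1 (k1 m) (h1 m).
Let w := vjet 0 (k2 m) (h2 m).
Let hp : half_profile F m (lam m) y := pf_half pf mr.

Let half_in t : 0 < t < 1 / 2 -> half t.
Proof. by rewrite ler_norml; lra. Qed.

Let ch1 : continuous (h1 m).
Proof. by have [_ [c _] _] := h_C1 sf; exact: c. Qed.

Let ch2 : continuous (h2 m).
Proof. by have [_ [c _] _] := h1_C1 sf; exact: c. Qed.

Let z4 t : 0 < t < 1 / 2 -> z 4%N t = pot m t * z 0%N t.
Proof.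
move=> tI; rewrite /z -(v1_vjet sf)//; last exact: half_in.
by rewrite /vjet /profile_source1 l1m /potential; ring.
Qed.

Lemma critical_z_ge0 t : 0 <= t <= 1 / 2 -> 0 <= z 0%N t.
Proof.
have [dy cy] := hp_jet hp.
(* Since [l1 m = 0] the equation of [z] is homogeneous. The equation of [v] being autonomous, [- v']
   is another solution, positive inside. *)
pose phi (j : nat) t := match j with
  | 4 => - (pot m t * y 1%N t) | j => - y j.+1 t end.
have [P hP] := pot_bound lam v Dm.
have [z00 z10 _ z30] := vjet_at0 1 (k1 m) ch1; rewrite -/z in z00 z10 z30.
have [_ y10 y20 y30] := vjet_at0 m (k m) (ct_h pf Dm); rewrite -/y in y10 y20 y30.
have [y0e y1e] := hp_end hp.
apply: (@linearized_ge0 _ (pot m) P z phi).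
- by move=> x; exact: (pot_ge0 pf).
- by move=> x; apply: le_trans (ler_norm _) (hP x).
- exact: jet_vjet.
- split=> [[|[|[|[|//]]]] _ x xI|[|[|[|[|//]]]] _]; rewrite /phi.
  + by apply: derN; exact: dy.
  + by apply: derN; exact: dy.
  + by apply: derN; exact: dy.
  + by apply: derN; exact: (der_h pf mr xI).
  + by apply: wctN; exact: cy.
  + by apply: wctN; exact: cy.
  + by apply: wctN; exact: cy.
  + by apply: wctN; apply: cont_within; exact: (ct_h pf Dm).
- exact: z4.
- by move=> x xI; rewrite /phi; ring.
- exact: z00.
- exact: z10.
- exact: z30.
- exact: (v1_end sf).
- exact: (v1_end sf).
- by move=> x xI; rewrite /phi oppr_gt0; exact: half_y1_lt0 hp _ xI.
- by rewrite /phi y10 oppr0.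
- by rewrite /phi y30 oppr0.
- by rewrite /phi y1e oppr0.
- by rewrite /phi oppr_lt0; exact: half_y2_end_gt0 hp.
Qed.

(* With [z = dv/dm] and [w = d2v/dm2], the concomitant of [w] and [z] vanishes
   at both ends while its derivative is [lam f''(v) z^3 + l2 f(v) z]. *)
Lemma turning : l2 m < 0.
Proof.
rewrite ltNge; apply/negP => l20.
have l0 := pf_lam pf mr.
have [z00 z10 _ z30] := vjet_at0 1 (k1 m) ch1; rewrite -/z in z00 z10 z30.
have [w00 w10 _ w30] := vjet_at0 0 (k2 m) ch2; rewrite -/w in w00 w10 w30.
have z0e : z 0%N (1 / 2) = 0 by exact: (v1_end sf).
have z1e : z 1%N (1 / 2) = 0 by exact: (v1_end sf).
have w0e : w 0%N (1 / 2) = 0 by exact: (v2_end sf).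
have w1e : w 1%N (1 / 2) = 0 by exact: (v2_end sf).
have dz j t : (j < 4)%N -> der (z j) t (z j.+1 t) by exact: der_vjet.
have dw j t : (j < 4)%N -> der (w j) t (w j.+1 t) by exact: der_vjet.
pose Q t := w 3%N t * z 0%N t - w 2%N t * z 1%N t + w 1%N t * z 2%N t - w 0%N t * z 3%N t.
pose q t := w 4%N t * z 0%N t - w 0%N t * z 4%N t.
have dQ t : der Q t (q t).
  apply: der_eq.
    apply: derD; last by apply: derN; apply: derM; [exact: (dw 0%N)|exact: (dz 3%N)].
    apply: derD; last by apply: derM; [exact: (dw 1%N)|exact: (dz 2%N)].
    apply: derD; first by apply: derM; [exact: (dw 3%N)|exact: (dz 0%N)].
    by apply: derN; apply: derM; [exact: (dw 2%N)|exact: (dz 1%N)].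
  rewrite /q; move: (w 0%N t) (w 1%N t) (w 2%N t) (w 3%N t) (w 4%N t).
  move: (z 0%N t) (z 1%N t) (z 2%N t) (z 3%N t) (z 4%N t).
  by move=> *; rewrite /=; ring.
have vI t : 0 < t < 1 / 2 -> 0 < v m t < r /\ clip m (v m t) = v m t.
  move=> tI; have tI1 : 0 <= t < 1 / 2 by lra.
  have tI2 : 0 <= t <= 1 / 2 by lra_from tI1.
  rewrite (pf_eq pf Dm) (half_y0_gt0 hp tI1).
  have /andP[_ ->] := hp_range hp tI2; split=> //.
  by rewrite clip_id// -(pf_eq pf Dm); apply: (pf_itv pf) => //; exact: half_in.
have qE t : 0 < t < 1 / 2 ->
    q t = z 0%N t * (lam m * f2 (v m t) * z 0%N t ^+ 2 + l2 m * f (v m t)).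
  move=> tI; have [_ cE] := vI t tI; have tH := half_in tI.
  have wE : w 4%N t = lam m * (f1 (v m t) * w 0%N t + f2 (v m t) * z 0%N t * z 0%N t)
    + l2 m * f (v m t).
    have -> : w 4%N t = lam m * (f1 (clip m (v m t)) * v2 m t
        + f2 (clip m (v m t)) * v1 m t * v1 m t)
      + l1 m * (f1 (clip m (v m t)) * v1 m t)
      + (l1 m * (f1 (clip m (v m t)) * v1 m t) + l2 m * f (clip m (v m t))) by [].
    by rewrite l1m cE (v1_vjet sf)// (v2_vjet sf)// -/w -/z; ring.
  have pE : pot m t = lam m * f1 (v m t) by rewrite -[in RHS]cE.
  by rewrite /q wE z4// pE; ring.
have q0 t : 0 < t < 1 / 2 -> 0 <= q t.
  move=> tI; have [vr _] := vI t tI; have tI2 : 0 <= t <= 1 / 2 by lra_from tI.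
  have vr' : 0 <= v m t < r by lra_from vr.
  have fp := nl_f_gt0 vr'; have f2p := nl_f2_gt0 vr.
  have z0 := critical_z_ge0 tI2.
  rewrite qE//; apply: mulr_ge0 => //; apply: addr_ge0; apply: mulr_ge0 => //.
  - by apply: mulr_ge0; exact: ltW.
  - exact: sqr_ge0.
  - exact: ltW.
have Q0 : Q 0 = 0 by rewrite /Q w30 z10 w10 z30; ring.
have Q1 : Q (1 / 2) = 0 by rewrite /Q z0e z1e w0e w1e; ring.
have cQ : {within `[0, 1 / 2], continuous Q} by exact: der_within dQ.
have mono := @nondecr_le _ 0 (1 / 2) Q q (fun x _ => dQ x) cQ q0.
(* A nondecreasing [Q] with equal end values is constant, so [q] vanishes. But near [0], where [z]
   is close to [1], both factors of [q] are positive. *)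
have Qz t : 0 < t < 1 / 2 -> Q t = 0.
  move=> tI; have a := mono 0 t (lexx _); have b := mono t (1 / 2).
  by rewrite Q0 in a; rewrite Q1 in b; lra_from tI.
have qz t : 0 < t < 1 / 2 -> q t = 0.
  move=> tI; apply: (der_uniq (f := Q) (x := t)); first exact: dQ.
  apply: (@der_near _ (fun=> 0) _ _ _ 0 (1 / 2)) => //; last exact: der_cst.
  by move=> s sI; rewrite Qz.
have cz0 : {for (0 : R), continuous (z 0%N)} by apply: der_cont (dz 0%N 0 isT).
have [d d0 hd] := (contP _ _).1 cz0 1 ltr01.
pose t := Num.min (d / 2) (1 / 4).
have t0 : 0 < t by rewrite lt_min; apply/andP; split; lra_from d0.
have [td t4] : t <= d / 2 /\ t <= 1 / 4 by rewrite !ge_min !lexx orbT.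
have tI : 0 < t < 1 / 2 by lra_from t0 t4.
have zt : 0 < z 0%N t.
  have := hd t; rewrite subr0 z00 gtr0_norm// => H.
  have : `|z 0%N t - 1| < 1 by apply: H; lra_from td tI.
  by rewrite ltr_norml; lra_from.
have [vr _] := vI t tI; have vr' : 0 <= v m t < r by lra_from vr.
have fp := nl_f_gt0 vr'; have f2p := nl_f2_gt0 vr.
have := qz t tI; rewrite qE// => /eqP; rewrite mulf_eq0 (gt_eqF zt) /= gt_eqF//.
by rewrite ltr_pwDl// ?mulr_gt0 ?exprn_gt0// mulr_ge0// ltW.
Qed.

End at_critical.
End turning.

(** * The singular end *)

Section singular_end.
Context {R : realType} (F : nonlinearity R).
Local Notation r := (nl_r F).
Local Notation f := (nl_f F).
Implicit Types (m t d e : R).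
Local Notation half t := (`|t| <= 1 / 2).
Local Notation D m := (0 <= m < r).
Variables (lam k : R -> R) (v : R -> R -> R).
Hypothesis pf : profile_family F lam k v.
Local Notation h := (profile_source F lam v).

Lemma primn_le n (g1 g2 : R -> R) T t : continuous g1 -> continuous g2 ->
  (forall x, 0 < x < T -> g1 x <= g2 x) -> 0 <= t <= T ->
  primn n.+1 g1 t <= primn n.+1 g2 t.
Proof.
move=> c1 c2 hg; elim: n t => [|n ih] t tI.
  by apply: prim_le => //; [lra|move=> x xt; apply: hg; lra].
rewrite primnS (primnS n.+1); apply: prim_le; try exact: ct_primn; first lra.
by move=> x xt; apply: ih; lra.
Qed.

Section one_profile.
Variable m : R.
Hypothesis mr : 0 < m < r.
Let Dm : D m. Proof. by move: mr => /andP[/ltW -> ->]. Qed.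
Let y := vjet m (k m) (h m).
Let hp : half_profile F m (lam m) y := pf_half pf mr.
Let dy := (hp_jet hp).1.
Let cy := (hp_jet hp).2.
Let ch : continuous (h m) := ct_h pf Dm.
Let l0 : 0 < lam m := pf_lam pf mr.

Let y4_ge0 t : 0 < t < 1 / 2 -> 0 <= y 4%N t.
Proof. by move=> tI; apply/ltW/(half_y4_gt0 hp). Qed.

(** On [[0, 1 / 4]] the kernel [green_q] is at least [1 / 192], while the whole integral of
    [y'''' * green_q] is [m]. The bound holds however singular [f] becomes near the maximum. *)
Lemma green_quarter : y 3%N (1 / 4) <= 192 * m.
Proof.
have [_ _ y30] := hp_init hp; have [P0 P1] := green_P_ends hp.
have Pm x z : 0 <= x -> x <= z -> z <= 1 / 2 -> green_P y x <= green_P y z.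
  move=> x0 xz z1; apply: (@nondecr_le _ 0 (1 / 2) _ _ (fun t => der_green_P hp (t := t)) (ct_green_P hp) _ x z) => //.
  by move=> t tI; rewrite mulr_ge0 ?y4_ge0// green_q_ge0//; lra.
have q4 t : 0 < t < 1 / 4 -> 1 / 192 <= green_q t.
  move=> tI; have -> : green_q t = 1 / 192 +
      (1 - 4 * t) * (2 + 2 * (4 * t) - (4 * t) ^+ 2) / 384 by rewrite /green_q; field.
  rewrite lerDl; apply: divr_ge0; last exact: ler0n.
  apply: mulr_ge0; first lra.
  have : (4 * t) ^+ 2 <= 1 by rewrite expr_le1//; lra.
  lra.
have a4 : 1 / 4 <= 1 / 4 :> R by rewrite lexx.
have a40 : 0 <= 1 / 4 :> R by lra.
have := @nondecr_le _ 0 (1 / 4) (fun t => green_P y t - 1 / 192 * y 3%N t)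
  (fun t => y 4%N t * green_q t - 1 / 192 * y 4%N t) _ _ _ 0 (1 / 4) (lexx _) a40 a4.
rewrite P0 y30 => H.
have {H} : - m - 1 / 192 * 0 <= green_P y (1 / 4) - 1 / 192 * y 3%N (1 / 4).
  apply: H.
  - move=> x xI; apply: derD; first by apply: der_green_P hp _ _; lra.
    by apply/derN/derZ; apply: dy => //; lra.
  - apply: wctD; first by apply: sub_cc (ct_green_P hp); lra.
    by apply/wctN/wctM; [exact: wct_cst|apply: sub_cc (cy (j := 3) isT); lra].
  - move=> x xI; rewrite [y 4%N x * _]mulrC -mulrBl; apply: mulr_ge0; first by rewrite subr_ge0 q4.
    by apply: y4_ge0; lra.
have := Pm (1 / 4) (1 / 2); rewrite P1 => H.
have : green_P y (1 / 4) <= 0 by apply: H; lra_from.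
lra.
Qed.

Lemma source_antitone s t : 0 < s -> s <= t -> t < 1 / 2 -> y 4%N t <= y 4%N s.
Proof.
move=> s0 st tI.
have sI : 0 <= s <= 1 / 2 by lra.
have tI' : 0 <= t <= 1 / 2 by lra.
rewrite !(hp_ode hp); [|lra|lra]; rewrite ler_pM2l//.
have [ys yt] := (hp_range hp sI, hp_range hp tI').
apply: f_nd; [lra| |lra].
move: st; rewrite le_eqVlt => /predU1P[->//|st].
by apply/ltW/(half_y0_decr hp); lra_from sI st tI'.
Qed.

(** [y''''] is nonincreasing, so [y'''] gains on [[1 / 4, 1 / 2]] at most what it gained on
    [[0, 1 / 4]]. *)
Lemma y3_end_le : y 3%N (1 / 2) <= 384 * m.
Proof.
have [_ _ y30] := hp_init hp.
have h1 : 0 < 1 / 4 :> R by lra.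
have h2 : 1 / 4 < 1 / 2 :> R by lra.
have d1 x : 0 < x < 1 / 4 -> der (y 3%N) x (y 4%N x) by move=> xI; apply: dy => //; lra.
have d2 x : 1 / 4 < x < 1 / 2 -> der (y 3%N) x (y 4%N x) by move=> xI; apply: dy => //; lra.
have [|c1 c1I E1] := MVT_in h1 d1 _; first by apply: sub_cc (cy (j := 3) isT); lra.
have [|c2 c2I E2] := MVT_in h2 d2 _; first by apply: sub_cc (cy (j := 3) isT); lra.
have := @source_antitone c1 c2; have := green_quarter; rewrite y30 in E1.
lra.
Qed.

Lemma y3_bounds t : 0 <= t <= 1 / 2 -> 0 <= y 3%N t <= 384 * m.
Proof.
move=> tI; have [_ _ y30] := hp_init hp; have mono := half_y3_incr hp.
apply/andP; split.
  have [->|t0] := eqVneq t 0; first by rewrite y30.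
  by apply/ltW/(half_y3_gt0 hp); rewrite lt_neqAle eq_sym t0; lra.
have [->|t1] := eqVneq t (1 / 2); first exact: y3_end_le.
have : y 3%N t < y 3%N (1 / 2) by apply: mono; [lra|rewrite lt_neqAle t1; lra|rewrite lexx].
by have := y3_end_le; lra.
Qed.

Let y2E t : y 2%N t = - k m + primn 2 (h m) t. Proof. by []. Qed.

Lemma k_upper : k m <= 192 * m.
Proof.
have [y00 y10 y30] := hp_init hp; have [_ y1e] := hp_end hp.
have h12 : 0 < 1 / 2 :> R by lra.
have [c cI] := MVT_in h12 (dy (j := 1) isT) (cy (j := 1) isT); rewrite y10 y1e => E.
have yc : y 2%N c = 0 by lra.
have c0 : 0 < c by lra.
have d2 x : 0 < x < c -> der (y 2%N) x (y 3%N x) by move=> xI; apply: dy => //; lra.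
have [|c' cI' E'] := MVT_in c0 d2 _; first by apply: sub_cc (cy (j := 2) isT); lra.
have [_ _ y20 _] := vjet_at0 m (k m) ch; rewrite -/y in y20.
have c'I : 0 <= c' <= 1 / 2 by lra.
have := y3_bounds c'I => /andP[_ b].
have : y 3%N c' * (c - 0) <= 384 * m * (1 / 2).
  by apply: ler_pM => //; [have := y3_bounds c'I; lra_from|lra_from cI'|lra_from cI].
by move: E'; rewrite yc y20; lra_from.
Qed.

Lemma v_lower t : 0 <= t <= 1 / 2 -> m - k m * (t ^+ 2 / 2) <= y 0%N t.
Proof.
move=> tI; have [_ _ _] := jet_taylor (hp_jet hp) y4_ge0 tI.
have [E0 E1 E2 E3] := vjet_at0 m (k m) ch; rewrite /y E0 E1 E2 E3; lra.
Qed.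

Lemma k_lower : 8 * m <= k m.
Proof.
have h12 : 0 <= (1 / 2 : R) <= (1 / 2 : R) by rewrite lexx divr_ge0.
have [e0 _] := hp_end hp; have := v_lower h12; rewrite e0 expr2; lra.
Qed.

Lemma v_upper t : 0 <= t <= 1 / 2 -> y 0%N t <= m - 4 * m * t ^+ 2 + 64 * m * t ^+ 3.
Proof.
move=> tI.
have : primn 3 (primn 1 (h m)) t <= primn 3 (fun=> 384 * m) t.
  apply: (@primn_le 2 _ _ (1 / 2)) => //; first exact: ct_primn.
    exact: ct_cst.
  by move=> x xI; have := @y3_bounds x; rewrite /y /vjet; lra.
have -> : primn 3 (primn 1 (h m)) t = primn 4 (h m) t by [].
rewrite primn_cst4; have -> : (3`! = 6)%N by [].
have := k_lower; rewrite /y /vjet => kl.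
have : 8 * m * (t ^+ 2 / 2) <= k m * (t ^+ 2 / 2).
  by apply: ler_wpM2r => //; rewrite divr_ge0// sqr_ge0.
lra.
Qed.

(* [v'''] is nearly the constant [v''' (1/2)] away from [0], hence [v] is
   nearly a cubic; the conditions at [1/2] then determine the constants. *)
Lemma cubic_approx d q : 0 < d <= 1 / 2 -> 0 <= q ->
  (forall t, d < t < 1 / 2 -> h m t <= q) ->
  let e := 384 * m * d + q in
  forall t, 0 <= t <= 1 / 2 -> `|y 2%N t - (- 24 * m + 96 * m * t)| <= 10 * e.
Proof.
move=> dI q0 hq e; pose M := y 3%N (1 / 2).
have h12 : 0 <= (1 / 2 : R) <= (1 / 2 : R) by rewrite lexx divr_ge0.
have M0 : 0 <= M <= 384 * m by exact: y3_bounds.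
have m0 : 0 < m by move: mr => /andP[].
(* The deficit of [v'''] from its end value. It is at most [M] on [[0, d]] and at most [q] beyond,
   so its primitive is at most [e]. *)
pose g t := M - primn 1 (h m) t.
have cg : continuous g by apply: ctD; [exact: ct_cst|apply: ctN; exact: ct_primn].
have g0 t : 0 < t < 1 / 2 -> 0 <= g t.
  move=> tI; rewrite subr_ge0; have := @half_y3_incr _ _ _ _ _ hp t (1 / 2).
  by move=> H; apply: ltW; apply: H; lra_from tI.
have gM t : 0 <= t <= 1 / 2 -> g t <= M by move=> tI; have := y3_bounds tI; rewrite /g /y /vjet; lra_from.
have gq t : d < t < 1 / 2 -> g t <= q.
  move=> tI; have t12 : t < 1 / 2 by lra.
  have d3 x : t < x < 1 / 2 -> der (y 3%N) x (y 4%N x) by move=> xI; apply: dy => //; lra.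
  have [|c cI E] := MVT_in t12 d3 _; first by apply: sub_cc (cy (j := 3) isT); lra_from dI tI.
  have hc : y 4%N c <= q by apply: hq; lra_from tI cI.
  have -> : g t = y 4%N c * (1 / 2 - t) by rewrite -E.
  have : y 4%N c * (1 / 2 - t) <= q * 1.
    by apply: ler_pM => //; [apply: y4_ge0|lra_from cI|lra_from dI tI]; lra.
  by rewrite mulr1.
have dpg t : der (prim g) t (g t) by exact: der_prim.
have cpg : continuous (prim g) by exact: continuous_prim.
have pg0 t : 0 <= t <= 1 / 2 -> 0 <= prim g t.
  move=> tI; have := @primn_le 0 (fun=> 0) g (1 / 2) t (@ct_cst _ 0) cg g0 tI.
  by rewrite primn_cst4 mul0r mul0r.
have pge t : 0 <= t <= 1 / 2 -> prim g t <= e.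
  have first_ s : 0 <= s <= d -> prim g s <= M * s.
    move=> sI; have := @primn_le 0 g (fun=> M) d s cg (@ct_cst _ M) _ sI.
    rewrite primn_cst4 expr1 divr1; apply => x xI; apply: gM; lra_from dI xI.
  have Md s : 0 <= s <= d -> M * s <= 384 * m * d by move=> sI; apply: ler_pM; lra_from M0 sI.
  move=> tI; have [td|dt] := leP t d.
    by have := first_ t; have := Md t; rewrite /e; lra.
  have dg x : d < x < t -> der (prim g) x (g x) by [].
  have [c cI E] := MVT_in dt dg (@cont_within _ _ _ cpg).
  have := first_ d; have := Md d.
  have gc : g c <= q by apply: gq; lra_from tI cI.
  have : g c * (t - d) <= q * 1 by apply: ler_pM => //; [apply: g0|lra_from cI|lra_from dI tI]; lra.
  by rewrite /e; lra_from dI E.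
have e0 : 0 <= e.
  have md : 0 <= m * d by apply: mulr_ge0; [exact: ltW|lra_from dI].
  by rewrite /e; lra.
have E n t : primn n.+1 g t = M / n.+1`!%:R * t ^+ n.+1 - primn n.+2 (h m) t.
  have /funeqP/(_ t) -> := primnB n.+1 (@ct_cst _ M) (@ct_primn _ 1 _ ch).
  rewrite primn_cst4; congr (_ - _).
  by rewrite /primn -iterD addn1.
have bd n t : 0 <= t <= 1 / 2 -> 0 <= primn n.+1 (prim g) t <= e / n.+1`!%:R * t ^+ n.+1.
  move=> tI; apply/andP; split.
    have := @primn_le n (fun=> 0) (prim g) (1 / 2) t (@ct_cst _ 0) cpg _ tI.
    by rewrite primn_cst4 !mul0r; apply => x xI; apply: pg0; lra_from xI.
  have := @primn_le n (prim g) (fun=> e) (1 / 2) t cpg (@ct_cst _ e) _ tI.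
  by rewrite primn_cst4; apply => x xI; apply: pge; lra_from xI.
have pE n : primn n.+1 (prim g) = primn n.+2 g by rewrite /primn -[in RHS]addn1 iterD.
have b3 := bd 0%N _ h12; have b4 := bd 1%N _ h12.
rewrite pE E in b3; rewrite pE E in b4.
have f2 : (2`! = 2)%N by []. have f3 : (3`! = 6)%N by []. have f1 : (1`! = 1)%N by [].
rewrite f1 f2 in b3; rewrite f2 f3 in b4.
have [v0e v1e] := hp_end hp; rewrite /y /vjet in v0e v1e.
have s2 : (1 / 2) ^+ 2 = 1 / 4 :> R by field.
have s3 : (1 / 2) ^+ 3 = 1 / 8 :> R by field.
rewrite s2 expr1 in b3; rewrite s2 s3 in b4; rewrite s2 in v0e.
move=> t tI; have := pg0 t tI; have := pge t tI.
have -> : prim g t = primn 1 g t by [].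
rewrite E f1 expr1 y2E; set p3 := primn 3 _ _ in b3 v1e; set p4 := primn 4 _ _ in b4 v0e.
set p2 := primn 2 _ _.
(* [E3] and [E4] are the second and third primitives of [g] at [1 / 2]. The two end conditions
   become a linear system for [M] and [k], with solution [96 * m] and [24 * m] up to these
   errors. *)
pose E3 := M / 2%:R * (1 / 4) - p3; pose E4 := M / 6%:R * (1 / 8) - p4.
have E3b : 0 <= E3 <= e / 2 by rewrite /E3; lra_from b3.
have E4b : 0 <= E4 <= e / 8 by rewrite /E4; lra_from b4.
have ME : M = 96 * m + 24 * E3 - 96 * E4 by rewrite /E3 /E4; lra_from v1e v0e.
have kE : k m = 24 * m + 4 * E3 - 24 * E4 by rewrite /E3 /E4; lra_from v1e v0e.
have tb : `|(M - 96 * m) * t| <= 6 * e.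
  rewrite normrM (ger0_norm (x := t)); last lra_from tI.
  have : `|M - 96 * m| <= 12 * e by rewrite ME ler_norml; lra_from E3b E4b.
  move=> hb; have : `|M - 96 * m| * t <= 12 * e * (1 / 2) by apply: ler_pM => //; lra_from tI.
  lra_from.
move: tb; rewrite mulrBl !ler_norml kE; lra_from E3b E4b.
Qed.

End one_profile.

(** For [m] within [s ^+ 2] of [r], the parabola below [v] keeps [v] within [K * s ^+ 2] of [r] on
    [[0, s]]. By [nl_sing] the source there is at least [lam * c / (K * s ^+ 2)], so [v'''] at [s]
    is at least [lam * c / (K * s)]. As it is at most [192 * m], [lam] is of order [s]. *)
Lemma lam_vanish e : 0 < e -> exists2 d, 0 < d & forall m, r - d < m < r -> lam m < e.
Proof.
move=> e0; have r0 := nl_r_gt0 F.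
have [c c0 [r1 r1r hc]] := nl_sing F.
(* The [1] accounts for [r - m < s ^+ 2], and [96 * r] for the parabola, as [k m <= 192 * m]. *)
have [K K0 KE] : exists2 K, 0 < K & K = 1 + 96 * r by exists (1 + 96 * r) => //; lra_from r0.
have [B B0 BE] : exists2 B, 0 < B & B = 192 * r * K.
  by exists (192 * r * K); [have := mulr_gt0 r0 K0; clear - pf; lra|].
have rr1 : 0 < r - r1 by lra.
have B2 : 0 < 2 * B by lra.
have K2 : 0 < 2 * K by lra.
have ec := mulr_gt0 e0 c0.
have [s [s0 s1 s2 [s3 s4]]] : exists s, [/\ 0 < s, s <= 1 / 4, s <= (r - r1) / (2 * K)
    & s <= r / 2 /\ s <= e * c / (2 * B)].
  exists (Num.min (1 / 4) (Num.min ((r - r1) / (2 * K)) (Num.min (r / 2) (e * c / (2 * B))))).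
  by rewrite !ge_min !lexx !orbT !lt_min !divr_gt0.
have ss : s * s <= s * (1 / 4) by apply: ler_wpM2l => //; exact: ltW.
have ss0 : 0 < s * s by rewrite mulr_gt0.
exists (s * s) => // m mI; have mr : 0 < m < r by lra.
have hp := pf_half pf mr; set y := vjet m (k m) (h m) in hp.
have vl x : 0 <= x <= s -> r - s * s * K <= y 0%N x.
  move=> xI; have xI' : 0 <= x <= 1 / 2 by lra_from s1 xI.
  have := v_lower mr xI'; rewrite -/y; have := k_upper mr => ku.
  have x2 : x ^+ 2 / 2 <= s * s / 2.
    by rewrite expr2 ler_pM2r ?invr_gt0//; apply: ler_pM; clear - pf xI; lra.
  have x20 : 0 <= x ^+ 2 / 2 by rewrite divr_ge0// sqr_ge0.
  have k0 := k_lower mr.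
  have : k m * (x ^+ 2 / 2) <= 192 * r * (s * s / 2) by apply: ler_pM => //; clear - pf k0 ku mr; lra.
  by rewrite KE; clear - pf mI; lra.
have [dy cy] := hp_jet hp; have [_ _ y30] := hp_init hp.
have d3 x : 0 < x < s -> der (y 3%N) x (y 4%N x) by move=> xI; apply: dy => //; clear - pf xI s1; lra.
have [|x xI E] := MVT_in s0 d3 _; first by apply: sub_cc (cy 3%N isT); clear - pf s1; lra.
have sI : 0 <= s <= 1 / 4 by clear - pf s0 s1; lra.
have y3s : y 3%N s <= 192 * m.
  have [sE|sn] := eqVneq s (1 / 4); first by rewrite sE; exact: green_quarter mr.
  have := half_y3_incr hp (s := s) (t := 1 / 4).
  have := green_quarter mr; rewrite -/y => gq H.
  have : y 3%N s < y 3%N (1 / 4) by apply: H; [exact: ltW|rewrite lt_neqAle sn|clear - pf; lra].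
  by clear - pf gq; lra.
have xI' : 0 <= x <= s by clear - pf xI; lra.
have xI2 : 0 <= x <= 1 / 2 by clear - pf xI s1; lra.
have xI3 : 0 < x < 1 / 2 by clear - pf xI s1; lra.
have vx := vl x xI'; have vr := hp_range hp xI2.
have sK : s * (2 * K) <= r - r1 by rewrite -ler_pdivlMr.
have ssK : s * s * K <= s * (1 / 4) * K by apply: ler_wpM2r => //; exact: ltW.
have v1 : r1 < y 0%N x < r by have sK0 : 0 < s * K by [exact: mulr_gt0]; lra.
have fv := hc _ v1.
have fv' : c <= s * s * K * f (y 0%N x).
  apply: le_trans fv _; apply: ler_wpM2r; last by clear - pf vx; lra.
  by apply/ltW/nl_f_gt0.
have l0 := pf_lam pf mr.
have g1 : lam m * c <= B * s.
  apply: (@le_trans _ _ (lam m * (s * s * K * f (y 0%N x)))); first by rewrite ler_pM2l.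
  have -> : lam m * (s * s * K * f (y 0%N x)) = (y 4%N x * s) * (K * s).
    by rewrite (hp_ode hp)//; ring.
  rewrite subr0 y30 subr0 in E; rewrite -E.
  have -> : B * s = 192 * r * (K * s) by rewrite BE; ring.
  by apply: ler_wpM2r; [exact/ltW/mulr_gt0|clear - pf y3s mI; lra].
have g2 : s * (2 * B) <= e * c by rewrite -ler_pdivlMr.
have g3 := mulr_gt0 B0 s0.
by rewrite -(ltr_pM2r c0); move: g1 g2 g3 ec; clear=> *; lra.
Qed.

(** Beyond a fixed [s], [v_upper] keeps [v] below [r - r * s ^+ 2], uniformly for [m] near [r].
    There [f v] is bounded by a constant, so the vanishing of [lam] makes the source small and
    [cubic_approx] applies. *)
Lemma second_derivative_limit e : 0 < e -> exists2 d, 0 < d & forall m, r - d < m < r ->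
  forall t, 0 <= t <= 1 / 2 ->
  `|vjet m (k m) (h m) 2%N t - (- 24 * r + 96 * r * t)| <= e.
Proof.
move=> e0; have r0 := nl_r_gt0 F.
have S0 : 0 < 20 * (384 * r + 1) * 2 by lra.
(* [s <= 1 / 64] lets a quarter of the quadratic term of [v_upper] absorb the cubic one; the other
   bound makes the error of [cubic_approx] at most [e / 4]. *)
have [s [s0 s1 s2']] : exists s, [/\ 0 < s, s <= 1 / 64 & s * (20 * (384 * r + 1) * 2) <= e].
  have h64 : 0 < 1 / 64 :> R by lra.
  exists (Num.min (1 / 64) (e / (20 * (384 * r + 1) * 2))); rewrite -(ler_pdivlMr _ _ S0).
  by rewrite !ge_min !lexx orbT lt_min h64 (divr_gt0 e0 S0).
have ss0 : 0 < s ^+ 2 by exact: exprn_gt0.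
have ss1 : s ^+ 2 <= 1 by rewrite expr_le1//; lra_from s1 s0.
have rs : 0 <= r - r * s ^+ 2 < r.
  have a1 : r * s ^+ 2 <= r * 1 by rewrite ler_pM2l.
  have a2 : 0 < r * s ^+ 2 by rewrite mulr_gt0.
  lra.
have [A [A0 AE]] : exists A, 0 < A /\ A = f (r - r * s ^+ 2) by exists (f (r - r * s ^+ 2)); split=> //; exact: nl_f_gt0.
have sA : 0 < s / A by rewrite divr_gt0.
have [d1 d10 hd1] := lam_vanish sA.
have r2 : 0 < r / 2 by clear - pf r0; lra.
have e240 : 0 < e / 240 by clear - pf e0; lra.
have [d [d0 dd1 dd2 dd3]] : exists d, [/\ 0 < d, d <= d1, d <= r / 2 & d <= e / 240].
  exists (Num.min d1 (Num.min (r / 2) (e / 240))); rewrite !ge_min !lexx !orbT !lt_min d10 r2.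
  by split.
exists d => // m mI t tI; have mr : 0 < m < r by lra_from dd2 mI.
have lA : lam m * A < s by rewrite -ltr_pdivlMr//; apply: hd1; lra_from dd1 mI.
have hp := pf_half pf mr; have l0 := pf_lam pf mr.
have hq u : s < u < 1 / 2 -> h m u <= s.
  move=> uI; have uI' : 0 < u < 1 / 2 by clear - pf uI s0; lra.
  have sI : 0 < s < 1 / 2 by clear - pf s0 s1; lra.
  have := @source_antitone m mr s u; rewrite (hp_ode hp sI) => H.
  apply: le_trans (H s0 _ _) _; [by case/andP: uI => /ltW|by case/andP: uI|].
  apply: le_trans (ltW lA); rewrite AE ler_pM2l//.
  have sI' : 0 <= s <= 1 / 2 by clear - pf s0 s1; lra.
  have vr := hp_range hp sI'; apply: f_nd; [by case/andP: vr| |by case/andP: rs].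
  have := v_upper mr sI'; move=> /le_trans; apply.
  have s3 : 64 * m * s ^+ 3 <= m * s ^+ 2.
    have -> : 64 * m * s ^+ 3 = (64 * s) * (m * s ^+ 2) by ring.
    rewrite -[leRHS]mul1r; apply: ler_wpM2r; last by clear - pf s1; lra.
    by apply: mulr_ge0; [case/andP: mr => /ltW|exact: ltW].
  have : r * s ^+ 2 <= 2 * (m * s ^+ 2) by rewrite mulrA ler_pM2r//; clear - pf dd2 mI; lra.
  have : 0 <= m * s ^+ 2 by apply: mulr_ge0; [case/andP: mr => /ltW|exact: ltW].
  lra_from mr s3.
have dI : 0 < s <= 1 / 2 by lra_from s0 s1.
have := cubic_approx mr dI (ltW s0) hq tI.
have ms : 384 * m * s <= 384 * r * s by apply: ler_wpM2r; clear - pf s0 mr; lra.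
set y2 := vjet _ _ _ _ _ => hy.
have : `|(r - m) * t| <= r - m.
  have rm : 0 <= r - m by rewrite subr_ge0; case/andP: mr => _ /ltW.
  case/andP: tI => t0 t1; have t2 : t <= 1 by clear - pf t1; lra.
  by rewrite ger0_norm ?mulr_ge0// -[leRHS]mulr1 ler_wpM2l.
move: hy; rewrite !ler_norml mulrBl; lra.
Qed.

(** The second derivative is integrated from the point where the limit and the profile agree: slope
    zero at [0], then value zero at [1 / 2]. *)
Lemma profile_limit e : 0 < e -> exists2 d, 0 < d & forall m, r - d < m < r ->
  forall t, 0 <= t <= 1 / 2 ->
  [/\ `|vjet m (k m) (h m) 0%N t - r * (1 - 12 * t ^+ 2 + 16 * t ^+ 3)| <= e,
      `|vjet m (k m) (h m) 1%N t - r * (- 24 * t + 48 * t ^+ 2)| <= e &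
      `|vjet m (k m) (h m) 2%N t - r * (- 24 + 96 * t)| <= e].
Proof.
move=> e0; have r0 := nl_r_gt0 F; have [d d0 hd] := second_derivative_limit e0.
exists (Num.min d r); first by rewrite lt_min d0.
move=> m mI; have [md mr] : r - d < m < r /\ 0 < m < r.
  have [a b] : Num.min d r <= d /\ Num.min d r <= r by rewrite !ge_min !lexx orbT.
  by split; lra_from mI a b.
have hp := pf_half pf mr; set y := vjet m (k m) (h m) in hp *.
have [dy cy] := hp_jet hp; have [y00 y10 _] := hp_init hp; have [y0e y1e] := hp_end hp.
have h2 t : 0 <= t <= 1 / 2 -> `|y 2%N t - r * (- 24 + 96 * t)| <= e.
  move=> tI; have -> : r * (- 24 + 96 * t) = - 24 * r + 96 * r * t by ring.
  exact: hd.
have dW1 x : der (fun t => r * (- 24 * t + 48 * t ^+ 2)) x (r * (- 24 + 96 * x)).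
  by apply: der_eq; [apply: derZ; der_auto|rewrite /=; ring].
have dW0 x : der (fun t => r * (1 - 12 * t ^+ 2 + 16 * t ^+ 3)) x (r * (- 24 * x + 48 * x ^+ 2)).
  by apply: der_eq; [apply: derZ; der_auto|rewrite /=; ring].
have h1 t : 0 <= t <= 1 / 2 -> `|y 1%N t - r * (- 24 * t + 48 * t ^+ 2)| <= e.
  move=> tI; have [->|t0] := eqVneq t 0.
    by rewrite y10 expr0n/= !mulr0 addr0 mulr0 subr0 normr0 ltW.
  have t0' : 0 < t by rewrite lt_neqAle eq_sym t0; lra_from tI.
  have [x xI||c cI] := @MVT_in _ 0 t (fun t => y 1%N t - r * (- 24 * t + 48 * t ^+ 2))
    (fun t => y 2%N t - r * (- 24 + 96 * t)) t0' _ _.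
  - by apply: derD; [apply: dy => //; lra_from tI xI|exact: derN].
  - apply: wctD; first by apply: sub_cc (cy 1%N isT); lra_from tI.
    by apply/wctN/der_within/dW1.
  rewrite y10 expr0n/= !mulr0 addr0 mulr0 subrr !subr0 => ->.
  rewrite normrM (ger0_norm (x := t)); last lra_from cI.
  have cI' : 0 <= c <= 1 / 2 by lra_from tI cI.
  by rewrite -[leRHS]mulr1; apply: ler_pM => //; [clear - pf tI; lra|exact: h2|clear - pf tI; lra].
move=> t tI; split; [|exact: h1|exact: h2].
have [->|t1] := eqVneq t (1 / 2).
  have -> : r * (1 - 12 * (1 / 2) ^+ 2 + 16 * (1 / 2) ^+ 3) = 0 by field.
  by rewrite y0e subr0 normr0 ltW.
have t1' : t < 1 / 2 by rewrite lt_neqAle t1; lra_from tI.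
have [x xI||c cI] := @MVT_in _ t (1 / 2) (fun t => y 0%N t - r * (1 - 12 * t ^+ 2 + 16 * t ^+ 3))
    (fun t => y 1%N t - r * (- 24 * t + 48 * t ^+ 2)) t1' _ _.
- by apply: derD; [apply: dy => //; lra_from tI xI|exact: derN].
- apply: wctD; first by apply: sub_cc (cy 0%N isT); lra_from tI.
  by apply/wctN/der_within/dW0.
have -> : r * (1 - 12 * (1 / 2) ^+ 2 + 16 * (1 / 2) ^+ 3) = 0 by field.
rewrite y0e subrr sub0r => E; rewrite -normrN E normrM (ger0_norm (x := 1 / 2 - t)); last lra_from cI.
have cI' : 0 <= c <= 1 / 2 by lra_from tI cI.
by rewrite -[leRHS]mulr1; apply: ler_pM => //; [clear - pf tI; lra|exact: h1|clear - pf tI; lra].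
Qed.

End singular_end.

(** * From the hypotheses on [f] to a [nonlinearity] *)

Section nonlinearity_exists.
Context {R : realType}.

Lemma nonlinearity_exists (r : R) (f : R -> R) : 0 < r -> Cn `[0, r[ 2 f ->
  (forall u, 0 <= u < r -> 0 < f u) ->
  (forall u, 0 < u < r -> 0 < derive_in_n `[0, r[ 1 f u) ->
  (forall u, 0 < u < r -> 0 < derive_in_n `[0, r[ 2 f u) ->
  (0 < limf_einf (fun u : R => ((r - u) * f u)%:E) r^'-)%E ->
  exists2 F : nonlinearity R, nl_r F = r & nl_f F = f.
Proof.
move=> r0 fC f0 f10 f20 flim.
have sing : exists2 c, 0 < c & exists2 r1, r1 < r &
    forall u, r1 < u < r -> c <= (r - u) * f u.
  (* A positive lower limit provides a left neighbourhood of [r] with positive infimum; if that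
     infimum is infinite, the constant [1] serves. *)
  move: flim; rewrite limf_einfE => /ereal_sup_gt[_ [V rV <-]] V0.
  have [c c0 cV] : exists2 c : R, 0 < c & forall u, V u -> c <= (r - u) * f u.
    have [x [x0 xV]] : exists x, (0 < x)%R /\ (x%:E <= ereal_inf [set ((r - u) * f u)%:E | u in V])%E.
      move: V0; case: (ereal_inf _) => [x|_|//].
        by rewrite lte_fin => x0; exists x.
      by exists 1; rewrite ltr01 leey.
    exists x => // u Vu; rewrite -lee_fin; apply: le_trans xV _.
    by apply: ereal_inf_lbound; exists u.
  exists c => //; move: rV; rewrite /at_left /within /= => /nbhs_ballP[d /= d0 dV].
  exists (r - d); first by rewrite ltrBlDr ltrDl.
  move=> u /andP[u1 u2]; apply: cV; apply: dV => //.
  by rewrite /ball /= ger0_norm; [rewrite ltrBlDl addrC -ltrBlDl|rewrite subr_ge0 ltW].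
have A u v : 0 < v < r -> 0 < u < r -> `[0, r[%classic v.
  by move=> /andP[/ltW v0 vr] _; rewrite /= in_itv/= v0.
have d (j : nat) u : (j < 2)%N -> 0 < u < r ->
    der (derive_in_n `[0, r[ j f) u (derive_in_n `[0, r[ j.+1 f u).
  by move=> j2 ur; apply: (Cn_der fC j2 ur) => v vr; exact: A ur.
by exists (Nonlinearity r0 (fC.2 0%N isT) (fC.2 1%N isT) (fC.2 2%N isT)
  (fun u => d 0%N u isT) (fun u => d 1%N u isT) f0 f10 f20 sing).
Qed.

End nonlinearity_exists.

(** * Monotonicity of [lam] on both sides of the turn *)

Section turning_point.
Context {R : realType} (F : nonlinearity R).
Local Notation r := (nl_r F).
Local Notation D m := (0 <= m < r).
Implicit Types (m a b c x y : R).

Lemma uder_der (g g' : R -> R) m : C1 r (fun m _ => g m) (fun m _ => g' m) ->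
  0 < m < r -> der g m (g' m).
Proof.
move=> [_ _ hu] mr; apply/derP => e e0.
have Dm : D m by case/andP: mr => /ltW -> ->.
have /NDP[d d0 hd] := hu m Dm e e0.
have half0 : `|0 : R| <= 1 / 2 by rewrite normr0 divr_ge0.
exists (Num.min d (Num.min m (r - m))); first by rewrite !lt_min d0 subr_gt0.
move=> y; rewrite !lt_min => /and3P[y1 y2 y3].
rewrite mulrC; apply: hd half0 => //.
by move: y2 y3; rewrite !ltr_norml; lra.
Qed.

Lemma ucont_within (g : R -> R) : C0 r (fun m _ => g m) -> {within `[0, r[, continuous g}.
Proof.
move=> [_ hu]; apply/withinC_P => m Im e e0.
have Dm : D m by move: Im; rewrite /= in_itv.
have e2 : 0 < e / 2 by exact: divr_gt0.
have /NDP[d d0 hd] := hu m Dm _ e2.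
have half0 : `|0 : R| <= 1 / 2 by rewrite normr0 divr_ge0.
exists d => // y; rewrite /= in_itv/= => Iy yd; apply: le_lt_trans (hd y Iy yd 0 half0) _.
by rewrite ltr_pdivrMr// ltr_pMr// ltr1n.
Qed.

Variables (lam k : R -> R) (v : R -> R -> R).
Variables (l1 l2 k1 k2 : R -> R) (v1 v2 : R -> R -> R).
Hypothesis sf : smooth_family F lam k v l1 l2 k1 k2 v1 v2.
Let pf := sf_pf sf.

Lemma ct_lam : {within `[0, r[, continuous lam}.
Proof. exact: ucont_within (C1_C0 (sf_l1 sf)). Qed.

(** At an interior minimum [l1] vanishes, so [turning] makes [l2] negative and [lam] decreases
    strictly just to the right. *)
Lemma no_local_min a b c : 0 <= a -> a < b -> b < c -> c < r ->
  ~ (forall y, a <= y <= c -> lam b <= lam y).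
Proof.
move=> a0 ab bc cr hmin.
have I y : a < y < c -> 0 < y < r.
  by case/andP=> ay yc; rewrite (le_lt_trans a0 ay) (lt_trans yc cr).
have bI : a < b < c by rewrite ab.
have dl y : a < y < c -> der lam y (l1 y) by move=> /I; exact: uder_der (sf_l1 sf).
have l10 : l1 b = 0.
  by apply: der_min bI (dl b bI) _ => y /andP[ay yc]; apply: hmin; rewrite !ltW.
have l2b : l2 b < 0 by exact: (turning sf (I b bI) l10).
have dl1 : der l1 b (l2 b) by apply: uder_der (sf_l2 sf) (I b bI).
have /derP/(_ (- l2 b / 2)) := dl1; rewrite divr_gt0 ?oppr_gt0// => /(_ isT)[d d0 hd].
have [y [yb yc yd]] : exists y, [/\ b < y, y < c & y < b + d].
  exists (b + Num.min d (c - b) / 2).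
  have m0 : 0 < Num.min d (c - b) by rewrite lt_min d0 subr_gt0.
  have [m1 m2] : Num.min d (c - b) <= d /\ Num.min d (c - b) <= c - b by rewrite !ge_min !lexx orbT.
  by split; lra.
have dy z : b < z < y -> der lam z (l1 z).
  by move=> zI; apply: dl; lra.
have [|z zI E] := MVT_in yb dy _.
  by apply: sub_r ct_lam; [exact: le_trans (ltW ab)|exact: lt_trans cr].
have l1z : l1 z < 0.
  have : `|z - b| < d by rewrite ger0_norm; lra.
  move=> /hd; rewrite l10 subr0 (ger0_norm (x := z - b)); last lra.
  have zb : 0 < - l2 b * (z - b) by apply: mulr_gt0; lra.
  by rewrite ler_norml; lra.
have : lam b <= lam y by apply: hmin; lra.
have : l1 z * (y - b) < 0 by rewrite nmulr_rlt0 ?subr_gt0.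
lra.
Qed.

Lemma lam_quasiconcave a b c : 0 <= a -> a < b -> b < c -> c < r ->
  lam a < lam b \/ lam c < lam b.
Proof.
move=> a0 ab bc cr; have ac : a <= c by lra.
have cl : {within `[a, c], continuous lam} by apply: sub_r ct_lam.
have [x] := EVT_min ac cl; rewrite in_itv/= => /andP[ax xc] hx.
have I y : a <= y <= c -> lam x <= lam y by move=> yI; apply: hx; rewrite in_itv.
have xb : lam x < lam b.
  rewrite ltNge; apply/negP => h; apply: (no_local_min a0 ab bc cr) => y yI.
  exact: le_trans h (I y yI).
have [<-|xa] := eqVneq x a; first by left.
have [<-|xc'] := eqVneq x c; first by right.
have ax' : a < x by rewrite lt_neqAle eq_sym xa.
have xc'' : x < c by rewrite lt_neqAle xc'.
by have := no_local_min a0 ax' xc'' cr I.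
Qed.

Lemma lam_shape : exists2 m0, 0 < m0 < r &
  (forall x y, 0 <= x -> x < y -> y <= m0 -> lam x < lam y) /\
  (forall x y, m0 <= x -> x < y -> y < r -> lam y < lam x).
Proof.
have r0 := nl_r_gt0 F; have r2 : 0 < r / 2 < r by lra.
(* Within [d] of [r], [lam] is below [lam (r / 2)]; hence a maximum over [[0, b]] is a maximum over
   [[0, r[]. *)
have [d d0 hd] := lam_vanish pf (pf_lam pf r2).
pose b := Num.max (r / 2) (r - d / 2).
have [b1 b2] : r / 2 <= b /\ r - d / 2 <= b by rewrite !le_max !lexx orbT.
have br : b < r by rewrite gt_max; apply/andP; split; lra.
have b0 : 0 <= b by lra.
have [m0] := EVT_max b0 (sub_r (lexx 0) br ct_lam); rewrite in_itv/= => m0I hm0.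
have m0r : m0 < r by lra.
have hmax y : 0 <= y < r -> lam y <= lam m0.
  move=> yI; have [yb|by_] := leP y b; first by apply: hm0; rewrite in_itv/= yb andbT; lra.
  apply: (@le_trans _ _ (lam (r / 2))); first by apply/ltW/hd; lra.
  by apply: hm0; rewrite in_itv/=; lra.
have m00 : 0 < m0.
  have [E|m00] := eqVneq m0 0; last by lra.
  have := hmax (r / 2) _; rewrite E (pf_lam0 pf) => h.
  have := pf_lam pf r2; have : lam (r / 2) <= 0 by apply: h; lra.
  lra.
exists m0; first by rewrite m00.
have inc x y : 0 <= x -> x < y -> y < m0 -> lam x < lam y.
  move=> x0 xy ym; have [//|h] := lam_quasiconcave x0 xy ym m0r.
  have := hmax y _; have yI : 0 <= y < r by lra.
  by move=> /(_ yI); lra.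
have dec x y : m0 < x -> x < y -> y < r -> lam y < lam x.
  move=> mx xy yr; have [h|//] := lam_quasiconcave (ltW m00) mx xy yr.
  have xI : 0 <= x < r by lra.
  by have := hmax x xI; lra.
split=> x y.
- move=> x0 xy; rewrite le_eqVlt => /predU1P[E|]; last exact: inc.
  (* At the turn itself strictness is gained by passing through a midpoint, since [lam m0] is only
     known to be a maximum. *)
  have zI : 0 <= (x + y) / 2 < r by lra.
  apply: lt_le_trans (inc x ((x + y) / 2) x0 _ _) _; [lra|lra|].
  by rewrite E; apply: hmax; rewrite -E.
- rewrite le_eqVlt => /predU1P[E|]; last exact: dec.
  move=> xy yr; have zI : 0 <= (x + y) / 2 < r by lra.
  apply: lt_le_trans (dec ((x + y) / 2) y _ _ yr) _; [lra|lra|].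
  by rewrite -E; apply: hmax; rewrite E.
Qed.

End turning_point.

(** * The curve *)

Section relative_equality.
Context {R : realType} {V : normedModType R}.
Implicit Types (A : set R) (g h : R -> V).

Lemma eq_derive_in_n A g h j : {in A, g =1 h} ->
  {in A, derive_in_n A j g =1 derive_in_n A j h}.
Proof. by move=> gh; elim: j => [//|j ih]; exact: eq_derive_in ih. Qed.

Lemma eq_Cn A n g h : {in A, g =1 h} -> Cn A n g -> Cn A n h.
Proof.
move=> gh [dg cg]; split=> [j jn x Ax|j jn].
  by apply: (eq_derivable_in (eq_derive_in_n j gh)) => //; exact: dg.
apply: (@subspace_eq_continuous _ _ _ (derive_in_n A j g : subspace A -> V)).
  by move=> y yA; exact: eq_derive_in_n.
exact: cg.
Qed.

Lemma co_segment_limit_point : `[(0:R), 1[%classic `<=` limit_point `[(0:R), 1[%classic.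
Proof.
move=> x /=; rewrite in_itv/= => /andP[x0 x1] U /nbhs_ballP[e /= e0 eU].
pose d := Num.min e (1 - x) / 2.
have m0 : 0 < Num.min e (1 - x) by rewrite lt_min e0 subr_gt0.
have [m1 m2] : Num.min e (1 - x) <= e /\ Num.min e (1 - x) <= 1 - x by rewrite !ge_min !lexx orbT.
have d0 : 0 < d by exact: divr_gt0.
exists (x + d); split.
- by rewrite gt_eqF// ltrDl.
- by rewrite /= in_itv/=; apply/andP; rewrite /d; split; lra.
- by apply: eU; rewrite /ball /= opprD addrA subrr sub0r normrN gtr0_norm// /d; lra.
Qed.

(* [P j] is the j-th derivative of [P 0] on [0, r[; the arc runs through it
   at constant speed [r]. *)
Lemma rescaled_Cn (r : R) (P : nat -> R -> V) n : 0 < r ->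
  (forall j m0 e, (j < n)%N -> 0 <= m0 < r -> 0 < e -> \forall m \near ND r m0,
     `|P j m - P j m0 - (m - m0) *: P j.+1 m0| <= e * `|m - m0|) ->
  (forall j m0 e, (j <= n)%N -> 0 <= m0 < r -> 0 < e -> \forall m \near ND r m0,
     `|P j m - P j m0| <= e) ->
  Cn `[0, 1[ n (fun s => P 0%N (r * s)) /\
  forall j, (j <= n)%N -> forall s, 0 <= s < 1 ->
    derive_in_n `[0, 1[ j (fun s => P 0%N (r * s)) s = r ^+ j *: P j (r * s).
Proof.
move=> r0 dP cP; pose G (j : nat) s := r ^+ j *: P j (r * s).
have D s : `[0, 1[%classic s -> 0 <= r * s < r.
  by rewrite /= in_itv/= => /andP[s0 s1]; rewrite mulr_ge0 ?(ltW r0)//= gtr_pMr.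
have rs x y : r * y - r * x = r * (y - x) by rewrite mulrBr.
have close d x y : 0 < d -> `|y - x| < d / r -> `|r * y - r * x| < d.
  by move=> d0 h; rewrite rs normrM gtr0_norm// mulrC -ltr_pdivlMr.
have [||CG dG] := @Cn_chain _ V `[0, 1[%classic n G co_segment_limit_point.
- move=> j jn x xI; apply/slope_in_cvgP => e e0.
  have e1 : 0 < e / r ^+ j.+1 by rewrite divr_gt0 ?exprn_gt0.
  have /NDP[d d0 hd] := dP j _ _ jn (D x xI) e1.
  exists (d / r) => [|y yI yx]; first exact: divr_gt0.
  have := hd _ (D y yI) (close _ _ _ d0 yx); rewrite rs.
  have -> : G j y - G j x - (y - x) *: G j.+1 x =
      r ^+ j *: (P j (r * y) - P j (r * x) - (r * (y - x)) *: P j.+1 (r * x)).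
    rewrite /G !scalerBr !scalerA; congr (_ - _ *: _); rewrite exprSr; ring.
  have rj : 0 < r ^+ j by exact: exprn_gt0.
  rewrite [X in _ <= _ * X]normrM (gtr0_norm r0) normrZ (gtr0_norm rj) => h.
  apply: (le_trans (ler_wpM2l (ltW rj) h)); rewrite exprSr le_eqVlt; apply/orP; left; apply/eqP.
  by field; rewrite !gt_eqF.
- move=> j jn; apply/withinC_P => x xI e e0.
  have e1 : 0 < e / 2 / r ^+ j by rewrite !divr_gt0 ?exprn_gt0.
  have /NDP[d d0 hd] := cP j _ _ jn (D x xI) e1.
  exists (d / r) => [|y yI yx]; first exact: divr_gt0.
  have := hd _ (D y yI) (close _ _ _ d0 yx); rewrite ler_pdivlMr ?exprn_gt0// => h.
  rewrite /G -scalerBr normrZ gtr0_norm ?exprn_gt0// mulrC; apply: le_lt_trans h _.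
  by rewrite ltr_pdivrMr// ltr_pMr// ltr1n.
have E : forall s, s \in `[(0:R), 1[%classic -> G 0%N s = P 0%N (r * s).
  by move=> s _; rewrite /G expr0 scale1r.
split; first exact: eq_Cn E CG.
move=> j jn s sI; have sA : s \in `[0, 1[%classic by rewrite inE /= in_itv.
by rewrite -(eq_derive_in_n j E)// dG.
Qed.

End relative_equality.

Section centred_jets.
Context {R : realType}.
Local Notation I01 := (`[0%R, 1%R]%classic : set R).
Implicit Types (y : nat -> R -> R) (u : clamped R).

Definition centred y : Prop :=
  [/\ forall j t, (j < 4)%N -> der (y j) t (y j.+1 t), continuous (y 4%N),
      forall j, (j <= 1)%N -> y j (1 / 2) = 0
    & forall j, (j <= 1)%N -> y j (- (1 / 2)) = 0].

(** The shifted function extended by zero, as elements of [clamped R] are represented. The default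
    zero of [insubd] is returned unless this function is clamped, which [centred] guarantees. *)
Definition centred_clamped y : clamped R :=
  insubd (0 : clamped R) (fun x => if 0 <= x <= 1 then y 0%N (x - 1 / 2) else 0).

Lemma der_shift (g : R -> R) c x d : der g (x - c) d -> der (fun x => g (x - c)) x d.
Proof.
move=> dg; apply: der_eq.
  exact: (@der_comp _ g (fun x => x - c) x d _ dg (derD (der_id x) (der_cst (- c) x))).
by rewrite addr0 mulr1.
Qed.

Lemma shifted_Cn n y : (forall j t, (j < n)%N -> der (y j) t (y j.+1 t)) ->
  continuous (y n) -> let g x := y 0%N (x - 1 / 2) in
  Cn I01 n g /\ forall j x, (j <= n)%N -> 0 <= x <= 1 -> derive_in_n I01 j g x = y j (x - 1 / 2).
Proof.
move=> dy cy g; pose G (j : nat) x := y j (x - 1 / 2).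
have cyj j : (j <= n)%N -> continuous (y j).
  rewrite leq_eqVlt => /predU1P[->//|jn] t; exact: der_cont (dy j t jn).
have [||CG dG] := @Cn_chain _ R I01 n G segment01_limit_point.
- by move=> j jn x _; apply/der_slope_in/der_shift/dy.
- move=> j jn; apply/cont_within/(ct_comp (cyj j jn)).
  by apply: ctD; [exact: ct_id|exact: ct_cst].
by split=> // j x jn xI; rewrite dG// inE /= in_itv.
Qed.

Lemma centred_clampedP y : centred y ->
  (forall x, 0 <= x <= 1 -> centred_clamped y x = y 0%N (x - 1 / 2)) /\
  forall j x, (j <= 4)%N -> 0 <= x <= 1 ->
    derive_in_n I01 j (centred_clamped y) x = y j (x - 1 / 2).
Proof.
move=> [dy cy yr yl].
pose U x := if 0 <= x <= 1 then y 0%N (x - 1 / 2) else 0.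
have [Cg dg] := shifted_Cn dy cy.
have E : {in I01, (fun x => y 0%N (x - 1 / 2)) =1 U}.
  by move=> x; rewrite inE /= in_itv/= /U => ->.
have dU j x : (j <= 4)%N -> 0 <= x <= 1 -> derive_in_n I01 j U x = y j (x - 1 / 2).
  by move=> j4 xI; rewrite -(eq_derive_in_n j E) ?dg// inE /= in_itv.
have I0 : 0 <= (0 : R) <= 1 by rewrite lexx ler01.
have I1 : 0 <= (1 : R) <= 1 by rewrite lexx ler01.
have e0 : 0 - 1 / 2 = - (1 / 2) :> R by rewrite sub0r.
have e1 : 1 - 1 / 2 = 1 / 2 :> R by field.
have UP : U \in @clamped_pred R.
  apply/asboolP; split.
  - exact: eq_Cn E Cg.
  - by rewrite /U I0 I1 e0 e1 yr ?yl.
  - by split; [have := dU 1%N 0 isT I0|have := dU 1%N 1 isT I1]; rewrite ?e0 ?e1 ?yr ?yl.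
  - by move=> x /= xI; rewrite /U; case: ifP => // h; case: xI; rewrite in_itv.
have vE : clamped_val (centred_clamped y) = U by apply: insubdK.
by split=> [x xI|j x j4 xI]; rewrite vE ?dU// /U xI.
Qed.

Lemma clamped_norm_le u e :
  (forall j x, (j <= 4)%N -> 0 <= x <= 1 -> `|derive_in_n I01 j u x| <= e) -> `|u| <= 5 * e.
Proof.
move=> h; have -> : `|u| = \sum_(j < 5) sup_norm01 (derive_in_n I01 j u) by [].
have -> : 5 * e = \sum_(j < 5) e by rewrite sumr_const card_ord mulr_natl.
apply: ler_sum => j _; apply: sup_norm01_le => x; rewrite /= in_itv/= => xI.
by apply: h xI; rewrite -ltnS.
Qed.

Lemma clamped_eval_le u x : `|u x| <= `|u|.
Proof.
have [xI|xI] := pselect (I01 x); last first.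
  by rewrite (clamped_out u xI) normr0.
have -> : `|u| = \sum_(j < 5) sup_norm01 (derive_in_n I01 j u) by [].
rewrite big_ord_recl/=; apply: le_trans (le_sup_norm01 (@clamped_derive_continuous _ u ord0) xI) _.
by rewrite lerDl sumr_ge0// => j _; exact: (sup_norm01_ge0 u (lift ord0 j)).
Qed.

Lemma clamped_jet_lin a u v j x : (j <= 4)%N -> 0 <= x <= 1 ->
  derive_in_n I01 j (a *: u + v : clamped R) x =
  a * derive_in_n I01 j u x + derive_in_n I01 j v x.
Proof.
move=> j4 xI; have xA : x \in I01 by rewrite inE /= in_itv.
exact: (clamped_derive_linear a u v (Ordinal (j4 : (j < 5)%N)) xA).
Qed.

Lemma clamped_jetB u v j x : (j <= 4)%N -> 0 <= x <= 1 ->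
  derive_in_n I01 j (u - v : clamped R) x = derive_in_n I01 j u x - derive_in_n I01 j v x.
Proof.
by move=> j4 xI; rewrite addrC -scaleN1r clamped_jet_lin// mulN1r addrC.
Qed.

Variable r : R.

Lemma near_le4 {T : Type} (Fi : set_system T) (P : nat -> T -> Prop) : Filter Fi ->
  (forall j, (j <= 4)%N -> \forall m \near Fi, P j m) ->
  \forall m \near Fi, forall j, (j <= 4)%N -> P j m.
Proof.
move=> FF h; apply: (filterS _ (filterI (h 0%N isT) (filterI (h 1%N isT)
  (filterI (h 2%N isT) (filterI (h 3%N isT) (h 4%N isT)))))).
by move=> m [? [? [? [? ?]]]] [|[|[|[|[|//]]]]].
Qed.

(** The norm of [clamped R] is the sum of five sup norms, so uniform expansions in [m] of the five
    derivatives add up to an expansion in that norm. *)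
Definition represents (u : R -> clamped R) (y : R -> nat -> R -> R) :=
  forall m, 0 <= m < r -> forall j x, (j <= 4)%N -> 0 <= x <= 1 ->
    derive_in_n I01 j (u m) x = y m j (x - 1 / 2).

Let half (x : R) : 0 <= x <= 1 -> `|x - 1 / 2| <= 1 / 2.
Proof. by move=> xI; rewrite ler_norml; lra. Qed.

Lemma represents_C0 (u : R -> clamped R) (y : R -> nat -> R -> R) : represents u y ->
  (forall j, (j <= 4)%N -> C0 r (fun m => y m j)) ->
  forall m0 e, 0 <= m0 < r -> 0 < e -> \forall m \near ND r m0, `|u m - u m0| <= e.
Proof.
move=> uy hy m0 e Dm0 e0.
have e5 : 0 < e / 5 by rewrite divr_gt0.
have : \forall m \near ND r m0, forall j, (j <= 4)%N ->
    forall t, `|t| <= 1 / 2 -> `|y m j t - y m0 j t| <= e / 5.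
  by apply: near_le4 => j j4; exact: (hy j j4).2.
apply: filterS2 (ND_in r m0) => m Dm h.
have -> : e = 5 * (e / 5) by field.
apply: clamped_norm_le => j x j4 xI; rewrite clamped_jetB// !uy//.
by apply: h => //; exact: half.
Qed.

Lemma represents_C1 (u u' : R -> clamped R) (y y' : R -> nat -> R -> R) : represents u y -> represents u' y' ->
  (forall j, (j <= 4)%N -> C1 r (fun m => y m j) (fun m => y' m j)) ->
  forall m0 e, 0 <= m0 < r -> 0 < e -> \forall m \near ND r m0,
    `|u m - u m0 - (m - m0) *: u' m0| <= e * `|m - m0|.
Proof.
move=> uy uy' hy m0 e Dm0 e0.
have e5 : 0 < e / 5 by rewrite divr_gt0.
have : \forall m \near ND r m0, forall j, (j <= 4)%N -> forall t, `|t| <= 1 / 2 ->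
    `|y m j t - y m0 j t - (m - m0) * y' m0 j t| <= e / 5 * `|m - m0|.
  by apply: near_le4 => j j4; have [_ _ +] := hy j j4; exact.
apply: filterS2 (ND_in r m0) => m Dm h.
have -> : e * `|m - m0| = 5 * (e / 5 * `|m - m0|) by field.
apply: clamped_norm_le => j x j4 xI.
have -> : u m - u m0 - (m - m0) *: u' m0 = (- (m - m0)) *: u' m0 + (u m - u m0).
  by rewrite scaleNr addrC.
rewrite clamped_jet_lin// clamped_jetB// !uy// uy'// mulNr addrC.
by apply: h => //; exact: half.
Qed.

End centred_jets.

Section solution_curve.
Context {R : realType} (F : nonlinearity R).
Local Notation r := (nl_r F).
Local Notation f := (nl_f F).
Local Notation I01 := (`[0%R, 1%R]%classic : set R).
Local Notation D m := (0 <= m < r).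
Implicit Types (m t x : R) (u : clamped R).
Variables (lam k : R -> R) (v : R -> R -> R).
Variables (l1 l2 k1 k2 : R -> R) (v1 v2 : R -> R -> R).
Hypothesis sf : smooth_family F lam k v l1 l2 k1 k2 v1 v2.
Let pf := sf_pf sf.
Local Notation h := (profile_source F lam v).
Local Notation h1 := (profile_source1 F lam v l1 v1).
Local Notation h2 := (profile_source2 F lam v l1 l2 v1 v2).
Let y m := vjet m (k m) (h m).
Let y1 m := vjet 1 (k1 m) (h1 m).
Let y2 m := vjet 0 (k2 m) (h2 m).

Lemma h_even m t : D m -> h m (- t) = h m t.
Proof.
move=> Dm; have E := solution_even Dm (pf_ct pf Dm) (pf_eq pf Dm).
by rewrite /profile_source /source E.
Qed.

Lemma profile_even m j t : D m -> (j <= 4)%N -> y m j (- t) = (-1) ^+ j * y m j t.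
Proof.
move=> Dm; have ch := ct_h pf Dm.
have P n s : primn n (h m) (- s) = (-1) ^+ n * primn n (h m) s.
  rewrite -[- s]mulN1r -(primn_even n (-1) s ch); have -> : (fun s => (-1) ^+ n * h m (-1 * s)) =
      fun s => (-1) ^+ n * h m s by apply/funext => x; rewrite mulN1r h_even.
  by have /funeqP -> := primnZ n ((-1) ^+ n) ch.
case: j => [|[|[|[|[|//]]]]] _; rewrite /y /vjet ?P ?h_even//; ring.
Qed.

Lemma y_C1 j : C1 r (fun m => y m j) (fun m => y1 m j).
Proof. exact: (vjet_C1 j (C1_id r) (sf_k1 sf) (h_C1 sf)). Qed.

Lemma y1_C1 j : C1 r (fun m => y1 m j) (fun m => y2 m j).
Proof. exact: (vjet_C1 j (C1_cst r (@ct_cst _ 1)) (sf_k2 sf) (h1_C1 sf)). Qed.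

Let halfN : `|- (1 / 2)| <= 1 / 2 :> R. Proof. by rewrite normrN half_half. Qed.

Lemma centred_y m : D m -> centred (y m).
Proof.
move=> Dm; have ch := ct_h pf Dm; have e j : (j <= 1)%N -> y m j (1 / 2) = 0.
  by case: j => [|[|//]] _; [rewrite /y -(pf_eq pf Dm) (pf_v0 pf)|exact: (pf_v1 pf)].
split=> //; first by move=> j t j4; exact: der_vjet.
by move=> j j1; rewrite profile_even ?e ?mulr0// (leq_trans j1).
Qed.

Lemma centred_y1 m : D m -> centred (y1 m).
Proof.
move=> Dm; have ch : continuous (h1 m) by have [_ [+ _] _] := h_C1 sf; exact.
split=> // [j t j4|j j1|j j1]; first exact: der_vjet.
- by apply: (C1_zero (y_C1 j) half_half _ Dm) => n /centred_y[_ _ + _]; exact.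
- by apply: (C1_zero (y_C1 j) halfN _ Dm) => n /centred_y[_ _ _ +]; exact.
Qed.

Lemma centred_y2 m : D m -> centred (y2 m).
Proof.
move=> Dm; have ch : continuous (h2 m) by have [_ [+ _] _] := h1_C1 sf; exact.
split=> // [j t j4|j j1|j j1]; first exact: der_vjet.
- by apply: (C1_zero (y1_C1 j) half_half _ Dm) => n /centred_y1[_ _ + _]; exact.
- by apply: (C1_zero (y1_C1 j) halfN _ Dm) => n /centred_y1[_ _ _ +]; exact.
Qed.

Definition profile_clamped m : clamped R := centred_clamped (y m).
Local Notation U := profile_clamped.

Lemma profile_clamped_jet m j x : D m -> (j <= 4)%N -> 0 <= x <= 1 ->
  derive_in_n I01 j (U m) x = vjet m (k m) (h m) j (x - 1 / 2).
Proof. by move=> Dm; have [_] := centred_clampedP (centred_y Dm); apply. Qed.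

Lemma profile_clampedE m x : D m -> 0 <= x <= 1 -> U m x = v m (x - 1 / 2).
Proof.
move=> Dm xI; have [+ _] := centred_clampedP (centred_y Dm) => /(_ x xI) ->.
by rewrite [RHS](pf_eq pf Dm).
Qed.

Let I2 : 0 <= (1 / 2 : R) <= 1. Proof. by apply/andP; split; lra. Qed.

Lemma profile_clamped_mid m : D m -> U m (1 / 2) = m.
Proof.
move=> Dm; rewrite profile_clampedE// subrr (pf_eq pf Dm).
by have [->] := vjet_at0 m (k m) (ct_h pf Dm).
Qed.

Definition curve_jet (j : nat) m : R * clamped R :=
  match j with
  | 0 => (lam m, U m)
  | 1 => (l1 m, centred_clamped (y1 m))
  | _ => (l2 m, centred_clamped (y2 m))
  end.

Definition profile_curve s : R * clamped R := (lam (r * s), U (r * s)).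

Local Notation curve := profile_curve.

Let rep0 : represents r U y.
Proof. by move=> m Dm; have [_] := centred_clampedP (centred_y Dm). Qed.
Let rep1 : represents r (fun m => centred_clamped (y1 m)) y1.
Proof. by move=> m Dm; have [_] := centred_clampedP (centred_y1 Dm). Qed.
Let rep2 : represents r (fun m => centred_clamped (y2 m)) y2.
Proof. by move=> m Dm; have [_] := centred_clampedP (centred_y2 Dm). Qed.

Let half0 : `|0 : R| <= 1 / 2. Proof. by rewrite normr0 divr_ge0. Qed.

Lemma pair_norm_le (a : R) u e : `|a| <= e -> `|u| <= e -> `|(a, u)| <= e.
Proof. by move=> ae ue; rewrite prod_normE /= ge_max ae. Qed.

Lemma pair_C0 (l : R -> R) (V : R -> clamped R) : C0 r (fun m _ => l m) ->
  (forall m0 e, D m0 -> 0 < e -> \forall m \near ND r m0, `|V m - V m0| <= e) ->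
  forall m0 e, D m0 -> 0 < e -> \forall m \near ND r m0,
    `|(l m, V m) - (l m0, V m0)| <= e.
Proof.
move=> [_ hl] hV m0 e Dm0 e0; have := hl m0 Dm0 e e0.
apply: filterS2 (hV m0 e Dm0 e0) => m a b.
exact: (pair_norm_le (b 0 half0) a).
Qed.

Lemma pair_C1 (l l' : R -> R) (V V' : R -> clamped R) :
  C1 r (fun m _ => l m) (fun m _ => l' m) ->
  (forall m0 e, D m0 -> 0 < e -> \forall m \near ND r m0,
     `|V m - V m0 - (m - m0) *: V' m0| <= e * `|m - m0|) ->
  forall m0 e, D m0 -> 0 < e -> \forall m \near ND r m0,
    `|(l m, V m) - (l m0, V m0) - (m - m0) *: (l' m0, V' m0)| <= e * `|m - m0|.
Proof.
move=> [_ _ hl] hV m0 e Dm0 e0; have := hl m0 Dm0 e e0.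
apply: filterS2 (hV m0 e Dm0 e0) => m a b.
exact: (pair_norm_le (b 0 half0) a).
Qed.

Lemma curve_Cn : Cn `[0, 1[ 2 curve /\ forall j, (j <= 2)%N -> forall s, 0 <= s < 1 ->
  derive_in_n `[0, 1[ j curve s = r ^+ j *: curve_jet j (r * s).
Proof.
apply: (@rescaled_Cn _ _ r curve_jet 2 (nl_r_gt0 F)).
- move=> [|[|//]] m0 e _.
  + exact: (pair_C1 (sf_l1 sf) (represents_C1 rep0 rep1 (fun j _ => y_C1 j))).
  + exact: (pair_C1 (sf_l2 sf) (represents_C1 rep1 rep2 (fun j _ => y1_C1 j))).
- move=> [|[|[|//]]] m0 e _.
  + exact: (pair_C0 (C1_C0 (sf_l1 sf)) (represents_C0 rep0 (fun j _ => C1_C0 (y_C1 j)))).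
  + exact: (pair_C0 (C1_C0' (sf_l1 sf)) (represents_C0 rep1 (fun j _ => C1_C0' (y_C1 j)))).
  + exact: (pair_C0 (C1_C0' (sf_l2 sf)) (represents_C0 rep2 (fun j _ => C1_C0' (y1_C1 j)))).
Qed.

Lemma curve_range s : 0 <= s < 1 -> D (r * s).
Proof.
have r0 := nl_r_gt0 F.
by move=> /andP[s0 s1]; rewrite mulr_ge0 ?(ltW r0)//= gtr_pMr.
Qed.

Lemma curve_mid s : 0 <= s < 1 -> (curve s).2 (1 / 2) = r * s.
Proof. by move=> sI; rewrite profile_clamped_mid//; exact: curve_range. Qed.

(** The value at the midpoint is a coordinate that equals [r * s] along the curve. It separates the
    points, and its derivative [r] keeps the velocity from vanishing. *)
Lemma curve_smooth : smooth_arc curve.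
Proof.
have [CC dC] := curve_Cn; have r0 := nl_r_gt0 F; split; first exact: CC.
- move=> s sI; have -> : derive_in `[0, 1[ curve s = derive_in_n `[0, 1[ 1 curve s by [].
  rewrite dC//; have Dm := curve_range sI; apply/eqP => /(congr1 snd)/(congr1 (fun u : clamped R => u (1 / 2))).
  have -> : (r ^+ 1 *: curve_jet 1 (r * s)).2 (1 / 2) = r * centred_clamped (y1 (r * s)) (1 / 2) by [].
  have [-> // _] := centred_clampedP (centred_y1 Dm).
  have ch : continuous (h1 (r * s)) by have [_ [+ _] _] := h_C1 sf; exact.
  have [E0 _ _ _] := vjet_at0 1 (k1 (r * s)) ch.
  rewrite subrr /y1 E0 mulr1 => E; by move: r0; rewrite E ltxx.
- move=> s t; rewrite !in_itv/= => sI tI E; apply: (mulfI (lt0r_neq0 r0)).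
  by rewrite -(curve_mid sI) -(curve_mid tI) E.
Qed.

Lemma profile_zero x : U 0 x = 0.
Proof.
have D0 : D (0 : R) by apply/andP; split; [exact: lexx|exact: nl_r_gt0].
have [xI|xI] := boolP (0 <= x <= 1); last first.
  by apply: clamped_out => /=; rewrite in_itv/=; exact/negP.
have : 0 <= v 0 (x - 1 / 2) <= 0 by apply: (pf_itv pf) => //; rewrite ler_norml; lra.
by rewrite profile_clampedE// => /le_anti.
Qed.

Lemma curve0 : curve 0 = (0, 0).
Proof.
rewrite /curve mulr0 (pf_lam0 pf); congr (_, _).
by apply: clamped_eq => x _; rewrite profile_zero.
Qed.

Lemma profile_solution m : 0 < m < r -> positive_solution r f (lam m) (U m).
Proof.
move=> mr; have Dm : D m by case/andP: mr => /ltW -> ->.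
have vI x : 0 <= x <= 1 -> 0 <= v m (x - 1 / 2) <= m.
  by move=> xI; apply: (pf_itv pf) => //; rewrite ler_norml; lra.
split; first exact: (pf_lam pf).
- split=> [x xI|x xI].
    by rewrite profile_clampedE//; have := vI x xI; lra.
  have xI' : 0 <= x <= 1 by lra.
  rewrite profile_clamped_jet// profile_clampedE//.
  have -> : vjet m (k m) (h m) 4%N (x - 1 / 2) = lam m * f (clip m (v m (x - 1 / 2))) by [].
  by rewrite clip_id// vI.
- exists (1 / 2); first by apply/andP; split; lra.
  by rewrite profile_clamped_mid// gt_eqF//; case/andP: mr.
Qed.

(** The right half of any positive solution is a half profile, identified with a member of the
    family by uniqueness; symmetry then covers the left half. *)
Lemma solution_profile l u : positive_solution r f l u ->
  [/\ 0 < u (1 / 2) < r, l = lam (u (1 / 2)) & u = U (u (1 / 2))].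
Proof.
move=> [l0 su _]; have hp := solution_half_profile l0 su.
have mr := half_m_gt0 hp; set m := u (1 / 2) in hp mr *.
have Dm : D m by case/andP: mr => /ltW -> ->.
have [-> _ E] := half_profile_unique hp (pf_half pf mr); split=> //.
have [lm0 sm _] := profile_solution mr.
have E' x : 1 / 2 <= x <= 1 -> u x = U m x.
  move=> xI; have tI : 0 <= x - 1 / 2 <= 1 / 2 by lra.
  have xI' : 0 <= x <= 1 by lra.
  by have /= := E _ tI; rewrite addrC subrK => ->; rewrite profile_clampedE// [RHS](pf_eq pf Dm).
apply: clamped_eq => x xI; have [x2|x2] := leP (1 / 2) x; first by apply: E'; lra.
rewrite -(solution_symmetric l0 su xI) -(solution_symmetric lm0 sm xI).
by apply: E'; lra.
Qed.

Lemma curve_image : curve @` `]0, 1[ = [set p | positive_solution r f p.1 p.2].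
Proof.
have r0 := nl_r_gt0 F; apply/seteqP; split=> [_ [s + <-]|[l u] /= /solution_profile[uI -> uE]].
  rewrite /= in_itv/= => /andP[s0 s1]; apply: profile_solution.
  by rewrite mulr_gt0//= gtr_pMr.
exists (u (1 / 2) / r).
  by case/andP: uI => u0 ur; rewrite /= in_itv/= divr_gt0//= ltr_pdivrMr// [1 * r]mul1r.
by rewrite /curve [r * _]mulrC divfK ?gt_eqF// -uE.
Qed.

End solution_curve.

(** * The limit function *)

Section holder_estimates.
Context {R : realType}.
Local Notation I01 := (`[0%R, 1%R]%classic : set R).
Implicit Types (g : R -> R) (alpha e d L M K : R).

Let I0 : I01 (0 : R). Proof. by rewrite /= in_itv/= lexx ler01. Qed.
Let I1 : I01 (1 : R). Proof. by rewrite /= in_itv/= lexx ler01. Qed.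

Lemma holder_norm_le g alpha M K :
  (forall j x, (j <= 2)%N -> 0 <= x <= 1 -> `|derive_in_n I01 j g x| <= M) ->
  (forall p q, 0 <= p <= 1 -> 0 <= q <= 1 -> p != q ->
    `|derive_in_n I01 2 g p - derive_in_n I01 2 g q| <= K * `|p - q| `^ alpha) ->
  (holder_norm 2 alpha g <= (3 * M + K)%:E)%E.
Proof.
move=> hM hK; rewrite /holder_norm EFinD; apply: leeD.
  have -> : (3 * M)%:E = (\sum_(j < 3) M%:E)%E.
    by rewrite sumEFin sumr_const card_ord mulr_natl.
  apply: lee_sum => j _; apply: ge_ereal_sup => _ [x Ix <-].
  by rewrite lee_fin; apply: hM; [rewrite -ltnS|move: Ix; rewrite /= in_itv].
apply: ge_ereal_sup => _ [[p q] /= [Ip Iq pq] <-].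
rewrite lee_fin ler_pdivrMr; last by rewrite powR_gt0// normr_gt0 subr_eq0.
by move: Ip Iq; rewrite /= !in_itv/= => Ip Iq; exact: hK.
Qed.

Lemma holder_norm_ge0 g alpha : (0 <= holder_norm 2 alpha g)%E.
Proof.
apply: adde_ge0; first (apply: sume_ge0 => j _).
  apply: (@le_trans _ _ `|derive_in_n I01 j g 0|%:E); first by rewrite lee_fin.
  by apply: ereal_sup_ubound; exists 0.
apply: (@le_trans _ _ (`|derive_in_n I01 2 g 0 - derive_in_n I01 2 g 1| / `|0 - 1| `^ alpha)%:E).
  by rewrite lee_fin divr_ge0// powR_ge0.
by apply: ereal_sup_ubound; exists (0, 1) => //=; split=> //; rewrite eq_sym oner_eq0.
Qed.

Lemma powR_split alpha d : 0 < alpha < 1 -> 0 <= d -> d = d `^ (1 - alpha) * d `^ alpha.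
Proof.
move=> a01 d0; rewrite -powRD subrK ?powRr1//.
by rewrite oner_eq0.
Qed.

(** At distances below [eta], the solution of L eta^(1 - alpha) = e, the Lipschitz bound is the
    better one; above it the sup bound [eps] is. *)
Lemma interpolation alpha L e : 0 < alpha < 1 -> 0 < L -> 0 < e ->
  exists2 eps, 0 < eps & forall d a, 0 < d -> a <= eps -> a <= L * d -> a <= e * d `^ alpha.
Proof.
move=> a01 L0 e0; have a1 : 0 < 1 - alpha by lra.
have a0 : 0 <= alpha by lra.
have eL : 0 < e / L by exact: divr_gt0.
pose eta := (e / L) `^ (1 - alpha)^-1.
have eta0 : 0 < eta by exact: powR_gt0.
exists (e * eta `^ alpha); first by rewrite mulr_gt0// powR_gt0.
move=> d a d0 ae ad; have [de|ed] := leP d eta.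
  apply: le_trans ad _; rewrite {1}(powR_split a01 (ltW d0)) mulrA.
  apply: ler_wpM2r; first exact: powR_ge0.
  have : d `^ (1 - alpha) <= eta `^ (1 - alpha).
    by apply: ge0_ler_powR => //; rewrite ?nnegrE; exact: ltW.
  by rewrite -powRrM mulVf ?gt_eqF// powRr1 ?(ltW eL)// ler_pdivlMr// mulrC.
apply: le_trans ae _; apply: ler_wpM2l; first exact: ltW.
by apply: ge0_ler_powR => //; rewrite ?nnegrE; exact: ltW.
Qed.

Lemma lipschitz_holder alpha d : 0 < alpha < 1 -> 0 < d <= 1 -> d <= d `^ alpha.
Proof. by move=> a01 d01; apply: ger1_powR => //; lra. Qed.

End holder_estimates.

Section limit_profile.
Context {R : realType} (r : R).
Hypothesis r0 : 0 < r.
Local Notation I01 := (`[0%R, 1%R]%classic : set R).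
Implicit Types (x t : R).

(** The limit centred at its maximum, with the cube of [|t|] written as [t * (t * |t|)]: even on the
    whole line, and differentiable by the product rule and [der_mul_norm] alone. *)
Definition cubic_jet (j : nat) t : R :=
  match j with
  | 0 => r * (1 - 12 * t ^+ 2 + 16 * (t * (t * `|t|)))
  | 1 => r * (- 24 * t + 48 * (t * `|t|))
  | _ => r * (- 24 + 96 * `|t|)
  end.

Definition limit_profile x : R := cubic_jet 0 (x - 1 / 2).
Local Notation w := limit_profile.

Lemma der_mul_norm t : der (fun s : R => s * `|s|) t (2 * `|t|).
Proof.
apply/derP => e e0; exists e => // s se.
have H : `|s * `|s| - t * `|t| - 2 * `|t| * (s - t)| <= `|s - t| * `|s - t|.
  rewrite -normrM ler_norml !(ger0_norm (x := (s - t) * (s - t))) ?sqr_ge0 -?expr2 ?sqr_ge0//.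
  have [s0|s0] := leP 0 s; have [t0|t0] := leP 0 t; rewrite ?(ger0_norm s0) ?(ltr0_norm s0) ?(ger0_norm t0) ?(ltr0_norm t0).
  - have := sqr_ge0 (s - t); rewrite !expr2; nra.
  - have := sqr_ge0 (s - t); have := sqr_ge0 t; have := sqr_ge0 s.
    have : s * t <= 0 by rewrite mulr_ge0_le0// ltW.
    rewrite !expr2; lra.
  - have := sqr_ge0 (s - t); have := sqr_ge0 t; have := sqr_ge0 s.
    have : s * t <= 0 by rewrite mulr_le0_ge0// ltW.
    rewrite !expr2; lra.
  - have := sqr_ge0 (s - t); rewrite !expr2; nra.
apply: le_trans H _; apply: ler_wpM2r => //; exact: ltW.
Qed.

Lemma der_cubic_jet j t : (j < 2)%N -> der (cubic_jet j) t (cubic_jet j.+1 t).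
Proof.
have d1 := der_mul_norm t; case: j => [|[|//]] _ /=.
- apply: der_eq.
    apply: derZ; apply: derD; last by apply: derZ; apply: derM d1; exact: der_id.
    by apply: derD; [exact: der_cst|apply/derN/derZ/derX/der_id].
  by rewrite /=; ring.
- apply: der_eq.
    by apply: derZ; apply: derD; [apply: derZ; exact: der_id|apply: derZ d1].
  by rewrite /=; ring.
Qed.

Lemma ct_cubic_jet2 : continuous (cubic_jet 2).
Proof.
apply: ctM; first exact: ct_cst.
apply: ctD; first exact: ct_cst.
by apply: ctM; [exact: ct_cst|move=> x; exact: norm_continuous].
Qed.

Lemma cubic_jet_even j t : (j <= 2)%N -> cubic_jet j (- t) = (-1) ^+ j * cubic_jet j t.
Proof. by case: j => [|[|[|//]]] _ /=; rewrite normrN; ring. Qed.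

Lemma cubic_jet_ge0E t : 0 <= t -> [/\ cubic_jet 0 t = r * (1 - 12 * t ^+ 2 + 16 * t ^+ 3),
  cubic_jet 1 t = r * (- 24 * t + 48 * t ^+ 2) & cubic_jet 2 t = r * (- 24 + 96 * t)].
Proof. by move=> t0; rewrite /= ger0_norm//; split; ring. Qed.

Lemma cubic_jet2_lip s t : `|cubic_jet 2 s - cubic_jet 2 t| <= 96 * r * `|s - t|.
Proof.
have rp := r0.
have -> : cubic_jet 2 s - cubic_jet 2 t = 96 * r * (`|s| - `|t|) by rewrite /=; ring.
have r96 : 0 <= 96 * r by lra.
by rewrite normrM (ger0_norm r96); apply: ler_wpM2l => //; exact: ler_dist_dist.
Qed.

Lemma limit_profile_Cn2 : Cn I01 2 w /\ forall j x, (j <= 2)%N -> 0 <= x <= 1 ->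
  derive_in_n I01 j w x = cubic_jet j (x - 1 / 2).
Proof. exact: (shifted_Cn der_cubic_jet ct_cubic_jet2). Qed.

Lemma limit_profileE x : (x <= 1 / 2 -> w x = - 16 * r * x ^+ 3 + 12 * r * x ^+ 2) /\
  (1 / 2 <= x -> w x = - 16 * r * (1 - x) ^+ 3 + 12 * r * (1 - x) ^+ 2).
Proof.
by split=> xI; rewrite /w /=; [rewrite ler0_norm; last lra|rewrite ger0_norm; last lra]; field.
Qed.

Lemma limit_profile_sym x : w (1 - x) = w x.
Proof.
rewrite /w; have -> : 1 - x - 1 / 2 = - (x - 1 / 2) by field.
by rewrite cubic_jet_even// expr0 mul1r.
Qed.

Lemma limit_profile_mid : w (1 / 2) = r.
Proof. by rewrite /w subrr /=; ring. Qed.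

Lemma limit_profile_itv x : 0 <= x <= 1 -> 0 <= w x <= r.
Proof.
have rp := r0.
wlog x2 : x / x <= 1 / 2 => [hw xI|xI].
  have [|x2] := leP x (1 / 2); first by move=> x2; exact: hw.
  by rewrite -limit_profile_sym; apply: hw; lra.
have [-> // _] := limit_profileE x.
have -> : - 16 * r * x ^+ 3 + 12 * r * x ^+ 2 = 4 * (r * (x ^+ 2 * (3 - 4 * x))) by ring.
have e : r - 4 * (r * (x ^+ 2 * (3 - 4 * x))) = r * ((1 - 2 * x) ^+ 2 * (1 + 4 * x)) by ring.
apply/andP; split; last by rewrite -subr_ge0 e !mulr_ge0 ?sqr_ge0//; lra.
have h : 0 <= r * (x ^+ 2 * (3 - 4 * x)) by rewrite !mulr_ge0 ?sqr_ge0//; lra.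
lra.
Qed.

(** At [1 / 2] the second derivative has a corner with slopes [96 * r] and [- 96 * r], which no
    number approximates within [r] on both sides. *)
Lemma limit_profile_notC3 : ~ Cn I01 3 w.
Proof.
have rp := r0.
move=> C3; have h2 : 0 < (1 / 2 : R) < 1 by apply/andP; split; lra.
have IA x : 0 < x < 1 -> I01 x by move=> xI; rewrite /= in_itv/=; lra.
have := Cn_der C3 (isT : (2 < 3)%N) h2 IA; set d := derive_in_n _ 3 _ _.
have E x : 0 <= x <= 1 -> derive_in_n I01 2 w x = cubic_jet 2 (x - 1 / 2).
  by move=> xI; have [_ ->] := limit_profile_Cn2.
move: E d; move: (derive_in_n I01 2 w) => g E d /derP/(_ r r0)[del del0 hd].
pose s := Num.min (del / 2) (1 / 4).
have s0 : 0 < s by rewrite lt_min divr_gt0//=; lra.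
have [s1 s2] : s <= del / 2 /\ s <= 1 / 4 by rewrite !ge_min !lexx orbT.
have Eh : g (1 / 2) = r * (- 24) by rewrite E ?subrr /= ?normr0 ?mulr0 ?addr0//; lra.
have Ep : g (1 / 2 + s) = r * (- 24 + 96 * s).
  rewrite E; last lra.
  by rewrite addrC addKr /= gtr0_norm.
have Em : g (1 / 2 - s) = r * (- 24 + 96 * s).
  rewrite E; last lra.
  by rewrite addrC addKr /= normrN gtr0_norm.
have hp := hd (1 / 2 + s); have hm := hd (1 / 2 - s).
rewrite Ep Eh [1 / 2 + s]addrC addrK in hp; rewrite Em Eh [1 / 2 - s]addrC addrK in hm.
have {}hp := hp _; have {}hm := hm _.
rewrite !normrN !(gtr0_norm s0) in hp hm.
have sd : s < del by lra.
have := hp sd; have := hm sd; rewrite !ler_norml.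
have rs : 0 < r * s by exact: mulr_gt0.
lra.
Qed.

Lemma punctured_limit_point : (I01 `\ (1 / 2)) `<=` limit_point (I01 `\ (1 / 2)).
Proof.
move=> x /= [+ /eqP x2]; rewrite in_itv/= => /andP[x0 x1] U /nbhs_ballP[e /= e0 eU].
have m0 : 0 < Num.min e `|x - 1 / 2| by rewrite lt_min e0 normr_gt0 subr_eq0.
have [m1 m2] : Num.min e `|x - 1 / 2| <= e /\ Num.min e `|x - 1 / 2| <= `|x - 1 / 2|.
  by rewrite !ge_min !lexx orbT.
pose d := Num.min e `|x - 1 / 2| / 2; have d0 : 0 < d by exact: divr_gt0.
have de : d < e by rewrite /d; lra.
have dx : d < `|x - 1 / 2| by rewrite /d; lra.
have [xl|xr] := ltP x (1 / 2).
  rewrite ltr0_norm in dx; last lra.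
  exists (x + d); split.
  - by rewrite gt_eqF// ltrDl.
  - by split; [rewrite in_itv/=; lra|move=> E; lra].
  - by apply: eU; rewrite /ball /= opprD addrA subrr sub0r normrN gtr0_norm.
rewrite ger0_norm in dx; last lra.
exists (x - d); split.
- by rewrite lt_eqF// gtrDl oppr_lt0.
- by split; [rewrite in_itv/=; lra|move=> E; lra].
- by apply: eU; rewrite /ball /= opprB addrC subrK gtr0_norm.
Qed.

Lemma limit_profile_Cn4 : Cn (I01 `\ (1 / 2)) 4 w.
Proof.
pose sg t : R := if t < 0 then -1 else 1.
pose y (j : nat) t : R := match j with
  | 3 => r * (96 * sg t) | 4 => 0 | j => cubic_jet j t end.
have dy j t : (j < 4)%N -> t != 0 -> der (y j) t (y j.+1 t).
  case: j => [|[|[|[|//]]]] _ t0; rewrite /y.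
  - exact: (@der_cubic_jet 0%N t isT).
  - exact: (@der_cubic_jet 1%N t isT).
  - have [tn|tp] := ltP t 0; rewrite /sg ?tn.
      apply: (@der_near _ (fun s => r * (- 24 + 96 * - s)) _ _ _ (t - 1) 0) => [|s sI|].
      + by rewrite tn andbT; lra.
      + by case/andP: sI => _ s0; rewrite /= (ltr0_norm s0).
      + apply: der_eq; first by apply: derZ; apply: derD; [exact: der_cst|apply/derZ/derN/der_id].
        by ring.
    have tp' : 0 < t by rewrite lt_neqAle eq_sym t0.
    rewrite ltNge tp /=; apply: (@der_near _ (fun s => r * (- 24 + 96 * s)) _ _ _ 0 (t + 1)) => [|s sI|].
    + by rewrite tp'; lra.
    + by case/andP: sI => s0 _; rewrite /= (gtr0_norm s0).
    + apply: der_eq; first by apply: derZ; apply: derD; [exact: der_cst|apply/derZ/der_id].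
      by ring.
  - have [tn|tp] := ltP t 0.
      apply: (@der_near _ (fun=> r * (96 * -1)) _ _ _ (t - 1) 0) => [|s sI|]; last exact: der_cst.
      + by rewrite tn andbT; lra.
      + by rewrite /sg; case/andP: sI => _ ->.
    have tp' : 0 < t by rewrite lt_neqAle eq_sym t0.
    apply: (@der_near _ (fun=> r * (96 * 1)) _ _ _ 0 (t + 1)) => [|s sI|]; last exact: der_cst.
    + by rewrite tp'; lra.
    + by rewrite /sg ltNge; case/andP: sI => /ltW ->.
have dG j x : (j < 4)%N -> (I01 `\ (1 / 2)) x ->
    der (fun x => y j (x - 1 / 2)) x (y j.+1 (x - 1 / 2)).
  by move=> j4 [_ /eqP x2]; apply/der_shift/dy; rewrite ?subr_eq0.
have [||+ _] := @Cn_chain _ R (I01 `\ (1 / 2)) 4 (fun j x => y j (x - 1 / 2)) punctured_limit_point.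
- by move=> j j4 x xA; apply/der_slope_in/dG.
- move=> j; rewrite leq_eqVlt => /predU1P[->|j4]; first exact: wct_cst.
  apply/withinC_P => x xA e e0.
  have [d d0 hd] := (contP _ _).1 (der_cont (dG j x j4 xA)) e e0.
  by exists d => // z _; exact: hd.
- by [].
Qed.

Lemma limit_profile_holder alpha : 0 < alpha < 1 -> holder 2 alpha w.
Proof.
have rp := r0.
move=> a01; have [C2 E] := limit_profile_Cn2; split=> //.
have hlt : (holder_norm 2 alpha w <= (3 * (100 * r) + 96 * r)%:E)%E.
  apply: holder_norm_le => [j x j2 xI|p q pI qI pq].
    have t1 : `|x - 1 / 2| <= 1 / 2 by rewrite ler_norml; lra.
    have n0 := normr_ge0 (x - 1 / 2).
    rewrite E//; move: (x - 1 / 2) t1 n0 => t t1 n0; have t1' := t1.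
    have tt : `|t * `|t| | <= 1 / 2.
      rewrite normrM normr_id; apply: (@le_trans _ _ (1 * (1 / 2))); last by rewrite mul1r.
      by apply: ler_pM => //; lra.
    have ttt : `|t * (t * `|t|)| <= 1.
      rewrite normrM; apply: (@le_trans _ _ (1 * 1)); last by rewrite mul1r.
      by apply: ler_pM => //; lra.
    have t2 : 0 <= t ^+ 2 <= 1.
      rewrite -[t ^+ 2]real_normK ?num_real// exprn_ge0//= expr_le1//; lra.
    case: j j2 => [|[|[|//]]] _ /=; rewrite normrM (gtr0_norm r0) mulrC;
      apply: ler_wpM2r; try exact: ltW; move: t1 tt ttt; rewrite !ler_norml; lra.
  rewrite !E//; apply: le_trans (cubic_jet2_lip _ _) _.
  apply: ler_wpM2l; first lra.
  have -> : p - 1 / 2 - (q - 1 / 2) = p - q by ring.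
  apply: lipschitz_holder => //; rewrite normr_gt0 subr_eq0 pq /= ler_norml; lra.
exact: le_lt_trans hlt (ltry _).
Qed.

End limit_profile.

Section end_of_curve.
Context {R : realType} (F : nonlinearity R).
Local Notation r := (nl_r F).
Local Notation I01 := (`[0%R, 1%R]%classic : set R).
Implicit Types (m t x e : R).
Variables (lam k : R -> R) (v : R -> R -> R).
Variables (l1 l2 k1 k2 : R -> R) (v1 v2 : R -> R -> R).
Hypothesis sf : smooth_family F lam k v l1 l2 k1 k2 v1 v2.
Let pf := sf_pf sf.
Local Notation h := (profile_source F lam v).
Local Notation U := (profile_clamped F lam k v).
Local Notation w := (limit_profile r).
Let y m := vjet m (k m) (h m).

Lemma profile_near_limit e : 0 < e -> exists2 d, 0 < d & forall m, r - d < m < r -> 0 < m ->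
  forall j t, (j <= 2)%N -> `|t| <= 1 / 2 -> `|y m j t - cubic_jet r j t| <= e.
Proof.
move=> e0; have [d d0 hd] := profile_limit pf e0; exists d => // m mI m0 j t j2 tI.
have Dm : 0 <= m < r by case/andP: mI => _ ->; rewrite ltW.
have pos s i : (i <= 2)%N -> 0 <= s <= 1 / 2 -> `|y m i s - cubic_jet r i s| <= e.
  move=> i2 sI; have [a b c] := hd m mI s sI; have s0 : 0 <= s by case/andP: sI.
  have [E0 E1 E2] := cubic_jet_ge0E r s0.
  by case: i i2 => [|[|[|//]]] _; rewrite ?E0 ?E1 ?E2.
have [t0|t0] := leP 0 t; first by apply: pos => //; rewrite t0; move: tI; rewrite ger0_norm.
have tN : 0 <= - t <= 1 / 2 by move: tI; rewrite ltr0_norm// => ->; rewrite oppr_ge0 ltW.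
rewrite -[t]opprK /y (profile_even sf)//; last exact: leq_trans j2 _.
rewrite cubic_jet_even// -mulrBr normrM normrX normrN1 expr1n mul1r.
exact: pos.
Qed.

Lemma profile_third_bound m t : 0 < m < r -> `|t| <= 1 / 2 -> `|y m 3%N t| <= 384 * r.
Proof.
move=> mr tI; have Dm : 0 <= m < r by case/andP: mr => /ltW -> ->.
have pos s : 0 <= s <= 1 / 2 -> `|y m 3%N s| <= 384 * r.
  by move=> sI; have := y3_bounds pf mr sI; rewrite ler_norml /y; lra.
have [t0|t0] := leP 0 t; first by apply: pos; rewrite t0; move: tI; rewrite ger0_norm.
rewrite -[t]opprK /y (profile_even sf)// normrM normrX normrN1 expr1n mul1r; apply: pos.
by move: tI; rewrite ltr0_norm// => ->; rewrite oppr_ge0 ltW.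
Qed.

Lemma second_derivative_lip m s t : 0 < m < r -> `|s| <= 1 / 2 -> `|t| <= 1 / 2 ->
  `|y m 2%N s - y m 2%N t| <= 384 * r * `|s - t|.
Proof.
move=> mr; have Dm : 0 <= m < r by case/andP: mr => /ltW -> ->.
have ch := ct_h pf Dm.
have lt_case a b : a < b -> `|a| <= 1 / 2 -> `|b| <= 1 / 2 ->
    `|y m 2%N b - y m 2%N a| <= 384 * r * `|b - a|.
  move=> ab aI bI; have dy x : a < x < b -> der (y m 2%N) x (y m 3%N x).
    by move=> _; exact: der_vjet.
  have [|c cI ->] := MVT_in ab dy _; first by apply: cont_within; exact: ct_vjet.
  rewrite normrM; apply: ler_wpM2r => //; apply: profile_third_bound => //.
  by move: aI bI; rewrite !ler_norml; lra.
move=> sI tI; have [st|ts|->] := ltgtP s t; last by rewrite !subrr normr0 mulr0.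
- by rewrite distrC [`|s - t|]distrC; exact: lt_case.
- exact: lt_case.
Qed.

Lemma difference_jet m j x : 0 < m < r -> (j <= 2)%N -> 0 <= x <= 1 ->
  derive_in_n I01 j (fun x => U m x - w x) x = y m j (x - 1 / 2) - cubic_jet r j (x - 1 / 2).
Proof.
move=> mr j2 xI; have Dm : 0 <= m < r by case/andP: mr => /ltW -> ->.
have ch := ct_h pf Dm; pose z (i : nat) t := y m i t - cubic_jet r i t.
have dz i t : (i < 2)%N -> der (z i) t (z i.+1 t).
  move=> i2; apply: derD; first by apply: der_vjet => //; exact: leq_trans i2 _.
  by apply: derN; exact: der_cubic_jet.
have cz : continuous (z 2%N) by apply: ctD; [exact: ct_vjet|apply: ctN; exact: ct_cubic_jet2].
have [_ E] := shifted_Cn dz cz.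
have xA : x \in I01 by rewrite inE /= in_itv.
transitivity (derive_in_n I01 j (fun x => z 0%N (x - 1 / 2)) x); last exact: E.
apply: eq_derive_in_n xA => x'; rewrite inE /= in_itv/= => xI'.
by rewrite /z /y -(pf_eq pf Dm) (profile_clampedE sf).
Qed.

Lemma curve_left_near d : 0 < d -> \forall s \near 1^'-, r - d < r * s < r /\ 0 < r * s.
Proof.
move=> d0; have r0 := nl_r_gt0 F.
have a1 : 1 - d / r < 1 by rewrite gtrBl divr_gt0.
near=> s.
have s1 : s < 1 by near: s; exact: nbhs_left_lt.
have s0 : 0 < s by near: s; apply: nbhs_left_gt; exact: ltr01.
have sd : 1 - d / r < s by near: s; exact: nbhs_left_gt.
rewrite mulr_gt0// gtr_pMr// s1 andbT; split=> //.
have : r * (1 - d / r) < r * s by rewrite ltr_pM2l.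
by rewrite mulrBr mulr1 mulrCA divff ?gt_eqF// mulr1.
Unshelve. all: by end_near. Qed.

Lemma lam_end : lam (r * s) @[s --> 1^'-] --> (0 : R).
Proof.
apply/cvgrPdist_le => e e0; have [d d0 hd] := lam_vanish pf e0.
apply: filterS (curve_left_near d0) => s [sI s0].
have mr : 0 < r * s < r by case/andP: sI => _ ->; rewrite s0.
by rewrite sub0r normrN gtr0_norm ?(pf_lam pf)//; apply/ltW/hd.
Qed.

(** Uniform convergence of the derivatives up to order 2, together with a Lipschitz bound on the
    second derivatives that does not depend on [m], gives Hoelder convergence by [interpolation]. *)
Lemma curve_end alpha : 0 < alpha < 1 ->
  holder_norm 2 alpha (fun x => U (r * s) x - w x) @[s --> 1^'-] --> 0%E.
Proof.
move=> a01; have r0 := nl_r_gt0 F.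
(* [384 * r] bounds the third derivative of the profiles, and [96 * r] is the Lipschitz constant of
   the second derivative of [w]. *)
have L0 : 0 < 480 * r by lra.
have bound e : 0 < e -> \forall s \near 1^'-,
    (0 <= holder_norm 2 alpha (fun x => U (r * s)%R x - w x)%R <= e%:E)%E.
  move=> e0; have e4 : 0 < e / 4 by exact: divr_gt0.
  have [eps eps0 hi] := interpolation a01 L0 e4.
  have m0 : 0 < Num.min eps (e / 4) / 2 by rewrite divr_gt0// lt_min eps0.
  have [m1 m2] : Num.min eps (e / 4) <= eps /\ Num.min eps (e / 4) <= e / 4.
    by rewrite !ge_min !lexx orbT.
  have [d d0 hd] := profile_near_limit m0.
  apply: filterS (curve_left_near d0) => s [sI s0].
  have mr : 0 < r * s < r by case/andP: sI => _ ->; rewrite s0.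
  have tI x : 0 <= x <= 1 -> `|x - 1 / 2| <= 1 / 2 by move=> xI; rewrite ler_norml; lra_from xI.
  rewrite holder_norm_ge0 /=; have -> : e = 3 * (e / 4) + e / 4 by field.
  apply: holder_norm_le => [j x j2 xI|p q pI qI pq]; rewrite !difference_jet//.
    by apply: le_trans (hd _ sI s0 j _ j2 (tI x xI)) _; lra_from m0 m2.
  have pt := tI p pI; have qt := tI q qI.
  apply: hi; first by rewrite normr_gt0 subr_eq0.
  - have := hd _ sI s0 2%N _ isT pt; have := hd _ sI s0 2%N _ isT qt.
    by rewrite !ler_norml; lra_from m1.
  - have a := second_derivative_lip mr pt qt; have b := cubic_jet2_lip r0 (p - 1 / 2) (q - 1 / 2).
    have E : p - 1 / 2 - (q - 1 / 2) = p - q by ring.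
    rewrite E in a b; move: a b; rewrite !ler_norml; lra_from.
apply/fine_cvgP; split.
  apply: filterS (bound 1 ltr01) => s /andP[a b].
  by rewrite ge0_fin_numE//; exact: le_lt_trans b (ltry _).
apply/cvgrPdist_le => e e0; apply: filterS (bound e e0) => s /andP[a b].
rewrite /= sub0r normrN ger0_norm ?fine_ge0//.
by rewrite -lee_fin fineK// ge0_fin_numE//; exact: le_lt_trans b (ltry _).
Qed.

End end_of_curve.

(** * Uniqueness and count *)

Section bounded_functional.
Context {R : realType} {V : normedModType R} (A : set R) (l : V -> R) (C : R).
Hypothesis l_lin : forall a u v, l (a *: u + v) = a * l u + l v.
Hypothesis l_bounded : forall u, `|l u| <= C * `|u|.
Hypothesis A_limit : A `<=` limit_point A.

Let lB u v : l (u - v) = l u - l v.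
Proof. by rewrite addrC -scaleN1r l_lin mulN1r addrC. Qed.

Let lZ a u : l (a *: u) = a * l u.
Proof.
have l0 : l 0 = 0 by rewrite -(subrr (0 : V)) lB subrr.
by rewrite -[a *: u]addr0 l_lin l0 addr0.
Qed.

Let l_bounded1 u : `|l u| <= (`|C| + 1) * `|u|.
Proof.
apply: le_trans (l_bounded u) _; apply: ler_wpM2r => //.
by have := ler_norm C; lra.
Qed.

(** Applied to evaluation at the midpoint divided by [r], the functional that recovers the parameter
    of the curve. *)
Lemma functional_Cn n (g : R -> V) : Cn A n g -> Cn A n (fun x => l (g x)) /\
  forall j, (j <= n)%N -> {in A, derive_in_n A j (fun x => l (g x)) =1
    fun x => l (derive_in_n A j g x)}.
Proof.
have C0 : 0 < `|C| + 1 by rewrite ltr_wpDl.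
move=> [dg cg]; apply: (@Cn_chain _ R A n (fun j x => l (derive_in_n A j g x)) A_limit).
- move=> j jn x Ax; apply/slope_in_cvgP => e e0.
  have /slope_in_cvgP/(_ (e / (`|C| + 1))) := derivable_in_cvg (dg j jn x Ax).
  rewrite divr_gt0// => /(_ isT)[d d0 hd]; exists d => // y Ay yx.
  have E z a b c : l a - l b - z *: l c = l (a - b - z *: c) by rewrite !lB lZ.
  have := hd y Ay yx; rewrite E => H.
  apply: le_trans (l_bounded1 _) _; rewrite mulrC -ler_pdivlMr//.
  by apply: le_trans H _; rewrite mulrAC.
- move=> j jn; apply/withinC_P => x Ax e e0.
  have := (withinC_P _ _).1 (cg j jn) x Ax (e / (`|C| + 1)).
  rewrite divr_gt0// => /(_ isT)[d d0 hd]; exists d => // y Ay yx.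
  by rewrite -lB; apply: le_lt_trans (l_bounded1 _) _; rewrite mulrC -ltr_pdivlMr//; exact: hd.
Qed.

End bounded_functional.

Section uniqueness.
Context {R : realType} (F : nonlinearity R).
Local Notation r := (nl_r F).
Local Notation f := (nl_f F).
Variables (lam k : R -> R) (v : R -> R -> R).
Variables (l1 l2 k1 k2 : R -> R) (v1 v2 : R -> R -> R).
Hypothesis sf : smooth_family F lam k v l1 l2 k1 k2 v1 v2.
Local Notation curve := (profile_curve F lam k v).
Variable delta : R -> R * clamped R.
Hypothesis delta_arc : smooth_arc delta.
Hypothesis delta_sol : forall s, 0 <= s < 1 -> solution r f (delta s).1 (delta s).2.
Hypothesis delta_onto :
  [set p | positive_solution r f p.1 p.2] `<=` delta @` `[0, 1[.
Implicit Types (s t c : R).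

(** The only possible change of parameter: every solution lies on [curve], at the parameter given by
    its midpoint value over [r]. *)
Let phi s : R := (delta s).2 (1 / 2) / r.
Let r0 : 0 < r := nl_r_gt0 F.

Let delta_curve s : 0 <= s < 1 -> 0 <= phi s < 1 /\ delta s = curve (phi s).
Proof.
move=> sI; rewrite /phi; move: (delta_sol sI); case: (delta s) => l u /= /solution_cases[[-> ->]|].
  have -> : (0 : clamped R) (1 / 2) = 0 by [].
  by rewrite mul0r lexx ltr01 (curve0 sf).
move=> /(solution_profile sf)[/andP[u0 ur] lE uE]; split.
  by rewrite divr_ge0 ?ltW//= ltr_pdivrMr// [1 * r]mul1r.
by rewrite /profile_curve [r * _]mulrC divfK ?gt_eqF// -uE -lE.
Qed.

Let phi_onto c : 0 < c < 1 -> exists2 s, 0 <= s < 1 & phi s = c.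
Proof.
move=> cI; have cp : positive_solution r f (curve c).1 (curve c).2.
  have : (curve @` `]0, 1[) (curve c) by exists c => //=; rewrite in_itv.
  by rewrite (curve_image sf).
have [s] := delta_onto cp; rewrite /= in_itv/= => sI E; exists s => //.
have cI' : 0 <= c < 1 by case/andP: cI => /ltW -> ->.
by rewrite /phi E (curve_mid sf)// mulrC mulKf ?gt_eqF.
Qed.

Let phi_C2 : Cn `[0, 1[ 2 phi.
Proof.
have [C2 _ _] := delta_arc.
have [] := @functional_Cn _ _ `[0, 1[%classic (fun p : R * clamped R => p.2 (1 / 2) / r) r^-1 _ _
  co_segment_limit_point 2 delta C2 => //.
- move=> a [p u] [q z]; transitivity ((a * u (1 / 2) + z (1 / 2)) / r); first by [].
  by rewrite mulrDl mulrA.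
- move=> [p u] /=; rewrite normrM mulrC (gtr0_norm (x := r^-1)) ?invr_gt0//.
  apply: ler_wpM2l; first by rewrite invr_ge0 ltW.
  by apply: le_trans (clamped_eval_le _ _) _; rewrite prod_normE /= le_max lexx orbT.
Qed.

Let phi_inj : {in `[0, 1[ &, injective phi}.
Proof.
have [_ _ inj] := delta_arc; move=> s t sI tI E; apply: inj => //.
move: sI tI; rewrite !in_itv/= => /delta_curve[_ ->] /delta_curve[_ ->].
by rewrite E.
Qed.

(** A continuous injection of an interval is monotone. If it were decreasing, the values in []phi 0,
    1[] would be missed, against [phi_onto]. *)
Let phi_mono : {in `[0, 1[ &, {mono phi : s t / s <= t}}.
Proof.
have I0 : (0 : R) \in `[0, 1[ by rewrite in_itv/= lexx ltr01.
have I2 : (1 / 2 : R) \in `[0, 1[ by rewrite in_itv/=; apply/andP; split; lra.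
have h2 : 0 < 1 / 2 :> R by lra.
have cphi : {within `[0, 1[%classic, continuous phi} := phi_C2.2 0%N isT.
have [le|/ltW ge] := leP (phi 0) (phi (1 / 2)).
  by apply: (@itv_continuous_inj_le _ phi `[0, 1[) => //; exists 0, (1 / 2).
have dec := @itv_continuous_inj_ge _ phi `[0, 1[ (ex_intro _ 0 (ex_intro _ (1 / 2) (And4 I0 I2 h2 ge))) cphi phi_inj.
have I0' : 0 <= (0 : R) < 1 by rewrite lexx ltr01.
have [p0 _] := delta_curve I0'.
have [|s sI sE] := @phi_onto ((1 + phi 0) / 2); first by lra.
have : phi s <= phi 0 by rewrite dec ?in_itv//; case/andP: sI.
by rewrite sE; lra.
Qed.

Let phi_image : phi @` `[0, 1[ = `[0, 1[%classic.
Proof.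
have I0 : 0 <= (0 : R) < 1 by rewrite lexx ltr01.
have [p0 _] := delta_curve I0.
have phi0 : phi 0 = 0.
  apply/eqP; rewrite eq_le (andP p0).1 andbT leNgt; apply/negP => ppos.
  have [|s sI sE] := @phi_onto (phi 0 / 2); first lra.
  have : phi 0 <= phi s by rewrite phi_mono ?in_itv//; case/andP: sI.
  by rewrite sE; lra.
apply/seteqP; split=> [_ [s + <-]|c].
  by rewrite /= !in_itv/= => /delta_curve[].
rewrite /= in_itv/= => /andP[]; rewrite le_eqVlt => /predU1P[<- _|c0 c1].
  by exists 0 => //=; rewrite in_itv.
have [|s sI sE] := @phi_onto c; first by rewrite c0.
by exists s => //=; rewrite in_itv.
Qed.

(** Monotonicity gives a nonnegative derivative. If it were zero, then [delta], which is [curve]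
    after [phi], would have zero velocity, because [curve] is Lipschitz at [phi s]. *)
Let phi_speed s : 0 <= s < 1 -> 0 < derive_in `[0, 1[ phi s.
Proof.
move=> sI; have sA : `[0, 1[%classic s by rewrite /= in_itv.
have [dphi _] := phi_C2; have := derivable_in_cvg (dphi 0%N isT s sA).
have -> : derive_in_n `[0, 1[ 0 phi = phi by [].
set d := derive_in _ _ _ => hphi.
have PF := limit_point_within_proper (co_segment_limit_point sA).
have dge0 : 0 <= d.
  rewrite leNgt; apply/negP => dneg; have e0 : 0 < - d / 2 by lra.
  have [del del0 hd] := (slope_in_cvgP _ _ _ _).1 hphi _ e0.
  have m0 : 0 < Num.min del (1 - s) by rewrite lt_min del0; lra.
  have [m1 m2] : Num.min del (1 - s) <= del /\ Num.min del (1 - s) <= 1 - s by rewrite !ge_min !lexx orbT.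
  pose t := s + Num.min del (1 - s) / 2.
  have ts : t - s = Num.min del (1 - s) / 2 by rewrite /t addrC addKr.
  have ts0 : 0 < t - s by rewrite ts; lra.
  have tI : 0 <= t < 1 by rewrite /t; lra.
  have := hd t; rewrite /= in_itv/= (gtr0_norm ts0) => /(_ tI).
  have td : t - s < del by rewrite ts; lra.
  move=> /(_ td); have : phi s <= phi t by rewrite phi_mono ?in_itv//; lra.
  have -> : (t - s) *: d = (t - s) * d by [].
  have : (t - s) * d < 0 by rewrite pmulr_rlt0.
  by move: ((t - s)) ts0 => z z0; rewrite ler_norml; lra.
rewrite lt_neqAle dge0 andbT eq_sym; apply/eqP => d0.
have [_ /(_ s sI) /eqP + _] := delta_arc; apply.
apply: cvg_lim => //; apply/slope_in_cvgP => e e0.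
have [pI ds] := delta_curve sI.
have pA : `[0, 1[%classic (phi s) by rewrite /= in_itv.
have [[dcurve _] _] := curve_Cn sf.
have hc := derivable_in_cvg (dcurve 0%N isT (phi s) pA); set D := derive_in _ _ _ in hc.
have [d1 d10 h1] := (slope_in_cvgP _ _ _ _).1 hc 1 ltr01.
have K0 : 0 < `|D| + 1 by rewrite ltr_wpDl.
have e'0 : 0 < e / (`|D| + 1) by rewrite divr_gt0.
rewrite d0 in hphi; have [d2 d20 h2] := (slope_in_cvgP _ _ _ _).1 hphi _ e'0.
exists (Num.min d2 (d1 / (e / (`|D| + 1)))); first by rewrite lt_min d20 divr_gt0.
move=> t /= tA; rewrite lt_min => /andP[t2 t1].
have tI : 0 <= t < 1 by move: tA; rewrite in_itv.
have [qI dt] := delta_curve tI.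
have := h2 t tA t2; rewrite scaler0 subr0 => hp.
have pt : `|phi t - phi s| < d1.
  by apply: le_lt_trans hp _; rewrite mulrC -ltr_pdivlMr.
have qA : `[0, 1[%classic (phi t) by rewrite /= in_itv.
have := h1 (phi t) qA pt; rewrite scaler0 subr0 ds dt.
have -> : derive_in_n `[0, 1[ 0 curve = curve by [].
rewrite mul1r => H.
have {}H : `|curve (phi t) - curve (phi s)| <= `|phi t - phi s| * (`|D| + 1).
  have := ler_normD (curve (phi t) - curve (phi s) - (phi t - phi s) *: D) ((phi t - phi s) *: D).
  rewrite subrK normrZ => T; rewrite mulrDr mulr1.
  by apply: (le_trans T); rewrite [leRHS]addrC lerD2r.
apply: le_trans H _; rewrite -ler_pdivlMr//; apply: le_trans hp _.
by rewrite mulrAC.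
Qed.

Lemma curve_unique : reparametrization curve delta.
Proof.
by exists phi; split=> // s /delta_curve[].
Qed.

End uniqueness.

Section solution_count.
Context {R : realType} (F : nonlinearity R).
Local Notation r := (nl_r F).
Local Notation f := (nl_f F).
Variables (lam k : R -> R) (v : R -> R -> R).
Variables (l1 l2 k1 k2 : R -> R) (v1 v2 : R -> R -> R).
Hypothesis sf : smooth_family F lam k v l1 l2 k1 k2 v1 v2.
Let pf := sf_pf sf.
Local Notation U := (profile_clamped F lam k v).
Implicit Types (m lambda : R).

Variable m0 : R.
Hypothesis m0r : 0 < m0 < r.
Hypothesis inc : forall x y, 0 <= x -> x < y -> y <= m0 -> lam x < lam y.
Hypothesis dec : forall x y, m0 <= x -> x < y -> y < r -> lam y < lam x.

Lemma solution_setE lambda : [set u | positive_solution r f lambda u] =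
  [set U m | m in [set m | 0 < m < r /\ lam m = lambda]].
Proof.
apply/seteqP; split=> [u /= /(solution_profile sf)[uI -> uE]|_ [m [mr <-]] <- /=].
  by exists (u (1 / 2)).
exact: (profile_solution sf mr).
Qed.

Lemma profile_clamped_inj m m' : 0 < m < r -> 0 < m' < r -> U m = U m' -> m = m'.
Proof.
move=> mr mr' E.
have [D D'] : 0 <= m < r /\ 0 <= m' < r.
  have [m0' mlt] := andP mr; have [m0'' mlt'] := andP mr'.
  by split; apply/andP; split; [exact: ltW|exact: mlt|exact: ltW|exact: mlt'].
by rewrite -(profile_clamped_mid sf D) E (profile_clamped_mid sf D').
Qed.

Lemma two_solutions lambda : 0 < lambda < lam m0 ->
  [set u | positive_solution r f lambda u] #= `I_2.
Proof.
move=> /andP[l0 ll]; have [m00 m0lt] := andP m0r.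
have [a aI aE] : exists2 a, 0 < a < m0 & lam a = lambda.
  have c1 : {within `[0, m0], continuous lam} by apply: sub_r (ct_lam sf).
  have [|a] := @IVT _ lam 0 m0 lambda (ltW m00) c1.
    by rewrite (pf_lam0 pf) ge_min le_max (ltW l0) (ltW ll) orbT.
  rewrite in_itv/= => /andP[a0 am] aE; exists a => //.
  apply/andP; split; rewrite lt_neqAle ?a0 ?am andbT; apply/eqP => E.
    by move: l0; rewrite -aE -E (pf_lam0 pf) ltxx.
  by move: ll; rewrite -aE E ltxx.
have [b bI bE] : exists2 b, m0 < b < r & lam b = lambda.
  have [d d0 hd] := lam_vanish pf l0.
  (* A point past the turn where [lam] has already fallen below [lambda], so that the intermediate
     value theorem applies on [[m0, c]]. *)
  pose c := Num.max ((m0 + r) / 2) (r - d / 2).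
  have [c1 c2] : (m0 + r) / 2 <= c /\ r - d / 2 <= c by rewrite !le_max !lexx orbT.
  have cr : c < r by rewrite gt_max; apply/andP; split; lra.
  have mc : m0 < c by lra.
  have lc : lam c < lambda by apply: hd; lra.
  have cc : {within `[m0, c], continuous lam} by apply: sub_r (ct_lam sf) => //; exact: ltW.
  have [|b] := @IVT _ lam m0 c lambda (ltW mc) cc.
    by rewrite ge_min le_max (ltW lc) (ltW ll) orbT.
  rewrite in_itv/= => /andP[mb bc] bE; exists b => //.
  rewrite (le_lt_trans bc cr) andbT lt_neqAle mb andbT; apply/eqP => E.
  by move: ll; rewrite -bE -E ltxx.
have ar : 0 < a < r by lra.
have br : 0 < b < r by lra.
have -> : [set u | positive_solution r f lambda u] =
    (fun i : nat => if i == 0%N then U a else U b) @` `I_2.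
  rewrite solution_setE; apply/seteqP; split=> [_ [m [mr mE] <-]|_ [[|[|//]] _ <-]] /=; last 2 first.
  - by exists a.
  - by exists b.
  have [mm|mm] := leP m m0.
    suff -> : m = a by exists 0%N.
    apply/eqP; rewrite eq_le !leNgt; apply/andP; split; apply/negP => h.
      by have := inc (ltW (andP aI).1) h mm; rewrite mE aE ltxx.
    by have := inc (ltW (andP mr).1) h (ltW (andP aI).2); rewrite mE aE ltxx.
  suff -> : m = b by exists 1%N.
  apply/eqP; rewrite eq_le !leNgt; apply/andP; split; apply/negP => h.
    by have := dec (ltW (andP bI).1) h (andP mr).2; rewrite mE bE ltxx.
  by have := dec (ltW mm) h (andP bI).2; rewrite mE bE ltxx.
have ab : U a <> U b by move=> /(profile_clamped_inj ar br); lra.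
have lt2 (i : nat) : (i < 2)%N -> i = 0%N \/ i = 1%N by case: i => [|[|]]; [left|right|].
apply: inj_card_eq => i j /set_mem /lt2 iE /set_mem /lt2 jE.
case: iE => ->; case: jE => -> E.
- reflexivity.
- by case: (ab E).
- by case: (ab (esym E)).
- reflexivity.
Qed.

Lemma one_solution : [set u | positive_solution r f (lam m0) u] #= `I_1.
Proof.
rewrite solution_setE (_ : [set m | _] = [set m0]); first by rewrite image_set1; exact: card_set1.
apply/seteqP; split=> [m [mr mE]|m ->] //=.
have [m00 m0lt] := andP m0r; apply/eqP; rewrite eq_le !leNgt; apply/andP; split; apply/negP => h.
  by have := dec (lexx m0) h (andP mr).2; rewrite mE ltxx.
by have := inc (ltW (andP mr).1) h (lexx m0); rewrite mE ltxx.
Qed.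

Lemma lam_le_max m : 0 < m < r -> lam m <= lam m0.
Proof.
move=> mr; have [mm|mm|->//] := ltgtP m m0; apply: ltW.
  exact: inc (ltW (andP mr).1) mm (lexx _).
exact: dec (lexx _) mm (andP mr).2.
Qed.

Lemma no_solution lambda : lam m0 < lambda -> [set u | positive_solution r f lambda u] = set0.
Proof.
move=> ll; rewrite solution_setE; apply/seteqP; split=> // _ [m [mr mE] _] /=.
by have := lam_le_max mr; rewrite mE leNgt ll.
Qed.

End solution_count.

Theorem theorem1p2 (R : realType) (r : R) (f : R -> R)
  (r_gt0 : 0 < r)
  (f_C2 : Cn `[0, r[ 2 f)
  (f_gt0 : forall u, 0 <= u < r -> 0 < f u)
  (df_gt0 : forall u, 0 < u < r -> 0 < derive_in_n `[0, r[ 1 f u)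
  (d2f_gt0 : forall u, 0 < u < r -> 0 < derive_in_n `[0, r[ 2 f u)
  (f_liminf : (0 < limf_einf (fun u : R => ((r - u) * f u)%:E) r^'-)%E) :
  exists (gamma : R -> R * clamped R) (s0 lambda0 : R) (w : R -> R),
    (* the positive solutions form a smooth curve starting at (0,0) *)
    [/\ smooth_arc gamma,
        gamma 0 = (0, 0)
      & gamma @` `]0, 1[ = [set p | positive_solution r f p.1 p.2]]
    /\
    (* uniqueness of the curve *)
    (forall delta : R -> R * clamped R,
       smooth_arc delta ->
       (forall s, 0 <= s < 1 -> solution r f (delta s).1 (delta s).2) ->
       [set p | positive_solution r f p.1 p.2] `<=` delta @` `[0, 1[ ->
       reparametrization gamma delta)
    /\
    (* exactly one turn, at lambda0 *)
    [/\ 0 < s0 < 1,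
        0 < lambda0,
        (gamma s0).1 = lambda0,
        {in `[0, s0] &, {homo (fun s => (gamma s).1) : s t / s < t}}
      & {in `[s0, 1[ &, {homo (fun s => (gamma s).1) : s t / s < t >-> t < s}}]
    /\
    (* behaviour at the end of the curve *)
    [/\ (gamma s).1 @[s --> 1^'-] --> 0,
        forall alpha, 0 < alpha < 1 ->
          holder_norm 2 alpha (fun x => (gamma s).2 x - w x) @[s --> 1^'-]
            --> 0%E
      & exists M : R, forall x, 0 <= x <= 1 -> `|w x| <= M]
    /\
    (* exact number of positive solutions *)
    [/\ forall lambda, 0 < lambda < lambda0 ->
          [set u | positive_solution r f lambda u] #= `I_2,
        [set u | positive_solution r f lambda0 u] #= `I_1
      & forall lambda, lambda0 < lambda ->
          [set u | positive_solution r f lambda u] = set0]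
    /\
    (* symmetry, and strict monotonicity of the maximum along the curve *)
    [/\ forall lambda u, positive_solution r f lambda u ->
          forall x, 0 <= x <= 1 -> u (1 - x) = u x,
        forall lambda u, positive_solution r f lambda u ->
          forall x, 0 <= x <= 1 -> u x <= u (1 / 2)
      & {in `[0, 1[ &, {homo (fun s => (gamma s).2 (1 / 2)) : s t / s < t}}]
    /\
    (* the limit function *)
    [/\ forall alpha, 0 < alpha < 1 -> holder 2 alpha w,
        ~ Cn `[0, 1] 3 w
      & Cn (`[0, 1] `\ (1 / 2)) 4 w]
    /\
    [/\ forall x, 0 <= x <= 1 -> w (1 - x) = w x,
        forall x, 0 <= x <= 1 -> w x <= w (1 / 2),
        w (1 / 2) = r,
        forall x, 0 <= x <= 1 / 2 -> w x = - 16 * r * x ^+ 3 + 12 * r * x ^+ 2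
      & forall x, 1 / 2 <= x <= 1 ->
          w x = - 16 * r * (1 - x) ^+ 3 + 12 * r * (1 - x) ^+ 2].
Proof.
have [F rE fE] := nonlinearity_exists r_gt0 f_C2 f_gt0 df_gt0 d2f_gt0 f_liminf.
subst r f; clear f_C2 f_gt0 df_gt0 d2f_gt0 f_liminf.
have [lam [k [v pf]]] := profile_family_exists F.
have [l1 [l2 [k1 [k2 [v1 [v2 sf]]]]]] := smooth_family_exists pf.
have [m0 m0r [inc dec]] := lam_shape sf.
set r := nl_r F in r_gt0 m0r dec *.
have [m00 m0lt] := andP m0r.
have rs0 : r * (m0 / r) = m0 by rewrite mulrC divfK ?gt_eqF.
have rsE s : r * s = s * r by rewrite mulrC.
exists (profile_curve F lam k v), (m0 / r), (lam m0), (limit_profile r).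
have mid l u : positive_solution r (nl_f F) l u -> forall x, 0 <= x <= 1 -> u x <= u (1 / 2).
  move=> /(solution_profile sf)[uI _ uE] x xI.
  have D : 0 <= u (1 / 2) < r by case/andP: uI => /ltW -> ->.
  rewrite {1}uE (profile_clampedE sf D xI).
  have : `|x - 1 / 2| <= 1 / 2 by rewrite ler_norml; lra.
  by move=> /(pf_itv pf D)/andP[].
split; first by split; [exact: (curve_smooth sf)|exact: (curve0 sf)|exact: (curve_image sf)].
split; first by move=> delta da ds dp; exact: (curve_unique sf).
split.
  split.
  - by rewrite divr_gt0//= ltr_pdivrMr// mul1r.
  - exact: (pf_lam pf).
  - by rewrite /= rs0.
  - move=> s t; rewrite !in_itv/= => /andP[s0 _] /andP[_ t1] st; apply: inc.
    + by rewrite mulr_ge0// ltW.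
    + by rewrite ltr_pM2l.
    + by rewrite -rs0 ler_pM2l.
  - move=> s t; rewrite !in_itv/= => /andP[s0 _] /andP[_ t1] st; apply: dec.
    + by rewrite -rs0 ler_pM2l.
    + by rewrite ltr_pM2l.
    + by rewrite gtr_pMr.
split.
  split; first exact: (lam_end sf).
    by move=> alpha a01; exact: (curve_end sf).
  exists r => x /(limit_profile_itv r_gt0)/andP[w0 w1].
  by rewrite ger0_norm.
split.
  split; first by move=> l; exact: (two_solutions sf).
    exact: (one_solution sf).
  by move=> l; exact: (no_solution sf).
split.
  split=> // [l u [l0 su _] x xI|s t]; first exact: (solution_symmetric l0 su xI).
  rewrite !in_itv/= => sI tI st.
  by rewrite (curve_mid sf sI) (curve_mid sf tI) ltr_pM2l.
split.
  split; [|exact: limit_profile_notC3|exact: limit_profile_Cn4].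
  by move=> alpha; exact: limit_profile_holder.
split.
- by move=> x _; exact: limit_profile_sym.
- by move=> x /(limit_profile_itv r_gt0)/andP[_]; rewrite limit_profile_mid.
- exact: limit_profile_mid.
- by move=> x /andP[_]; exact: (limit_profileE r x).1.
- by move=> x /andP[+ _]; exact: (limit_profileE r x).2.
Qed.
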